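(* Let $\alpha>0$, $\beta>0$, $L>0$, $0<T<\infty$, $\Omega=(0,L)^2$. Suppose that the unique $\Omega$-periodic solution $\Phi$ of the MPFC equation $$\beta\,\partial_{tt}\Phi+\partial_t\Phi=\Delta\left(\Phi^3+\alpha\Phi+2\Delta\Phi+\Delta^2\Phi\right)$$ with $\partial_t\Phi(\cdot,\cdot,0)\equiv 0$ satisfies $$\Phi\in H^4(0,T;L^2(\Omega))\cap L^\infty(0,T;H^8(\Omega))\cap W^{2,\infty}(0,T;H^2(\Omega))\cap H^2(0,T;H^6(\Omega)).$$ Let $N$ be an even positive integer, $h=L/N$, $s>0$, and let $\Phi_N$ be the finite Fourier projection of $\Phi$ defined in the context. Let $\phi^k,\psi^k$ ($k\ge 1$) be the periodic grid functions produced by the second-order convex splitting scheme stated in the context, with $\phi^0_{i,j}=\Phi(p_i,p_j,0)$, $\phi^{-1}_{i,j}=\phi^0_{i,j}$ and $\psi^0_{i,j}=0$. Define $$\tilde\phi^k_{i,j}:=\Phi_N(p_i,p_j,ks)-\phi^k_{i,j}.$$ Then there is a constant $C>0$, independent of $h$ and $s$, such that, provided $s$ is sufficiently small, $$\|\tilde\phi^k\|_2+\|\nabla_h(\Delta_h\tilde\phi^k)\|_2\le C\,(s^2+h^2)$$ for all $k\ge1$ with $ks\le T$.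
   Context: Grid: $p_i=(i-\tfrac12)h$, $h=L/N$. A periodic grid function is a function $\phi_{i,j}$ of $(i,j)\in\mathbb{Z}^2$ that is $N$-periodic in $i$ and in $j$; $\phi_{i,j}$ represents a value at the cell center $(p_i,p_j)$. Difference operators: $D_x\phi_{i+1/2,j}=(\phi_{i+1,j}-\phi_{i,j})/h$, $D_y\phi_{i,j+1/2}=(\phi_{i,j+1}-\phi_{i,j})/h$, $\Delta_h\phi_{i,j}=(\phi_{i+1,j}+\phi_{i-1,j}+\phi_{i,j+1}+\phi_{i,j-1}-4\phi_{i,j})/h^2$. Norms: $\|\phi\|_2^2=h^2\sum_{i,j=1}^N|\phi_{i,j}|^2$ and $\|\nabla_h\phi\|_2^2=h^2\sum_{i,j=1}^N\left(|D_x\phi_{i+1/2,j}|^2+|D_y\phi_{i,j+1/2}|^2\right)$. Scheme: given periodic grid functions $\phi^{k-1},\phi^k,\psi^k$, find periodic grid functions $\phi^{k+1},\psi^{k+1},\mu^{k+1/2}$ such that $$\beta(\psi^{k+1}-\psi^k)=s\Delta_h\mu^{k+1/2}-s\psi^{k+1/2},$$ $$\mu^{k+1/2}=\chi(\phi^{k+1},\phi^k)+\alpha\phi^{k+1/2}+2\Delta_h\hat\phi^{k+1/2}+\Delta_h^2\phi^{k+1/2},$$ $$\phi^{k+1}-\phi^k=s\psi^{k+1/2},$$ where $\phi^{k+1/2}=\frac{\phi^{k+1}+\phi^k}{2}$, $\psi^{k+1/2}=\frac{\psi^{k+1}+\psi^k}{2}$, $\hat\phi^{k+1/2}=\frac{3\phi^k-\phi^{k-1}}{2}$,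 and $\chi(\phi,\psi)=\frac{\phi^2+\psi^2}{2}\cdot\frac{\phi+\psi}{2}$ (pointwise). The scheme is uniquely solvable for every $s>0$. Fourier projection: with $\widehat\Phi_{k,l}(t)=\frac{1}{|\Omega|}\int_\Omega\Phi(x,y,t)e^{-\frac{2\pi \mathrm{i}}{L}(kx+ly)}\,dx\,dy$, $$\Phi_N(x,y,t)=\sum_{k,l=-N/2+1}^{N/2}\widehat\Phi_{k,l}(t)\,e^{\frac{2\pi \mathrm{i}}{L}(kx+ly)}.$$ Sobolev spaces $H^r(\Omega)$ are those of $\Omega$-periodic functions. *)

(* Defs.v *)
From HB Require Import structures.
From mathcomp Require Import all_boot all_order all_algebra.
From mathcomp Require Import all_classical all_reals all_analysis.
From mathcomp Require Import complex.

Set Implicit Arguments.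
Unset Strict Implicit.
Unset Printing Implicit Defensive.

Import Order.TTheory GRing.Theory Num.Theory.
Import numFieldNormedType.Exports.

Local Open Scope classical_set_scope.
Local Open Scope ring_scope.

Section Spaces.
Context {R : realType}.
Implicit Types (L T : R) (u w : R * R -> R) (U V : R -> R * R -> R).

Definition Omega L : set (R * R) := `]0, L[ `*` `]0, L[.

(* Functions of (x, y, t) are written Bochner style, as [U : R -> R * R -> R],
   with [U t (x, y)] the value at the point (x, y) and the time t. *)

Definition mu1 : {measure set (measurableTypeR R) -> \bar R} :=
  @lebesgue_measure R.
Definition mu2 :
    {measure set (measurableTypeR R * measurableTypeR R) -> \bar R} :=
  (@lebesgue_measure R \x @lebesgue_measure R)%E.

Definition periodic2 (K : Type) L (f : R * R -> K) : Prop :=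
  forall x y, f (x + L, y) = f (x, y) /\ f (x, y + L) = f (x, y).

(* C^oo functions on the plane: every iterated directional derivative is
   (Frechet) differentiable everywhere. *)
Definition smooth2 (eta : R * R -> R) : Prop :=
  forall (vs : seq (R * R)) (z : R * R),
    differentiable (foldr (fun v (g : R * R -> R) => 'D_v g) eta vs) z.

Definition dpartial (a b : nat) (eta : R * R -> R) : R * R -> R :=
  iter a (fun g : R * R -> R => 'D_((1, 0) : R * R) g)
    (iter b (fun g : R * R -> R => 'D_((0, 1) : R * R) g) eta).

(* C_c^oo(0, T) *)
Definition time_test T (theta : R -> R) : Prop :=
  (forall n t, derivable (derive1n n theta) t 1) /\
  exists a b : R, [/\ 0 < a, b < T &
    forall t, ~ (a <= t <= b) -> theta t = 0].

Definition L2norm L u : \bar R := ('N[mu2]_2%:E [EFin \o (u \_ (Omega L))])%E.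

Definition in_L2 L u : Prop :=
  measurable_fun (Omega L : set (measurableTypeR R * measurableTypeR R)) u
  /\ (L2norm L u < +oo)%E.

(* [w] is the weak derivative d_x^a d_y^b [u] of an Omega-periodic function;
   periodicity is encoded by testing against all smooth periodic functions,
   not only those supported in Omega.  Only the values of [u] and [w] in
   Omega matter. *)
Definition weak_partial L (a b : nat) u w : Prop :=
  [/\ in_L2 L u, in_L2 L w &
    forall eta : R * R -> R, smooth2 eta -> periodic2 L eta ->
      (\int[mu2]_(z in Omega L) (u z * dpartial a b eta z))%R =
      (-1) ^+ (a + b) * (\int[mu2]_(z in Omega L) (w z * eta z))%R].

Definition weak_laplacian L u w : Prop :=
  exists uxx uyy : R * R -> R,
    [/\ weak_partial L 2 0 u uxx, weak_partial L 0 2 u uyy &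
        {ae mu2, forall z, Omega L z -> w z = uxx z + uyy z}].

(* L^p(0, T; L^2(Omega)) *)
Definition in_LpL2 T L (p : \bar R) U : Prop :=
  measurable_fun
    (`]0, T[ `*` Omega L
       : set (measurableTypeR R * (measurableTypeR R * measurableTypeR R)))
    (fun q => U q.1 q.2)
  /\ ('N[mu1]_p [(fun t => L2norm L (U t)) \_ `]0%R, T[] < +oo)%E.

(* L^p(0, T; H^r(Omega)), for the space H^r of Omega-periodic functions whose
   weak derivatives of order at most r are in L^2. *)
Definition in_LpH T L (p : \bar R) (r : nat) U : Prop :=
  in_LpL2 T L p U /\
  exists D : nat -> nat -> R -> R * R -> R,
    forall a b, (a + b <= r)%N ->
      in_LpL2 T L p (D a b) /\
      {ae mu1, forall t, 0 < t < T -> weak_partial L a b (U t) (D a b t)}.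

(* [V] is the j-th weak time derivative of [U] on (0, T), for functions with
   values in L^2(Omega): the Bochner integrals of the usual definition are
   evaluated at almost every point of Omega. *)
Definition weak_dt T L (j : nat) U V : Prop :=
  [/\ in_LpL2 T L 2%:E U, in_LpL2 T L 2%:E V &
    forall theta : R -> R, time_test T theta ->
      {ae mu2, forall z, Omega L z ->
        (\int[mu1]_(t in `]0, T[) (U t z * derive1n j theta t))%R =
        (-1) ^+ j * (\int[mu1]_(t in `]0, T[) (V t z * theta t))%R}].

(* W^{m,p}(0, T; H^r(Omega)) *)
Definition in_WH T L (m : nat) (p : \bar R) (r : nat) U : Prop :=
  exists V : nat -> R -> R * R -> R,
    forall j, (j <= m)%N -> weak_dt T L j U (V j) /\ in_LpH T L p r (V j).

(* beta u_tt + u_t = Lap (u^3 + alpha u + 2 Lap u + Lap^2 u) a.e. in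
   Omega x (0, T), all derivatives being weak. *)
Definition solves_MPFC T L (alpha beta : R) U : Prop :=
  exists Ut Utt : R -> R * R -> R,
    [/\ weak_dt T L 1 U Ut, weak_dt T L 2 U Utt &
      {ae mu1, forall t, 0 < t < T ->
        exists d1 d2 : R * R -> R,
          [/\ weak_laplacian L (U t) d1, weak_laplacian L d1 d2 &
              weak_laplacian L
                (fun z => U t z ^+ 3 + alpha * U t z + 2 * d1 z + d2 z)
                (fun z => beta * Utt t z + Ut t z)]}].

End Spaces.

Section Fourier.
Context {R : realType}.
Local Open Scope complex_scope.

Definition cexpi (x : R) : R[i] := cos x +i* sin x.

Definition cintegral (L : R) (f : R * R -> R[i]) : R[i] :=
  (\int[mu2]_(z in Omega L) complex.Re (f z))%R +i*
  (\int[mu2]_(z in Omega L) complex.Im (f z))%R.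

Definition phase (L : R) (k l : int) (z : R * R) : R :=
  2 * pi / L * (k%:~R * z.1 + l%:~R * z.2).

Definition fourier_coef (L : R) (u : R * R -> R) (k l : int) : R[i] :=
  (L ^- 2)%:C * cintegral L (fun z => (u z)%:C * cexpi (- phase L k l z)).

(* The frequencies -N/2+1, .., N/2 are [m - N/2 + 1] for m = 0, .., N-1.  The
   range is not symmetric, so the projection of a real function is in general
   complex-valued. *)
Definition freq (N m : nat) : int := m%:Z - (N./2)%:Z + 1.

Definition fourier_proj (L : R) (N : nat) (u : R * R -> R) (z : R * R) : R[i] :=
  \sum_(0 <= a < N) \sum_(0 <= b < N)
    fourier_coef L u (freq N a) (freq N b)
    * cexpi (phase L (freq N a) (freq N b) z).

End Fourier.

Section Grid.

Definition grid_periodic (K : Type) (N : nat) (f : int -> int -> K) : Prop :=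
  forall i j, f (i + N%:Z) j = f i j /\ f i (j + N%:Z) = f i j.

(* [Dx h f i j] and [Dy h f i j] are the values at the edge points (i+1/2, j)
   and (i, j+1/2). *)
Definition Dx (K : fieldType) (h : K) (f : int -> int -> K) (i j : int) : K :=
  (f (i + 1) j - f i j) / h.
Definition Dy (K : fieldType) (h : K) (f : int -> int -> K) (i j : int) : K :=
  (f i (j + 1) - f i j) / h.

Definition dlap (K : fieldType) (h : K) (f : int -> int -> K) (i j : int) : K :=
  (f (i + 1) j + f (i - 1) j + f i (j + 1) + f i (j - 1) - 4 * f i j) / h ^+ 2.

Context {R : realType}.

Definition gpoint (h : R) (i j : int) : R * R :=
  ((i%:~R - 2^-1) * h, (j%:~R - 2^-1) * h).

Local Notation normc := ComplexField.Normc.normc.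

Definition gnorm2 (N : nat) (h : R) (f : int -> int -> R[i]) : R :=
  Num.sqrt (h ^+ 2 * \sum_(1 <= i < N.+1) \sum_(1 <= j < N.+1)
    normc (f i%:Z j%:Z) ^+ 2).

Definition ggradnorm2 (N : nat) (h : R) (f : int -> int -> R[i]) : R :=
  Num.sqrt (h ^+ 2 * \sum_(1 <= i < N.+1) \sum_(1 <= j < N.+1)
    (normc (Dx h%:C%C f i%:Z j%:Z) ^+ 2 + normc (Dy h%:C%C f i%:Z j%:Z) ^+ 2)).

Definition chi (a b : R) : R := (a ^+ 2 + b ^+ 2) / 2 * ((a + b) / 2).

(* One step of the scheme: [phim], [phi], [phip] are phi^{k-1}, phi^k,
   phi^{k+1} and [psi], [psip] are psi^k, psi^{k+1}. *)
Definition scheme_step (N : nat) (h s alpha beta : R)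
    (phim phi psi phip psip : int -> int -> R) : Prop :=
  let phihalf i j := (phip i j + phi i j) / 2 in
  let psihalf i j := (psip i j + psi i j) / 2 in
  let phihat i j := (3 * phi i j - phim i j) / 2 in
  exists mu : int -> int -> R, grid_periodic N mu /\
    forall i j : int,
      [/\ beta * (psip i j - psi i j) = s * dlap h mu i j - s * psihalf i j,
          mu i j = chi (phip i j) (phi i j) + alpha * phihalf i j
                   + 2 * dlap h phihat i j + dlap h (dlap h phihalf) i j &
          phip i j - phi i j = s * psihalf i j].

(* [phi k] is defined for k >= -1. *)
Definition scheme_solution (N : nat) (h s alpha beta : R)
    (Phi0 : R * R -> R)
    (phi : int -> int -> int -> R) (psi : nat -> int -> int -> R) : Prop :=
  [/\ forall i j, phi 0 i j = Phi0 (gpoint h i j),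
      forall i j, phi (-1) i j = phi 0 i j,
      forall i j, psi 0%N i j = 0,
      forall k : nat,
        grid_periodic N (phi k.+1%:Z) /\ grid_periodic N (psi k.+1) &
      forall k : nat,
        scheme_step N h s alpha beta (phi (k%:Z - 1)) (phi k%:Z) (psi k)
          (phi k.+1%:Z) (psi k.+1)].

End Grid.

(* Main.v *)
Require Import Defs.
From HB Require Import structures.
From mathcomp Require Import all_boot all_order all_algebra.
From mathcomp Require Import all_classical all_reals all_analysis.
From mathcomp Require Import complex measurable_realfun ring lra zify.

Set Implicit Arguments.
Unset Strict Implicit.
Unset Printing Implicit Defensive.

Import Order.TTheory GRing.Theory Num.Theory.
Import numFieldNormedType.Exports.

Local Open Scope classical_set_scope.
Local Open Scope ring_scope.

(* The scheme is stable because the splitting makes a discrete energy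
   non-increasing: besides the quartic potential and the H^-1 norm of psi it
   controls the discrete H^2 norm, hence the maximum norm.  Subtracting the
   scheme from the equation satisfied by the Fourier projection u^k of Phi
   leaves the truncation errors of the time averages, of the five-point
   Laplacian and of the cubic term; the same energy argument applied to the
   error, with the Lipschitz bound that the maximum norm gives for the
   nonlinearity, and a discrete Gronwall inequality reduce the theorem to bounds
   on these.  They are proved mode by mode: the Fourier coefficients of Phi have
   classical time derivatives whose increments are controlled by the weak
   derivatives, and Bessel's inequality turns sums over the modes into the
   assumed Sobolev norms.  The truncation error of phi_t = psi involves three
   derivatives in time together with three in space, whose square integrability
   is interpolated between H^2(0,T;H^6) and H^4(0,T;L^2).  Aliasing is handled
   with Fejer means: Phi(t) is a limit of trigonometric polynomials whose
   weighted coefficient sums are bounded. *)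

(** * Energy estimates for the splitting *)

(** Two energies at different levels are used. Stability tests the momentum equation in H^-1, the
    level at which the cubic term is an exact difference of potentials; it yields an H^2 bound
    without growth in time. The error is tested one order higher, [psi] in L^2 and [phi] in H^3,
    where the cubic term is only Lipschitz, so that the H^2 bound must come first. There the defect
    of phi_t = psi is charged with three powers of the discrete Laplacian: this dictates the norm
    [truncation] and the weight [wgt ^+ 3], whose square is the weight available for two time
    derivatives.

    Time is handled one Fourier coefficient at a time, on functions of one real variable. Estimates
    on modes hold uniformly for arbitrary finite families of frequencies; no infinite series is
    summed.

    The projection keeps the frequency N/2 but not -N/2, so it has an imaginary part, whereas the
    scheme is real: this part is estimated separately. The initial velocity is given pointwise in
    space, as a one-sided limit, and a domination argument is needed before its coefficients are
    known to vanish. *)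

Section Energy.
Context {R : realFieldType} {V : lmodType R} (ip : V -> V -> R) (A : V -> V).
Hypothesis ipC : forall x y, ip x y = ip y x.
Hypothesis ipDl : forall x y z, ip (x + y) z = ip x z + ip y z.
Hypothesis ipZl : forall a x y, ip (a *: x) y = a * ip x y.
Hypothesis ip_ge0 : forall x, 0 <= ip x x.
Hypothesis AD : forall x y, A (x + y) = A x + A y.
Hypothesis AZ : forall a x, A (a *: x) = a *: A x.
Hypothesis ipA : forall x y, ip (A x) y = ip x (A y).
Hypothesis ipA_ge0 : forall x, 0 <= ip x (A x).

Lemma ipDr x y z : ip x (y + z) = ip x y + ip x z.
Proof. by rewrite ipC ipDl !(ipC x). Qed.

Lemma ipZr a x y : ip x (a *: y) = a * ip x y.
Proof. by rewrite ipC ipZl ipC. Qed.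

Lemma ipNl x y : ip (- x) y = - ip x y.
Proof. by rewrite -scaleN1r ipZl mulN1r. Qed.

Lemma ipNr x y : ip x (- y) = - ip x y.
Proof. by rewrite ipC ipNl ipC. Qed.

Lemma opAN x : A (- x) = - A x.
Proof. by rewrite -scaleN1r AZ scaleN1r. Qed.

Definition ipE := (ipDl, ipDr, ipZl, ipZr, ipNl, ipNr).

Lemma ipA1C x y : ip x (A y) = ip y (A x).
Proof. by rewrite -ipA ipC. Qed.

Lemma ipA2C x y : ip x (A (A y)) = ip y (A (A x)).
Proof. by rewrite ipA1C ipA. Qed.

Lemma ipA3C x y : ip x (A (A (A y))) = ip y (A (A (A x))).
Proof. by rewrite ipA1C !ipA. Qed.

Lemma ip_young x y : 2 * ip x y <= ip x x + ip y y.
Proof. by have := ip_ge0 (x - y); rewrite !ipE (ipC y x); lra. Qed.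

Lemma ip_youngN x y : - (2 * ip x y) <= ip x x + ip y y.
Proof. by have := ip_ge0 (x + y); rewrite !ipE (ipC y x); lra. Qed.

Lemma ipA_young x y : 2 * ip x (A y) <= ip x (A x) + ip y (A y).
Proof.
have := ipA_ge0 (x - y).
by rewrite AD opAN !ipE (ipC y (A x)) ipA; lra.
Qed.

(** Positivity of [A] on [A x - 4 *: x] bounds [A x] by a third-order and a first-order form, and
    the square of [A x - 2 *: x] removes the latter. The fraction 1/4 leaves half of the third-order
    part of [err_energy]; the price 4 is why that energy carries [5 * ip e e]. *)
Lemma ipA_sq_interp x :
  ip (A x) (A x) <= 4^-1 * ip (A x) (A (A x)) + 4 * ip x x.
Proof.
have h1 := ipA_ge0 (A x - 4 *: x); have h2 := ip_ge0 (A x - 2 *: x).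
move: h1 h2; rewrite !(AD, opAN, AZ, ipE).
have -> : ip x (A (A x)) = ip (A x) (A x) by rewrite ipA.
by rewrite (ipC (A x) x); lra.
Qed.

Lemma ip_norm_half x y :
  ip (2^-1 *: (x + y)) (2^-1 *: (x + y)) <= 2^-1 * (ip x x + ip y y).
Proof. by have := ip_ge0 (x - y); rewrite !ipE (ipC y x); lra. Qed.

Lemma ipA_half x y :
  ip (2^-1 *: (x + y)) (A (2^-1 *: (x + y))) <= 2^-1 * (ip x (A x) + ip y (A y)).
Proof.
have := ipA_ge0 (x - y); rewrite !(AD, opAN, AZ, ipE) (ipC y (A x)) ipA.
by lra.
Qed.

(* Writing 3 a - a' = (a'' + a) - (a'' - 2 a + a'), the explicit concave term
   telescopes up to the nonnegative square of the second difference. *)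
Lemma extrapolation_identity am a ap :
  - ip (3 *: a - am) (ap - a) =
  - (ip ap ap - ip a a) + 2^-1 * ip (ap - a) (ap - a)
  - 2^-1 * ip (a - am) (a - am)
  + 2^-1 * ip (ap - 2 *: a + am) (ap - 2 *: a + am).
Proof.
rewrite !ipE (ipC ap a) (ipC am a) (ipC am ap).
by field.
Qed.

Section Stability.
Variables (Q : V -> R) (alpha beta : R).
Hypothesis beta_gt0 : 0 < beta.

(** A modified energy: the form in [phi - phim] is the part of the extrapolation identity that
    telescopes, and the last term is the H^-1 norm of psi when [A eta] is psi. The negative gradient
    term comes from the explicit second-order part of the potential. *)
Definition stab_energy (phim phi eta : V) : R :=
  Q phi + alpha / 2 * ip phi phi - ip phi (A phi) + 2^-1 * ip (A phi) (A phi)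
  + 2^-1 * ip (phi - phim) (A (phi - phim)) + beta / 2 * ip eta (A eta).

(* [eta] plays the role of A^-1 psi. *)
Lemma stab_energy_step s phim phi phip eta etap mu ch :
  0 < s ->
  ip ch (phip - phi) = Q phip - Q phi ->
  beta *: (etap - eta) = - (s *: mu) - s *: (2^-1 *: (etap + eta)) ->
  mu = ch + alpha *: (2^-1 *: (phip + phi))
       - 2 *: A (2^-1 *: (3 *: phi - phim)) + A (A (2^-1 *: (phip + phi))) ->
  phip - phi = s *: A (2^-1 *: (etap + eta)) ->
  stab_energy phi phip etap <= stab_energy phim phi eta.
Proof.
move=> s0 Hch Heta Hmu Hphi.
(* Pairing with [A] of the midpoint of [eta], which is the increment of phi divided by [s], is the
   discrete H^-1 test; the friction becomes a nonnegative dissipation. *)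
have E1 : beta / 2 * (ip etap (A etap) - ip eta (A eta))
   + s * ip (2^-1 *: (etap + eta)) (A (2^-1 *: (etap + eta)))
   = - ip mu (phip - phi).
  have := congr1 (fun x => ip x (A (2^-1 *: (etap + eta)))) Heta.
  rewrite Hphi !(ipE, AD, AZ) (ipA1C etap eta).
  by lra.
have E2 : ip mu (phip - phi) = Q phip - Q phi
   + alpha / 2 * (ip phip phip - ip phi phi)
   - ip (3 *: phi - phim) (A (phip - phi))
   + 2^-1 * (ip (A phip) (A phip) - ip (A phi) (A phi)).
  rewrite Hmu !ipDl Hch !(ipE, AD, opAN, AZ, ipA) (ipC phi phip).
  by rewrite (ipA2C phi phip); field.
have E3 : - ip (3 *: phi - phim) (A (phip - phi)) =
  - (ip phip (A phip) - ip phi (A phi)) + 2^-1 * ip (phip - phi) (A (phip - phi))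
  - 2^-1 * ip (phi - phim) (A (phi - phim))
  + 2^-1 * ip (phip - 2 *: phi + phim) (A (phip - 2 *: phi + phim)).
  rewrite !(ipE, AD, opAN, AZ) (ipA1C phi phip) (ipA1C phim phip) (ipA1C phim phi).
  by field.
have h1 := ipA_ge0 (phip - 2 *: phi + phim).
have h2 : 0 <= s * ip (2^-1 *: (etap + eta)) (A (2^-1 *: (etap + eta))).
  by rewrite mulr_ge0 ?ipA_ge0// ltW.
rewrite /stab_energy; lra.
Qed.

(** By Young's inequality the negative gradient term costs [4^-1 * ip (A phi) (A phi) + ip phi phi],
    so half of the top-order term remains; the loss of [ip phi phi] is left to the quartic [Q]. *)
Lemma stab_energy_coercive phim phi eta : 0 <= alpha ->
  4^-1 * ip (A phi) (A phi) + (Q phi - ip phi phi) <= stab_energy phim phi eta.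
Proof.
move=> a0; have h1 := ip_ge0 (A phi - 2 *: phi).
move: h1; rewrite !ipE (ipC (A phi) phi) => h1.
have h2 := ipA_ge0 (phi - phim).
have h3 : 0 <= beta / 2 * ip eta (A eta) by rewrite mulr_ge0 ?ipA_ge0// divr_ge0// ltW.
have h4 : 0 <= alpha / 2 * ip phi phi by rewrite mulr_ge0 ?ip_ge0// divr_ge0.
rewrite /stab_energy; lra.
Qed.

End Stability.

(** * One step of the error recursion *)

Section ErrorStep.
Variables (alpha beta : R).
Hypotheses (alpha_ge0 : 0 <= alpha) (beta_gt0 : 0 < beta).

(** One level above [stab_energy]: [rho] is measured in the plain norm, and the cubic difference is
    paired with [rho] directly. The coefficient 5 makes the sum coercive in spite of the negative
    term; it is paid for by controlling the growth of [ip e e] in each step. *)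
Definition err_energy (em e rho : V) : R :=
  beta / 2 * ip rho rho + 2^-1 * ip (A e) (A (A e)) + alpha / 2 * ip e (A e)
  - ip (A e) (A e) + 2^-1 * ip (A (e - em)) (A (e - em)) + 5 * ip e e.

Definition err_size (em e rho : V) : R :=
  ip rho rho + ip (A e) (A (A e)) + ip (A (e - em)) (A (e - em)) + ip e e.

Lemma err_size_ge0 em e rho : 0 <= err_size em e rho.
Proof. by rewrite /err_size !addr_ge0 ?ip_ge0 ?ipA_ge0. Qed.

Lemma err_size_le em e rho :
  err_size em e rho <= (4 + 2 / beta) * err_energy em e rho.
Proof.
have h1 := ipA_sq_interp e.
have h2 := ip_ge0 rho; have h3 := ipA_ge0 (A e).
have h4 := ip_ge0 (A (e - em)); have h5 := ip_ge0 e.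
have h6 : 0 <= alpha / 2 * ip e (A e) by rewrite mulr_ge0 ?ipA_ge0// divr_ge0.
have hb : beta * beta^-1 = 1 by rewrite divff ?gt_eqF.
have hb0 : 0 < beta^-1 by rewrite invr_gt0.
set E := err_energy _ _ _.
(* Four of the five copies of [ip e e] absorb the negative term. The quarter that remains of the
   third-order form explains the factor 4 of the lemma, and [beta / 2] explains [2 / beta]. *)
have HE : beta / 2 * ip rho rho + 4^-1 * ip (A e) (A (A e))
   + 2^-1 * ip (A (e - em)) (A (e - em)) + ip e e <= E.
  by rewrite /E /err_energy; lra.
have h7 : 0 <= beta / 2 * ip rho rho by rewrite mulr_ge0 // divr_ge0 // ltW.
have h8 : ip rho rho <= 2 / beta * E.
  have : 2 / beta * (beta / 2 * ip rho rho) <= 2 / beta * E.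
    by apply: ler_wpM2l; [rewrite divr_ge0// ltW|lra].
  by rewrite mulrA (_ : 2 / beta * (beta / 2) = 1) ?mul1r//; field; rewrite gt_eqF.
rewrite /err_size; lra.
Qed.

Lemma err_energy_ge0 em e rho : 0 <= err_energy em e rho.
Proof.
have := le_trans (err_size_ge0 em e rho) (err_size_le em e rho).
by rewrite pmulr_rge0// addr_gt0// divr_gt0.
Qed.

(** Since phi^{-1} = phi^0 and psi starts without error, only the initial projection error
    enters. *)
Lemma err_energy_init e : err_energy e e 0 <= (1 + alpha) * ip (A e) (A (A e)) + (10 + 2 * alpha) * ip e e.
Proof.
have h1 := ipA_sq_interp e; have h3 := ipA_ge0 (A e).
have h5 := ip_ge0 e; have h6 := ip_ge0 (A e).
have h7 := ip_young e (A e).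
rewrite /err_energy subrr.
have -> : A 0 = 0 by have := AZ 0 0; rewrite !scale0r.
have ip00 x : ip 0 x = 0 by have := ipZl 0 x x; rewrite scale0r mul0r.
rewrite !ip00.
have : alpha * (2 * ip e (A e)) <= alpha * (4 * ip (A e) (A (A e)) + 5 * ip e e).
  by apply: ler_wpM2l => //; lra.
have : 0 <= alpha * ip (A e) (A (A e)) by rewrite mulr_ge0.
have : 0 <= alpha * ip e e by rewrite mulr_ge0.
lra.
Qed.

(** The momentum equation is tested with [r], the midpoint of [rho]. In the linear terms [s *: r] is
    replaced by [ep - e - s *: t2]: they telescope, but [t2] meets up to three powers of [A]. The
    term in [d] keeps [r], against which the friction [ip r r] is available. *)
Lemma err_energy_step s K em e ep rho rhop d t1 t2 :
  0 < s -> 0 <= K ->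
  beta *: (rhop - rho) =
    - (s *: A (d + alpha *: (2^-1 *: (ep + e)) - 2 *: A (2^-1 *: (3 *: e - em))
             + A (A (2^-1 *: (ep + e)))))
    - s *: (2^-1 *: (rhop + rho)) + s *: t1 ->
  ep - e = s *: (2^-1 *: (rhop + rho)) + s *: t2 ->
  ip (A d) (A d) <= K * (ip ep ep + ip (A ep) (A ep) + ip e e + ip (A e) (A e)) ->
  err_energy e ep rhop - err_energy em e rho
    <= s * ((30 + 2 * alpha + 5 * K) *
        (err_size e ep rhop + err_size em e rho
          + (ip t1 t1 + ip t2 t2 + ip (A t2) (A t2) + ip (A t2) (A (A t2))))).
Proof.
move=> s0 K0 H1 H2 Hd.
set r := 2^-1 *: (rhop + rho) in H1 H2 *.
set eh := 2^-1 *: (ep + e) in H1 *.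
set ex := 2^-1 *: (3 *: e - em) in H1 *.
(* The midpoints are made opaque, so that expansions into inner products stay small; their
   definitions survive as equations. *)
have [Er [Eh Ex]] : r = 2^-1 *: (rhop + rho) /\ eh = 2^-1 *: (ep + e)
  /\ ex = 2^-1 *: (3 *: e - em) by [].
clearbody r eh ex.
have D1 : beta / 2 * (ip rhop rhop - ip rho rho) =
   - (s * ip (A d) r) - ip (A (alpha *: eh - 2 *: A ex + A (A eh))) (s *: r)
   - s * ip r r + s * ip t1 r.
  have Hr : ip (rhop - rho) r = 2^-1 * (ip rhop rhop - ip rho rho).
    by rewrite Er !ipE (ipC rhop rho); lra.
  have := congr1 (fun x => ip x r) H1.
  by rewrite ipZl Hr !(ipE, AD, opAN, AZ); lra.
have Hsr : s *: r = (ep - e) - s *: t2 by rewrite H2 addrK.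
have D2 : ip (A (alpha *: eh - 2 *: A ex + A (A eh))) (ep - e) =
   alpha / 2 * (ip ep (A ep) - ip e (A e))
   + 2^-1 * (ip (A ep) (A (A ep)) - ip (A e) (A (A e)))
   + (- ip (3 *: A e - A em) (A ep - A e)).
  rewrite Eh Ex !(ipE, AD, opAN, AZ, ipA).
  rewrite (ipA1C e ep) (ipA2C em e) (ipA2C e ep) (ipA2C em ep) (ipA3C e ep).
  by field.
have D3 : ip (A (alpha *: eh - 2 *: A ex + A (A eh))) t2 =
   alpha * ip eh (A t2) - 2 * ip (A ex) (A t2) + ip (A eh) (A (A t2)).
  by rewrite !(ipE, AD, opAN, AZ, ipA).
(* [ip e e] does not arise from testing the momentum equation; its growth follows from the second
   equation alone. *)
have D4 : ip ep ep - ip e e = s * ip (r + t2) (ep + e).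
  have -> : s * ip (r + t2) (ep + e) = ip (ep - e) (ep + e).
    by rewrite -ipZl scalerDr -H2.
  by rewrite !ipE (ipC e ep); lra.
move: D1; rewrite Hsr ipDr ipNr (ipZr s _ t2) D2 extrapolation_identity D3 => D1.
have p1 := ip_youngN (A d) r; have p2 := ip_young t1 r.
have p3 := ip_young eh (A t2); have p4 := ip_youngN (A ex) (A t2).
have p5 := ipA_young (A eh) (A t2).
have p6 := ip_young (r + t2) (ep + e).
have p7 : ip (r + t2) (r + t2) <= 2 * ip r r + 2 * ip t2 t2.
  by have := ip_ge0 (r - t2); rewrite !ipE (ipC r t2); lra.
have p8 : ip (ep + e) (ep + e) <= 2 * ip ep ep + 2 * ip e e.
  by have := ip_ge0 (ep - e); rewrite !ipE (ipC ep e); lra.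
have p9 : ip r r <= 2^-1 * (ip rhop rhop + ip rho rho).
  by rewrite Er; exact: ip_norm_half.
have p10 : ip eh eh <= 2^-1 * (ip ep ep + ip e e).
  by rewrite Eh; exact: ip_norm_half.
have p11 : ip (A eh) (A (A eh)) <=
    2^-1 * (ip (A ep) (A (A ep)) + ip (A e) (A (A e))).
  by rewrite Eh AZ AD; exact: ipA_half.
have p12 : ip (A ex) (A ex) <= 2 * ip (A e) (A e) + 2^-1 * ip (A (e - em)) (A (e - em)).
  have -> : ex = e + 2^-1 *: (e - em).
    rewrite Ex; apply: (scalerI (_ : 2 != 0 :> R)); first by rewrite pnatr_eq0.
    rewrite scalerA mulfV ?pnatr_eq0// scale1r scalerDr scalerA mulfV ?pnatr_eq0//.
    rewrite scale1r addrA; congr (_ - _).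
    by rewrite -[X in _ = _ + X]scale1r -scalerDl; congr (_ *: _); ring.
  set z := e - em.
  rewrite AD AZ.
  by have := ip_ge0 (A e - 2^-1 *: A z); rewrite !ipE (ipC (A z) (A e)); lra.
have q1 := ipA_sq_interp e; have q2 := ipA_sq_interp ep.
have g1 := ip_ge0 (A ep - A e - (A e - A em)).
have n1 := ip_ge0 rho; have n2 := ip_ge0 rhop; have n3 := ip_ge0 e.
have n4 := ip_ge0 ep; have n5 := ip_ge0 r; have n6 := ip_ge0 t2.
have n7 := ip_ge0 (A t2); have n8 := ipA_ge0 (A t2); have n9 := ip_ge0 t1.
have n10 := ipA_ge0 (A e); have n11 := ipA_ge0 (A ep).
have n12 := ip_ge0 (A (e - em)); have n13 := ip_ge0 (A (ep - e)).
set Sp := err_size e ep rhop; set S := err_size em e rho.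
set Tau := (ip t1 t1 + ip t2 t2 + ip (A t2) (A t2) + ip (A t2) (A (A t2))).
have Tau0 : 0 <= Tau by rewrite /Tau !addr_ge0.
have b1 : ip (A d) (A d) <= K * (5 * (Sp + S)).
  apply: (le_trans Hd); apply: ler_wpM2l => //.
  by rewrite /Sp /S /err_size; lra.
have b2 : alpha * (2 * ip eh (A t2)) <= alpha * (2 * (Sp + S + Tau)).
  apply: ler_wpM2l => //.
  by rewrite /Sp /S /err_size /Tau; lra.
have sec : A ep - 2 *: A e + A em = A ep - A e - (A e - A em).
  by rewrite opprB scaler_nat mulr2n opprD !addrA addrAC.
rewrite sec in D1.
have key : err_energy e ep rhop - err_energy em e rho <=
  s * (- ip (A d) r - ip r r + ip t1 r + (alpha * ip eh (A t2)
    - 2 * ip (A ex) (A t2) + ip (A eh) (A (A t2))) + 5 * ip (r + t2) (ep + e)).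
  rewrite /err_energy !(AD, opAN).
  lra.
apply: (le_trans key); apply: ler_wpM2l; first exact: ltW.
have aa : 0 <= alpha * (Sp + S + Tau).
  by rewrite mulr_ge0// !addr_ge0// err_size_ge0.
have kk : 0 <= K * Tau by rewrite mulr_ge0.
have kk' : 0 <= K * (Sp + S) by rewrite mulr_ge0 ?addr_ge0 ?err_size_ge0.
have base : - ip r r + 2^-1 * ip r r + ip t1 r
   - 2 * ip (A ex) (A t2) + ip (A eh) (A (A t2)) + 5 * ip (r + t2) (ep + e)
   <= 30 * (Sp + S + Tau).
  by rewrite /Sp /S /err_size /Tau; lra.
lra.
Qed.

End ErrorStep.
End Energy.

(** The new value also occurs on the right. For [x <= 1/2] the quotient (1 + x) / (1 - x) is at most
    1 + 4 x and 1 / (1 - x) is at most 2, which gives both constants. *)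
Lemma discrete_gronwall (R : realFieldType) (E tau : nat -> R) (x : R) (n : nat) :
  0 <= x <= 2^-1 -> (forall k, 0 <= tau k) -> 0 <= E 0%N ->
  (forall k, (k < n)%N -> E k.+1 - E k <= x * (E k.+1 + E k + tau k)) ->
  E n <= (1 + 4 * x) ^+ n * (E 0%N + 2 * x * \sum_(k < n) tau k).
Proof.
move=> /andP[x0 x1] tau0 E0; elim: n => [|n IH] H.
  by rewrite big_ord0 mulr0 addr0 mul1r.
have {}IH := IH (fun k kn => H k (ltnW kn)).
have Hn := H n (ltnSn n).
set G := E 0%N + 2 * x * _ in IH.
have G0 : 0 <= G by rewrite addr_ge0 ?mulr_ge0 ?sumr_ge0.
have p1 : 1 <= (1 + 4 * x) ^+ n by rewrite exprn_ege1//; lra.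
set p := (1 + 4 * x) ^+ n in IH p1.
have B0 : 0 <= p * G by rewrite mulr_ge0//; lra.
rewrite big_ord_recr/= (mulrDr (2 * x)) addrA -/G exprS -/p.
have t0 := tau0 n.
have xt : 0 <= x * tau n by rewrite mulr_ge0.
have xx : 0 <= x * (1 - 2 * x) by rewrite mulr_ge0//; lra.
have step : E n.+1 <= (1 + 4 * x) * (p * G) + 2 * x * tau n.
  have h1 : (1 - x) * E n.+1 <= (1 + x) * (p * G) + x * tau n by nra.
  have h2 : (1 + x) * (p * G) + x * tau n <=
    (1 - x) * ((1 + 4 * x) * (p * G) + 2 * x * tau n).
    have : 0 <= (x * (1 - 2 * x)) * (2 * (p * G)) by rewrite mulr_ge0// mulr_ge0.
    have : 0 <= (x * tau n) * (1 - 2 * x) by rewrite mulr_ge0//; lra.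
    lra.
  have hx : 0 < 1 - x by lra.
  by rewrite -(ler_pM2l hx); exact: le_trans h1 h2.
apply: (le_trans step).
have : 2 * x * tau n * 1 <= 2 * x * tau n * ((1 + 4 * x) * p).
  by apply: ler_wpM2l; [nra|nra].
lra.
Qed.

(** * Discrete Sobolev inequalities *)

Section ShiftSum.
Context {R : realFieldType} {T : finType} (s s' : T -> T).
Hypothesis (sK : cancel s s') (s'K : cancel s' s).

Lemma sum_shift (f : T -> R) : \sum_x f (s x) = \sum_x f x.
Proof. by rewrite [RHS](reindex s)//; apply: onW_bij; exists s'. Qed.

Lemma sum_shift' (f : T -> R) : \sum_x f (s' x) = \sum_x f x.
Proof. by rewrite [RHS](reindex s')//; apply: onW_bij; exists s. Qed.

Lemma sum_by_parts (f g : T -> R) :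
  \sum_x f x * (2 * g x - g (s x) - g (s' x)) =
  \sum_x (f (s x) - f x) * (g (s x) - g x).
Proof.
have e1 : \sum_x f (s x) * g (s x) = \sum_x f x * g x.
  exact: (sum_shift (fun x => f x * g x)).
have e2 : \sum_x f x * g (s' x) = \sum_x f (s x) * g x.
  by rewrite -(sum_shift (fun x => f x * g (s' x))); apply: eq_bigr => x _; rewrite sK.
have -> : \sum_x f x * (2 * g x - g (s x) - g (s' x)) =
  2 * \sum_x f x * g x - \sum_x f x * g (s x) - \sum_x f x * g (s' x).
  by rewrite mulr_sumr -!sumrB; apply: eq_bigr => x _; ring.
have -> : \sum_x (f (s x) - f x) * (g (s x) - g x) =
  \sum_x f (s x) * g (s x) + \sum_x f x * g x - \sum_x f x * g (s x) - \sum_x f (s x) * g x.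
  by rewrite -big_split -!sumrB; apply: eq_bigr => x _ /=; ring.
rewrite e1 e2; ring.
Qed.

Variables (h : R).
Hypothesis h_gt0 : 0 < h.

Definition fdiff (f : T -> R) x := (f (s x) - f x) / h.
(** Minus the second difference, so that summation by parts yields a nonnegative form. *)
Definition sdiff (f : T -> R) x := (2 * f x - f (s x) - f (s' x)) / h ^+ 2.

Lemma sum_sdiff (f g : T -> R) :
  \sum_x f x * sdiff g x = \sum_x fdiff f x * fdiff g x.
Proof.
transitivity (h ^- 2 * \sum_x (f (s x) - f x) * (g (s x) - g x)).
  by rewrite -sum_by_parts mulr_sumr; apply: eq_bigr => x _; rewrite /sdiff; field; rewrite gt_eqF.
by rewrite mulr_sumr; apply: eq_bigr => x _; rewrite /fdiff; field; rewrite gt_eqF.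
Qed.

(* Summation by parts of p^3 times the difference of f, where p = fdiff f. *)
Lemma sum_fdiff4 (f : T -> R) (F : R) : (forall x, f x ^+ 2 <= F) ->
  \sum_x fdiff f x ^+ 4 <= 9 * F * \sum_x sdiff f x ^+ 2.
Proof.
move=> fF.
pose p := fdiff f; pose p' x := p (s' x).
have hn0 : h != 0 by rewrite gt_eqF.
have E1 : \sum_x p x ^+ 4 = \sum_x f x * sdiff f x * (p x ^+ 2 + p x * p' x + p' x ^+ 2).
  have -> : \sum_x p x ^+ 4 = h^-1 * (\sum_x p x ^+ 3 * f (s x) - \sum_x p x ^+ 3 * f x).
    rewrite -sumrB mulr_sumr; apply: eq_bigr => x _.
    by rewrite exprSr {2}/p /fdiff; field.
  have -> : \sum_x p x ^+ 3 * f (s x) = \sum_x p' x ^+ 3 * f x.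
    by rewrite -(sum_shift (fun x => p' x ^+ 3 * f x)); apply: eq_bigr => x _; rewrite /p' sK.
  rewrite -sumrB mulr_sumr; apply: eq_bigr => x _.
  have -> : sdiff f x = (p' x - p x) / h.
    by rewrite /p' /p /fdiff /sdiff s'K; field.
  by ring.
have E2 : \sum_x p' x ^+ 4 = \sum_x p x ^+ 4 by exact: (sum_shift' (fun x => p x ^+ 4)).
(* Young's inequality is weighted so that the fourth powers on the right add up to half of those on
   the left and can be absorbed. *)
have : \sum_x f x * sdiff f x * (p x ^+ 2 + p x * p' x + p' x ^+ 2) <=
   \sum_x (9 / 2 * F * sdiff f x ^+ 2 + 4^-1 * (p x ^+ 4 + p' x ^+ 4)).
  apply: ler_sum => x _.
  have h1 : 9 / 2 * (f x ^+ 2 * sdiff f x ^+ 2) <= 9 / 2 * (F * sdiff f x ^+ 2).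
    by rewrite ler_pM2l ?divr_gt0// ler_wpM2r ?sqr_ge0.
  move: (f x) (sdiff f x) h1 (p x) (p' x) => a q h1 b c.
  set m := b ^+ 2 + b * c + c ^+ 2.
  have h2 : m ^+ 2 <= 9 / 2 * (b ^+ 4 + c ^+ 4).
    have bc := sqr_ge0 (b + c); have bc' := sqr_ge0 (b - c).
    have b0 := sqr_ge0 b; have c0 := sqr_ge0 c.
    have m0 : 0 <= m by rewrite /m; lra.
    have m1 : m <= 3 / 2 * (b ^+ 2 + c ^+ 2) by rewrite /m; lra.
    clearbody m.
    have : m ^+ 2 <= (3 / 2 * (b ^+ 2 + c ^+ 2)) ^+ 2 by rewrite lerXn2r// nnegrE//; lra.
    have := sqr_ge0 (b ^+ 2 - c ^+ 2); lra.
  clearbody m; move: (b ^+ 4 + c ^+ 4) h2 => B h2.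
  have -> : 4^-1 * B = 18^-1 * (9 / 2 * B) by field.
  have := sqr_ge0 (3 * (a * q) - 3^-1 * m); nra.
rewrite -E1 big_split/= -!mulr_sumr big_split/= E2.
by rewrite /p; lra.
Qed.

(** The weights [G / F] and [F / G] balance Young's inequality, so that the bound is linear in [F]
    and in [G], as a bilinear estimate requires. *)
Lemma sum_sqr_fdiffM (f g : T -> R) (F G : R) : 0 < F -> 0 < G ->
  (forall x, f x ^+ 2 <= F) -> (forall x, g x ^+ 2 <= G) ->
  \sum_x (fdiff f x * fdiff g x) ^+ 2 <=
  9 / 2 * (G * \sum_x sdiff f x ^+ 2 + F * \sum_x sdiff g x ^+ 2).
Proof.
move=> F0 G0 fF gG.
have h1 := sum_fdiff4 fF; have h2 := sum_fdiff4 gG.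
have : \sum_x (fdiff f x * fdiff g x) ^+ 2 <=
  \sum_x (2^-1 * (G / F) * fdiff f x ^+ 4 + 2^-1 * (F / G) * fdiff g x ^+ 4).
  apply: ler_sum => x _.
  move: (fdiff f x) (fdiff g x) => a b.
  have := sqr_ge0 (G * a ^+ 2 - F * b ^+ 2).
  have -> : 2^-1 * (G / F) * a ^+ 4 + 2^-1 * (F / G) * b ^+ 4 =
     (a * b) ^+ 2 + (G * a ^+ 2 - F * b ^+ 2) ^+ 2 / (2 * (F * G)).
    by field; rewrite !gt_eqF.
  by move=> sq; rewrite lerDl; apply: divr_ge0 => //; rewrite pmulr_rge0// ltW// mulr_gt0.
rewrite big_split/= -!mulr_sumr.
have k1 : 2^-1 * (G / F) * \sum_x fdiff f x ^+ 4 <= 9 / 2 * (G * \sum_x sdiff f x ^+ 2).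
  have c0 : 0 <= 2^-1 * (G / F) by rewrite mulr_ge0 ?invr_ge0 ?divr_ge0 ?ltW.
  apply: (le_trans (ler_wpM2l c0 h1)).
  by rewrite le_eqVlt; apply/orP; left; apply/eqP; field; rewrite gt_eqF.
have k2 : 2^-1 * (F / G) * \sum_x fdiff g x ^+ 4 <= 9 / 2 * (F * \sum_x sdiff g x ^+ 2).
  have c0 : 0 <= 2^-1 * (F / G) by rewrite mulr_ge0 ?invr_ge0 ?divr_ge0 ?ltW.
  apply: (le_trans (ler_wpM2l c0 h2)).
  by rewrite le_eqVlt; apply/orP; left; apply/eqP; field; rewrite gt_eqF.
lra.
Qed.

End ShiftSum.

Section Torus.
Context {R : realFieldType} (N : nat).
Let T : finType := ('I_N * 'I_N)%type.

Definition shx (p : T) : T := (ordS p.1, p.2).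
Definition shx' (p : T) : T := (ord_pred p.1, p.2).
Definition shy (p : T) : T := (p.1, ordS p.2).
Definition shy' (p : T) : T := (p.1, ord_pred p.2).

Lemma shxK : cancel shx shx'. Proof. by case=> i j; rewrite /shx' /= ordSK. Qed.
Lemma shx'K : cancel shx' shx. Proof. by case=> i j; rewrite /shx /= ord_predK. Qed.
Lemma shyK : cancel shy shy'. Proof. by case=> i j; rewrite /shy' /= ordSK. Qed.
Lemma shy'K : cancel shy' shy. Proof. by case=> i j; rewrite /shy /= ord_predK. Qed.

Variables (h L : R).
Hypotheses (h_gt0 : 0 < h) (L_gt0 : 0 < L) (hN : h * N%:R = L).

Local Notation d1 := (fdiff shx h).
Local Notation d2 := (fdiff shy h).
Local Notation l1 := (sdiff shx shx' h).
Local Notation l2 := (sdiff shy shy' h).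

Definition tlap (f : T -> R) p := l1 f p + l2 f p.

Lemma sum_tlap (f g : T -> R) :
  \sum_p f p * tlap g p = \sum_p d1 f p * d1 g p + \sum_p d2 f p * d2 g p.
Proof.
rewrite -(sum_sdiff shxK shx'K h_gt0 f g) -(sum_sdiff shyK shy'K h_gt0 f g) -big_split.
by apply: eq_bigr => p _; rewrite /tlap mulrDr.
Qed.

(** After two summations by parts the cross term of the two directions is a sum of squares of mixed
    differences. Hence the Laplacian alone controls every second difference: elliptic regularity on
    the discrete torus. *)
Lemma sum_tlap_sqr (f : T -> R) : \sum_p tlap f p ^+ 2 =
  \sum_p l1 f p ^+ 2 + \sum_p l2 f p ^+ 2 + 2 * \sum_p d1 (d2 f) p ^+ 2.
Proof.
have -> : \sum_p d1 (d2 f) p ^+ 2 = \sum_p l1 f p * l2 f p.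
  rewrite (sum_sdiff shyK shy'K h_gt0).
  under [RHS]eq_bigr => p _.
    rewrite (_ : d2 (l1 f) p = l1 (d2 f) p).
    rewrite mulrC; over.
    by rewrite /fdiff /sdiff /shx /shy /=; ring.
  by rewrite (sum_sdiff shxK shx'K h_gt0); apply: eq_bigr => p _; rewrite expr2.
rewrite mulr_sumr -!big_split; apply: eq_bigr => p _ /=.
by rewrite /tlap; ring.
Qed.

(** The path between the two indices that avoids the identification of the end points is part of the
    whole cycle. *)
Lemma cyclic_variation (a : 'I_N -> R) i j :
  a i - a j <= \sum_k `|a (ordS k) - a k|.
Proof.
case: N a i j => [|n] a i j; first by case: i.
pose b m := a (inord m).
have bE (k : 'I_n.+1) : a k = b k by rewrite /b inord_val.
have key p q : (p <= q)%N -> (q <= n)%N ->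
    `|b q - b p| <= \sum_k `|a (ordS k) - a k|.
  move=> pq qn; rewrite -(telescope_sumr b pq).
  apply: (le_trans (ler_norm_sum _ _ _)).
  pose F k := `|a (ordS (inord k)) - a (inord k)|.
  have -> : \sum_(k < n.+1) `|a (ordS k) - a k| = \sum_(0 <= k < p) F k +
     (\sum_(p <= k < q) F k + \sum_(q <= k < n.+1) F k).
    rewrite -big_cat_nat ?leqW// -big_cat_nat ?(leq_trans pq) ?leqW//.
    by rewrite big_mkord; apply: eq_bigr => k _; rewrite /F inord_val.
  rewrite [leRHS]addrCA -[leLHS]addr0 lerD//.
    rewrite !big_nat; apply: ler_sum => k /andP[pk kq]; rewrite /F /b.
    suff -> : ordS (inord k) = inord k.+1 :> 'I_n.+1 by [].
    have kn : (k < n)%N := leq_trans kq qn.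
    by apply: val_inj; rewrite /= !inordK ?modn_small ?ltnS// ltnW.
  by apply: addr_ge0; apply: sumr_ge0 => k _; exact: normr_ge0.
have [ij|ji] := leqP i j.
  have := key _ _ ij (ltn_ord j : (j < n.+1)%N); rewrite -!bE => /(le_trans _); apply.
  by rewrite distrC ler_norm.
have := key _ _ (ltnW ji) (ltn_ord i : (i < n.+1)%N); rewrite -!bE => /(le_trans _); apply.
exact: ler_norm.
Qed.

(** [cyclic_variation] is applied to the squares, whose increments are products of a difference and
    a sum, and the result is averaged over [j]; the averaging produces [L^-1]. *)
Lemma sobolev1 (g : 'I_N -> R) i :
  g i ^+ 2 <= (1 + L^-1) * (h * \sum_k g k ^+ 2)
              + h * \sum_k ((g (ordS k) - g k) / h) ^+ 2.
Proof.
set D := h * \sum_k ((g (ordS k) - g k) / h) ^+ 2; set S := h * \sum_k g k ^+ 2.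
have hn0 : h != 0 by rewrite gt_eqF.
have N0 : (N%:R : R) != 0.
  by apply: contraTneq L_gt0 => e; rewrite -hN e mulr0 ltxx.
have st j : g i ^+ 2 - g j ^+ 2 <= D + S.
  apply: (le_trans (cyclic_variation (fun k => g k ^+ 2) i j)).
  have sh : \sum_k g (ordS k) ^+ 2 = \sum_k g k ^+ 2.
    exact: (sum_shift (@ordSK N) (@ord_predK N) (fun k => g k ^+ 2)).
  have -> : S = \sum_k (h / 2 * g (ordS k) ^+ 2 + h / 2 * g k ^+ 2).
    by rewrite big_split/= -!mulr_sumr sh /S; field.
  rewrite /D mulr_sumr -big_split/=; apply: ler_sum => k _.
  move: (g (ordS k)) (g k) => a b.
  have -> : a ^+ 2 - b ^+ 2 = h * (((a - b) / h) * (a + b)) by field.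
  rewrite normrM (gtr0_norm h_gt0).
  have -> : h * ((a - b) / h) ^+ 2 + (h / 2 * a ^+ 2 + h / 2 * b ^+ 2) =
     h * (((a - b) / h) ^+ 2 + 2^-1 * (a ^+ 2 + b ^+ 2)) by field.
  apply: ler_wpM2l; first exact: ltW.
  rewrite ler_norml; move: (_ / h) => c.
  have := sqr_ge0 (c - 2^-1 * (a + b)); have := sqr_ge0 (c + 2^-1 * (a + b)).
  have := sqr_ge0 (a - b); nra.
have : \sum_(j < N) (g i ^+ 2 - g j ^+ 2) <= \sum_(j < N) (D + S) by apply: ler_sum.
rewrite sumrB !sumr_const card_ord -(mulr_natl (g i ^+ 2)) -(mulr_natl (D + S)) => key.
have : h * (N%:R * g i ^+ 2 - \sum_i0 g i0 ^+ 2) <= h * (N%:R * (D + S)) by rewrite ler_pM2l.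
rewrite mulrBr -/S [h * (_ * g i ^+ 2)]mulrA [h * (_ * (D + S))]mulrA hN => k2.
rewrite -(ler_pM2l L_gt0).
have -> : L * ((1 + L^-1) * S + D) = L * S + S + L * D by field; rewrite gt_eqF.
by lra.
Qed.

Definition sob2 (f : T -> R) := h ^+ 2 * (\sum_p f p ^+ 2 + \sum_p tlap f p ^+ 2).

Lemma sob2_ge0 f : 0 <= sob2 f.
Proof. by rewrite /sob2 mulr_ge0 ?sqr_ge0 ?addr_ge0 ?sumr_ge0 => // p _; exact: sqr_ge0. Qed.

(** The one-dimensional inequality is used in the first variable and then, for the function and its
    first difference, in the second; the mixed difference that appears is bounded through
    [sum_tlap_sqr]. *)
Lemma sobolev2 (f : T -> R) p : f p ^+ 2 <= 2 * (1 + L^-1) ^+ 2 * sob2 f.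
Proof.
have c1 : 1 <= 1 + L^-1 by rewrite lerDl invr_ge0 ltW.
set c := 1 + L^-1 in c1 *.
have s1 k : f (k, p.2) ^+ 2 <= c * (h * \sum_j f (k, j) ^+ 2) + h * \sum_j d2 f (k, j) ^+ 2.
  exact: (sobolev1 (fun j => f (k, j)) p.2).
have s2 k : d1 f (k, p.2) ^+ 2 <=
    c * (h * \sum_j d1 f (k, j) ^+ 2) + h * \sum_j d2 (d1 f) (k, j) ^+ 2.
  exact: (sobolev1 (fun j => d1 f (k, j)) p.2).
have s0 : f p ^+ 2 <= c * (h * \sum_k f (k, p.2) ^+ 2) + h * \sum_k d1 f (k, p.2) ^+ 2.
  by case: (p) => i j; exact: (sobolev1 (fun i => f (i, j)) i).
have pr (g : T -> R) : \sum_k \sum_j g (k, j) = \sum_p g p.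
  by rewrite pair_big; apply: eq_bigr => -[].
set A0 := \sum_p f p ^+ 2; set A1 := \sum_p d1 f p ^+ 2.
set A2 := \sum_p d2 f p ^+ 2; set A3 := \sum_p d2 (d1 f) p ^+ 2.
have r0 : h * \sum_k f (k, p.2) ^+ 2 <= h * (c * (h * A0) + h * A2).
  rewrite ler_pM2l// /A0 /A2 -!pr !mulr_sumr -big_split.
  by apply: ler_sum => k _.
have r1 : h * \sum_k d1 f (k, p.2) ^+ 2 <= h * (c * (h * A1) + h * A3).
  rewrite ler_pM2l// /A1 /A3 -!pr !mulr_sumr -big_split.
  by apply: ler_sum => k _.
have t1 : A1 + A2 <= 2^-1 * (A0 + \sum_p tlap f p ^+ 2).
  have -> : A1 + A2 = \sum_p f p * tlap f p.
    by rewrite sum_tlap; congr (_ + _); apply: eq_bigr => q _; rewrite expr2.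
  rewrite -big_split mulr_sumr; apply: ler_sum => q _ /=.
  by have := sqr_ge0 (f q - tlap f q); lra.
have t2 : 2 * A3 <= \sum_p tlap f p ^+ 2.
  have -> : A3 = \sum_p d1 (d2 f) p ^+ 2.
    by apply: eq_bigr => q _; congr (_ ^+ 2); rewrite /fdiff /shx /shy /=; ring.
  by rewrite sum_tlap_sqr lerDr addr_ge0// sumr_ge0// => q _; exact: sqr_ge0.
have A00 : 0 <= A0 by rewrite sumr_ge0// => q _; exact: sqr_ge0.
have A10 : 0 <= A1 by rewrite sumr_ge0// => q _; exact: sqr_ge0.
have A20 : 0 <= A2 by rewrite sumr_ge0// => q _; exact: sqr_ge0.
have A30 : 0 <= A3 by rewrite sumr_ge0// => q _; exact: sqr_ge0.
rewrite /sob2 -/A0; set B := \sum_p tlap f p ^+ 2 in t1 t2 *.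
have : f p ^+ 2 <= h ^+ 2 * (c ^+ 2 * A0 + c * (A1 + A2) + A3).
  apply: (le_trans s0).
  have := ler_wpM2l (ltW (lt_le_trans ltr01 c1)) r0.
  by lra.
move=> /le_trans; apply.
rewrite mulrCA; apply: ler_wpM2l; first exact: sqr_ge0.
have c2 : c <= c ^+ 2 by rewrite expr2 ler_peMl//; lra.
have c3 : 1 <= c ^+ 2 by lra.
have : c * (A1 + A2) <= c ^+ 2 * (2^-1 * (A0 + B)).
  by apply: ler_pM => //; [lra|rewrite addr_ge0].
have B0 : 0 <= B by lra.
have : 1 * B <= c ^+ 2 * B by apply: ler_wpM2r.
have : 0 <= c ^+ 2 * A0 by rewrite mulr_ge0//; lra.
lra.
Qed.

Lemma tlapM (f g : T -> R) p : tlap (fun q => f q * g q) p =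
  f p * tlap g p + g p * tlap f p -
  (d1 f p * d1 g p + d1 f (shx' p) * d1 g (shx' p)
   + (d2 f p * d2 g p + d2 f (shy' p) * d2 g (shy' p))).
Proof.
have h0 : h != 0 by rewrite gt_eqF.
by rewrite /tlap /sdiff /fdiff shx'K shy'K; field.
Qed.

(** The Leibniz expansion has two gradient products in each direction, bounded by [sum_sqr_fdiffM],
    a discrete Gagliardo-Nirenberg inequality. Its six terms give 6 (1 + 18) = 114 before the
    lower-order part is added. *)
Lemma sob2M_aux (f g : T -> R) (F G : R) : 0 < F -> 0 < G ->
  (forall x, f x ^+ 2 <= F) -> (forall x, g x ^+ 2 <= G) ->
  sob2 (fun p => f p * g p) <= 115 * (F * sob2 g + G * sob2 f).
Proof.
move=> F0 G0 fF gG.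
have n0 (u : T -> R) : 0 <= \sum_p u p ^+ 2 by rewrite sumr_ge0// => p _; exact: sqr_ge0.
have m1 := sum_sqr_fdiffM shxK shx'K h_gt0 F0 G0 fF gG.
have m2 := sum_sqr_fdiffM shyK shy'K h_gt0 F0 G0 fF gG.
have sub u : \sum_p l1 u p ^+ 2 <= \sum_p tlap u p ^+ 2 /\
   \sum_p l2 u p ^+ 2 <= \sum_p tlap u p ^+ 2.
  rewrite sum_tlap_sqr; have := n0 (d1 (d2 u)); have := n0 (l1 u); have := n0 (l2 u).
  by move=> *; split; lra.
have [f1 f2] := sub f; have [g1 g2] := sub g.
have q1 : \sum_p (f p * g p) ^+ 2 <= F * \sum_p g p ^+ 2.
  rewrite mulr_sumr; apply: ler_sum => p _; rewrite exprMn.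
  by apply: ler_wpM2r => //; exact: sqr_ge0.
set Bf := \sum_p tlap f p ^+ 2 in f1 f2 *; set Bg := \sum_p tlap g p ^+ 2 in g1 g2 *.
set X1 := \sum_x (d1 f x * d1 g x) ^+ 2 in m1.
set X2 := \sum_x (d2 f x * d2 g x) ^+ 2 in m2.
have q2 : \sum_p tlap (fun q => f q * g q) p ^+ 2 <=
    6 * (F * Bg + G * Bf + 2 * X1 + 2 * X2).
  have e1 : X1 = \sum_p (d1 f (shx' p) * d1 g (shx' p)) ^+ 2.
    by rewrite (sum_shift' shxK shx'K (fun p => (d1 f p * d1 g p) ^+ 2)).
  have e2 : X2 = \sum_p (d2 f (shy' p) * d2 g (shy' p)) ^+ 2.
    by rewrite (sum_shift' shyK shy'K (fun p => (d2 f p * d2 g p) ^+ 2)).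
  have -> : 6 * (F * Bg + G * Bf + 2 * X1 + 2 * X2) =
    6 * (F * Bg + G * Bf + (X1 + X1) + (X2 + X2)) by ring.
  rewrite {2}e1 {2}e2 /X1 /X2 /Bf /Bg !mulr_sumr -!big_split mulr_sumr.
  apply: ler_sum => p _ /=; rewrite tlapM.
  have u1 : (f p * tlap g p) ^+ 2 <= F * tlap g p ^+ 2.
    by rewrite exprMn ler_wpM2r ?sqr_ge0.
  have u2 : (g p * tlap f p) ^+ 2 <= G * tlap f p ^+ 2.
    by rewrite exprMn ler_wpM2r ?sqr_ge0.
  move: (f p * tlap g p) (g p * tlap f p) (d1 f p * d1 g p)
    (d1 f (shx' p) * d1 g (shx' p)) (d2 f p * d2 g p) (d2 f (shy' p) * d2 g (shy' p)) u1 u2.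
  move: (F * _) (G * _) => a b x1 x2 x3 x4 x5 x6 u1 u2.
  have := sqr_ge0 (x1 + x2 + (x3 + x4)); have := sqr_ge0 (x1 + x2 + (x5 + x6)).
  have := sqr_ge0 (x3 + x4 - (x5 + x6)); have := sqr_ge0 (x1 - x2).
  have := sqr_ge0 (x3 - x4); have := sqr_ge0 (x5 - x6); lra.
have FG0 : 0 <= F * Bg /\ 0 <= G * Bf by rewrite !mulr_ge0 ?n0// ltW.
rewrite /sob2 -/Bf -/Bg mulrCA (mulrCA G) -mulrDr mulrCA; apply: ler_wpM2l; first exact: sqr_ge0.
have k1 : G * \sum_x l1 f x ^+ 2 <= G * Bf by rewrite ler_pM2l.
have k2 : F * \sum_x l1 g x ^+ 2 <= F * Bg by rewrite ler_pM2l.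
have k3 : G * \sum_x l2 f x ^+ 2 <= G * Bf by rewrite ler_pM2l.
have k4 : F * \sum_x l2 g x ^+ 2 <= F * Bg by rewrite ler_pM2l.
have k5 : 0 <= F * \sum_x g x ^+ 2 by rewrite mulr_ge0 ?n0// ltW.
have k6 : 0 <= G * \sum_x f x ^+ 2 by rewrite mulr_ge0 ?n0// ltW.
lra.
Qed.

Definition sobC : R := 2 * (1 + L^-1) ^+ 2.

Lemma sobC_gt0 : 0 < sobC.
Proof. by rewrite /sobC mulr_gt0// exprn_gt0// addr_gt0// invr_gt0. Qed.

(** The sup bounds for [sob2M_aux] come from [sobolev2]: discrete H^2 is an algebra with a constant
    independent of the mesh. The weights used there need positive bounds, so vanishing factors are
    set apart. *)
Lemma sob2M (f g : T -> R) :
  sob2 (fun p => f p * g p) <= 230 * sobC * (sob2 f * sob2 g).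
Proof.
have z (u v : T -> R) : sob2 u = 0 -> sob2 (fun p => u p * v p) = 0 /\ sob2 (fun p => v p * u p) = 0.
  move=> u0; have uz p : u p = 0.
    by apply/eqP; rewrite -sqrf_eq0 eq_le sqr_ge0 andbT; have := sobolev2 u p; rewrite u0 mulr0.
  have e0 : sob2 (fun=> 0) = 0.
    rewrite /sob2 !big1 ?addr0 ?mulr0// => p _; rewrite /tlap /sdiff.
      by rewrite !(mulr0, subr0, mul0r, addr0) expr0n.
    by rewrite expr0n.
  by split; rewrite -[RHS]e0; congr sob2; apply/funext => p; rewrite uz ?mul0r ?mulr0.
have [f0|fn0] := eqVneq (sob2 f) 0; first by rewrite (z f g f0).1 f0 mul0r mulr0.
have [g0|gn0] := eqVneq (sob2 g) 0; first by rewrite (z g f g0).2 g0 !mulr0.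
have c0 := sobC_gt0.
have F0 : 0 < sobC * sob2 f by rewrite mulr_gt0// lt_neqAle eq_sym fn0 sob2_ge0.
have G0 : 0 < sobC * sob2 g by rewrite mulr_gt0// lt_neqAle eq_sym gn0 sob2_ge0.
apply: (le_trans (sob2M_aux F0 G0 (sobolev2 f) (sobolev2 g))).
lra.
Qed.

Lemma sob2D (f g : T -> R) : sob2 (fun p => f p + g p) <= 2 * (sob2 f + sob2 g).
Proof.
rewrite /sob2 -mulrDr mulrCA; apply: ler_wpM2l; first exact: sqr_ge0.
rewrite addrACA mulrDr; apply: lerD; rewrite -big_split mulr_sumr; apply: ler_sum => p _ /=.
  by have := sqr_ge0 (f p - g p); lra.
have -> : tlap (fun p => f p + g p) p = tlap f p + tlap g p.
  by rewrite /tlap /sdiff; ring.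
by have := sqr_ge0 (tlap f p - tlap g p); lra.
Qed.

Lemma sob2Z a (f : T -> R) : sob2 (fun p => a * f p) = a ^+ 2 * sob2 f.
Proof.
rewrite /sob2 mulrCA; congr (_ * _); rewrite mulrDr !mulr_sumr; congr (_ + _).
  by apply: eq_bigr => p _; rewrite exprMn.
apply: eq_bigr => p _; rewrite -exprMn; congr (_ ^+ 2).
by rewrite /tlap /sdiff; ring.
Qed.
End Torus.
Arguments shx {N}.
Arguments shx' {N}.
Arguments shy {N}.
Arguments shy' {N}.
Arguments shxK {N}.
Arguments shx'K {N}.
Arguments shyK {N}.
Arguments shy'K {N}.

(** * The scheme on the discrete torus *)

Section GridScheme.
Context {R : realFieldType} (N : nat) (h L : R).
Hypotheses (h_gt0 : 0 < h) (L_gt0 : 0 < L) (hN : h * N%:R = L).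
Let T : finType := ('I_N * 'I_N)%type.
Let V : lmodType R := (T -> R^o).

Lemma gevD (f g : V) p : (f + g) p = (f p : R) + (g p : R) :> R. Proof. by []. Qed.
Lemma gevN (f : V) p : (- f) p = - (f p : R) :> R. Proof. by []. Qed.
Lemma gevZ a (f : V) p : (a *: f) p = a * (f p : R) :> R. Proof. by []. Qed.
Definition gev := (gevD, gevN, gevZ).

Definition gip (f g : V) : R := h ^+ 2 * \sum_p (f p : R) * g p.

Lemma gipC f g : gip f g = gip g f.
Proof. by congr (_ * _); apply: eq_bigr => p _; rewrite mulrC. Qed.

Lemma gipDl (f g k : V) : gip (f + g) k = gip f k + gip g k.
Proof.
by rewrite /gip -mulrDr -big_split; congr (_ * _); apply: eq_bigr => p _; exact: mulrDl.
Qed.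

Lemma gipZl a (f g : V) : gip (a *: f) g = a * gip f g.
Proof.
by rewrite /gip [RHS]mulrCA [in RHS]mulr_sumr; congr (_ * _); apply: eq_bigr => p _; rewrite [RHS]mulrA.
Qed.

Lemma gip_ge0 f : 0 <= gip f f.
Proof.
by rewrite mulr_ge0 ?sqr_ge0// sumr_ge0// => p _; rewrite -expr2 sqr_ge0.
Qed.

(* Locked, so that [gA f] is not taken for the sum in the body of [tlap]. *)
Fact gA_key : unit. Proof. exact: tt. Qed.
Definition gA : V -> V := locked_with gA_key (fun f : V => tlap h f : V).

Lemma gAE f : gA f = tlap h f. Proof. by rewrite /gA unlock. Qed.

Lemma gAD (f g : V) : gA (f + g) = gA f + gA g.
Proof.
by rewrite !gAE; apply/funext => p; rewrite gevD /tlap /sdiff !gev; ring.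
Qed.

Lemma gAZ a (f : V) : gA (a *: f) = a *: gA f.
Proof.
by rewrite !gAE; apply/funext => p; rewrite gevZ /tlap /sdiff !gev; ring.
Qed.

Lemma gAN (f : V) : gA (- f) = - gA f.
Proof. exact: opAN gAZ f. Qed.

Lemma gipA (f g : V) : gip (gA f) g = gip f (gA g).
Proof.
rewrite gipC !gAE; congr (_ * _).
transitivity (\sum_p g p * tlap h f p) => //.
rewrite sum_tlap// [RHS](sum_tlap h_gt0 f g).
by congr (_ + _); apply: eq_bigr => p _; rewrite mulrC.
Qed.

Lemma gip_gradE (f : V) : gip f (gA f) =
  h ^+ 2 * (\sum_p fdiff shx h f p ^+ 2 + \sum_p fdiff shy h f p ^+ 2).
Proof.
by rewrite gAE; congr (_ * _); rewrite [LHS](sum_tlap h_gt0 f f); congr (_ + _); apply: eq_bigr => p _; rewrite expr2.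
Qed.

Lemma gipA_ge0 (f : V) : 0 <= gip f (gA f).
Proof.
by rewrite gip_gradE mulr_ge0 ?sqr_ge0// addr_ge0// sumr_ge0// => p _; rewrite sqr_ge0.
Qed.

Lemma sob2_gip (f : V) : sob2 h f = gip f f + gip (gA f) (gA f).
Proof.
by rewrite gAE /sob2 mulrDr; congr (_ * _ + _ * _); apply: eq_bigr => p _; rewrite expr2.
Qed.

Lemma gip_const : gip (fun=> 1) (fun=> 1) = L ^+ 2.
Proof.
rewrite /gip mulr1 sumr_const card_prod card_ord -hN natrM; ring.
Qed.

Definition qrt (f : V) : R := h ^+ 2 * \sum_p 4^-1 * f p ^+ 4.

Definition gchi (f g : V) : V :=
  fun p => (f p ^+ 2 + g p ^+ 2) / 2 * ((f p + g p) / 2).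

(** [gchi] is a secant of the quartic: (a^2 + b^2)(a + b)(a - b) = a^4 - b^4. This exactness makes
    the implicit cubic term harmless for stability. *)
Lemma gip_gchi (f g : V) : gip (gchi f g) (f - g) = qrt f - qrt g.
Proof.
rewrite /qrt -mulrBr -sumrB; congr (_ * _); apply: eq_bigr => p _.
by rewrite /gchi !gev; field.
Qed.

(** From (f^2 - 4)^2 >= 0. The factor 2 covers the square lost in [stab_energy_coercive] and leaves
    one copy for the L^2 norm. *)
Lemma qrt_lower (f : V) : 2 * gip f f - 4 * L ^+ 2 <= qrt f.
Proof.
rewrite -gip_const /gip /qrt mulrCA (mulrCA 4) -mulrBr.
apply: ler_wpM2l; first exact: sqr_ge0.
rewrite !mulr_sumr -sumrB; apply: ler_sum => p _.
by have := sqr_ge0 (f p ^+ 2 - 4); lra.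
Qed.

Lemma qrt_upper (f : V) : qrt f <= sobC L * sob2 h f ^+ 2.
Proof.
have c0 := sobC_gt0 L_gt0; have s0 := sob2_ge0 h f.
have : qrt f <= sobC L * sob2 h f * gip f f.
  rewrite /qrt /gip [leRHS]mulrCA; apply: ler_wpM2l; first exact: sqr_ge0.
  rewrite mulr_sumr; apply: ler_sum => p _.
  have := sobolev2 h_gt0 L_gt0 hN f p; rewrite -/(sobC L) => b.
  have := ler_wpM2r (sqr_ge0 (f p)) b.
  have := sqr_ge0 (f p ^+ 2); lra.
move=> /le_trans; apply; rewrite expr2 mulrA; apply: ler_wpM2l.
  by rewrite mulr_ge0// ltW.
by rewrite sob2_gip lerDl gip_ge0.
Qed.

Section Stable.
Variables (alpha beta s : R).
Hypotheses (alpha_ge0 : 0 <= alpha) (beta_gt0 : 0 < beta) (s_gt0 : 0 < s).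

(* With [A = - Delta_h]; the scheme's [phi^{k-1}] is [phi k.-1], since
   phi^{-1} = phi^0. *)
Definition grid_step (phim phi psi phip psip : V) : Prop :=
  beta *: (psip - psi) =
    - (s *: gA (gchi phip phi + alpha *: (2^-1 *: (phip + phi))
        - 2 *: gA (2^-1 *: (3 *: phi - phim)) + gA (gA (2^-1 *: (phip + phi)))))
    - s *: (2^-1 *: (psip + psi))
  /\ phip - phi = s *: (2^-1 *: (psip + psi)).

Variables (phi psi : nat -> V).
Hypothesis psi0 : psi 0%N = 0.

(** The discrete Laplacian has the constants in its kernel and is not inverted: as psi^0 = 0, the
    scheme itself can be solved recursively for a potential of psi. *)
Lemma grid_potential n :
  (forall k, (k < n)%N -> grid_step (phi k.-1) (phi k) (psi k) (phi k.+1) (psi k.+1)) ->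
  exists eta, gA eta = psi n /\
   stab_energy gip gA qrt alpha beta (phi n.-1) (phi n) eta <=
   stab_energy gip gA qrt alpha beta (phi 0%N) (phi 0%N) 0.
Proof.
have A0 : gA 0 = 0 by have := gAZ 0 0; rewrite !scale0r.
elim: n => [_|n IH H].
  by exists 0; rewrite A0 psi0.
have [|eta [Heta Een]] := IH; first by move=> k kn; exact: (H k (ltnW kn)).
have [H1 H2] := H n (ltnSn n).
set mu : V := gchi (phi n.+1) (phi n) + _ - _ + _ in H1.
have bs : beta + s / 2 != 0 by rewrite gt_eqF// addr_gt0// divr_gt0.
(* Solution of the momentum equation with one power of [gA] removed; the friction is taken at the
   midpoint, hence [beta + s / 2]. *)
pose etap : V := (beta + s / 2)^-1 *: ((beta - s / 2) *: eta - s *: mu).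
have Aetap : gA etap = psi n.+1.
  rewrite /etap gAZ; apply: (scalerI bs); rewrite scalerA mulfV// scale1r.
  rewrite gAD -scaleN1r !gAZ Heta scaleN1r.
  apply/funext => p; have := congr1 (fun f : V => f p) H1.
  rewrite !gev; lra.
exists etap; split => //; apply: le_trans Een.
apply: (stab_energy_step (mu := mu) (ch := gchi (phi n.+1) (phi n))
  gipC gipDl gipZl gAD gAZ gipA gipA_ge0 s_gt0) => //.
- exact: gip_gchi.
- have He : (beta + s / 2) *: etap = (beta - s / 2) *: eta - s *: mu.
    by rewrite /etap scalerA mulfV// scale1r.
  apply/funext => p; have := congr1 (fun f : V => f p : R) He.
  rewrite !gev; lra.
- by rewrite H2 gAZ gAD Aetap Heta.
Qed.

(** Coercivity keeps a quarter of the top-order norm, so the bound on the initial energy, together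
    with [4 * L ^+ 2] from [qrt_lower], is multiplied by 4. *)
Definition stabC (B : R) : R :=
  4 * (sobC L * B ^+ 2 + (alpha + 1) * B + 4 * L ^+ 2).

Lemma grid_stable B n : sob2 h (phi 0%N) <= B ->
  (forall k, (k < n)%N -> grid_step (phi k.-1) (phi k) (psi k) (phi k.+1) (psi k.+1)) ->
  sob2 h (phi n) <= stabC B.
Proof.
move=> HB /grid_potential [eta [_ Een]].
have co := stab_energy_coercive gipC gipDl gipZl gip_ge0 gipA_ge0 qrt beta_gt0
  (phi n.-1) (phi n) eta alpha_ge0.
have lo := qrt_lower (phi n).
have up : stab_energy gip gA qrt alpha beta (phi 0%N) (phi 0%N) 0 <=
    sobC L * B ^+ 2 + (alpha + 1) * B.
  have z : gip 0 (gA 0) = 0.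
    by rewrite /gip big1 ?mulr0// => p _; exact: mul0r.
  rewrite /stab_energy subrr z !mulr0 !addr0.
  have B0 := sob2_ge0 h (phi 0%N).
  have u1 : qrt (phi 0%N) <= sobC L * B ^+ 2.
    apply: (le_trans (qrt_upper _)); rewrite ler_pM2l ?sobC_gt0//.
    by rewrite lerXn2r// nnegrE// (le_trans B0).
  have g1 := gip_ge0 (phi 0%N); have g2 := gipA_ge0 (phi 0%N); have g3 := gip_ge0 (gA (phi 0%N)).
  move: HB; rewrite sob2_gip => HB.
  have : alpha * gip (phi 0%N) (phi 0%N) <= alpha * B by apply: ler_wpM2l => //; lra.
  have : 0 <= alpha * gip (phi 0%N) (phi 0%N) by rewrite mulr_ge0.
  lra.
have g3 := gip_ge0 (gA (phi n)); have g1 := gip_ge0 (phi n).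
rewrite sob2_gip /stabC; lra.
Qed.

End Stable.

Definition chiC (B : R) : R := (230 * sobC L) ^+ 2 * 80 * B ^+ 2.

Lemma sob2_six B (f1 f2 f3 f4 f5 f6 g1 g2 g3 g4 g5 g6 : T -> R) :
  all (fun f => sob2 h f <= B) [:: f1; f2; f3; f4; f5; f6; g1; g2; g3; g4; g5; g6] ->
  sob2 h (fun p => 4^-1 * (((f1 p * g1 p + f2 p * g2 p) + (f3 p * g3 p + f4 p * g4 p))
     + (f5 p * g5 p + f6 p * g6 p))) <= 230 * sobC L * 40 * B ^+ 2.
Proof.
move=> /= /and5P[a1 a2 a3 a4 /and5P[a5 a6 b1 b2 /and5P[b3 b4 b5 b6 _]]].
have c0 := sobC_gt0 L_gt0.
have M (f g : T -> R) : sob2 h f <= B -> sob2 h g <= B ->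
    sob2 h (fun p => f p * g p) <= 230 * sobC L * B ^+ 2.
  move=> fB gB; apply: (le_trans (sob2M h_gt0 L_gt0 hN f g)).
  apply: ler_wpM2l; first by rewrite mulr_ge0// ltW.
  by rewrite expr2 ler_pM ?sob2_ge0.
have D (f g : T -> R) a b : sob2 h f <= a -> sob2 h g <= b ->
    sob2 h (fun p => f p + g p) <= 2 * (a + b).
  by move=> fa gb; apply: (le_trans (sob2D h f g)); lra.
rewrite sob2Z.
have m1 := M _ _ a1 b1; have m2 := M _ _ a2 b2; have m3 := M _ _ a3 b3.
have m4 := M _ _ a4 b4; have m5 := M _ _ a5 b5; have m6 := M _ _ a6 b6.
have := D _ _ _ _ (D _ _ _ _ (D _ _ _ _ m1 m2) (D _ _ _ _ m3 m4)) (D _ _ _ _ m5 m6).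
have := sob2_ge0 h (fun p => (((f1 p * g1 p + f2 p * g2 p) + (f3 p * g3 p + f4 p * g4 p))
     + (f5 p * g5 p + f6 p * g6 p))).
move: (sob2 h _) => X; lra.
Qed.

(** Changing one argument at a time gives cofactors [P] and [Q] that are sums of six products. The
    square of [230 * sobC L] in [chiC] stems from two multiplications, one inside the cofactors and
    one with the differences. *)
Lemma sob2_gchiB B (a b c d : V) :
  sob2 h a <= B -> sob2 h b <= B -> sob2 h c <= B -> sob2 h d <= B ->
  sob2 h (gchi a b - gchi c d) <= chiC B * (sob2 h (a - c) + sob2 h (b - d)).
Proof.
move=> aB bB cB dB; have c0 := sobC_gt0 L_gt0.
pose P p := 4^-1 * (((a p * a p + a p * c p) + (c p * c p + a p * b p)) + (c p * b p + b p * b p)).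
pose Q p := 4^-1 * (((b p * b p + b p * d p) + (d p * d p + c p * c p)) + (c p * b p + c p * d p)).
have PB : sob2 h P <= 230 * sobC L * 40 * B ^+ 2 by apply: sob2_six; rewrite /= aB bB cB.
have QB : sob2 h Q <= 230 * sobC L * 40 * B ^+ 2 by apply: sob2_six; rewrite /= bB cB dB.
have -> : gchi a b - gchi c d = (fun p => (a - c) p * P p + (b - d) p * Q p).
  apply/funext => p; rewrite /gchi /P /Q !gev.
  by field.
apply: (le_trans (sob2D h _ _)).
have m1 := sob2M h_gt0 L_gt0 hN (a - c) P.
have m2 := sob2M h_gt0 L_gt0 hN (b - d) Q.
have n1 := sob2_ge0 h (a - c); have n2 := sob2_ge0 h (b - d).
have k1 := ler_wpM2l n1 PB; have k2 := ler_wpM2l n2 QB.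
have cc : 0 <= 230 * sobC L by rewrite mulr_ge0// ltW.
have := ler_wpM2l cc k1; have := ler_wpM2l cc k2.
rewrite /chiC; lra.
Qed.

(** The norms in which [err_energy_step] needs the defects: L^2 for the momentum equation, H^3 for
    phi_t = psi. *)
Definition truncation (t1 t2 : V) : R :=
  gip t1 t1 + gip t2 t2 + gip (gA t2) (gA t2) + gip (gA t2) (gA (gA t2)).

Definition errC (alpha beta B : R) : R :=
  (4 + 2 / beta) * (30 + 2 * alpha + 5 * chiC B).

(** [err_energy_step] bounds the growth of the energy by [err_size], which the energy controls in
    turn, so the implicit Gronwall inequality applies for small [s]. The common H^2 bound [B] makes
    [gchi] Lipschitz with constant [chiC B]. *)
Lemma grid_error (alpha beta s B : R) (phi psi u v t1 t2 : nat -> V) n :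
  0 <= alpha -> 0 < beta -> 0 < s ->
  s * errC alpha beta B <= 2^-1 ->
  (forall k, (k < n)%N ->
    grid_step alpha beta s (phi k.-1) (phi k) (psi k) (phi k.+1) (psi k.+1)) ->
  (forall k, (k < n)%N ->
    beta *: (v k.+1 - v k) =
    - (s *: gA (gchi (u k.+1) (u k) + alpha *: (2^-1 *: (u k.+1 + u k))
        - 2 *: gA (2^-1 *: (3 *: u k - u k.-1)) + gA (gA (2^-1 *: (u k.+1 + u k)))))
    - s *: (2^-1 *: (v k.+1 + v k)) + s *: t1 k
   /\ u k.+1 - u k = s *: (2^-1 *: (v k.+1 + v k)) + s *: t2 k) ->
  psi 0%N = v 0%N ->
  (forall k, (k <= n)%N -> sob2 h (phi k) <= B /\ sob2 h (u k) <= B) ->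
  gip (u n - phi n) (u n - phi n)
    + gip (gA (u n - phi n)) (gA (gA (u n - phi n))) <=
  (4 + 2 / beta) * ((1 + 4 * (s * errC alpha beta B)) ^+ n *
   ((1 + alpha) * gip (gA (u 0%N - phi 0%N)) (gA (gA (u 0%N - phi 0%N)))
    + (10 + 2 * alpha) * gip (u 0%N - phi 0%N) (u 0%N - phi 0%N)
    + 2 * (s * errC alpha beta B) * \sum_(k < n) truncation (t1 k) (t2 k))).
Proof.
move=> a0 b0 s0 small Hphi Hu Hpsi HB.
have cb : 0 < 4 + 2 / beta by rewrite addr_gt0// divr_gt0.
have cb0 : 0 < 2 / beta by rewrite divr_gt0.
have cb1 : 1 <= 4 + 2 / beta by lra.
have K0 : 0 <= chiC B.
  by apply: mulr_ge0; [apply: mulr_ge0 => //|]; exact: sqr_ge0.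
have c30 : 0 <= 30 + 2 * alpha + 5 * chiC B by lra.
pose e k : V := u k - phi k; pose rho k : V := v k - psi k.
have Tau0 k : 0 <= truncation (t1 k) (t2 k).
  by rewrite /truncation !addr_ge0 ?gip_ge0 ?gipA_ge0.
pose En k := err_energy gip gA alpha beta (e k.-1) (e k) (rho k).
pose S k := err_size gip gA (e k.-1) (e k) (rho k).
have SE k : S k <= (4 + 2 / beta) * En k.
  exact: (err_size_le gipC gipDl gipZl gip_ge0 gAD gAZ gipA gipA_ge0 a0 b0).
have E0 k : 0 <= En k.
  exact: (err_energy_ge0 gipC gipDl gipZl gip_ge0 gAD gAZ gipA gipA_ge0 a0 b0).
have step k : (k < n)%N -> En k.+1 - En k <=
    (s * errC alpha beta B) * (En k.+1 + En k + truncation (t1 k) (t2 k)).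
  move=> kn; have [P1 P2] := Hphi k kn; have [U1 U2] := Hu k kn.
  have kn' := ltnW kn.
  pose d : V := gchi (u k.+1) (u k) - gchi (phi k.+1) (phi k).
  have A1 : beta *: (rho k.+1 - rho k) =
      - (s *: gA (d + alpha *: (2^-1 *: (e k.+1 + e k)) - 2 *: gA (2^-1 *: (3 *: e k - e k.-1))
             + gA (gA (2^-1 *: (e k.+1 + e k)))))
      - s *: (2^-1 *: (rho k.+1 + rho k)) + s *: t1 k.
    rewrite /e /rho /d.
    have -> : beta *: (v k.+1 - psi k.+1 - (v k - psi k)) =
      beta *: (v k.+1 - v k) - beta *: (psi k.+1 - psi k).
      by rewrite -scalerBr; congr (_ *: _); rewrite !opprB addrACA [RHS]addrACA; congr (_ + _); rewrite addrC.
    rewrite U1 P1; apply/funext => p.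
    by rewrite !(gAD, gAZ, gAN) !gev; field.
  have A2 : e k.+1 - e k = s *: (2^-1 *: (rho k.+1 + rho k)) + s *: t2 k.
    rewrite /e /rho.
    have -> : u k.+1 - phi k.+1 - (u k - phi k) = (u k.+1 - u k) - (phi k.+1 - phi k).
      by rewrite !opprB addrACA [RHS]addrACA; congr (_ + _); rewrite addrC.
    by rewrite U2 P2; apply/funext => p; rewrite !gev; field.
  have A3 : gip (gA d) (gA d) <= chiC B *
      (gip (e k.+1) (e k.+1) + gip (gA (e k.+1)) (gA (e k.+1))
       + gip (e k) (e k) + gip (gA (e k)) (gA (e k))).
    have [q1 q2] := HB k kn'; have [q3 q4] := HB k.+1 kn.
    have := sob2_gchiB q4 q2 q3 q1; rewrite -/d !(sob2_gip _) -/(e k) -/(e k.+1).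
    have := gip_ge0 d; lra.
  have := @err_energy_step R V gip gA gipC gipDl gipZl gip_ge0 gAD gAZ gipA gipA_ge0
    alpha beta a0 s (chiC B) (e k.-1) (e k) (e k.+1) (rho k) (rho k.+1) d (t1 k) (t2 k)
    s0 K0 A1 A2 A3.
  rewrite -/(En k.+1) -/(En k) -/(S k.+1) -/(S k) -/(truncation (t1 k) (t2 k)) => st.
  apply: (le_trans st); rewrite -mulrA; apply: ler_wpM2l; first exact: ltW.
  rewrite /errC [X in _ <= X * _]mulrC -mulrA; apply: ler_wpM2l => //.
  have := SE k; have := SE k.+1; have := ler_wpM2r (Tau0 k) cb1; lra.
have x0 : 0 <= s * errC alpha beta B.
  by rewrite mulr_ge0 ?mulr_ge0// ltW.
have := @discrete_gronwall R En (fun k => truncation (t1 k) (t2 k)) (s * errC alpha beta B) n.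
rewrite x0 small => /(_ isT Tau0 (E0 0%N) step) G.
have ini : En 0%N <= (1 + alpha) * gip (gA (e 0%N)) (gA (gA (e 0%N)))
    + (10 + 2 * alpha) * gip (e 0%N) (e 0%N).
  rewrite /En /rho Hpsi subrr.
  exact: (err_energy_init gipC gipDl gipZl gip_ge0 gAD gAZ gipA gipA_ge0 beta a0).
apply: (@le_trans _ _ (S n)).
  rewrite /S /err_size -/(e n).
  have := gip_ge0 (rho n); have := gip_ge0 (gA (e n - e n.-1)); lra.
apply: (le_trans (SE n)); apply: ler_wpM2l; first exact: ltW.
apply: (le_trans G); apply: ler_wpM2l; first by rewrite exprn_ge0// addr_ge0// mulr_ge0.
by rewrite lerD2r.
Qed.

End GridScheme.

(** * Trigonometric polynomials on the grid *)

Section TrigBounds.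
Context {R : realType}.

Lemma ge0_of_derive (f df : R -> R) (x : R) : (forall y : R, is_derive y 1 f (df y)) ->
  f (0 : R) = 0 :> R -> (forall y : R, 0 <= y -> 0 <= df y) -> 0 <= x -> 0 <= f x.
Proof.
move=> fdf f0 df0 x0; have [->|xn0] := eqVneq x 0; first by rewrite f0.
have xp : 0 < x by rewrite lt_def xn0.
have cf : {within `[0, x], continuous f}.
  by apply: continuous_subspaceT => y; apply: differentiable_continuous; apply/derivable1_diffP; case: (fdf y).
have [c cx] := MVT xp (fun y _ => fdf y) cf.
rewrite f0 !subr0 => ->; rewrite mulr_ge0// df0//.
by move: cx; rewrite in_itv/= => /andP[/ltW].
Qed.

(** First link of a chain in which each Taylor remainder is the derivative of the next, so that the
    signs propagate. *)
Lemma sin_le_id (x : R) : 0 <= x -> sin x <= x.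
Proof.
move=> x0; rewrite -subr_ge0.
apply: (@ge0_of_derive (fun y => y - sin y) (fun y => 1 - cos y)) => //.
by rewrite sin0 subr0.
Qed.

Lemma cos_lower0 (x : R) : 0 <= x -> 1 - x ^+ 2 / 2 <= cos x.
Proof.
move=> x0; rewrite -subr_ge0.
apply: (@ge0_of_derive (fun y => cos y - (1 - y ^+ 2 / 2)) (fun y => y - sin y)) => //.
- by move=> y; apply: is_derive_eq; rewrite /GRing.scale/=; field.
- by rewrite /= cos0 expr0n/= mul0r subr0 subrr.
- by move=> y y0; rewrite subr_ge0 sin_le_id.
Qed.

Lemma sin_lower0 (x : R) : 0 <= x -> x - x ^+ 3 / 6 <= sin x.
Proof.
move=> x0; rewrite -subr_ge0.
apply: (@ge0_of_derive (fun y => sin y - (y - y ^+ 3 / 6)) (fun y => cos y - (1 - y ^+ 2 / 2))) => //.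
- by move=> y; apply: is_derive_eq; rewrite /GRing.scale/=; field.
- by rewrite /= sin0 expr0n/= mul0r !subr0.
- by move=> y y0; rewrite subr_ge0 cos_lower0.
Qed.

Lemma cos_upper0 (x : R) : 0 <= x -> cos x <= 1 - x ^+ 2 / 2 + x ^+ 4 / 24.
Proof.
move=> x0; rewrite -subr_ge0.
apply: (@ge0_of_derive (fun y => 1 - y ^+ 2 / 2 + y ^+ 4 / 24 - cos y) (fun y => sin y - (y - y ^+ 3 / 6))) => //.
- by move=> y; apply: is_derive_eq; rewrite /GRing.scale/=; field.
- by rewrite /= cos0 !expr0n/= !mul0r subr0 addr0 subrr.
- by move=> y y0; rewrite subr_ge0 sin_lower0.
Qed.

Lemma cos_taylor (x : R) : 1 - x ^+ 2 / 2 <= cos x <= 1 - x ^+ 2 / 2 + x ^+ 4 / 24.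
Proof.
have e2 : x ^+ 2 = `|x| ^+ 2 by rewrite real_normK ?num_real.
have e4 : x ^+ 4 = `|x| ^+ 4 by rewrite -[4%N]/(2 * 2)%N !exprM e2.
by rewrite -cos_norm e2 e4 cos_lower0// cos_upper0.
Qed.

Lemma trig_int_period (x : R) (n : int) :
  cos (x + 2 * pi * n%:~R) = cos x /\ sin (x + 2 * pi * n%:~R) = sin x.
Proof.
have nat (k : nat) (y : R) : cos (y + 2 * pi * k%:R) = cos y /\ sin (y + 2 * pi * k%:R) = sin y.
  have -> : y + 2 * pi * k%:R = y + (pi *+ 2) *+ k by rewrite -[in RHS](mulr_natl pi) mulr_natr.
  split; [exact: (periodicn (@cosD2pi R) k y)|exact: (periodicn (@sinD2pi R) k y)].
case: n => k; first exact: nat.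
have := nat k.+1 (x + 2 * pi * (Negz k)%:~R).
by rewrite NegzE mulrNz mulrN subrK => -[<- <-].
Qed.

Lemma cos_lt1 (x : R) : 0 < `|x| < 2 * pi -> cos x < 1.
Proof.
move=> /andP[x0 x1]; rewrite -cos_norm lt_def cos_le1 andbT.
apply/eqP => e.
have := sin_gt0_pi (x := `|x| / 2).
rewrite divr_gt0// ltr_pdivrMr// mulrC x1 => /(_ isT).
have : cos ((`|x| / 2) *+ 2) = cos `|x| by congr cos; rewrite -mulr_natl; field.
rewrite cos_mulr2n -e => e2 s0.
have := cos2Dsin2 (`|x| / 2).
have : 0 < sin (`|x| / 2) ^+ 2 by rewrite exprn_gt0.
by rewrite -mulr_natl in e2; lra.
Qed.

End TrigBounds.

Section GridModes.
Context {R : realType} (N : nat) (L : R).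
Hypotheses (N_gt0 : (0 < N)%N) (L_gt0 : 0 < L).
Let T : finType := ('I_N * 'I_N)%type.
Let h := L / N%:R.
Let N0 : (N%:R : R) != 0. Proof. by rewrite pnatr_eq0 -lt0n. Qed.
Let h_gt0 : 0 < h. Proof. by rewrite divr_gt0// ltr0n. Qed.

(** Ordinals start at 0 and grid indices at 1, hence the successors. *)
Definition gpt (p : T) : R * R := gpoint h (p.1.+1)%:Z (p.2.+1)%:Z.

Definition wave (k : int) : R := 2 * pi / L * k%:~R.

Lemma phaseE k l z : phase L k l z = wave k * z.1 + wave l * z.2.
Proof. by rewrite /phase /wave; ring. Qed.

Lemma waveD k l : wave (k + l) = wave k + wave l.
Proof. by rewrite /wave intrD mulrDr. Qed.

Lemma waveN k : wave (- k) = - wave k.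
Proof. by rewrite /wave intrN mulrN. Qed.

(** The real part of (a - i b) e^{i phase}. Energies and grid sums thus stay over the reals, and the
    complex projection is split only at the end. *)
Definition tmode (k : int * int) (a b : R) (z : R * R) : R :=
  a * cos (phase L k.1 k.2 z) + b * sin (phase L k.1 k.2 z).

Definition lam (k : int * int) : R := wave k.1 ^+ 2 + wave k.2 ^+ 2.
Definition dsym1 (k : int) : R := (2 - 2 * cos (wave k * h)) / h ^+ 2.
(** Eigenvalue of minus the five-point Laplacian on the mode [k]; [lam] is its continuous
    counterpart. *)
Definition dsym (k : int * int) : R := dsym1 k.1 + dsym1 k.2.

Lemma lam_ge0 k : 0 <= lam k. Proof. by rewrite addr_ge0 ?sqr_ge0. Qed.

Lemma tmode_ext k a b z w : (exists n : int,
    phase L k.1 k.2 z = phase L k.1 k.2 w + 2 * pi * n%:~R) ->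
  tmode k a b z = tmode k a b w.
Proof. by move=> [n e]; rewrite /tmode e !(trig_int_period _ n).1 !(trig_int_period _ n).2. Qed.

Lemma tmode_rot k a b z (d : R) w :
  phase L k.1 k.2 w = phase L k.1 k.2 z + d ->
  tmode k a b w = tmode k (a * cos d + b * sin d) (b * cos d - a * sin d) z.
Proof. by move=> e; rewrite /tmode e cosD sinD; ring. Qed.

Let wave_per (k : int) (n : int) : wave k * (L * n%:~R) = 2 * pi * (k * n)%:~R.
Proof. by rewrite /wave intrM; field; rewrite gt_eqF. Qed.

(** The cyclic successor of the last point is the first one, a period [L] back; modes do not see
    this shift. *)
Lemma coordS (i : 'I_N) : exists n : int,
  ((ordS i).+1%:~R - 2^-1) * h = (i.+1%:~R - 2^-1) * h + h + L * n%:~R.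
Proof.
have hL : L = h * N%:R by rewrite /h divfK.
have pz (m : nat) : ((m%:Z)%:~R : R) = m%:R by rewrite pmulrn.
have := ltn_ord i; rewrite leq_eqVlt => /orP[/eqP e|lt].
  exists (-1); rewrite /= e modnn hL !pz -e -!natr1; ring.
exists 0; rewrite mulr0 addr0 /= modn_small// !pz -!natr1; ring.
Qed.

Lemma coord_pred (i : 'I_N) : exists n : int,
  ((ord_pred i).+1%:~R - 2^-1) * h = (i.+1%:~R - 2^-1) * h - h + L * n%:~R.
Proof.
have [n e] := coordS (ord_pred i); rewrite ord_predK in e.
by exists (- n); rewrite e intrN; ring.
Qed.

Lemma tmode_shx k a b p : tmode k a b (gpt (shx p)) =
  tmode k (a * cos (wave k.1 * h) + b * sin (wave k.1 * h))
          (b * cos (wave k.1 * h) - a * sin (wave k.1 * h)) (gpt p).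
Proof.
have [n e] := coordS p.1.
pose w := ((p.1.+1%:~R - 2^-1) * h + h, (p.2.+1%:~R - 2^-1) * h).
rewrite (@tmode_ext _ _ _ _ w); last first.
  exists (k.1 * n); rewrite !phaseE /w /gpt /gpoint/= e -wave_per; ring.
by apply: tmode_rot; rewrite !phaseE /w /gpt /gpoint/=; ring.
Qed.

Lemma tmode_shx' k a b p : tmode k a b (gpt (shx' p)) =
  tmode k (a * cos (wave k.1 * h) - b * sin (wave k.1 * h))
          (b * cos (wave k.1 * h) + a * sin (wave k.1 * h)) (gpt p).
Proof.
have [n e] := coord_pred p.1.
pose w := ((p.1.+1%:~R - 2^-1) * h - h, (p.2.+1%:~R - 2^-1) * h).
rewrite (@tmode_ext _ _ _ _ w); last first.
  exists (k.1 * n); rewrite !phaseE /w /gpt /gpoint/= e -wave_per; ring.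
rewrite (@tmode_rot _ _ _ (gpt p) (- (wave k.1 * h))).
  by rewrite cosN sinN !mulrN opprK.
by rewrite !phaseE /w /gpt /gpoint/=; ring.
Qed.

Lemma tmode_shy k a b p : tmode k a b (gpt (shy p)) =
  tmode k (a * cos (wave k.2 * h) + b * sin (wave k.2 * h))
          (b * cos (wave k.2 * h) - a * sin (wave k.2 * h)) (gpt p).
Proof.
have [n e] := coordS p.2.
pose w := ((p.1.+1%:~R - 2^-1) * h, (p.2.+1%:~R - 2^-1) * h + h).
rewrite (@tmode_ext _ _ _ _ w); last first.
  exists (k.2 * n); rewrite !phaseE /w /gpt /gpoint/= e -wave_per; ring.
by apply: tmode_rot; rewrite !phaseE /w /gpt /gpoint/=; ring.
Qed.

Lemma tmode_shy' k a b p : tmode k a b (gpt (shy' p)) =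
  tmode k (a * cos (wave k.2 * h) - b * sin (wave k.2 * h))
          (b * cos (wave k.2 * h) + a * sin (wave k.2 * h)) (gpt p).
Proof.
have [n e] := coord_pred p.2.
pose w := ((p.1.+1%:~R - 2^-1) * h, (p.2.+1%:~R - 2^-1) * h - h).
rewrite (@tmode_ext _ _ _ _ w); last first.
  exists (k.2 * n); rewrite !phaseE /w /gpt /gpoint/= e -wave_per; ring.
rewrite (@tmode_rot _ _ _ (gpt p) (- (wave k.2 * h))).
  by rewrite cosN sinN !mulrN opprK.
by rewrite !phaseE /w /gpt /gpoint/=; ring.
Qed.

Lemma tlap_tmode k a b p :
  tlap h (fun p => tmode k a b (gpt p)) p = dsym k * tmode k a b (gpt p).
Proof.
rewrite /tlap /sdiff tmode_shx tmode_shx' tmode_shy tmode_shy' /tmode /dsym /dsym1.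
by field; rewrite gt_eqF.
Qed.

(* Forward differences rotate the pair of coefficients. *)
Definition rotc (d : R) (a b : R) : R * R :=
  ((a * (cos d - 1) + b * sin d) / h, (b * (cos d - 1) - a * sin d) / h).

Lemma fdiffx_tmode k a b p : fdiff shx h (fun p => tmode k a b (gpt p)) p =
  tmode k (rotc (wave k.1 * h) a b).1 (rotc (wave k.1 * h) a b).2 (gpt p).
Proof. by rewrite /fdiff tmode_shx /tmode /=; field; rewrite gt_eqF. Qed.

Lemma fdiffy_tmode k a b p : fdiff shy h (fun p => tmode k a b (gpt p)) p =
  tmode k (rotc (wave k.2 * h) a b).1 (rotc (wave k.2 * h) a b).2 (gpt p).
Proof. by rewrite /fdiff tmode_shy /tmode /=; field; rewrite gt_eqF. Qed.

(** This is |e^{i d} - 1|^2 = 2 - 2 cos d. *)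
Lemma rotc_norm k a b :
  (rotc (wave k * h) a b).1 ^+ 2 + (rotc (wave k * h) a b).2 ^+ 2 =
  dsym1 k * (a ^+ 2 + b ^+ 2).
Proof.
have sc := cos2Dsin2 (wave k * h).
have -> : dsym1 k * (a ^+ 2 + b ^+ 2) =
  (((cos (wave k * h)) ^+ 2 + (sin (wave k * h)) ^+ 2 + 1 - 2 * cos (wave k * h)) / h ^+ 2) * (a ^+ 2 + b ^+ 2).
  by rewrite sc /dsym1; congr (_ / _ * _); ring.
by rewrite /rotc/=; field; rewrite gt_eqF.
Qed.

Lemma dsym1_bounds k : 0 <= dsym1 k <= wave k ^+ 2 /\
  wave k ^+ 2 - dsym1 k <= h ^+ 2 * wave k ^+ 4.
Proof.
have hh : 0 < h ^+ 2 by rewrite exprn_gt0.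
rewrite /dsym1; move: h hh => e hh; have [/andP[c1 c2] c3] := (cos_taylor (wave k * e), cos_le1 (wave k * e)).
move: (wave k) c1 c2 c3 => w c1 c2 c3; split; last first.
  rewrite -(ler_pM2r hh) mulrBl divfK ?gt_eqF//.
  move: c2; rewrite !exprMn; have := sqr_ge0 (w ^+ 2 * e ^+ 2); lra.
apply/andP; split; first by rewrite divr_ge0 ?(ltW hh)//; lra.
rewrite ler_pdivrMr//; move: c1; rewrite !exprMn; lra.
Qed.

Lemma dsym_ge0 k : 0 <= dsym k.
Proof. by have [/andP[a _] _] := dsym1_bounds k.1; have [/andP[b _] _] := dsym1_bounds k.2; rewrite addr_ge0. Qed.

Lemma dsym_le k : dsym k <= lam k.
Proof. by have [/andP[_ a] _] := dsym1_bounds k.1; have [/andP[_ b] _] := dsym1_bounds k.2; rewrite lerD. Qed.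

Lemma dsym_consistent k : lam k - dsym k <= h ^+ 2 * lam k ^+ 2.
Proof.
have [_ a] := dsym1_bounds k.1; have [_ b] := dsym1_bounds k.2.
rewrite /lam /dsym; apply: le_trans (_ : h ^+ 2 * (wave k.1 ^+ 4 + wave k.2 ^+ 4) <= _); first by lra.
apply: ler_wpM2l; first exact: sqr_ge0.
have := mulr_ge0 (sqr_ge0 (wave k.1)) (sqr_ge0 (wave k.2)); lra.
Qed.

(** The pair of the cosine and sine sums is invariant under a grid shift, which acts on it as the
    rotation by [d]. A rotation with [cos d < 1] fixes only the origin, and a nonzero frequency
    below [N] gives such an angle. *)
Lemma sum_tmode k a b : (0 < `|k.1| < N)%N || (0 < `|k.2| < N)%N ->
  \sum_p tmode k a b (gpt p) = 0.
Proof.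
have main (d : R) : cos d < 1 ->
   (forall a b, \sum_(p : T) tmode k a b (gpt p) =
     \sum_(p : T) tmode k (a * cos d + b * sin d) (b * cos d - a * sin d) (gpt p)) ->
   \sum_p tmode k a b (gpt p) = 0.
  move=> d1 H; set C := \sum_(p : T) tmode k 1 0 (gpt p).
  set S := \sum_(p : T) tmode k 0 1 (gpt p).
  have E x y : \sum_(p : T) tmode k x y (gpt p) = x * C + y * S.
    by rewrite /C /S !mulr_sumr -big_split; apply: eq_bigr => p _ /=; rewrite /tmode; ring.
  have e1 := H 1 0; have e2 := H 0 1; rewrite !E in e1 e2.
  have CS : (C ^+ 2 + S ^+ 2) * (1 - cos d) = 0 by nra.
  move: CS => /eqP; rewrite mulf_eq0 [X in _ || X]gt_eqF ?subr_gt0// orbF.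
  rewrite paddr_eq0 ?sqr_ge0// !sqrf_eq0 => /andP[/eqP C0 /eqP S0].
  by rewrite E C0 S0 !mulr0 addr0.
have dlt (j : int) : (0 < `|j| < N)%N -> cos (wave j * h) < 1.
  move=> /andP[j0 jN]; apply: cos_lt1.
  have -> : wave j * h = 2 * pi * (j%:~R / N%:R).
    by rewrite /wave /h; field; rewrite N0 gt_eqF.
  have p2 : 0 < 2 * pi :> R by rewrite mulr_gt0// pi_gt0.
  rewrite normrM (gtr0_norm p2) normrM normfV normr_nat -intr_norm.
  have jE : `|j|%:~R = (absz j)%:R :> R by rewrite -abszE pmulrn.
  by rewrite jE mulr_gt0 ?divr_gt0 ?ltr0n// gtr_pMr// ltr_pdivrMr ?ltr0n// mul1r ltr_nat jN.
move=> /orP[k1|k2].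
  apply: (main (wave k.1 * h)); first exact: dlt.
  move=> x y; rewrite -(sum_shift shxK shx'K (fun p => tmode k x y (gpt p))).
  by apply: eq_bigr => p _; rewrite tmode_shx.
apply: (main (wave k.2 * h)); first exact: dlt.
move=> x y; rewrite -(sum_shift shyK shy'K (fun p => tmode k x y (gpt p))).
by apply: eq_bigr => p _; rewrite tmode_shy.
Qed.

Section Parseval.
Variables (I : finType) (kap : I -> int * int).

Definition tpoly (a b : I -> R) (z : R * R) : R := \sum_i tmode (kap i) (a i) (b i) z.

Definition ksub (k l : int * int) : int * int := (k.1 - l.1, k.2 - l.2).

(* |sum_i (a_i - i b_i) e^{i phase_i}|^2, expanded as a double sum; the second
   square on the left is the one of the imaginary part. *)
Lemma tpoly_sqr (a b : I -> R) z :
  tpoly a b z ^+ 2 + tpoly (fun i => - b i) a z ^+ 2 =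
  \sum_i \sum_j tmode (ksub (kap i) (kap j))
     (a i * a j + b i * b j) (b i * a j - a i * b j) z.
Proof.
rewrite /tpoly !expr2 !big_distrlr -big_split; apply: eq_bigr => i _ /=.
rewrite -big_split; apply: eq_bigr => j _ /=.
rewrite /tmode /ksub /=.
have -> : phase L ((kap i).1 - (kap j).1) ((kap i).2 - (kap j).2) z =
  phase L (kap i).1 (kap i).2 z - phase L (kap j).1 (kap j).2 z.
  by rewrite !phaseE !waveD !waveN; ring.
by rewrite cosB sinB; ring.
Qed.

Hypothesis kap_sep : forall i j, i != j ->
  (0 < `|(ksub (kap i) (kap j)).1| < N)%N || (0 < `|(ksub (kap i) (kap j)).2| < N)%N.

(** The squared modulus of the complex sum expands into difference frequencies, of which only the
    diagonal ones survive by [kap_sep]. Dropping the square of the imaginary part leaves an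
    inequality. *)
Lemma grid_parseval (a b : I -> R) :
  h ^+ 2 * \sum_p tpoly a b (gpt p) ^+ 2 <= L ^+ 2 * \sum_i (a i ^+ 2 + b i ^+ 2).
Proof.
have -> : L ^+ 2 = h ^+ 2 * N%:R ^+ 2 by rewrite /h expr_div_n divfK// expf_neq0.
rewrite -mulrA; apply: ler_wpM2l; first exact: sqr_ge0.
apply: (@le_trans _ _ (\sum_p (tpoly a b (gpt p) ^+ 2 + tpoly (fun i => - b i) a (gpt p) ^+ 2))).
  by apply: ler_sum => p _; rewrite lerDl sqr_ge0.
under eq_bigr do rewrite tpoly_sqr.
rewrite exchange_big mulr_sumr /=; apply: ler_sum => i _.
rewrite exchange_big (bigD1 i)//= [X in _ + X]big1 ?addr0; last first.
  by move=> j ji; apply: sum_tmode; apply: kap_sep; rewrite eq_sym.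
rewrite (eq_bigr (fun=> a i ^+ 2 + b i ^+ 2)).
  by rewrite sumr_const card_prod card_ord [N%:R ^+ 2]expr2 -natrM mulr_natl.
move=> p _; rewrite /tmode /ksub /= !subrr phaseE /wave !mulr0 !mul0r addr0 cos0 sin0.
by rewrite mulr1 mulr0 addr0 !expr2.
Qed.

Lemma tlap_tpoly (a b : I -> R) p : tlap h (fun p => tpoly a b (gpt p)) p =
  tpoly (fun i => dsym (kap i) * a i) (fun i => dsym (kap i) * b i) (gpt p).
Proof.
have -> : tlap h (fun p => tpoly a b (gpt p)) p =
   \sum_i tlap h (fun p => tmode (kap i) (a i) (b i) (gpt p)) p.
  rewrite /tlap /sdiff /tpoly !mulr_sumr -!sumrB !mulr_suml -big_split.
  by apply: eq_bigr.
by apply: eq_bigr => i _; rewrite tlap_tmode /tmode; ring.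
Qed.

Lemma fdiff_tpoly (a b : I -> R) p :
  fdiff shx h (fun p => tpoly a b (gpt p)) p =
    tpoly (fun i => (rotc (wave (kap i).1 * h) (a i) (b i)).1)
          (fun i => (rotc (wave (kap i).1 * h) (a i) (b i)).2) (gpt p) /\
  fdiff shy h (fun p => tpoly a b (gpt p)) p =
    tpoly (fun i => (rotc (wave (kap i).2 * h) (a i) (b i)).1)
          (fun i => (rotc (wave (kap i).2 * h) (a i) (b i)).2) (gpt p).
Proof.
split.
  rewrite /fdiff /tpoly -sumrB mulr_suml; apply: eq_bigr => i _.
  exact: fdiffx_tmode.
rewrite /fdiff /tpoly -sumrB mulr_suml; apply: eq_bigr => i _.
exact: fdiffy_tmode.
Qed.

Lemma gip_tpoly_grad (a b : I -> R) (f := fun p => tpoly a b (gpt p)) :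
  gip h f (gA h f) <= L ^+ 2 * \sum_i dsym (kap i) * (a i ^+ 2 + b i ^+ 2).
Proof.
rewrite gip_gradE// mulrDr.
have -> : \sum_i dsym (kap i) * (a i ^+ 2 + b i ^+ 2) =
   \sum_i dsym1 (kap i).1 * (a i ^+ 2 + b i ^+ 2) + \sum_i dsym1 (kap i).2 * (a i ^+ 2 + b i ^+ 2).
  by rewrite -big_split; apply: eq_bigr => i _; rewrite /= /dsym mulrDl.
rewrite mulrDr; apply: lerD.
  have -> : \sum_i dsym1 (kap i).1 * (a i ^+ 2 + b i ^+ 2) =
     \sum_i ((rotc (wave (kap i).1 * h) (a i) (b i)).1 ^+ 2
             + (rotc (wave (kap i).1 * h) (a i) (b i)).2 ^+ 2).
    by apply: eq_bigr => i _; rewrite rotc_norm.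
  under eq_bigr do rewrite (fdiff_tpoly a b _).1.
  exact: grid_parseval.
have -> : \sum_i dsym1 (kap i).2 * (a i ^+ 2 + b i ^+ 2) =
   \sum_i ((rotc (wave (kap i).2 * h) (a i) (b i)).1 ^+ 2
           + (rotc (wave (kap i).2 * h) (a i) (b i)).2 ^+ 2).
  by apply: eq_bigr => i _; rewrite rotc_norm.
under eq_bigr do rewrite (fdiff_tpoly a b _).2.
exact: grid_parseval.
Qed.

End Parseval.

End GridModes.

(** * Functions of time *)

Section Bump.
Context {R : realType}.

Lemma is_derive_quadratic (f : R -> R) (x C : R) :
  (forall y : R, `|f y - f x| <= C * (y - x) ^+ 2) -> is_derive x 1 f 0.
Proof.
move=> H; apply/is_derive1_caratheodory.
exists (fun z => if z == x then 0 else (f z - f x) / (z - x)); split; last by rewrite eqxx.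
  move=> z; case: eqP => [->|/eqP zx]; first by rewrite !subrr mulr0.
  by rewrite divfK// subr_eq0.
rewrite /prop_for /continuous_at eqxx.
have C0 : 0 <= C.
  by have := le_trans (normr_ge0 _) (H (x + 1)); rewrite addrAC subrr add0r expr1n mulr1.
apply/cvgrPdist_le => /= e e0.
have C1 : 0 < C + 1 by rewrite ltr_wpDl.
near=> z; rewrite sub0r normrN; case: eqP => [_|/eqP zx].
  by rewrite normr0 ltW.
rewrite normrM normfV ler_pdivrMr ?normr_gt0 ?subr_eq0//.
apply: (le_trans (H z)); rewrite -[X in X <= _]/(C * (z - x) ^+ 2) -real_normK ?num_real// expr2 mulrA.
apply: ler_wpM2r => //.
have : `|x - z| <= e / (C + 1).
  by near: z; apply: cvgr_dist_le; [exact: cvg_id|rewrite divr_gt0].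
rewrite ler_pdivlMr// distrC => h1.
by have := normr_ge0 (z - x); lra.
Unshelve. all: by end_near. Qed.

(** The classical e^{-1/x} with a polynomial in 1/x in front, so that the family is closed under
    differentiation. *)
Definition flat (P : {poly R}) (x : R) : R :=
  if 0 < x then P.[x^-1] * expR (- x^-1) else 0.

(** For y = 1/x the exponential series gives y^{i+2} <= (i+2)! e^y; the two spare powers of x make
    the derivative at 0 vanish. *)
Lemma flat_quadratic (P : {poly R}) : exists C, forall x, `|flat P x| <= C * x ^+ 2.
Proof.
pose C := \sum_(i < size P) `|P`_i| * (i.+2)`!%:R.
exists C => x; rewrite /flat; case: ltP => x0; last first.
  by rewrite normr0 mulr_ge0 ?sqr_ge0// sumr_ge0// => i _; rewrite mulr_ge0.
have y0 : 0 < x^-1 by rewrite invr_gt0.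
rewrite -[x]invrK; move: x^-1 y0 => {x0}y y0.
rewrite invrK expRN normrM [`|(expR y)^-1|]gtr0_norm ?invr_gt0 ?expR_gt0//.
rewrite ler_pdivrMr ?expR_gt0// exprVn mulrAC ler_pdivlMr ?exprn_gt0//.
rewrite horner_coef /C !mulr_suml.
apply: (@le_trans _ _ (\sum_(i < size P) `|P`_i * y ^+ i| * y ^+ 2)).
  by rewrite -mulr_suml ler_wpM2r ?sqr_ge0// ler_norm_sum.
apply: ler_sum => i _; rewrite normrM -!mulrA; apply: ler_wpM2l => //.
rewrite ger0_norm ?exprn_ge0 ?(ltW y0)// -exprD addn2.
have := expR_ge1Dxn i.+1 (ltW y0).
have f0 : 0 < (i.+2)`!%:R :> R by rewrite ltr0n fact_gt0.
move=> h; rewrite mulrC -ler_pdivrMr//; apply: le_trans h.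
by rewrite lerDr.
Qed.

Lemma flat_deriv (P : {poly R}) (x : R) :
  is_derive x 1 (flat P) (flat ('X^2 * (P - P^`())) x).
Proof.
have [x0|x0|->] := ltgtP x 0.
- rewrite {2}/flat ltNge (ltW x0)/=.
  apply: (@near_eq_is_derive _ _ _ (cst 0)).
  near=> y; rewrite /flat; have : y < 0 by near: y; exact: lt_nbhsl.
  by move=> y0; rewrite ltNge (ltW y0).
- rewrite {2}/flat x0.
  have xn0 : x != 0 by rewrite gt_eqF.
  have dV : is_derive x 1 (fun y : R => y^-1) (- x ^- 2).
    apply: is_derive_eq; first exact: (is_deriveV xn0).
    by rewrite /GRing.scale/= mulr1.
  have dP : is_derive x 1 (fun y : R => P.[y^-1]) (P^`().[x^-1] * - x ^- 2).
    have dp : is_derive (x^-1) 1 (horner P) P^`().[x^-1] by exact: is_derive_poly.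
    have := @is_derive1_comp R (horner P) (fun y : R => y^-1) x _ _ dp dV.
    exact.
  have dE : is_derive x 1 (fun y : R => expR (- y^-1)) (expR (- x^-1) * x ^- 2).
    have dn : is_derive x 1 (fun y : R => - y^-1) (x ^- 2).
      by apply: is_derive_eq; rewrite opprK.
    exact: (@is_derive1_comp R expR (fun y : R => - y^-1) x).
  have dF : is_derive x 1 (fun y : R => P.[y^-1] * expR (- y^-1))
      (('X^2 * (P - P^`())).[x^-1] * expR (- x^-1)).
    by apply: is_derive_eq; rewrite !hornerE /GRing.scale/= exprVn; ring.
  apply: near_eq_is_derive dF.
  near=> y; rewrite /flat; have -> // : 0 < y by near: y; exact: lt_nbhsr.
- rewrite {2}/flat ltxx.
  have [C HC] := flat_quadratic P; apply: (@is_derive_quadratic _ _ C) => y.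
  by rewrite {2}/flat ltxx !subr0.
Unshelve. all: by end_near. Qed.

(** The derivative of a product of two flat factors, one of them reflected, is a difference of two
    such products; hence the class is stable under derivatives of every order. *)
Inductive bump_class (a b : R) : (R -> R) -> Prop :=
| BumpProd P Q : bump_class a b (fun t => flat P (t - a) * flat Q (b - t))
| BumpSub f g : bump_class a b f -> bump_class a b g ->
    bump_class a b (fun t => f t - g t).

Lemma bump_class_deriv (a b : R) (f : R -> R) : bump_class a b f ->
  exists2 g, bump_class a b g & forall t : R, is_derive t 1 f (g t).
Proof.
elim=> [P Q|f1 f2 _ [g1 bg1 d1] _ [g2 bg2 d2]]; last first.
  exists (fun t => g1 t - g2 t); first exact: BumpSub.
  by move=> t; have d1t := d1 t; have d2t := d2 t; apply: is_derive_eq.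
pose P' := 'X^2 * (P - P^`()); pose Q' := 'X^2 * (Q - Q^`()).
exists (fun t => flat P' (t - a) * flat Q (b - t) - flat P (t - a) * flat Q' (b - t)).
  by apply: BumpSub; exact: BumpProd.
move=> t.
have dP : is_derive t 1 (fun t => flat P (t - a)) (flat P' (t - a)).
  have d1 : is_derive t 1 (fun t => t - a) 1 by apply: is_derive_eq; rewrite subr0.
  rewrite -[X in is_derive _ _ _ X]mulr1.
  exact: (@is_derive1_comp R (flat P) (fun t => t - a) t _ _ (flat_deriv P _) d1).
have dQ : is_derive t 1 (fun t => flat Q (b - t)) (- flat Q' (b - t)).
  have d1 : is_derive t 1 (fun t => b - t) (- 1) by apply: is_derive_eq; rewrite add0r mul1r.
  rewrite -[X in is_derive _ _ _ X]mulrN1.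
  exact: (@is_derive1_comp R (flat Q) (fun t => b - t) t _ _ (flat_deriv Q _) d1).
by apply: is_derive_eq; rewrite /GRing.scale/=; ring.
Qed.

Lemma bump_class_derivable (a b : R) (f : R -> R) n (t : R) : bump_class a b f -> derivable (derive1n n f) t 1.
Proof.
move=> bf; suff : bump_class a b (derive1n n f).
  by case/bump_class_deriv => g _ /(_ t) [].
elim: n => // n /bump_class_deriv[g bg dg]; rewrite derive1nS.
rewrite (_ : derive1 (derive1n n f) = g)//; apply/funext => x.
by rewrite derive1E; have [_ ->] := dg x.
Qed.

Definition bump_fun (a b t : R) : R := flat 1 (t - a) * flat 1 (b - t).

Lemma bump_ge0 a b t : 0 <= bump_fun a b t.
Proof.
rewrite mulr_ge0// /flat; case: ifP => // _; rewrite hornerE mul1r expR_ge0//.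
Qed.

Lemma bump_out a b t : ~ (a <= t <= b) -> bump_fun a b t = 0.
Proof.
rewrite /bump_fun /flat !subr_gt0; case: ltP => ta; last by rewrite mul0r.
by case: ltP => tb; [rewrite (ltW ta) (ltW tb)|rewrite mulr0].
Qed.

Lemma bump_lower a b e : 0 < e -> exists2 c : R, 0 < c &
  forall t : R, a + e <= t <= b - e -> c <= bump_fun a b t.
Proof.
move=> e0; exists (expR (- e^-1) * expR (- e^-1)); first by rewrite mulr_gt0 ?expR_gt0.
move=> t /andP[ta tb].
have ta' : e <= t - a by lra.
have tb' : e <= b - t by lra.
have mono y : e <= y -> expR (- e^-1) <= flat 1 y.
  move=> ey; rewrite /flat (lt_le_trans e0 ey) hornerC mul1r.
  by rewrite ler_expR lerN2 lef_pV2 ?posrE ?(lt_le_trans e0).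
by rewrite /bump_fun; apply: ler_pM; rewrite ?expR_ge0 ?mono.
Qed.

Lemma bump_test (T a b : R) : 0 < a -> b < T -> time_test T (bump_fun a b).
Proof.
move=> a0 bT; split; first by move=> n t; exact: (@bump_class_derivable a b _ n t (BumpProd a b 1 1)).
by exists a, b; split => // t; exact: bump_out.
Qed.

End Bump.

(** * Fubini on rectangles for real-valued integrals *)

Section FubiniOn.
Context d1 d2 (T1 : measurableType d1) (T2 : measurableType d2) (R : realType).
Variables (m1 : {sigma_finite_measure set T1 -> \bar R})
          (m2 : {sigma_finite_measure set T2 -> \bar R}).
Variables (D1 : set T1) (D2 : set T2).
Hypotheses (mD1 : measurable D1) (mD2 : measurable D2).
Variable F : T1 * T2 -> R.

Let D := D1 `*` D2.
Let mD : measurable D. Proof. exact: measurableX. Qed.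
Let G : T1 * T2 -> \bar R := (EFin \o F) \_ D.

Let GE1 x y : D1 x -> G (x, y) = ((fun y => (F (x, y))%:E) \_ D2) y.
Proof.
move=> Dx; rewrite /G !patchE /D; case: ifPn => [|].
  by rewrite inE => -[/= _ Dy]; rewrite ifT// inE.
rewrite notin_setE /= => nD; case: ifPn => //; rewrite inE => Dy.
by case: nD; split.
Qed.

Let GE1n x y : ~ D1 x -> G (x, y) = 0%E.
Proof. by move=> Dx; rewrite /G patchE ifN// notin_setE => -[]. Qed.

Let GE2 x y : D2 y -> G (x, y) = ((fun x => (F (x, y))%:E) \_ D1) x.
Proof.
move=> Dx; rewrite /G !patchE /D; case: ifPn => [|].
  by rewrite inE => -[/= Dy _]; rewrite ifT// inE.
rewrite notin_setE /= => nD; case: ifPn => //; rewrite inE => Dy.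
by case: nD; split.
Qed.

Let GE2n x y : ~ D2 y -> G (x, y) = 0%E.
Proof. by move=> Dx; rewrite /G patchE ifN// notin_setE => -[]. Qed.

Hypothesis iF : (m1 \x m2)%E.-integrable D (EFin \o F).

Let iG : (m1 \x m2)%E.-integrable setT G.
Proof. by rewrite /G -integrable_mkcond. Qed.

Lemma section_integrable1 :
  {ae m1, forall x, D1 x -> m2.-integrable D2 (fun y => (F (x, y))%:E)}.
Proof.
have := ae_integrable1 iG; apply: filterS => x ix Dx.
by apply/(integrable_mkcond _ mD2); move: ix; congr integrable; apply/funext => y; exact: GE1.
Qed.

Lemma section_integrable2 :
  {ae m2, forall y, D2 y -> m1.-integrable D1 (fun x => (F (x, y))%:E)}.
Proof.
have := ae_integrable2 iG; apply: filterS => x ix Dx.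
by apply/(integrable_mkcond _ mD1); move: ix; congr integrable; apply/funext => y; exact: GE2.
Qed.

Let FE x : fubini_F m2 G x = ((fun x => \int[m2]_(y in D2) (F (x, y))%:E)%E \_ D1) x.
Proof.
rewrite /fubini_F patchE; case: ifPn => [|]; rewrite ?inE ?notin_setE => Dx.
  by rewrite [RHS]integral_mkcond; apply: eq_integral => y _; rewrite GE1.
by rewrite integral0_eq// => y _; rewrite GE1n.
Qed.

Let GEE y : fubini_G m1 G y = ((fun y => \int[m1]_(x in D1) (F (x, y))%:E)%E \_ D2) y.
Proof.
rewrite /fubini_G patchE; case: ifPn => [|]; rewrite ?inE ?notin_setE => Dx.
  by rewrite [RHS]integral_mkcond; apply: eq_integral => x _; rewrite GE2.
by rewrite integral0_eq// => x _; rewrite GE2n.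
Qed.

Lemma fubini_integrable1 :
  m1.-integrable D1 (fun x => (\int[m2]_(y in D2) F (x, y))%:E).
Proof.
have iF1 : m1.-integrable D1 (fun x => \int[m2]_(y in D2) (F (x, y))%:E)%E.
  apply/(integrable_mkcond _ mD1).
  by have := integrable_fubini_F iG; congr integrable; apply/funext => x; exact: FE.
have [mf foo] := integrableP _ _ _ iF1.
apply/integrableP; split.
  by apply/measurable_EFinP; exact: (measurableT_comp (fine_measurable _) mf).
apply: le_lt_trans foo; apply: ge0_le_integral => //.
- by apply: measurableT_comp => //; apply/measurable_EFinP; exact: (measurableT_comp (fine_measurable _) mf).
- exact: measurableT_comp.
(* Where the inner integral is infinite, [fine] returns 0, so the real-valued inner integral is
   still dominated. *)
- by move=> x Dx; rewrite /Rintegral; case: (\int[m2]_(y in D2) _)%E => //=; rewrite ?normr0 ?leey.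
Qed.

Lemma fubini_integrable2 :
  m2.-integrable D2 (fun y => (\int[m1]_(x in D1) F (x, y))%:E).
Proof.
have iF1 : m2.-integrable D2 (fun y => \int[m1]_(x in D1) (F (x, y))%:E)%E.
  apply/(integrable_mkcond _ mD2).
  rewrite (_ : _ \_ _ = fubini_G m1 G); last by apply/funext => x; rewrite GEE.
  apply/integrableP; split; first exact: (measurable_fubini_G iG).
  apply: (@le_lt_trans _ _ (\int[m2]_y \int[m1]_x `|G (x, y)|)%E).
    apply: ge0_le_integral => //.
    - by apply: measurableT_comp => //; exact: (measurable_fubini_G iG).
    - apply: (measurable_fun_fubini_tonelli_G (abse \o G)); last by move=> y; exact: abse_ge0.
      by apply: measurableT_comp => //; exact: (measurable_int _ iG).
    - move=> y _; apply: le_abse_integral => //.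
      by apply: measurableT_comp => //; exact: (measurable_int _ iG).
  have mG : measurable_fun setT G := measurable_int _ iG.
  exact: ((@integrable21ltyP _ _ _ _ R m1 m2 G mG).1 iG).
have [mf foo] := integrableP _ _ _ iF1.
apply/integrableP; split.
  by apply/measurable_EFinP; exact: (measurableT_comp (fine_measurable _) mf).
apply: le_lt_trans foo; apply: ge0_le_integral => //.
- by apply: measurableT_comp => //; apply/measurable_EFinP; exact: (measurableT_comp (fine_measurable _) mf).
- exact: measurableT_comp.
- by move=> x Dx; rewrite /Rintegral; case: (\int[m1]_(y in D1) _)%E => //=; rewrite ?normr0 ?leey.
Qed.

Lemma Rfubini1 : \int[(m1 \x m2)%E]_(z in D) F z =
  \int[m1]_(x in D1) (\int[m2]_(y in D2) F (x, y)).
Proof.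
rewrite /Rintegral; congr fine; rewrite integral_mkcond -/G -(integral12_prod_meas1 iG).
rewrite [RHS]integral_mkcond; apply: ae_eq_integral => //.
- exact: (measurable_fubini_F iG).
- by apply/(measurable_restrictT _ _).1 => //; exact: (measurable_int _ fubini_integrable1).
have := section_integrable1; apply: filterS => x ix _.
rewrite FE !patchE; case: ifPn => //; rewrite inE => Dx.
by rewrite fineK//; apply: integrable_fin_num => //; exact: ix.
Qed.

Lemma Rfubini2 : \int[(m1 \x m2)%E]_(z in D) F z =
  \int[m2]_(y in D2) (\int[m1]_(x in D1) F (x, y)).
Proof.
rewrite /Rintegral; congr fine; rewrite integral_mkcond -/G -(integral21_prod_meas1 iG).
rewrite [RHS]integral_mkcond; apply: ae_eq_integral => //.
- exact: (measurable_fubini_G iG).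
- by apply/(measurable_restrictT _ _).1 => //; exact: (measurable_int _ fubini_integrable2).
have := section_integrable2; apply: filterS => x ix _.
rewrite GEE !patchE; case: ifPn => //; rewrite inE => Dx.
by rewrite fineK//; apply: integrable_fin_num => //; exact: ix.
Qed.

Lemma Rfubini : \int[m1]_(x in D1) (\int[m2]_(y in D2) F (x, y)) =
  \int[m2]_(y in D2) (\int[m1]_(x in D1) F (x, y)).
Proof. by rewrite -Rfubini1 Rfubini2. Qed.

End FubiniOn.

Section AlmostEverywhere.
Context d (T : measurableType d) (R : realType) (mu : {measure set T -> \bar R}).

Lemma ae_imply (P Q : T -> Prop) : (forall x, P x -> Q x) ->
  {ae mu, forall x, P x} -> {ae mu, forall x, Q x}.
Proof. by move=> PQ; apply: filterS => x; exact: PQ. Qed.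

Lemma ae_conj (P Q : T -> Prop) : {ae mu, forall x, P x} -> {ae mu, forall x, Q x} ->
  {ae mu, forall x, P x /\ Q x}.
Proof. by move=> HP HQ; apply: filterI. Qed.

End AlmostEverywhere.

Section IntegrableProducts.
Context d (T : measurableType d) (R : realType) (mu : {measure set T -> \bar R}).
Variables (D : set T) (mD : measurable D).

Lemma integrable_bounded_mul (f g : T -> R) (M : R) :
  measurable_fun D g -> (forall x, D x -> `|g x| <= M) ->
  mu.-integrable D (EFin \o f) -> mu.-integrable D (EFin \o (fun x => f x * g x)).
Proof.
move=> mg gM fi.
have := @integrableMl _ _ _ mu D mD (EFin \o f) g fi mg; apply.
by exists M; split; [exact: num_real|move=> x /ltW Mx y Dy; exact: le_trans (gM y Dy) Mx].
Qed.

Lemma integrable_bounded (f : T -> R) (M : R) : (mu D < +oo)%E ->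
  measurable_fun D f -> (forall x, D x -> `|f x| <= M) ->
  mu.-integrable D (EFin \o f).
Proof.
move=> Dfin mf fM; apply: measurable_bounded_integrable => //.
by exists M; split; [exact: num_real|move=> x /ltW Mx y Dy; exact: le_trans (fM y Dy) Mx].
Qed.

Lemma integrable_mul_sqr (f g : T -> R) :
  measurable_fun D f -> measurable_fun D g ->
  mu.-integrable D (EFin \o (fun x => f x ^+ 2)) ->
  mu.-integrable D (EFin \o (fun x => g x ^+ 2)) ->
  mu.-integrable D (EFin \o (fun x => f x * g x)).
Proof.
move=> mf mg f2 g2.
apply: (le_integrable mD (g := fun x => (f x ^+ 2)%:E + (g x ^+ 2)%:E)%E).
- by apply/measurable_EFinP; exact: measurable_funM.
- move=> x Dx /=; rewrite lee_fin.
  rewrite [X in _ <= X]ger0_norm ?addr_ge0 ?sqr_ge0// ler_norml.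
  by have := sqr_ge0 (f x - g x); have := sqr_ge0 (f x + g x); nra.
exact: integrableD.
Qed.

Lemma Rintegral_sum (I : Type) (s : seq I) (f : I -> T -> R) :
  (forall i, mu.-integrable D (EFin \o f i)) ->
  \int[mu]_(x in D) (\sum_(i <- s) f i x) = \sum_(i <- s) \int[mu]_(x in D) f i x.
Proof.
move=> fi; elim: s => [|i s IH].
  rewrite big_nil; under eq_Rintegral do rewrite big_nil.
  by rewrite Rintegral_cst// mul0r.
rewrite big_cons -IH -RintegralD//; first by apply: eq_Rintegral => x _; rewrite big_cons.
rewrite (_ : EFin \o _ = fun x => \sum_(i <- s) (f i x)%:E)%E; last first.
  by apply/funext => x /=; rewrite sumEFin.
by apply: integrable_sum => // j _; exact: fi.
Qed.

Lemma integrable_fsum (I : Type) (s : seq I) (f : I -> T -> R) :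
  (forall i, mu.-integrable D (EFin \o f i)) ->
  mu.-integrable D (EFin \o (fun x => \sum_(i <- s) f i x)).
Proof.
move=> fi; rewrite (_ : EFin \o _ = fun x => \sum_(i <- s) (f i x)%:E)%E; last first.
  by apply/funext => x /=; rewrite sumEFin.
by apply: integrable_sum => // j _; exact: fi.
Qed.

Lemma ae_eq_Rintegral (f g : T -> R) :
  measurable_fun D f -> measurable_fun D g ->
  {ae mu, forall x, D x -> f x = g x} ->
  \int[mu]_(x in D) f x = \int[mu]_(x in D) g x.
Proof.
move=> mf mg fg; congr fine; apply: ae_eq_integral => //; [exact/measurable_EFinP..|].
by apply: filterS fg => x h Dx; rewrite h.
Qed.

Lemma ae_le_Rintegral (f g : T -> R) :
  mu.-integrable D (EFin \o f) -> mu.-integrable D (EFin \o g) ->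
  {ae mu, forall x, D x -> f x <= g x} ->
  \int[mu]_(x in D) f x <= \int[mu]_(x in D) g x.
Proof.
move=> fi gi fg.
have mf : measurable_fun D f by apply/measurable_EFinP; exact: (measurable_int _ fi).
have mg : measurable_fun D g by apply/measurable_EFinP; exact: (measurable_int _ gi).
rewrite -subr_ge0 -RintegralB//.
rewrite (@ae_eq_Rintegral _ (fun x => `|g x - f x|)).
- by apply: Rintegral_ge0 => x _.
- exact: measurable_funB.
- by apply: measurableT_comp => //; exact: measurable_funB.
- by apply: filterS fg => x h Dx; rewrite ger0_norm// subr_ge0 h.
Qed.

(* Cauchy-Schwarz against the constant 1, from int (f - c)^2 >= 0. *)
Lemma sqr_Rintegral_le (f : T -> R) : (mu D < +oo)%E ->
  mu.-integrable D (EFin \o f) -> mu.-integrable D (EFin \o (fun x => f x ^+ 2)) ->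
  (\int[mu]_(x in D) f x) ^+ 2 <= fine (mu D) * \int[mu]_(x in D) (f x ^+ 2).
Proof.
move=> Dfin fi f2; set A := \int[mu]_(x in D) f x; set B := \int[mu]_(x in D) _.
set m := fine (mu D); have m0 : 0 <= m by rewrite fine_ge0.
have key c : 0 <= B - 2 * c * A + c ^+ 2 * m.
  have ic : mu.-integrable D (EFin \o (fun=> c ^+ 2)).
    by apply: (@integrable_bounded _ (c ^+ 2)) => // x _; rewrite ger0_norm ?sqr_ge0.
  have icf : mu.-integrable D (EFin \o (fun x => (- 2 * c) * f x)).
    have := integrableZl mD (- 2 * c) fi; congr integrable.
  have i2 : mu.-integrable D (EFin \o (fun x => f x ^+ 2 + (- 2 * c) * f x)).
    exact: (integrableD mD f2 icf).
  have -> : B - 2 * c * A + c ^+ 2 * m = \int[mu]_(x in D) ((f x - c) ^+ 2).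
    transitivity (\int[mu]_(x in D) (f x ^+ 2 + (- 2 * c) * f x + c ^+ 2)).
      by rewrite RintegralD// RintegralD// RintegralZl// Rintegral_cst// -/A -/B -/m; ring.
    by apply: eq_Rintegral => x _; ring.
  by apply: Rintegral_ge0 => x _; exact: sqr_ge0.
(* For a null domain the quadratic in [c] is affine; if its slope were not 0, the chosen [c] would
   give it the value -1. *)
have [m00|mn0] := eqVneq m 0.
  have A0 : A = 0.
    apply/eqP/negPn/negP => An0.
    have := key ((B + 1) / (2 * A)); rewrite m00 mulr0 addr0.
    by rewrite (_ : 2 * _ * A = B + 1); [lra|field].
  by rewrite A0 m00 mul0r expr0n.
have mp : 0 < m by rewrite lt_def mn0.
have := ler_wpM2l m0 (key (A / m)).
by rewrite mulr0 (_ : m * (_ - _ + _) = m * B - A ^+ 2); [lra|field].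
Qed.

End IntegrableProducts.

Section Tensor.
Context d1 d2 (T1 : measurableType d1) (T2 : measurableType d2) (R : realType).
Variables (m1 : {sigma_finite_measure set T1 -> \bar R})
          (m2 : {sigma_finite_measure set T2 -> \bar R}).
Variables (D1 : set T1) (D2 : set T2).
Hypotheses (mD1 : measurable D1) (mD2 : measurable D2).

Lemma integrable_tensor (a : T1 -> R) (b : T2 -> R) :
  m1.-integrable D1 (EFin \o a) -> m2.-integrable D2 (EFin \o b) ->
  (m1 \x m2)%E.-integrable (D1 `*` D2) (EFin \o (fun q => a q.1 * b q.2)).
Proof.
move=> ia ib.
have ma : measurable_fun setT (a \_ D1).
  by apply/(measurable_restrictT _ _).1 => //; apply/measurable_EFinP; exact: (measurable_int _ ia).
have mb : measurable_fun setT (b \_ D2).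
  by apply/(measurable_restrictT _ _).1 => //; apply/measurable_EFinP; exact: (measurable_int _ ib).
have ia' : m1.-integrable setT (EFin \o (a \_ D1)).
  by rewrite -restrict_EFin -integrable_mkcond.
have ib' : m2.-integrable setT (EFin \o (b \_ D2)).
  by rewrite -restrict_EFin -integrable_mkcond.
apply/(integrable_mkcond _ (measurableX mD1 mD2)).
pose G : T1 * T2 -> \bar R := EFin \o (fun q => (a \_ D1) q.1 * (b \_ D2) q.2).
rewrite (_ : _ \_ _ = G); last first.
  apply/funext => -[x y]; rewrite /G /= !patchE.
  case: ifPn => [|]; rewrite ?inE ?notin_setE.
    by move=> [/= Dx Dy]; rewrite !ifT ?inE.
  move=> nD; case: ifPn => [|]; rewrite ?inE => Dx; last by rewrite mul0r.
  by case: ifPn => [|]; rewrite ?inE ?mulr0// => Dy; case: nD.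
have mbE : measurable_fun setT (fun y => `|((b \_ D2) y)%:E|)%E.
  by apply: measurableT_comp => //; apply/measurable_EFinP.
have maE : measurable_fun setT (fun x => `|((a \_ D1) x)%:E|)%E.
  by apply: measurableT_comp => //; apply/measurable_EFinP.
have mG : measurable_fun setT G.
  apply/measurable_EFinP; apply: measurable_funM.
    exact: (measurableT_comp ma measurable_fst).
  exact: (measurableT_comp mb measurable_snd).
apply/(@integrable12ltyP _ _ _ _ R m1 m2 G mG).
have [_ a0] := integrableP _ _ _ ia'; have [_ b0] := integrableP _ _ _ ib'.
set B := (\int[m2]_y `|(EFin \o b \_ D2) y|)%E in b0.
have B0 : (0 <= B)%E by apply: integral_ge0.
have -> : (\int[m1]_x \int[m2]_y `|G (x, y)| = \int[m1]_x (`|(EFin \o a \_ D1) x| * B))%E.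
  apply: eq_integral => x _; rewrite -ge0_integralZl//=.
  by apply: eq_integral => y _; rewrite /G/= normrM EFinM.
rewrite ge0_integralZr//=.
by rewrite muleC lte_mul_pinfty// ge0_fin_numE.
Qed.

End Tensor.

(** * Primitives and integration by parts on an interval *)

Section Prim.
Context {R : realType}.
Variable T : R.
Hypothesis T_gt0 : 0 < T.
Local Notation mu := (@lebesgue_measure R).
Local Notation I := (`[0, T]%classic : set R).

Definition icont (f : R -> R) : Prop := {within `[0, T], continuous f}.
Definition iint (f : R -> R) : Prop := mu.-integrable `[0, T] (EFin \o f).
Definition intT (f : R -> R) : R := \int[mu]_(x in `[0, T]) f x.
Definition prim (g : R -> R) (t : R) : R := \int[mu]_(x in `[0, t]) g x.

Let mI : measurable I. Proof. exact: measurable_itv. Qed.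

Lemma icontP f : icont f <-> forall x, 0 <= x <= T -> forall e, 0 < e ->
  exists2 d, 0 < d & forall y, 0 <= y <= T -> `|y - x| < d -> `|f y - f x| < e.
Proof.
rewrite /icont; split=> [/subspace_continuousP H x x0T e e0|H].
  have /H/cvgrPdist_lt/(_ e e0) : I x by rewrite /= in_itv.
  rewrite near_withinE => /nbhs_ballP[d /= d0 Hd]; exists d => // y y0T yx.
  rewrite distrC; apply: Hd; last by rewrite /= in_itv.
  by rewrite /ball/= distrC.
apply/subspace_continuousP => x; rewrite /= in_itv/= => x0T.
apply/cvgrPdist_lt => e e0; have [d d0 Hd] := H x x0T e e0.
rewrite near_withinE; apply/nbhs_ballP; exists d => //= y yx; rewrite /= in_itv/= => y0T.
by rewrite distrC Hd// distrC.
Qed.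

Lemma icont_iint f : icont f -> iint f.
Proof. by move=> cf; apply: continuous_compact_integrable => //; exact: segment_compact. Qed.

Lemma icontD f g : icont f -> icont g -> icont (fun x => f x + g x).
Proof. by move=> cf cg x; apply: cvgD; [exact: cf|exact: cg]. Qed.

Lemma icontM f g : icont f -> icont g -> icont (fun x => f x * g x).
Proof. by move=> cf cg x; apply: cvgM; [exact: cf|exact: cg]. Qed.

Lemma icontB f g : icont f -> icont g -> icont (fun x => f x - g x).
Proof. by move=> cf cg x; apply: cvgB; [exact: cf|exact: cg]. Qed.

Lemma continuous_icont (f : R -> R) : continuous f -> icont f.
Proof. exact: continuous_subspaceT. Qed.

Lemma icont_inner f t : icont f -> 0 < t < T -> {for t, continuous f}.
Proof.
move=> /(continuous_within_itvP _ T_gt0)[cf _ _] tT.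
by apply: cf; rewrite in_itv.
Qed.

Lemma icont_bounded f : icont f -> exists M : R, forall x : R, 0 <= x <= T -> `|f x| <= M.
Proof.
move=> cf; have cn : {within `[0, T], continuous (fun x => `|f x|)}.
  by move=> x; apply: cvg_norm; exact: cf.
have [c _ Hc] := EVT_max (ltW T_gt0) cn.
by exists `|f c| => x xT; apply: Hc; rewrite in_itv.
Qed.

(** If [f t > M], the same holds on an interval of positive length near [t] inside []0, T[], which a
    null set cannot contain; cutting at 0 and [T] covers the end points. *)
Lemma icont_ae_le f M : icont f -> {ae mu, forall t, 0 < t < T -> f t <= M} ->
  forall t, 0 <= t <= T -> f t <= M.
Proof.
move=> /icontP cf [Z [mZ Z0 HZ]] t tT; rewrite leNgt; apply/negP => ft.
have [d d0 Hd] := cf t tT (f t - M) ltac:(by rewrite subr_gt0).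
pose a := Num.max 0 (t - d); pose b := Num.min T (t + d).
have [t0 tT'] := andP tT; have ab : a < b.
  by rewrite /a /b lt_min !gt_max T_gt0/=; apply/and3P; split; lra.
have sub : `]a, b[%classic `<=` Z.
  move=> y; rewrite /= in_itv/= /a /b gt_max lt_min => /andP[/andP[y0 yd] /andP[yT yd']].
  apply: HZ => /= H; have := H ltac:(by rewrite y0).
  have yd2 : `|y - t| < d by apply/ltr_normlP; split; lra.
  have := Hd y ltac:(by rewrite !ltW) yd2.
  by move=> /ltr_normlP[]; lra.
have : (mu `]a, b[%classic <= mu Z)%E by apply: le_measure => //; rewrite inE//; exact: measurable_itv.
by rewrite Z0 lebesgue_measure_itv/= lte_fin ab -EFinD lee_fin; lra.
Qed.

Lemma icont_ae_eq0 f : icont f -> {ae mu, forall t, 0 < t < T -> f t = 0} ->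
  forall t, 0 <= t <= T -> f t = 0.
Proof.
move=> cf H t tT; apply/eqP; rewrite eq_le; apply/andP; split.
  by apply: icont_ae_le tT => //; apply: ae_imply H => x h xT; rewrite h.
rewrite -oppr_le0 -sub0r; apply: (@icont_ae_le (fun x => 0 - f x) 0 _ _ t tT) => //.
  by apply: icontB => //; apply: continuous_icont; exact: cst_continuous.
by apply: ae_imply H => x h xT; rewrite h// subr0.
Qed.

Lemma prim_icont g : iint g -> icont (prim g).
Proof. by move=> ig; apply: parameterized_integral_continuous => //; exact: ltW. Qed.

Lemma prim_derive g t : icont g -> 0 < t < T -> is_derive t 1 (prim g) (g t).
Proof.
move=> cg /[dup] tT /andP[t0 tT'].
have [d e] := continuous_FTC1_closed tT' (icont_iint cg) t0 (icont_inner cg tT).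
by split; [exact: d|rewrite -derive1E; exact: e].
Qed.

Lemma prim0 g : prim g 0 = 0.
Proof. by rewrite /prim set_itv1 Rintegral_set1. Qed.

Lemma prim_diff g x y : iint g -> 0 <= x -> x <= y -> y <= T ->
  prim g y - prim g x = \int[mu]_(t in `[x, y]) g t.
Proof.
move=> ig x0 xy yT; rewrite /prim.
have igy : mu.-integrable `[0, y] (EFin \o g).
  by apply: integrableS ig => //; exact: subset_itvl.
rewrite (@Rintegral_itvB R g (BLeft 0) (BRight y) x) ?bnd_simp//.
rewrite Rintegral_itv_obnd_cbnd//.
by apply: integrableS igy => //; apply: subset_itvr; rewrite bnd_simp.
Qed.

(** The derivative is known only inside []0, T[]. The difference of [f] and the primitive of [df] is
    continuous up to the ends with zero derivative inside, so the mean value theorem applies. *)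
Lemma FTC2_inner (f df : R -> R) x y : 0 <= x -> x <= y -> y <= T ->
  icont f -> icont df -> (forall t, 0 < t < T -> is_derive t 1 f (df t)) ->
  \int[mu]_(t in `[x, y]) df t = f y - f x.
Proof.
move=> x0 xy yT cf cdf H; rewrite -prim_diff//; last exact: icont_iint.
pose k t := f t - prim df t.
have ck : icont k by apply: icontB => //; apply: prim_icont; exact: icont_iint.
have dk (t : R) : t \in `]x, y[ -> is_derive t 1 k 0.
  rewrite in_itv/= => /andP[xt ty]; have tT : 0 < t < T by apply/andP; split; lra.
  have d1 := H t tT; have d2 := prim_derive cdf tT.
  by apply: is_derive_eq; rewrite subrr.
have ckxy : {within `[x, y], continuous k}.
  apply: continuous_subspaceW ck => z; rewrite /= !in_itv/=; lra.
have [c _] := MVT_segment xy dk ckxy.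
by rewrite mul0r /k => ?; lra.
Qed.

Local Notation test := (time_test T).

Lemma test_derive th (t : R) : test th -> is_derive t 1 th (derive1 th t).
Proof. by move=> [/(_ 0%N t) d _]; split => //; rewrite derive1E. Qed.

Lemma test_test th : test th -> test (derive1 th).
Proof.
move=> [sm [a [b [a0 bT out]]]]; split.
  by move=> n t; have := sm n.+1 t; rewrite /derive1n iterSr.
exists a, b; split => // t nt; rewrite derive1E.
have : is_derive t 1 (cst (0 : R)) 0 by exact: is_derive_cst.
have near0 : \forall x \near t, cst 0 x = th x.
  have [ta|ta] := ltP t a.
    by near=> x; rewrite out//; have : x < a by [near: x; exact: lt_nbhsl]; move=> ? /andP[]; lra.
  have tb : b < t by rewrite ltNge; apply/negP => tb; apply: nt; rewrite ta.
  by near=> x; rewrite out//; have : b < x by [near: x; exact: lt_nbhsr]; move=> ? /andP[]; lra.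
by move/(near_eq_is_derive near0) => [].
Unshelve. all: by end_near. Qed.

Lemma test_continuous th : test th -> continuous th.
Proof.
move=> tth x; apply: differentiable_continuous; apply/derivable1_diffP.
by have [] := test_derive x tth.
Qed.

Lemma test_ends th : test th -> th 0 = 0 /\ th T = 0.
Proof. by move=> [_ [a [b [a0 bT out]]]]; split; apply: out => /andP[]; lra. Qed.

Lemma test_derive1n th n : test th -> test (derive1n n th).
Proof. by move=> tth; elim: n => // n IH; rewrite derive1nS; exact: test_test. Qed.

Lemma intT_parts_C1 (f df th : R -> R) : icont f -> icont df ->
  (forall t, 0 < t < T -> is_derive t 1 f (df t)) -> test th ->
  intT (fun t => f t * derive1 th t) = - intT (fun t => df t * th t).
Proof.
move=> cf cdf H tth; have [th0 thT] := test_ends tth.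
have cth := test_continuous tth; have cth' := test_continuous (test_test tth).
have i1 : iint (fun t => f t * derive1 th t).
  by apply: icont_iint; apply: icontM => //; exact: continuous_icont.
have i2 : iint (fun t => df t * th t).
  by apply: icont_iint; apply: icontM => //; exact: continuous_icont.
apply/eqP; rewrite -subr_eq0 opprK /intT -RintegralD//.
apply/eqP; transitivity (f T * th T - f 0 * th 0); last by rewrite th0 thT !mulr0 subrr.
apply: (@FTC2_inner (fun t => f t * th t)); rewrite ?lexx ?ltW//.
- by apply: icontM => //; exact: continuous_icont.
- by apply: icontD; apply: icontM => //; exact: continuous_icont.
- move=> t tT; have d1 := H t tT; have d2 := test_derive t tth.
  by apply: is_derive_eq; rewrite /GRing.scale/=; ring.
Qed.

(** As [g] is only integrable, its primitive need not be differentiable everywhere. Instead, an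
    integral over the triangle below the diagonal is evaluated in both orders. *)
Lemma intT_parts_prim g th : iint g -> test th ->
  intT (fun t => prim g t * derive1 th t) = - intT (fun t => g t * th t).
Proof.
move=> ig tth; have [th0 thT] := test_ends tth.
have cth := test_continuous tth; have cth' := test_continuous (test_test tth).
have [M HM] := icont_bounded (continuous_icont cth').
pose A : set (measurableTypeR R * measurableTypeR R) := [set q | (q.2 : R) <= q.1].
pose F (q : measurableTypeR R * measurableTypeR R) : R := \1_A q * (derive1 th q.1 * g q.2).
have mI' : measurable (I : set (measurableTypeR R)) := mI.
have mA : measurable A.
  rewrite -[A]setTI; apply: (@measurable_fun_ler _ _ R setT snd fst) => //.
have mth' : measurable_fun I (derive1 th).
  by apply: measurable_funTS; exact: continuous_measurable_fun.
have ith' : iint (derive1 th) by apply: icont_iint; exact: continuous_icont.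
have iF : (mu \x mu)%E.-integrable (I `*` I) (EFin \o F).
  have it := @integrable_tensor _ _ _ _ R mu mu _ _ mI' mI' _ _ ith' ig.
  apply: (le_integrable _ _ _ it); first exact: measurableX.
    apply/measurable_EFinP; apply: measurable_funM.
      by apply: measurable_funTS; exact: measurable_indic.
    by apply/measurable_EFinP; exact: (measurable_int _ it).
  move=> q Dq /=; rewrite lee_fin /F normrM indicE ger0_norm//.
  by apply: ler_piMl => //; case: (_ \in _).
have := Rfubini mI' mI' iF.
have -> : \int[mu]_(x in I) (\int[mu]_(y in I) F (x, y)) = intT (fun t => prim g t * derive1 th t).
  apply: eq_Rintegral => t; rewrite inE/= in_itv/= => /andP[t0 tT].
  have igt : mu.-integrable `[0, t] (EFin \o g).
    by apply: integrableS ig => //; exact: subset_itvl.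
  rewrite mulrC /prim -RintegralZl//.
  have -> : `[0, t]%classic = I `&` [set y | y <= t].
    apply/seteqP; split => y /=; rewrite !in_itv/=.
      by move=> /andP[-> yt]; rewrite yt (le_trans yt).
    by move=> [/andP[-> _] ->].
  rewrite Rintegral_mkcondr; apply: eq_Rintegral => y _.
  rewrite patchE /F indicE/=; case: ifPn => [|]; rewrite ?inE ?notin_setE /= => yt.
    by rewrite mem_set// mul1r.
  by rewrite memNset// mul0r.
move=> ->; rewrite /intT -mulN1r -RintegralZl//; last first.
  have : iint (fun t => g t * th t).
    have [K HK] := icont_bounded (continuous_icont cth).
    apply: (@integrable_bounded_mul _ _ R mu _ mI' g th K) => //.
    by apply: measurable_funTS; exact: continuous_measurable_fun.
  by [].
apply: eq_Rintegral => r; rewrite inE/= in_itv/= => /andP[r0 rT].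
transitivity (\int[mu]_(x in I `&` [set x | r <= x]) (g r * derive1 th x)).
  rewrite Rintegral_mkcondr; apply: eq_Rintegral => x _.
  rewrite patchE /F indicE/=; case: ifPn => [|]; rewrite ?inE ?notin_setE /= => yt.
    by rewrite mem_set// mul1r mulrC.
  by rewrite memNset// mul0r.
have -> : I `&` [set x | r <= x] = `[r, T]%classic.
  apply/seteqP; split => y /=; rewrite !in_itv/=.
    by move=> [/andP[_ ->] ->].
  by move=> /andP[ry ->]; rewrite ry (le_trans r0).
rewrite RintegralZl//; last by apply: integrableS ith' => //; exact: subset_itvr.
have -> : \int[mu]_(x in `[r, T]) derive1 th x = th T - th r.
  apply: (@FTC2_inner th); rewrite ?lexx//; [exact: continuous_icont..|].
  by move=> t _; exact: test_derive.
by rewrite thT sub0r; ring.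
Qed.

End Prim.

(** * From weak to classical derivatives in time *)

Section Regularity.
Context {R : realType}.
Variable T : R.
Hypothesis T_gt0 : 0 < T.
Local Notation mu := (@lebesgue_measure R).
Local Notation I := (`[0, T]%classic : set R).
Local Notation test := (time_test T).
Local Notation IT := (intT T).
Local Notation icont := (icont T).
Local Notation iint := (iint T).

Let mI : measurable (I : set (measurableTypeR R)). Proof. exact: measurable_itv. Qed.

Lemma intT_ext (f g : R -> R) : f =1 g -> IT f = IT g.
Proof. by move=> /funext ->. Qed.

Lemma intTB (f g : R -> R) : iint f -> iint g -> IT (fun t => f t - g t) = IT f - IT g.
Proof. by move=> jf jg; rewrite /intT RintegralB. Qed.

Lemma intTZ c (f : R -> R) : iint f -> IT (fun t => c * f t) = c * IT f.
Proof. by move=> jf; rewrite /intT RintegralZl. Qed.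

Lemma iint_test_mul F th : icont F -> test th -> iint (fun t => F t * th t).
Proof.
move=> cF tth; apply: icont_iint; apply: icontM => //.
by apply: continuous_icont; exact: (test_continuous tth).
Qed.

Lemma test_pos_integral (F : R -> R) t : icont F -> 0 < t < T -> 0 < F t ->
  exists2 th, test th & 0 < IT (fun t => F t * th t).
Proof.
move=> cF /andP[t0 tT] Ft.
have [|d d0 Hd] := (icontP T F).1 cF t _ (F t / 2) ltac:(by rewrite divr_gt0).
  by rewrite !ltW.
(* Half of the smallest margin keeps the support of the bump inside []0, T[] and where [F] exceeds
   half of its value at [t]. *)
pose e := Num.min d (Num.min t (T - t)) / 2.
have e0 : 0 < e by rewrite divr_gt0// !lt_min d0 t0 subr_gt0 tT.
have [ed [et eT]] : [/\ e < d, e < t & e < T - t].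
  have h : e < 2 * e by lra.
  have : 2 * e <= Num.min d (Num.min t (T - t)) by rewrite /e mulrC divfK.
  by rewrite !le_min => /and3P[*]; split; exact: lt_le_trans h _.
have tb : test (bump_fun (t - e) (t + e)) by apply: bump_test; lra.
exists (bump_fun (t - e) (t + e)) => //.
have e2 : 0 < e / 2 by rewrite divr_gt0.
have [c c0 Hc] := bump_lower (t - e) (t + e) e2.
pose J : set R := `[t - e / 2, t + e / 2]%classic.
have JI : I `&` J = J.
  by apply/setIidPr => y; rewrite /J /= !in_itv/= => /andP[? ?]; apply/andP; split; lra.
have muJoo : (mu J < +oo)%E.
  by rewrite /J lebesgue_measure_itv/=; case: ifPn => _; exact: ltry.
have kappa0 : 0 < F t / 2 * c by rewrite mulr_gt0// divr_gt0.
apply: (@lt_le_trans _ _ (F t / 2 * c * e)); first by rewrite mulr_gt0.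
have -> : F t / 2 * c * e = \int[mu]_(x in I) ((cst (F t / 2 * c)) \_ J) x.
  rewrite -Rintegral_mkcondr JI Rintegral_cst; last exact: measurable_itv.
  have muJ : fine (mu J) = e.
    rewrite /J lebesgue_measure_itv/= lte_fin; case: ltP => h; last by lra.
    by rewrite -EFinB /=; lra.
  by rewrite -[in LHS]muJ.
apply: le_Rintegral => //.
- rewrite -restrict_EFin -integrable_restrict; last exact: measurable_itv.
  rewrite JI; apply: (@integrable_bounded _ _ R mu J _ (cst (F t / 2 * c)) (F t / 2 * c)).
  + exact: measurable_itv.
  + exact: muJoo.
  + exact: measurable_cst.
  + by move=> x _; rewrite ger0_norm// ltW.
  + exact: measurable_itv.
- exact: (iint_test_mul cF tb).
- move=> x; rewrite /= in_itv/= => xT; rewrite patchE; case: ifPn => [|_].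
    rewrite inE /J/= in_itv/= => /andP[x1 x2].
    have : c <= bump_fun (t - e) (t + e) x by apply: Hc; apply/andP; split; lra.
    have : F t / 2 <= F x.
      have xt : `|x - t| < d by apply/ltr_normlP; split; lra.
      by have /ltr_normlP[] := Hd x xT xt; lra.
    by move=> h1 h2; apply: ler_pM => //; [rewrite divr_ge0// ltW|exact: ltW].
  have [xin|xout] := boolP (t - e <= x <= t + e); last first.
    by rewrite (bump_out (negP xout)) mulr0.
  apply: mulr_ge0; last exact: bump_ge0.
  have /andP[x1 x2] := xin.
  have xt : `|x - t| < d by apply/ltr_normlP; split; lra.
  by have /ltr_normlP[] := Hd x xT xt; lra.
Qed.

Lemma test_vanish0 F : icont F -> (forall th, test th -> IT (fun t => F t * th t) = 0) ->
  forall t, 0 <= t <= T -> F t = 0.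
Proof.
move=> cF H; apply: (icont_ae_eq0 T_gt0 cF); apply: aeW => t tT.
apply/eqP; rewrite eq_le !leNgt; apply/andP; split; apply/negP => Ft.
  by have [th /H->] := test_pos_integral cF tT Ft; rewrite ltxx.
have cF' : icont (fun t => -1 * F t).
  by apply: icontM => //; apply: continuous_icont; exact: cst_continuous.
have [|th tth] := test_pos_integral cF' tT; first by rewrite mulN1r oppr_gt0.
suff -> : IT (fun t => -1 * F t * th t) = - IT (fun t => F t * th t).
  by rewrite H// oppr0 ltxx.
rewrite /intT -[RHS]mulN1r -RintegralZl//; last exact: (iint_test_mul cF tth).
by apply: eq_Rintegral => x _; rewrite mulrA.
Qed.

Lemma test_unit : exists2 th, test th & IT th = 1.
Proof.
have c1 : icont (fun=> 1) by apply: continuous_icont; exact: cst_continuous.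
have [||th tth p] := @test_pos_integral (fun=> 1) (T / 2) c1; first 2 last.
- exists (fun t => (IT th)^-1 * th t); last first.
    rewrite /intT RintegralZl//; last first.
      have := iint_test_mul c1 tth; apply: eq_integrable => // x _.
      by rewrite /= mul1r.
    rewrite mulVf// gt_eqF//; move: p; congr (_ < _).
    by apply: eq_Rintegral => x _; rewrite mul1r.
  move: (IT th)^-1 => c; have [sm [a [b [a0 bT out]]]] := tth.
  split; last by exists a, b; split => // t /out->; rewrite mulr0.
  move=> n t; rewrite (_ : derive1n n _ = fun t => c * derive1n n th t).
    by apply: derivableM; [exact: derivable_cst|exact: sm].
  elim: n => // n IH; rewrite !derive1nS IH; apply/funext => x.
  rewrite !derive1E; have := sm n x => dx.
  by rewrite (deriveZ c dx) /GRing.scale/=.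
- by have h := T_gt0; apply/andP; split; [rewrite divr_gt0|rewrite ltr_pdivrMr//; move: h; move: T => t h; lra].
- by [].
Qed.

Lemma test_sub (c : R) f g : test f -> test g ->
  (forall n, derive1n n (fun t => f t - c * g t) =
     fun t => derive1n n f t - c * derive1n n g t) /\ test (fun t => f t - c * g t).
Proof.
move=> [sf [a [b [a0 bT of_]]]] [sg [a' [b' [a0' bT' og]]]].
have lin n : derive1n n (fun t => f t - c * g t) = fun t => derive1n n f t - c * derive1n n g t.
  elim: n => // n IH; rewrite !derive1nS IH; apply/funext => x; rewrite !derive1E.
  have df : is_derive x 1 (derive1n n f) ('D_1 (derive1n n f) x) by exact/derivableP/sf.
  have dg : is_derive x 1 (derive1n n g) ('D_1 (derive1n n g) x) by exact/derivableP/sg.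
  have : is_derive x 1 (fun t => derive1n n f t - c * derive1n n g t)
     ('D_1 (derive1n n f) x - c * 'D_1 (derive1n n g) x).
    by apply: is_derive_eq; rewrite /GRing.scale/=; ring.
  by case.
split; first exact: lin.
split.
  move=> n t; rewrite lin; have sfn := sf n t; have sgn := sg n t.
  by apply: derivableB; [exact: sfn|apply: derivableM; [exact: derivable_cst|exact: sgn]].
exists (Num.min a a'), (Num.max b b'); split; [by rewrite lt_min a0|by rewrite gt_max bT|].
move=> t nt; rewrite of_ ?og ?mulr0 ?subr0// => /andP[h1 h2]; apply: nt.
  by rewrite ge_min le_max h1 h2 !orbT.
by rewrite ge_min le_max h1 h2.
Qed.

(** Mean zero makes the primitive vanish to the right of the support. For [t <= 0] the interval of
    integration is empty or a point, and the primitive is 0 there. *)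
Lemma prim_test th : test th -> IT th = 0 ->
  test (prim th) /\ derive1 (prim th) = th.
Proof.
move=> tth th0; have cth := test_continuous tth.
have [sm [a [b [a0 bT out]]]] := tth.
have z1 t : t < a -> prim th t = 0.
  move=> ta; rewrite /prim (@eq_Rintegral _ _ _ _ _ (fun=> 0)) ?Rintegral_cst ?mul0r//.
  by move=> x; rewrite inE/= in_itv/= => /andP[_ xt]; apply: out => /andP[]; lra.
have z2 t : b < t -> prim th t = 0.
  move=> bt; rewrite -th0 /prim /intT (Rintegral_mkcond mu) [RHS](Rintegral_mkcond mu); apply: eq_Rintegral => x _.
  rewrite !patchE; have [xb|bx] := leP x b; last first.
    by rewrite out ?if_same// => /andP[_]; lra.
  suff -> : (x \in `[0, t]%classic) = (x \in `[0, T]%classic) by [].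
  by apply/idP/idP => /set_mem; rewrite /= !in_itv/= => /andP[x0 _]; apply/mem_set; rewrite /= in_itv/= x0/=; lra.
have D (t : R) : is_derive t 1 (prim th) (th t).
  have [t0|t0] := ltP 0 t.
    have [dd e] := @continuous_FTC1_closed R th 0 t (t + 1) ltac:(by rewrite ltrDl)
      ltac:(by apply: continuous_compact_integrable; [exact: segment_compact|exact: continuous_subspaceT]) t0 (cth t).
    by split; [exact: dd|rewrite -derive1E; exact: e].
  rewrite out; last by move=> /andP[]; lra.
  have near0 : \forall x \near t, cst 0 x = prim th x.
    by near=> x; rewrite z1//; near: x; apply: lt_nbhsl; exact: le_lt_trans t0 a0.
  by apply: (near_eq_is_derive near0); exact: is_derive_cst.
have De : derive1 (prim th) = th.
  by apply/funext => t; rewrite derive1E; have [_ ->] := D t.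
split => //; split; last first.
  exists a, b; split => // t nt; have [/z1//|ta] := ltP t a.
  by apply: z2; rewrite ltNge; apply/negP => tb; apply: nt; rewrite ta.
case=> [|n] t; first by have [] := D t.
by rewrite /derive1n iterSr -/(derive1n n _) De; exact: sm.
Unshelve. all: by end_near. Qed.

Lemma horner_icont (p : {poly R}) : icont (horner p).
Proof. by apply: continuous_icont; exact: continuous_horner. Qed.

Lemma intT_poly_parts m (p : {poly R}) th : test th ->
  IT (fun t => p.[t] * derive1n m th t) = (-1) ^+ m * IT (fun t => (p^`(m)).[t] * th t).
Proof.
move=> tth; elim: m p => [|m IH] p; first by rewrite mul1r.
rewrite derive1nS (@intT_parts_C1 _ _ T_gt0 _ (horner p^`())).
- by rewrite IH derivSn exprS mulN1r mulNr.
- exact: horner_icont.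
- exact: horner_icont.
- exact: test_derive1n.
Qed.

(* du Bois-Reymond: subtracting from a test function a multiple of a fixed one
   gives the derivative of a test function. *)
Lemma test_vanish m F : icont F ->
  (forall th, test th -> IT (fun t => F t * derive1n m th t) = 0) ->
  exists p : {poly R}, (size p <= m)%N /\ forall t, 0 <= t <= T -> F t = p.[t].
Proof.
elim: m F => [|m IH] F cF H.
  by exists 0; rewrite size_poly0; split => // t tT; rewrite horner0 (test_vanish0 cF H).
have [x0 tx0 x01] := test_unit.
pose K := IT (fun t => F t * derive1n m x0 t).
(* The [m]-th derivative of [q] is, up to sign, the constant [K]; therefore [F - q] annihilates the
   [m]-th derivatives of all test functions and not only of those with mean zero. *)
pose q : {poly R} := ((-1) ^+ m * K / m`!%:R) *: 'X^m.
have m0 : m`!%:R != 0 :> R by rewrite pnatr_eq0 -lt0n fact_gt0.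
have qm : q^`(m) = ((-1) ^+ m * K)%:P.
  rewrite /q derivnZ derivnXn subnn expr0 ffactnn -mul_polyC -[_ *+ _]mulr_natr mul1r.
  by rewrite -polyC_natr -polyCM divfK.
have cFq : icont (fun t => F t - q.[t]) by apply: icontB => //; exact: horner_icont.
have [th tth|p [sp Hp]] := IH _ cFq.
  pose c := IT th; have [lin tsub] := test_sub c tth tx0.
  have ix0 : iint x0 by apply: icont_iint; apply: continuous_icont; exact: (test_continuous tx0).
  have ith : iint th by apply: icont_iint; apply: continuous_icont; exact: (test_continuous tth).
  have icx0 : iint (fun t => c * x0 t) by have := integrableZl mI c ix0.
  have s0 : IT (fun t => th t - c * x0 t) = 0.
    by rewrite intTB// intTZ// x01 mulr1 subrr.
  have [tp dp] := prim_test tsub s0.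
  have := H _ tp; rewrite /derive1n iterSr -/(derive1n m _) dp lin.
  have i1 := iint_test_mul cF (test_derive1n m tth).
  have i2 := iint_test_mul cF (test_derive1n m tx0).
  have i2c : iint (fun t => c * (F t * derive1n m x0 t)) by have := integrableZl mI c i2.
  rewrite (@intT_ext _ (fun t => F t * derive1n m th t - c * (F t * derive1n m x0 t))); last first.
    by move=> t; ring.
  rewrite intTB// intTZ// -/K => E.
  have i3 := iint_test_mul (@horner_icont q) (test_derive1n m tth).
  rewrite (@intT_ext _ (fun t => F t * derive1n m th t - q.[t] * derive1n m th t)); last first.
    by move=> t; rewrite -/(derive1n m th) mulrBl.
  rewrite intTB//.
  have -> : IT (fun t => q.[t] * derive1n m th t) = c * K.
    rewrite intT_poly_parts// qm.
    rewrite (@intT_ext _ (fun t => ((-1) ^+ m * K) * th t)); last by move=> t; rewrite hornerC.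
    by rewrite intTZ// -/c !mulrA -expr2 sqrr_sign mul1r mulrC.
  by move/eqP: E; rewrite subr_eq0 => /eqP ->; rewrite subrr.
exists (p + q); split.
  apply: (leq_trans (size_polyD _ _)); rewrite geq_max (leqW sp)/=.
  by apply: (leq_trans (size_scale_leq _ _)); rewrite size_polyXn.
by move=> t tT; rewrite hornerD -Hp// subrK.
Qed.

Lemma iter_prim_icont m g : iint g -> (0 < m)%N -> icont (iter m prim g).
Proof.
move=> ig; case: m => // m _; elim: m => [|m IH]; first exact: prim_icont.
by rewrite iterS; apply: prim_icont => //; exact: icont_iint.
Qed.

(** The [m]-fold primitive of [g] passes the same tests as [F], so the lemma of du Bois-Reymond
    leaves a polynomial. *)
Lemma weak_primitive m F g : icont F -> iint g -> (0 < m)%N ->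
  (forall th, test th -> IT (fun t => F t * derive1n m th t) =
     (-1) ^+ m * IT (fun t => g t * th t)) ->
  exists p : {poly R}, (size p <= m)%N /\
    forall t, 0 <= t <= T -> F t = p.[t] + iter m prim g t.
Proof.
move=> cF ig m0 H; have cg := iter_prim_icont ig m0.
have [th tth|p [sp Hp]] := @test_vanish m _ (icontB cF cg).
  have i1 := iint_test_mul cF (test_derive1n m tth).
  have i2 := iint_test_mul cg (test_derive1n m tth).
  rewrite (@intT_ext _ (fun t => F t * derive1n m th t - iter m prim g t * derive1n m th t)); last first.
    by move=> t; rewrite -/(derive1n m th) mulrBl.
  rewrite intTB// H//.
  suff -> : IT (fun t => iter m prim g t * derive1n m th t) = (-1) ^+ m * IT (fun t => g t * th t).
    by rewrite subrr.
  elim: (m) => [|j IHj]; first by rewrite mul1r.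
  rewrite derive1nS iterS intT_parts_prim//.
  - by rewrite IHj exprS mulN1r mulNr.
  - by case: j {IHj} => // j; apply: icont_iint; exact: iter_prim_icont.
  - exact: test_derive1n.
by exists p; split => // t tT; rewrite -Hp// subrK.
Qed.

Lemma prim_increment v x y : iint v -> iint (fun t => v t ^+ 2) ->
  0 <= x -> x <= y -> y <= T ->
  (prim v y - prim v x) ^+ 2 <=
  (y - x) * (prim (fun t => v t ^+ 2) y - prim (fun t => v t ^+ 2) x).
Proof.
move=> iv iv2 x0 xy yT; rewrite !(prim_diff (T := T))//.
have sub : `[x, y]%classic `<=` I by move=> z; rewrite /= !in_itv/= => /andP[? ?]; apply/andP; split; lra.
have m : fine (mu `[x, y]%classic) = y - x.
  rewrite lebesgue_measure_itv/= lte_fin; case: ltP => h; first by rewrite -EFinB.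
  by rewrite /= (le_anti (_ : x <= y <= x)) ?subrr// xy.
have fin : (mu `[x, y]%classic < +oo)%E.
  by rewrite lebesgue_measure_itv/=; case: ifPn => _; exact: ltry.
rewrite -m; apply: sqr_Rintegral_le => //; [exact: integrableS iv|exact: integrableS iv2].
Qed.

Lemma poly_const (p : {poly R}) x y : (size p <= 1)%N -> p.[x] = p.[y].
Proof. by move=> /size1_polyC ->; rewrite !hornerC. Qed.

Lemma size_deriv_leq (p : {poly R}) n : (size p <= n.+1)%N -> (size p^`() <= n)%N.
Proof.
have [->|p0] := eqVneq p 0; first by rewrite deriv0 size_poly0.
by move=> h; rewrite -ltnS; apply: leq_trans h; exact: lt_size_deriv.
Qed.

(** The representation by a fourfold primitive of [v4] gives three continuous derivatives and the
    increments of [f3]; the one by a twofold primitive of [v2] gives those of [f1]. The two are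
    linked by the uniqueness of the first derivative. *)
Lemma time_regularity f v2 v4 : icont f ->
  iint v2 -> iint (fun t => v2 t ^+ 2) -> iint v4 -> iint (fun t => v4 t ^+ 2) ->
  (forall th, test th -> IT (fun t => f t * derive1n 2 th t) = IT (fun t => v2 t * th t)) ->
  (forall th, test th -> IT (fun t => f t * derive1n 4 th t) = IT (fun t => v4 t * th t)) ->
  exists f1 f2 f3 : R -> R,
  [/\ [/\ icont f1, icont f2 & icont f3],
      forall t, 0 < t < T -> [/\ is_derive t 1 f (f1 t), is_derive t 1 f1 (f2 t) & is_derive t 1 f2 (f3 t)],
      forall x y, 0 <= x -> x <= y -> y <= T -> (f1 y - f1 x) ^+ 2 <=
        (y - x) * (prim (fun t => v2 t ^+ 2) y - prim (fun t => v2 t ^+ 2) x) &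
      forall x y, 0 <= x -> x <= y -> y <= T -> (f3 y - f3 x) ^+ 2 <=
        (y - x) * (prim (fun t => v4 t ^+ 2) y - prim (fun t => v4 t ^+ 2) x)].
Proof.
move=> cf i2 i22 i4 i42 w2 w4.
have [|q [sq Hq]] := @weak_primitive 2 f v2 cf i2 isT; first by move=> th tth; rewrite sqrrN expr1n mul1r w2.
have [|p [sp Hp]] := @weak_primitive 4 f v4 cf i4 isT.
  by move=> th tth; rewrite -signr_odd/= mul1r w4.
pose F j t := (p^`(j)).[t] + iter (4 - j) prim v4 t.
have cF j : (j < 4)%N -> icont (F j).
  by move=> j4; apply: icontD; [exact: horner_icont|apply: iter_prim_icont => //; rewrite subn_gt0].
have dF j t : (j < 3)%N -> 0 < t < T -> is_derive t 1 (F j) (F j.+1 t).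
  move=> j3 tT; rewrite /F (_ : (4 - j = (4 - j.+1).+1)%N); last by lia.
  have c : icont (iter (4 - j.+1) prim v4) by apply: iter_prim_icont => //; lia.
  have d1 : is_derive t 1 (horner p^`(j)) (p^`(j.+1)).[t] by rewrite derivnS; exact: is_derive_poly.
  have d2 : is_derive t 1 (iter (4 - j.+1).+1 prim v4) (iter (4 - j.+1) prim v4 t).
    exact: (prim_derive T_gt0 c).
  exact: is_deriveD.
have near_in t : 0 < t < T -> \forall x \near t, 0 < x < T.
  move=> /andP[t0 tT]; near=> x; apply/andP; split; near: x; [exact: lt_nbhsr|exact: lt_nbhsl].
have df t : 0 < t < T -> is_derive t 1 f (F 1%N t).
  move=> tT; have := dF 0%N t isT tT; apply: near_eq_is_derive.
  near=> x; rewrite /F subn0 derivn0 -Hp//.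
  have : 0 < x < T by near: x; exact: near_in.
  by move=> /andP[? ?]; rewrite !ltW.
exists (F 1%N), (F 2%N), (F 3%N); split.
- by split; exact: cF.
- by move=> t tT; split; [exact: df|exact: dF|exact: dF].
(* In the twofold representation the polynomial has degree at most 1, so its derivative is constant
   and drops out of the increments. *)
- have G t : 0 <= t <= T -> F 1%N t - ((q^`()).[t] + prim v2 t) = 0.
    move: t; apply: (icont_ae_eq0 T_gt0).
      by apply: icontB; [exact: cF|apply: icontD; [exact: horner_icont|exact: prim_icont]].
    apply: aeW => {}t tT.
    have c2 : icont (prim v2) by exact: prim_icont.
    have d1 : is_derive t 1 (horner q) (q^`()).[t] by exact: is_derive_poly.
    have d2 : is_derive t 1 (prim (prim v2)) (prim v2 t) by exact: (prim_derive T_gt0 c2).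
    have d3 : is_derive t 1 (horner q + prim (prim v2)) ((q^`()).[t] + prim v2 t) by exact: is_deriveD.
    have d4 : is_derive t 1 f ((q^`()).[t] + prim v2 t).
      apply: near_eq_is_derive d3; near=> x; rewrite Hq//.
      have : 0 < x < T by near: x; exact: near_in.
      by move=> /andP[? ?]; rewrite !ltW.
    by have [_ <-] := df t tT; have [_ <-] := d4; rewrite subrr.
  move=> x y x0 xy yT.
  have gx := G x ltac:(by rewrite x0 (le_trans xy)).
  have gy := G y ltac:(by rewrite (le_trans x0 xy)).
  have e : (q^`()).[x] = (q^`()).[y].
    by apply: poly_const; exact: size_deriv_leq.
  have -> : F 1%N y - F 1%N x = prim v2 y - prim v2 x by lra.
  exact: prim_increment.
- move=> x y x0 xy yT.
  have e : (p^`(3)).[x] = (p^`(3)).[y].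
    by apply: poly_const; rewrite !derivnS derivn0; do 3 apply: size_deriv_leq.
  have -> : F 3%N y - F 3%N x = prim v4 y - prim v4 x by rewrite /F e /=; lra.
  exact: prim_increment.
Unshelve. all: by end_near. Qed.

End Regularity.

(** * Quadrature and difference errors, interpolation in time *)

Section Quadrature.
Context {R : realType}.
Variable T : R.
Hypothesis T_gt0 : 0 < T.
Local Notation mu := (@lebesgue_measure R).

Lemma MVT_inner (f df : R -> R) (x y : R) : icont T f ->
  (forall t, 0 < t < T -> is_derive t 1 f (df t)) ->
  0 <= x -> x <= y -> y <= T -> exists2 c, x <= c <= y & f y - f x = df c * (y - x).
Proof.
move=> cf H x0 xy yT.
have dk (t : R) : t \in `]x, y[ -> is_derive t 1 f (df t).
  by rewrite in_itv/= => /andP[xt ty]; apply: H; apply/andP; split; [exact: le_lt_trans xt|exact: lt_le_trans yT].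
have cxy : {within `[x, y], continuous f}.
  by apply: continuous_subspaceW cf => z; rewrite /= !in_itv/= => /andP[? ?]; apply/andP; split; [exact: le_trans x0 _|exact: le_trans yT].
have [c cxy' e] := MVT_segment xy dk cxy.
by exists c => //; move: cxy'; rewrite in_itv.
Qed.

(** The trapezoidal defect is regarded as a function of its right end point. Its derivative is half
    of F1 r - F1 a - (r - a) F2 r, and a second use of the mean value theorem reduces this to an
    increment of [F2]. *)
Lemma quadrature (F0 F1 F2 : R -> R) (a b K : R) :
  icont T F0 -> icont T F1 -> icont T F2 ->
  (forall t, 0 < t < T -> is_derive t 1 F0 (F1 t)) ->
  (forall t, 0 < t < T -> is_derive t 1 F1 (F2 t)) ->
  0 <= a -> a <= b -> b <= T ->
  (forall x y, a <= x -> x <= y -> y <= b -> (F2 y - F2 x) ^+ 2 <= (b - a) * K) ->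
  (F0 b - F0 a - (b - a) * (2^-1 * (F1 b + F1 a))) ^+ 2 <= 4^-1 * (b - a) ^+ 5 * K.
Proof.
move=> c0 c1 c2 d0 d1 a0 ab bT HK.
pose G r := F0 r - F0 a - (r - a) * (2^-1 * (F1 r + F1 a)).
pose dG r := 2^-1 * (F1 r - F1 a - (r - a) * F2 r).
have cc (k : R) : icont T (fun=> k) by apply: continuous_icont; exact: cst_continuous.
have cid : icont T (fun r => r - a).
  by apply: icontB => //; apply: continuous_icont => x; exact: cvg_id.
have cG : icont T G.
  by apply: icontB; [exact: icontB|apply: icontM => //; apply: icontM => //; exact: icontD].
have dGd (t : R) : 0 < t < T -> is_derive t 1 G (dG t).
  move=> tT; have e0 := d0 t tT; have e1 := d1 t tT.
  by apply: is_derive_eq; rewrite /GRing.scale/= /dG; field.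
have [c /andP[ac cb] e] := MVT_inner cG dGd a0 ab bT.
have [x /andP[ax xc] e1] := MVT_inner c1 d1 a0 ac (le_trans cb bT).
have -> : F0 b - F0 a - (b - a) * (2^-1 * (F1 b + F1 a)) = dG c * (b - a).
  by rewrite -e /G; ring.
have -> : dG c = - (2^-1 * (c - a) * (F2 c - F2 x)) by rewrite /dG e1; field.
rewrite mulNr sqrrN.
have h := HK x c ax xc cb.
rewrite !exprMn.
have ca : (c - a) ^+ 2 <= (b - a) ^+ 2.
  by rewrite lerXn2r ?nnegrE ?subr_ge0// lerD2r.
have : (c - a) ^+ 2 * (F2 c - F2 x) ^+ 2 <= (b - a) ^+ 2 * ((b - a) * K).
  by apply: ler_pM => //; exact: sqr_ge0.
move=> h2; have := ler_wpM2r (sqr_ge0 (b - a)) h2.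
move: (c - a) (F2 c - F2 x) (b - a) => u v w; lra.
Qed.

Lemma second_difference (f f1 P : R -> R) (t s : R) :
  icont T f -> (forall t, 0 < t < T -> is_derive t 1 f (f1 t)) ->
  (forall x y, 0 <= x -> x <= y -> y <= T -> (f1 y - f1 x) ^+ 2 <= (y - x) * (P y - P x)) ->
  {homo P : x y / x <= y} ->
  0 < s -> s <= t -> t + s <= T ->
  (f (t + s) - 2 * f t + f (t - s)) ^+ 2 <= 2 * s ^+ 3 * (P (t + s) - P (t - s)).
Proof.
move=> cf d H Pm s0 st tsT.
have [x /andP[tx xt] ex] := @MVT_inner f f1 t (t + s) cf d ltac:(by lra) ltac:(by lra) ltac:(by lra).
have [y /andP[ty yt] ey] := @MVT_inner f f1 (t - s) t cf d ltac:(by lra) ltac:(by lra) ltac:(by lra).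
have -> : f (t + s) - 2 * f t + f (t - s) = s * (f1 x - f1 y).
  have -> : f (t + s) - 2 * f t + f (t - s) = (f (t + s) - f t) - (f t - f (t - s)) by ring.
  by rewrite ex ey; ring.
have h := H y x ltac:(by lra) ltac:(by lra) ltac:(by lra).
have hP : P x - P y <= P (t + s) - P (t - s) by apply: lerB; apply: Pm; lra.
have P0 : 0 <= P x - P y by rewrite subr_ge0; apply: Pm; lra.
have : (x - y) * (P x - P y) <= (2 * s) * (P (t + s) - P (t - s)).
  by apply: ler_pM => //; lra.
move=> h3; rewrite exprMn; have := ler_wpM2l (sqr_ge0 s) (le_trans h h3).
by move: (f1 x - f1 y) (P (t + s) - P (t - s)) => u v; lra.
Qed.

(** The zero initial velocity turns the bound on the increments of [f1] into one on [f1] itself. It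
    serves the first step, where phi^{-1} = phi^0 makes the second difference degenerate. *)
Lemma first_difference (f f1 P : R -> R) (a b : R) :
  icont T f -> (forall t, 0 < t < T -> is_derive t 1 f (f1 t)) ->
  (forall x y, 0 <= x -> x <= y -> y <= T -> (f1 y - f1 x) ^+ 2 <= (y - x) * (P y - P x)) ->
  {homo P : x y / x <= y} -> f1 0 = 0 -> P 0 = 0 ->
  0 <= a -> a <= b -> b <= T ->
  (f b - f a) ^+ 2 <= (b - a) ^+ 2 * (b * P b).
Proof.
move=> cf d H Pm z P0 a0 ab bT.
have [x /andP[tx xt] ex] := MVT_inner cf d a0 ab bT.
rewrite ex exprMn mulrC; apply: ler_wpM2l; first exact: sqr_ge0.
have := H 0 x (lexx 0) (le_trans a0 tx) (le_trans xt bT).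
rewrite z P0 !subr0 => /le_trans; apply; apply: ler_pM => //.
- exact: le_trans tx.
- by rewrite -P0; apply: Pm; exact: le_trans tx.
- exact: Pm.
Qed.

Lemma prim_le_const (g : R -> R) (a b K : R) : icont T g -> 0 <= a -> a <= b -> b <= T ->
  (forall x, a <= x <= b -> g x <= K) -> prim g b - prim g a <= (b - a) * K.
Proof.
move=> cg a0 ab bT H.
have ig := icont_iint cg.
have cK : icont T (fun=> K) by apply: continuous_icont; exact: cst_continuous.
have iK := icont_iint cK.
have sub : `[a, b]%classic `<=` (`[0, T]%classic : set R).
  by move=> z; rewrite /= !in_itv/= => /andP[? ?]; apply/andP; split; [exact: le_trans a0 _|exact: le_trans bT].
rewrite (prim_diff ig)//.
apply: (@le_trans _ _ (\int[mu]_(x in `[a, b]) K)).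
  apply: le_Rintegral => //.
  - by apply: integrableS ig.
  - by apply: integrableS iK.
have -> : (b - a) * K = K * b - K * a by ring.
rewrite le_eqVlt; apply/orP; left; apply/eqP.
apply: (@FTC2_inner R T T_gt0 (fun t : R => K * t) (fun=> K) a b a0 ab bT) => //.
- by apply: icontM => //; apply: continuous_icont => x; exact: cvg_id.
- by move=> t _; apply: is_derive_eq; rewrite /GRing.scale/=; ring.
Qed.

Section Interpolation.
Variables (f1 f2 f3 P2 P4 : R -> R).
Hypotheses (c1 : icont T f1) (c2 : icont T f2) (c3 : icont T f3).
Hypothesis d1 : forall t, 0 < t < T -> is_derive t 1 f1 (f2 t).
Hypothesis d2 : forall t, 0 < t < T -> is_derive t 1 f2 (f3 t).
Hypotheses (P2m : {homo P2 : x y / x <= y}) (P4m : {homo P4 : x y / x <= y}).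
Hypothesis H1 : forall x y, 0 <= x -> x <= y -> y <= T -> (f1 y - f1 x) ^+ 2 <= (y - x) * (P2 y - P2 x).
Hypothesis H3 : forall x y, 0 <= x -> x <= y -> y <= T -> (f3 y - f3 x) ^+ 2 <= (y - x) * (P4 y - P4 x).

Lemma average_bound a b : 0 <= a -> a < b -> b <= T ->
  exists2 x, a <= x <= b & (b - a) * f2 x ^+ 2 <= P2 b - P2 a.
Proof.
move=> a0 ab bT; have [x xab e] := MVT_inner c1 d1 a0 (ltW ab) bT.
exists x => //; have := H1 a0 (ltW ab) bT; rewrite e exprMn.
have ba : 0 < b - a by rewrite subr_gt0.
rewrite [f2 x ^+ 2 * _]mulrC [(b - a) ^+ 2]expr2 -!mulrA => h.
by rewrite -(ler_pM2l ba).
Qed.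

(** In the first and in the last third of the window [f2] is bounded at some point by
    [average_bound]. The difference quotient of the two values, at distance at least [dl / 3],
    bounds [f3] somewhere between, and [H3] carries the bound to the whole window. *)
Lemma interpolation_window c dl t : 0 < dl -> 0 <= c -> c + dl <= T -> c <= t <= c + dl ->
  dl ^+ 3 * f3 t ^+ 2 <=
   216 * (P2 (c + dl) - P2 c) + 2 * dl ^+ 4 * (P4 (c + dl) - P4 c).
Proof.
move=> dl0 c0 cT /andP[ct td].
have [x /andP[x1 x2] hx] := @average_bound c (c + dl / 3) c0 ltac:(by lra) ltac:(by lra).
have [y /andP[y1 y2] hy] := @average_bound (c + 2 * dl / 3) (c + dl) ltac:(by lra) ltac:(by lra) cT.
have [r /andP[r1 r2] er] := @MVT_inner f2 f3 x y c2 d2 ltac:(by lra) ltac:(by lra) ltac:(by lra).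
have px : P2 (c + dl / 3) - P2 c <= P2 (c + dl) - P2 c by apply: lerB => //; apply: P2m; lra.
have py : P2 (c + dl) - P2 (c + 2 * dl / 3) <= P2 (c + dl) - P2 c by apply: lerB => //; apply: P2m; lra.
set A := P2 (c + dl) - P2 c in px py *; set B := P4 (c + dl) - P4 c.
have bx : dl * f2 x ^+ 2 <= 3 * A.
  by move: hx; rewrite (_ : c + dl / 3 - c = dl / 3); [lra|ring].
have by' : dl * f2 y ^+ 2 <= 3 * A.
  by move: hy; rewrite (_ : c + dl - (c + 2 * dl / 3) = dl / 3); [lra|field].
have br : dl ^+ 3 * f3 r ^+ 2 <= 108 * A.
  have yx : dl / 3 <= y - x by lra.
  have yx2 : (dl / 3) ^+ 2 <= (y - x) ^+ 2 by rewrite lerXn2r ?nnegrE; lra.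
  have s1 : (dl / 3) ^+ 2 * f3 r ^+ 2 <= 2 * (f2 y ^+ 2 + f2 x ^+ 2).
    apply: (@le_trans _ _ ((y - x) ^+ 2 * f3 r ^+ 2)).
      by apply: ler_wpM2r => //; exact: sqr_ge0.
    rewrite mulrC -exprMn -er; have := sqr_ge0 (f2 y + f2 x); lra.
  have := ler_wpM2l (ltW dl0) s1; lra.
have b3 : (f3 t - f3 r) ^+ 2 <= dl * B.
  have B0 : 0 <= B by rewrite subr_ge0; apply: P4m; lra.
  have [rt|tr] := leP r t.
    apply: (le_trans (H3 _ rt _)); [lra|lra|].
    apply: ler_pM; [lra|by rewrite subr_ge0; exact: P4m|lra|by apply: lerB; apply: P4m; lra].
  rewrite -sqrrN opprB; apply: (le_trans (H3 _ (ltW tr) _)); [lra|lra|].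
  apply: ler_pM; [lra|by rewrite subr_ge0; apply: P4m; exact: ltW|lra|by apply: lerB; apply: P4m; lra].
have s2 : f3 t ^+ 2 <= 2 * f3 r ^+ 2 + 2 * (f3 t - f3 r) ^+ 2.
  by have := sqr_ge0 (f3 t - 2 * f3 r); lra.
have d30 : 0 <= dl ^+ 3 by rewrite exprn_ge0// ltW.
have := ler_wpM2l d30 s2; have := ler_wpM2l d30 b3.
by move: (f3 t - f3 r) => u; lra.
Qed.

Lemma interpolation_n n : (0 < n)%N ->
  prim (fun t => f3 t ^+ 2) T <=
   216 * (n%:R / T) ^+ 2 * (P2 T - P2 0) + 2 * (T / n%:R) ^+ 2 * (P4 T - P4 0).
Proof.
move=> n0; have n0' : 0 < n%:R :> R by rewrite ltr0n.
set dl := T / n%:R; have dl0 : 0 < dl by rewrite divr_gt0.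
have dn : dl * n%:R = T by rewrite /dl divfK// gt_eqF.
have cs : icont T (fun t => f3 t ^+ 2) by apply: icontM.
have step k : (k < n)%N ->
   prim (fun t => f3 t ^+ 2) (k.+1%:R * dl) - prim (fun t => f3 t ^+ 2) (k%:R * dl) <=
   216 * (n%:R / T) ^+ 2 * (P2 (k.+1%:R * dl) - P2 (k%:R * dl))
   + 2 * dl ^+ 2 * (P4 (k.+1%:R * dl) - P4 (k%:R * dl)).
  move=> kn.
  have e : k.+1%:R * dl = k%:R * dl + dl by rewrite -natr1; ring.
  have k0 : 0 <= k%:R * dl by rewrite mulr_ge0// ltW.
  have kT : k%:R * dl + dl <= T.
    by rewrite -e -dn [leRHS]mulrC; apply: ler_wpM2r; [exact: ltW|rewrite ler_nat].
  rewrite e.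
  pose K := 216 / dl ^+ 3 * (P2 (k%:R * dl + dl) - P2 (k%:R * dl))
    + 2 * dl * (P4 (k%:R * dl + dl) - P4 (k%:R * dl)).
  have := @prim_le_const _ (k%:R * dl) (k%:R * dl + dl) K cs k0 ltac:(by lra) kT.
  move=> /(_ _)/le_trans; apply.
    move=> x xin; have := interpolation_window dl0 k0 kT xin.
    have d3 : 0 < dl ^+ 3 by rewrite exprn_gt0.
    move=> h; rewrite -(ler_pM2l d3); apply: (le_trans h).
    by rewrite le_eqVlt; apply/orP; left; apply/eqP; rewrite /K; field; rewrite gt_eqF.
  rewrite le_eqVlt; apply/orP; left; apply/eqP; rewrite /K.
  have -> : n%:R / T = dl^-1 by rewrite /dl invf_div.
  by field; rewrite gt_eqF.
have tele : \sum_(0 <= k < n) (prim (fun t => f3 t ^+ 2) (k.+1%:R * dl) - prim (fun t => f3 t ^+ 2) (k%:R * dl)) <=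
   \sum_(0 <= k < n) (216 * (n%:R / T) ^+ 2 * (P2 (k.+1%:R * dl) - P2 (k%:R * dl))
   + 2 * dl ^+ 2 * (P4 (k.+1%:R * dl) - P4 (k%:R * dl))).
  by rewrite !big_nat; apply: ler_sum => k /andP[_ kn]; exact: step.
move: tele; rewrite [X in _ <= X -> _]big_split/=.
have ms c (F : nat -> R) : \sum_(0 <= k < n) c * F k = c * \sum_(0 <= k < n) F k by rewrite mulr_sumr.
rewrite (ms _ (fun k => P2 (k.+1%:R * dl) - P2 (k%:R * dl))) (ms _ (fun k => P4 (k.+1%:R * dl) - P4 (k%:R * dl))).
rewrite (telescope_sumr (fun k => prim (fun t => f3 t ^+ 2) (k%:R * dl))) ?leq0n//.
rewrite (telescope_sumr (fun k => P2 (k%:R * dl))) ?leq0n//.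
rewrite (telescope_sumr (fun k => P4 (k%:R * dl))) ?leq0n//.
by rewrite mul0r [n%:R * dl]mulrC dn prim0 subr0.
Qed.

(** With about T sqrt(w) windows their length is about 1 / sqrt(w), and both terms of
    [interpolation_n] get the right power of [w]. The free weight is what allows an interpolation
    between spaces, one mode at a time. *)
Lemma interpolation (w : R) : 1 <= w ->
  w * prim (fun t => f3 t ^+ 2) T <=
  432 * (1 + T ^- 2) * w ^+ 2 * (P2 T - P2 0) + 2 * (P4 T - P4 0).
Proof.
move=> w1; pose x := Num.sqrt w.
have w0 : 0 < w by lra.
have x0 : 0 < x by rewrite sqrtr_gt0.
have xx : x ^+ 2 = w by rewrite sqr_sqrtr// ltW.
have x1 : 1 <= x by rewrite -sqrtr1 ler_wsqrtr.
(* The lower bound [T * x] bounds the window length; the excess over it is at most 1, the source of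
   [T ^- 2]. *)
pose n := (Num.truncn (T * x)).+1.
have Tx : 0 <= T * x by rewrite mulr_ge0// ltW.
have n1 : T * x <= n%:R by apply: ltW; exact: truncnS_gt.
have n2 : n%:R <= T * x + 1 by rewrite /n -natr1 lerD2r truncn_le.
have n0 : 0 < n%:R :> R by rewrite ltr0n.
have p2 : 0 <= P2 T - P2 0 by rewrite subr_ge0; apply: P2m; exact: ltW.
have p4 : 0 <= P4 T - P4 0 by rewrite subr_ge0; apply: P4m; exact: ltW.
have a1 : (n%:R / T) ^+ 2 <= 2 * (1 + T ^- 2) * w.
  have : n%:R / T <= x + T^-1.
    by rewrite ler_pdivrMr// mulrDl mulVf ?gt_eqF// [x * T]mulrC.
  move=> h; have : (n%:R / T) ^+ 2 <= (x + T^-1) ^+ 2.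
    by rewrite lerXn2r ?nnegrE ?divr_ge0 ?addr_ge0 ?invr_ge0// ltW.
  move=> /le_trans; apply.
  have := sqr_ge0 (x - T^-1).
  have : T ^- 2 * 1 <= T ^- 2 * w by apply: ler_wpM2l => //; rewrite invr_ge0 sqr_ge0.
  by rewrite -exprVn; move: T^-1 => u; rewrite -xx; lra.
have a2 : w * (T / n%:R) ^+ 2 <= 1.
  apply: (@le_trans _ _ (1 ^+ 2)); last by rewrite expr1n.
  rewrite -xx -exprMn; apply: lerXn2r; rewrite ?nnegrE//.
    by rewrite mulr_ge0 ?divr_ge0// ltW.
  by rewrite mulrA ler_pdivrMr// mul1r mulrC.
have := ler_wpM2l (ltW w0) (interpolation_n (ltn0Sn _ : (0 < n)%N)).
move=> /le_trans; apply.
have b1 := ler_wpM2l (mulr_ge0 (ltW w0) p2) a1.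
have b2 := ler_wpM2r p4 a2.
lra.
Qed.

End Interpolation.
End Quadrature.

(** * Fourier coefficients *)

Section Modes.
Context {R : realType} (L : R).
Hypothesis L_gt0 : 0 < L.
Local Notation mu := (@lebesgue_measure R).
Local Notation MR := (measurableTypeR R).
Local Notation nu := ((@lebesgue_measure R \x @lebesgue_measure R)%E).
Local Notation Om := (Omega L : set (MR * MR)).

Lemma mItv : measurable (`]0, L[%classic : set MR).
Proof. exact: measurable_itv. Qed.

Lemma measurable_Omega : measurable Om.
Proof. by apply: measurableX; exact: mItv. Qed.

Lemma itv_measure : mu (`]0, L[%classic : set MR) = L%:E.
Proof. by rewrite lebesgue_measure_itv/= lte_fin L_gt0 sube0. Qed.

Lemma Omega_measure : nu Om = (L ^+ 2)%:E.
Proof.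
have -> : nu Om = (mu (`]0%R, L[%classic : set MR) * mu (`]0%R, L[%classic : set MR))%E.
  by apply: product_measure1E; exact: mItv.
by rewrite itv_measure -EFinM expr2.
Qed.

Lemma Omega_fin : (nu Om < +oo)%E.
Proof. by rewrite Omega_measure ltry. Qed.

Lemma measurable_tmode k a b (D : set (MR * MR)) : measurable_fun D (tmode L k a b).
Proof.
have mph : measurable_fun D (fun z : MR * MR => phase L k.1 k.2 z).
  apply: measurable_funM => //; apply: measurable_funD; apply: measurable_funM => //.
  - by apply: measurable_funTS; exact: measurable_fst.
  - by apply: measurable_funTS; exact: measurable_snd.
apply: measurable_funD; apply: measurable_funM => //.
- apply: measurableT_comp mph; apply: continuous_measurable_fun; exact: continuous_cos.
- apply: measurableT_comp mph; apply: continuous_measurable_fun; exact: continuous_sin.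
Qed.

Lemma tmode_le (k : int * int) (a b : R) z : `|tmode L k a b z| <= `|a| + `|b|.
Proof.
rewrite (le_trans (ler_normD _ _))// !normrM lerD// ler_piMr//.
- by rewrite cos_abs_le1 || (rewrite ler_norml cos_geN1 cos_le1).
- by rewrite (ler_norml) sin_geN1 sin_le1.
Qed.

Lemma integrable_tmode k a b : nu.-integrable Om (EFin \o tmode L k a b).
Proof.
apply: (@integrable_bounded _ _ _ nu Om measurable_Omega _ (`|a| + `|b|) Omega_fin).
- exact: measurable_tmode.
- by move=> z _; exact: tmode_le.
Qed.

Lemma integrable_tmodeM k a b u : nu.-integrable Om (EFin \o u) ->
  nu.-integrable Om (EFin \o (fun z => u z * tmode L k a b z)).
Proof.
move=> iu; apply: (@integrable_bounded_mul _ _ _ nu Om measurable_Omega u _ (`|a| + `|b|)) => //.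
- exact: measurable_tmode.
- by move=> z _; exact: tmode_le.
Qed.

Lemma tmode0 (a b : R) z : tmode L (0, 0) a b z = a.
Proof. by rewrite /tmode phaseE /wave !mulr0 !mul0r addr0 cos0 sin0; ring. Qed.

Lemma int_mode1 (w a b c : R) (n : int) : n != 0 -> w = wave L n ->
  \int[mu]_(x in `]0, L[) (a * cos (w * x + c) + b * sin (w * x + c)) = 0.
Proof.
move=> n0 wE.
have w0 : w != 0.
  rewrite wE /wave; apply: mulf_neq0; last by rewrite intr_eq0.
  apply: mulf_neq0; last by rewrite invr_eq0 gt_eqF.
  by apply: mulf_neq0; rewrite ?pnatr_eq0// gt_eqF// pi_gt0.
pose F (x : R) := (a * sin (w * x + c) - b * cos (w * x + c)) / w.
pose f (x : R) := a * cos (w * x + c) + b * sin (w * x + c).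
have dF (x : R) : is_derive x 1 F (f x).
  by apply: is_derive_eq; rewrite /GRing.scale/= /f; field.
have cf : icont L f.
  apply: continuous_icont => x; apply/differentiable_continuous/derivable1_diffP.
  by rewrite /f; apply: ex_derive.
have cF : icont L F.
  apply: continuous_icont => x; apply/differentiable_continuous/derivable1_diffP.
  by have [] := dF x.
have := @FTC2_inner R L L_gt0 F f 0 L (lexx _) (ltW L_gt0) (lexx _) cF cf (fun t _ => dF t).
have -> : F L = F 0.
  rewrite /F mulr0 add0r; have [e1 e2] := trig_int_period c n.
  have -> : w * L + c = c + 2 * pi * n%:~R by rewrite wE /wave; field; rewrite gt_eqF.
  by rewrite e1 e2.
have i0 := icont_iint cf.
rewrite subrr => e; transitivity (\int[mu]_(x in `[0, L]) f x); last exact: e.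
rewrite -(@Rintegral_itv_obnd_cbnd _ 0 (BRight L) f); last first.
  by apply: integrableS i0 => //; apply: subset_itvr; rewrite bnd_simp.
rewrite -(@Rintegral_itv_bndo_bndc _ (BRight 0) L f)//.
by apply: integrableS i0 => // z; rewrite /= !in_itv/= => /andP[/ltW -> /ltW ->].
Qed.

(** The inner integral is taken in a variable whose frequency is not zero, where a full period
    integrates to 0. *)
Lemma int_tmode k a b : \int[nu]_(z in Om) tmode L k a b z = if k == (0, 0) then L ^+ 2 * a else 0.
Proof.
case: eqP => [->|kn].
  under eq_Rintegral do rewrite tmode0.
  rewrite (Rintegral_cst nu measurable_Omega) mulrC; congr (_ * _).
  exact: (congr1 fine Omega_measure).
have [k20|k2] := eqVneq k.2 0.
  have k1 : k.1 != 0 by apply/eqP => k10; apply: kn; case: (k) k10 k20 => /= ? ? -> ->.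
  rewrite (Rfubini2 mItv mItv (integrable_tmode k a b)).
  under eq_Rintegral.
    move=> y _.
    under eq_Rintegral do rewrite /tmode phaseE/=.
    rewrite (int_mode1 _ _ _ k1 erefl); over.
  by rewrite (Rintegral_cst mu mItv) mul0r.
rewrite (Rfubini1 mItv mItv (integrable_tmode k a b)).
under eq_Rintegral.
  move=> y _.
  under eq_Rintegral do rewrite /tmode phaseE/= [_ * y + _]addrC.
  rewrite (int_mode1 _ _ _ k2 erefl); over.
by rewrite (Rintegral_cst mu mItv) mul0r.
Qed.

Lemma tmodeM k l a b c d z : tmode L k a b z * tmode L l c d z =
  tmode L (k.1 + l.1, k.2 + l.2) ((a * c - b * d) / 2) ((a * d + b * c) / 2) z +
  tmode L (k.1 - l.1, k.2 - l.2) ((a * c + b * d) / 2) ((b * c - a * d) / 2) z.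
Proof.
have p1 : phase L (k.1 + l.1) (k.2 + l.2) z = phase L k.1 k.2 z + phase L l.1 l.2 z.
  by rewrite !phaseE !waveD; ring.
have p2 : phase L (k.1 - l.1) (k.2 - l.2) z = phase L k.1 k.2 z - phase L l.1 l.2 z.
  by rewrite !phaseE !waveD !waveN; ring.
by rewrite /tmode/= p1 p2 cosD sinD cosB sinB; field.
Qed.

Lemma tmode_linear k (a b : R) z : tmode L k a b z = a * tmode L k 1 0 z + b * tmode L k 0 1 z.
Proof. by rewrite /tmode; ring. Qed.

(** Opposite frequencies span the same real modes, so a symmetric range meets every nonconstant real
    mode twice; this is the origin of the halves below. *)
Definition kopp (k : int * int) : int * int := (- k.1, - k.2).

Lemma tmode_kopp k (a b : R) z : tmode L (kopp k) a b z = tmode L k a (- b) z.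
Proof.
have e : phase L (kopp k).1 (kopp k).2 z = - phase L k.1 k.2 z.
  by rewrite !phaseE /= !waveN; ring.
by rewrite /tmode e cosN sinN; ring.
Qed.

Lemma lam_kopp k : lam L (kopp k) = lam L k.
Proof. by rewrite /lam/= !waveN; ring. Qed.

Lemma derive_tmode k (a b : R) (v z : R * R) (w := wave L k.1 * v.1 + wave L k.2 * v.2) :
  'D_v (tmode L k a b) z = tmode L k (b * w) (- (a * w)) z.
Proof.
pose f (h : R) := a * cos (w * h + phase L k.1 k.2 z) + b * sin (w * h + phase L k.1 k.2 z).
have e (h : R) : tmode L k a b (h *: v + z) = f h.
  rewrite /tmode/f; have -> // : phase L k.1 k.2 (h *: v + z) = w * h + phase L k.1 k.2 z.
  by rewrite !phaseE /w /=; rewrite /GRing.scale/=; ring.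
have d : is_derive (0 : R) 1 f (tmode L k (b * w) (- (a * w)) z).
  apply: is_derive_eq; rewrite /GRing.scale/= /tmode mulr0 add0r; ring.
have := @derive_val _ _ _ _ _ _ _ d; rewrite /derive => <-.
set F1 := (X in lim (X @ _) = _); set F2 := (X in _ = lim (X @ _)).
suff -> : F1 = F2 by [].
apply/funext => h; rewrite /F1 /F2 /= e.
by rewrite {1}(_ : z = 0 *: v + z) ?e ?scale0r ?add0r// /GRing.scale/= mulr1 addr0.
Qed.

Lemma differentiable_tmode k (a b : R) z : differentiable (tmode L k a b) z.
Proof.
have dp (y : R * R) : differentiable (phase L k.1 k.2) y.
  have -> : phase L k.1 k.2 = (fun z : R * R => wave L k.1 *: (fst z : R^o) + wave L k.2 *: (snd z : R^o)).
    by apply/funext => x; rewrite phaseE.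
  apply: differentiableD; apply: differentiableZ; apply: linear_differentiable => x.
  - exact: cvg_fst.
  - exact: cvg_snd.
have dc (g : R -> R) : (forall x : R, derivable g x 1) -> differentiable (fun x => g (phase L k.1 k.2 x)) z.
  by move=> dg; apply: differentiable_comp => //; apply/derivable1_diffP.
have -> : tmode L k a b = (fun z => a *: (cos (phase L k.1 k.2 z) : R^o) + b *: (sin (phase L k.1 k.2 z) : R^o)) by [].
by apply: differentiableD; apply: differentiableZ; apply: dc.
Qed.

Lemma derive_tmodeE k a b (v : R * R) : exists c d, (fun z => 'D_v (tmode L k a b) z) = tmode L k c d.
Proof.
by exists (b * (wave L k.1 * v.1 + wave L k.2 * v.2)), (- (a * (wave L k.1 * v.1 + wave L k.2 * v.2))); apply/funext => z; exact: derive_tmode.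
Qed.

Lemma smooth_tmode k a b : smooth2 (tmode L k a b).
Proof.
move=> vs z; suff [c [d ->]] : exists c d, foldr (fun v (g : R * R -> R) => 'D_v g) (tmode L k a b) vs = tmode L k c d.
  exact: differentiable_tmode.
elim: vs => [|v vs [c [d e]]] /=; first by exists a, b.
by rewrite e; have [c' [d' e']] := derive_tmodeE k c d v; exists c', d'; rewrite -e'.
Qed.

Lemma periodic_tmode k a b : periodic2 L (tmode L k a b).
Proof.
move=> x y; split; apply: tmode_ext.
  by exists k.1; rewrite !phaseE/= /wave; field; rewrite gt_eqF.
by exists k.2; rewrite !phaseE/= /wave; field; rewrite gt_eqF.
Qed.

(** Even orders multiply a mode by a scalar, whereas odd orders exchange cosine and sine; the
    Sobolev bounds use pure even derivatives. *)
Lemma dpartial_tmode k (a b : R) m :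
  dpartial m.*2 0 (tmode L k a b) = tmode L k ((- wave L k.1 ^+ 2) ^+ m * a) ((- wave L k.1 ^+ 2) ^+ m * b) /\
  dpartial 0 m.*2 (tmode L k a b) = tmode L k ((- wave L k.2 ^+ 2) ^+ m * a) ((- wave L k.2 ^+ 2) ^+ m * b).
Proof.
rewrite /dpartial/=.
elim: m => [|m [IH1 IH2]]; first by rewrite !expr0 !mul1r.
rewrite doubleS !iterS IH1 IH2.
have D c d (v : R * R) : 'D_v (tmode L k c d) = tmode L k (d * (wave L k.1 * v.1 + wave L k.2 * v.2))  (- (c * (wave L k.1 * v.1 + wave L k.2 * v.2))).
  by apply/funext => z; exact: derive_tmode.
by rewrite !D/= !mulr1 !mulr0 !addr0 !add0r; split; congr tmode; rewrite !exprS; ring.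
Qed.

End Modes.

Section Coefficients.
Context {R : realType} (L : R).
Hypothesis L_gt0 : 0 < L.
Local Notation MR := (measurableTypeR R).
Local Notation nu := ((@lebesgue_measure R \x @lebesgue_measure R)%E).
Local Notation Om := (Omega L : set (MR * MR)).
Local Notation tm := (tmode L).

(** Unnormalised: [(a, b) = (1, 0)] gives the cosine and [(0, 1)] the sine integral; the factor
    [L ^- 2] of a Fourier coefficient is kept apart. *)
Definition cf (u : R * R -> R) (k : int * int) (a b : R) : R :=
  \int[nu]_(z in Om) (u z * tm k a b z).

Definition oint (u : R * R -> R) := nu.-integrable Om (EFin \o u).

Let mOm := measurable_Omega L.

Lemma ointZ c u : oint u -> oint (fun z => c * u z).
Proof. by move=> iu; exact: (integrableZl mOm c iu). Qed.

Lemma ointD u v : oint u -> oint v -> oint (fun z => u z + v z).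
Proof. by move=> iu iv; exact: (integrableD mOm iu iv). Qed.

Lemma cf_linear u k a b : oint u -> cf u k a b = a * cf u k 1 0 + b * cf u k 0 1.
Proof.
move=> iu; rewrite /cf.
have -> : (\int[nu]_(z in Om) (u z * tm k a b z)) =
   \int[nu]_(z in Om) (a * (u z * tm k 1 0 z) + b * (u z * tm k 0 1 z)).
  by apply: eq_Rintegral => z _; rewrite (tmode_linear L k a b); ring.
rewrite RintegralD//; first by rewrite !RintegralZl//; exact: integrable_tmodeM.
- by apply: ointZ; exact: integrable_tmodeM.
- by apply: ointZ; exact: integrable_tmodeM.
Qed.

Lemma cfD u v k a b : oint u -> oint v -> cf (fun z => u z + v z) k a b = cf u k a b + cf v k a b.
Proof.
move=> iu iv; rewrite /cf -RintegralD//; [|exact: integrable_tmodeM..].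
by apply: eq_Rintegral => z _; rewrite mulrDl.
Qed.

Lemma cfZ c u k a b : oint u -> cf (fun z => c * u z) k a b = c * cf u k a b.
Proof.
move=> iu; rewrite /cf -RintegralZl//; last exact: integrable_tmodeM.
by apply: eq_Rintegral => z _; rewrite mulrA.
Qed.

(** In the product formula the difference frequency is 0 at [m = k] and the sum frequency at
    [m = kopp k]. At frequency 0 both happen and the halves add up. *)
Lemma cf_tmode m (c d : R) k (a b : R) : cf (tm m c d) k a b =
  L ^+ 2 / 2 * (if m == k then a * c + b * d else 0) + L ^+ 2 / 2 * (if m == kopp k then a * c - b * d else 0).
Proof.
rewrite /cf.
under eq_Rintegral do rewrite tmodeM.
rewrite RintegralD//; [|exact: integrable_tmode..].
rewrite !int_tmode// !xpair_eqE.
rewrite addrC !subr_eq0 !addr_eq0.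
have -> : (m == k) = (m.1 == k.1) && (m.2 == k.2) by rewrite [m]surjective_pairing [k]surjective_pairing xpair_eqE.
have -> : (m == kopp k) = (m.1 == - k.1) && (m.2 == - k.2) by rewrite [m]surjective_pairing /kopp xpair_eqE.
by do 2 case: ifP => _; field.
Qed.

Section Bessel.
Variables (I : finType) (kap : I -> int * int).
Hypothesis kap_inj : injective kap.

(** As on the grid, adding the square of the imaginary part makes the modes orthogonal even if both
    [k] and [kopp k] occur. *)
Lemma int_tpoly_sqr (a b : I -> R) :
  \int[nu]_(z in Om) (tpoly L kap a b z ^+ 2) <= L ^+ 2 * \sum_i (a i ^+ 2 + b i ^+ 2).
Proof.
have itp c d : oint (tpoly L kap c d) by apply: (integrable_fsum mOm) => i; exact: integrable_tmode.
have bd c d z : `|tpoly L kap c d z| <= \sum_i (`|c i| + `|d i|).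
  by rewrite /tpoly; apply: (le_trans (ler_norm_sum _ _ _)); apply: ler_sum => i _; exact: tmode_le.
have i2 c d : oint (fun z => tpoly L kap c d z ^+ 2).
  apply: (@integrable_bounded_mul _ _ _ nu Om mOm (tpoly L kap c d) (tpoly L kap c d) (\sum_i (`|c i| + `|d i|))) => //.
  by apply/measurable_EFinP; exact: measurable_int (itp c d).
  exact: itp.
apply: (@le_trans _ _ (\int[nu]_(z in Om) (tpoly L kap a b z ^+ 2 + tpoly L kap (fun i => - b i) a z ^+ 2))).
  apply: le_Rintegral => //.
  - exact: i2.
  - exact: (ointD (i2 a b) (i2 (fun i => - b i) a)).
  - by move=> z _; rewrite lerDl sqr_ge0.
under eq_Rintegral do rewrite tpoly_sqr.
rewrite Rintegral_sum//; last first.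
  by move=> i; apply: (integrable_fsum mOm) => j; exact: integrable_tmode.
rewrite mulr_sumr le_eqVlt; apply/orP; left; apply/eqP; apply: eq_bigr => i _.
rewrite Rintegral_sum//; last by move=> j; exact: integrable_tmode.
rewrite (bigD1 i)//= big1 ?addr0 => [|j ji]; rewrite int_tmode// /ksub.
  by rewrite !subrr eqxx; congr (_ * _); ring.
rewrite xpair_eqE !subr_eq0; case: ifP => // /andP[/eqP e1 /eqP e2].
by move: ji; rewrite (kap_inj (_ : kap j = kap i)) ?eqxx//; move: e1 e2; case: (kap i) (kap j) => ? ? [? ?]/= -> ->.
Qed.

(** With [p] the polynomial built from these coefficients, [(L * u - L^-1 * p) ^+ 2] has a
    nonnegative integral; the scaling balances the factor in [int_tpoly_sqr]. *)
Lemma bessel u : oint u -> oint (fun z => u z ^+ 2) ->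
  \sum_i (cf u (kap i) 1 0 ^+ 2 + cf u (kap i) 0 1 ^+ 2) <= L ^+ 2 * \int[nu]_(z in Om) (u z ^+ 2).
Proof.
move=> iu iu2; set S := \sum_i _.
pose a i := cf u (kap i) 1 0; pose b i := cf u (kap i) 0 1.
pose p := tpoly L kap a b.
have ip : oint p by apply: (integrable_fsum mOm) => i; exact: integrable_tmode.
have bd z : `|p z| <= \sum_i (`|a i| + `|b i|).
  by rewrite /p /tpoly; apply: (le_trans (ler_norm_sum _ _ _)); apply: ler_sum => i _; exact: tmode_le.
have mp : measurable_fun Om p by apply/measurable_EFinP; exact: measurable_int ip.
have ip2 : oint (fun z => p z ^+ 2).
  by apply: (@integrable_bounded_mul _ _ _ nu Om mOm p p _ mp (fun z _ => bd z)).
have iup : oint (fun z => u z * p z).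
  by apply: (@integrable_bounded_mul _ _ _ nu Om mOm u p _ mp (fun z _ => bd z)).
have up : \int[nu]_(z in Om) (u z * p z) = S.
  have -> : \int[nu]_(z in Om) (u z * p z) = \int[nu]_(z in Om) (\sum_i u z * tm (kap i) (a i) (b i) z).
    by apply: eq_Rintegral => z _; rewrite mulr_sumr.
  rewrite Rintegral_sum//; last by move=> i; exact: integrable_tmodeM.
  by apply: eq_bigr => i _; rewrite -/(cf u (kap i) (a i) (b i)) cf_linear// /a /b !expr2.
have p2 : \int[nu]_(z in Om) (p z ^+ 2) <= L ^+ 2 * S by exact: int_tpoly_sqr.
have L2 : 0 < L ^+ 2 by rewrite exprn_gt0.
have : 0 <= \int[nu]_(z in Om) (L ^+ 2 * u z ^+ 2 + (L ^- 2 * p z ^+ 2 + - 2 * (u z * p z))).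
  apply: Rintegral_ge0 => z _.
  have -> : L ^+ 2 * u z ^+ 2 + (L ^- 2 * p z ^+ 2 + - 2 * (u z * p z)) = (L * u z - L^-1 * p z) ^+ 2.
    by field; rewrite gt_eqF.
  exact: sqr_ge0.
rewrite RintegralD//; last 2 first.
- exact: ointZ.
- by apply: ointD; exact: ointZ.
rewrite RintegralD//; [|exact: ointZ..].
rewrite !RintegralZl// up.
have := ler_wpM2l (_ : 0 <= L ^- 2) p2; rewrite invr_ge0 ltW// => /(_ isT).
rewrite mulrA mulVf ?gt_eqF// mul1r.
lra.
Qed.

End Bessel.
End Coefficients.

Definition boxfreq n (i : 'I_n.*2.+1) : int := i%:Z - n%:Z.

Section BoxSums.
Context {R : comRingType}.

Definition zsum n (F : int -> R) : R := \sum_(i < n.*2.+1) F (i%:Z - n%:Z).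

Lemma zsumS n F : zsum n.+1 F = F n.+1%:Z + F (- n.+1%:Z) + zsum n F.
Proof.
rewrite /zsum doubleS big_ord_recl big_ord_recr/=.
have -> : 0%:Z - n.+1%:Z = - n.+1%:Z by rewrite sub0r.
have -> : (bump 0 n.*2.+1)%:Z - n.+1%:Z = n.+1%:Z by rewrite /bump/=; lia.
have -> : \sum_(i < n.*2.+1) F ((bump 0 i)%:Z - n.+1%:Z) = \sum_(i < n.*2.+1) F (i%:Z - n%:Z).
  by apply: eq_bigr => i _; congr F; rewrite /bump/=; lia.
ring.
Qed.

Lemma zsum_cross n (g : int -> R) : zsum n g =
  \sum_(i < n) g (i%:Z - n%:Z) + \sum_(i < n) g (n%:Z - i%:Z) + g 0.
Proof.
elim: n => [|n IH].
  by rewrite /zsum !big_ord0 big_ord1 subrr !add0r.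
have e1 : \sum_(i < n.+1) g (i%:Z - n.+1%:Z) = g (- n.+1%:Z) + \sum_(i < n) g (i%:Z - n%:Z).
  rewrite big_ord_recl; congr (g _ + _); first by rewrite /= sub0r.
  by apply: eq_bigr => i _; congr g; rewrite /= /bump leq0n; lia.
have e2 : \sum_(i < n.+1) g (n.+1%:Z - i%:Z) = g n.+1%:Z + \sum_(i < n) g (n%:Z - i%:Z).
  rewrite big_ord_recl; congr (g _ + _); first by rewrite /= subr0.
  by apply: eq_bigr => i _; congr g; rewrite /= /bump leq0n; lia.
rewrite zsumS IH e1 e2.
move: (\sum_(i < n) g (i%:Z - n%:Z)) (\sum_(i < n) g (n%:Z - i%:Z)) (g n.+1%:Z) (g (- n.+1%:Z)) (g 0) => a b c d e.
ring.
Qed.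

(** There are n - |k| pairs of indices with difference k: these are the triangular weights of the
    Fejer kernel. *)
Lemma sum_diff_pairs n (g : int -> R) :
  \sum_(i < n) \sum_(j < n) g (i%:Z - j%:Z) = zsum n (fun k => (n%:Z - `|k|)%:~R * g k).
Proof.
elim: n => [|n IH].
  by rewrite big_ord0 /zsum big_ord1 subrr mul0r.
have st k : (n.+1%:Z - `|k|)%:~R * g k = (n%:Z - `|k|)%:~R * g k + g k.
  have -> : n.+1%:Z - `|k| = (n%:Z - `|k|) + 1 :> int by rewrite -addn1 PoszD addrAC.
  by rewrite rmorphD/= mulrDl rmorph1 mul1r.
have -> : zsum n.+1 (fun k => (n.+1%:Z - `|k|)%:~R * g k) = zsum n (fun k => (n.+1%:Z - `|k|)%:~R * g k).
  by rewrite zsumS normrN ger0_norm// subrr !mul0r !add0r.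
rewrite /zsum.
under [RHS]eq_bigr do rewrite st.
rewrite big_split/= -/(zsum n (fun k => (n%:Z - `|k|)%:~R * g k)) -/(zsum n g) -IH zsum_cross big_ord_recr/=.
have -> : \sum_(i < n) \sum_(j < n.+1) g (i%:Z - j%:Z) =
   \sum_(i < n) \sum_(j < n) g (i%:Z - j%:Z) + \sum_(i < n) g (i%:Z - n%:Z).
  by rewrite -big_split; apply: eq_bigr => i _; rewrite big_ord_recr.
rewrite big_ord_recr/= subrr.
by rewrite !addrA.
Qed.

End BoxSums.

Local Notation kk := (int * int)%type.

Definition boxfreq2 n (i : 'I_n.*2.+1 * 'I_n.*2.+1) : kk := (boxfreq i.1, boxfreq i.2).

Lemma boxfreq_inj n : injective (@boxfreq n).
Proof. by move=> i j; rewrite /boxfreq => e; apply/val_inj => /=; lia. Qed.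

Lemma boxfreq2_inj n : injective (@boxfreq2 n).
Proof. by move=> [i j] [i' j'] [/boxfreq_inj -> /boxfreq_inj ->]. Qed.

Lemma boxfreq2_onto n (k : kk) : (`|k.1| <= n)%N -> (`|k.2| <= n)%N -> exists i, @boxfreq2 n i = k.
Proof.
move=> k1 k2.
have p1 : (`|(k.1 + n%:Z)%R| < n.*2.+1)%N by lia.
have p2 : (`|(k.2 + n%:Z)%R| < n.*2.+1)%N by lia.
exists (Ordinal p1 : 'I_n.*2.+1, Ordinal p2 : 'I_n.*2.+1); rewrite /boxfreq2 /boxfreq/=.
by case: k k1 k2 p1 p2 => /= k1 k2 h1 h2 _ _; congr pair; lia.
Qed.

Section LatticeSum.
Context {R : realType} (L : R).
Hypothesis L_gt0 : 0 < L.

(** Symbol of the identity minus the Laplacian: [wgt ^+ r] against squared coefficients corresponds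
    to the norm of H^r. *)
Definition wgt (k : kk) : R := 1 + lam L k.

Lemma wgt_ge1 k : 1 <= wgt k.
Proof. by rewrite /wgt lerDl lam_ge0. Qed.

Lemma wgt_gt0 k : 0 < wgt k.
Proof. exact: lt_le_trans (wgt_ge1 k). Qed.

Definition latC : R := (1 + (L / pi) ^+ 2) ^+ 2.

Lemma latC_ge0 : 0 <= latC. Proof. exact: sqr_ge0. Qed.

(** Comparison with a telescoping sum through 1/n^2 <= 2 (1/n - 1/(n+1)); a sharper bound carries
    the induction. *)
Lemma zsum_inv_sqr n : zsum n (fun k => (1 + wave L k ^+ 2)^-1) <= 1 + (L / pi) ^+ 2.
Proof.
have w0 k : 0 < 1 + wave L k ^+ 2 by rewrite ltr_pwDl ?sqr_ge0.
suff : zsum n (fun k => (1 + wave L k ^+ 2)^-1) <= 1 + (L / pi) ^+ 2 * (1 - n.+1%:R^-1).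
  move=> /le_trans; apply; rewrite lerD2l ler_piMr ?sqr_ge0// lerBlDr lerDl invr_ge0 ler0n//.
elim: n => [|n IH].
  by rewrite /zsum big_ord1 subrr /wave mulr0 expr0n addr0 invr1 subrr mulr0 addr0.
rewrite zsumS.
have -> : wave L (- n.+1%:Z) ^+ 2 = wave L n.+1%:Z ^+ 2 by rewrite waveN sqrrN.
have x0 : 0 < n.+1%:R :> R by rewrite ltr0n.
have x2 : 0 < n.+2%:R :> R by rewrite ltr0n.
have p0 : 0 < pi :> R by exact: pi_gt0.
have b : (1 + wave L n.+1%:Z ^+ 2)^-1 <= (L / pi) ^+ 2 / 4 / n.+1%:R ^+ 2.
  have -> : (L / pi) ^+ 2 / 4 / n.+1%:R ^+ 2 = (wave L n.+1%:Z ^+ 2)^-1 :> R.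
    have aux (q y : R) : 0 < q -> 0 < y -> (L / q) ^+ 2 / 4 / y ^+ 2 = (2 * q / L * y) ^- 2.
    by move=> q0 y0; field; rewrite !gt_eqF.
  exact: aux.
  rewrite lef_pV2 ?posrE ?w0// ?lerDr// exprn_gt0// /wave mulr_gt0// ?ltr0z// divr_gt0// mulr_gt0//.
have h : n.+1%:R ^- 2 <= 2 * (n.+1%:R^-1 - n.+2%:R^-1) :> R.
  have -> : 2 * (n.+1%:R^-1 - n.+2%:R^-1) = 2 * n.+1%:R / n.+2%:R * n.+1%:R ^- 2 :> R.
    have e : n.+2%:R = n.+1%:R + 1 :> R by rewrite [LHS]mulrS addrC.
    have aux (y : R) : 0 < y -> 2 * (y^-1 - (y + 1)^-1) = 2 * y / (y + 1) * y ^- 2.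
      by move=> y0; field; rewrite !gt_eqF// addr_gt0.
    by rewrite e; exact: aux.
  rewrite ler_peMl ?invr_ge0 ?sqr_ge0// ler_pdivlMr// mul1r -natrM ler_nat; lia.
have h2 := ler_wpM2l (sqr_ge0 (L / pi)) h.
have : 0 <= (L / pi) ^+ 2 * n.+1%:R ^- 2 by rewrite mulr_ge0 ?sqr_ge0 ?invr_ge0 ?sqr_ge0.
move: IH b h2; move: (zsum _ _) ((L / pi) ^+ 2) (n.+1%:R ^- 2) (n.+1%:R^-1) (n.+2%:R^-1) ((1 + wave L n.+1 ^+ 2)^-1) => z c y a b u.
lra.
Qed.

Lemma sum_inj_le (I J : finType) (f : I -> J) (F : J -> R) : injective f ->
  (forall j, 0 <= F j) -> \sum_i F (f i) <= \sum_j F j.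
Proof.
move=> fi F0; rewrite -(big_map f xpredT F)/= -[X in \sum_(_ <- X) _]/(map f (index_enum I)).
have u : uniq (map f (index_enum I)) by rewrite map_inj_uniq ?index_enum_uniq.
by rewrite big_uniq//= [leRHS](bigID (mem (map f (index_enum I))))/= lerDl sumr_ge0.
Qed.

Lemma finite_in_box (I : finType) (kap : I -> kk) :
  exists n, forall i, (`|(kap i).1| <= n)%N && (`|(kap i).2| <= n)%N.
Proof.
exists (\max_i maxn `|(kap i).1| `|(kap i).2|)%N => i.
by rewrite -geq_max; exact: (leq_bigmax i).
Qed.

(** (1 + x + y)^2 >= (1 + x)(1 + y) splits the planar sum into a product of sums over the line. An
    injective finite family embeds into a square box, so the bound is uniform. *)
Lemma lattice_sum (I : finType) (kap : I -> kk) : injective kap ->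
  \sum_i wgt (kap i) ^- 2 <= latC.
Proof.
move=> ki; have [n kn] := finite_in_box kap.
pose c k : R := (1 + wave L k ^+ 2)^-1.
have c0 k : 0 <= c k by rewrite invr_ge0 addr_ge0// sqr_ge0.
have wc k : wgt k ^- 2 <= c k.1 * c k.2.
  rewrite /c -invfM lef_pV2 ?posrE ?mulr_gt0 ?exprn_gt0 ?wgt_gt0// ?ltr_pwDl ?sqr_ge0//.
  rewrite /wgt /lam; have := sqr_ge0 (wave L k.1); have := sqr_ge0 (wave L k.2).
  move: (wave L k.1 ^+ 2) (wave L k.2 ^+ 2) => x y x0 y0.
  have := mulr_ge0 x0 y0; have := sqr_ge0 x; have := sqr_ge0 y; lra.
have ex i : exists j, @boxfreq2 n j = kap i.
  by have /andP[h1 h2] := kn i; exact: (@boxfreq2_onto n (kap i) h1 h2).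
pose f i : 'I_n.*2.+1 * 'I_n.*2.+1 := projT1 (cid (ex i)).
have fE i : boxfreq2 (f i) = kap i by rewrite /f; case: cid.
have fi : injective f by move=> i j e; apply: ki; rewrite -!fE e.
apply: (@le_trans _ _ (\sum_i c (@boxfreq2 n (f i)).1 * c (@boxfreq2 n (f i)).2)).
  by apply: ler_sum => i _; rewrite fE.
apply: (le_trans (@sum_inj_le _ _ f (fun j => c (@boxfreq2 n j).1 * c (@boxfreq2 n j).2) fi _)).
  by move=> j; rewrite mulr_ge0.
have -> : \sum_j c (@boxfreq2 n j).1 * c (@boxfreq2 n j).2 = zsum n c * zsum n c.
  transitivity (\sum_(i < n.*2.+1) \sum_(j < n.*2.+1) c (boxfreq i) * c (boxfreq j)); first by rewrite pair_bigA.
  by rewrite /zsum big_distrlr.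
by rewrite /latC expr2; apply: ler_pM; rewrite ?sumr_ge0//; exact: zsum_inv_sqr.
Qed.

Lemma sqr_sum_le (I : finType) (x y : I -> R) :
  (\sum_i x i * y i) ^+ 2 <= (\sum_i x i ^+ 2) * (\sum_i y i ^+ 2).
Proof.
set X := \sum_i x i ^+ 2; set Y := \sum_i y i ^+ 2; set S := \sum_i x i * y i.
have X0 : 0 <= X by apply: sumr_ge0 => i _; exact: sqr_ge0.
have [XE|Xn] := eqVneq X 0.
  have x0 i : x i = 0.
    have /eqP := psumr_eq0P (fun i _ => sqr_ge0 (x i)) XE (i := i) isT.
    by rewrite sqrf_eq0 => /eqP.
  rewrite /S big1 ?XE ?mul0r ?expr0n// => i _; by rewrite x0 mul0r.
have Xp : 0 < X by rewrite lt_def Xn.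
have : 0 <= \sum_i (X * y i - S * x i) ^+ 2 by apply: sumr_ge0 => i _; exact: sqr_ge0.
have -> : \sum_i (X * y i - S * x i) ^+ 2 = X * (X * Y - S ^+ 2).
  have e i : (X * y i - S * x i) ^+ 2 = X ^+ 2 * y i ^+ 2 + ((- 2 * X * S) * (x i * y i) + S ^+ 2 * x i ^+ 2) by ring.
  under eq_bigr do rewrite e.
  rewrite !big_split/= -!mulr_sumr -/X -/Y -/S; ring.
by rewrite pmulr_rge0// subr_ge0.
Qed.

(** Cauchy-Schwarz against [wgt^-1], whose square is summable over the planar lattice: one power of
    the weight is spent, so eight powers in the square sum leave three in the absolute sum. *)
Lemma weighted_sum_le (I : finType) (kap : I -> kk) (x : I -> R) : injective kap ->
  (\sum_i wgt (kap i) ^+ 3 * `|x i|) ^+ 2 <= latC * \sum_i wgt (kap i) ^+ 8 * x i ^+ 2.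
Proof.
move=> ki.
have -> : \sum_i wgt (kap i) ^+ 3 * `|x i| = \sum_i (wgt (kap i))^-1 * (wgt (kap i) ^+ 4 * `|x i|).
  by apply: eq_bigr => i _; field; rewrite gt_eqF ?wgt_gt0.
apply: (le_trans (sqr_sum_le _ _)); apply: ler_pM.
- by apply: sumr_ge0 => i _; exact: sqr_ge0.
- by apply: sumr_ge0 => i _; exact: sqr_ge0.
- by apply: le_trans (lattice_sum ki); apply: ler_sum => i _; rewrite exprVn.
- by apply: ler_sum => i _; rewrite exprMn real_normK ?num_real// -exprM.
Qed.

End LatticeSum.

(** * Fejer means on the torus *)

Section Fejer.
Context {R : realType} (L : R).
Hypothesis L_gt0 : 0 < L.
Local Notation MR := (measurableTypeR R).
Local Notation nu := ((@lebesgue_measure R \x @lebesgue_measure R)%E).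
Local Notation Om := (Omega L : set (MR * MR)).
Local Notation tm := (tmode L).
Local Notation oint := (oint L).
Local Notation cf := (cf L).
Let mOm := measurable_Omega L.
Variable n : nat.
Hypothesis n_gt0 : (0 < n)%N.

Definition tri (k : int) : R := (n%:Z - `|k|)%:~R / n%:R.
Definition rho (k : kk) : R := tri k.1 * tri k.2.

Let nR : 0 < n%:R :> R. Proof. by rewrite ltr0n. Qed.

Lemma tri_bound (i : 'I_n.*2.+1) : 0 <= tri (boxfreq i) <= 1.
Proof.
have h : (`|boxfreq i| <= n)%N by rewrite /boxfreq; have := ltn_ord i; lia.
apply/andP; split.
  by apply: divr_ge0; [rewrite ler0z; lia|exact: ltW].
rewrite ler_pdivrMr// mul1r -[n%:R]/(n%:Z%:~R) ler_int; lia.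
Qed.

Lemma rho_bound i : 0 <= rho (@boxfreq2 n i) <= 1.
Proof.
have /andP[a0 a1] := tri_bound i.1; have /andP[b0 b1] := tri_bound i.2.
by rewrite /rho mulr_ge0//= mulr_ile1.
Qed.

Definition fker (z : R * R) (w : R * R) : R :=
  \sum_i rho (@boxfreq2 n i) * tm (@boxfreq2 n i) 1 0 (w.1 - z.1, w.2 - z.2).

(** The triangular weights make the kernel [n%:R ^- 2] times the squared modulus of a sum of
    exponentials. *)
Lemma fker_ge0 z w : 0 <= fker z w.
Proof.
set p := (w.1 - z.1, w.2 - z.2).
have -> : fker z w = n%:R ^- 2 * \sum_(i1 < n) \sum_(j1 < n) \sum_(i2 < n) \sum_(j2 < n)
    tm (i1%:Z - j1%:Z, i2%:Z - j2%:Z) 1 0 p.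
  rewrite (sum_diff_pairs n (fun a => \sum_(i2 < n) \sum_(j2 < n) tm (a, i2%:Z - j2%:Z) 1 0 p)).
  rewrite /zsum mulr_sumr /fker -/p.
  transitivity (\sum_(i < n.*2.+1) \sum_(j < n.*2.+1) rho (boxfreq i, boxfreq j) * tm (boxfreq i, boxfreq j) 1 0 p); first by rewrite pair_bigA.
  apply: eq_bigr => i _.
  rewrite (sum_diff_pairs n (fun b => tm (boxfreq i, b) 1 0 p)) /zsum !mulr_sumr.
  apply: eq_bigr => j _; rewrite /rho /tri/=; field.
  by rewrite gt_eqF.
rewrite mulr_ge0 ?invr_ge0 ?sqr_ge0//.
pose kap (i : 'I_n * 'I_n) : kk := (i.1%:Z, i.2%:Z).
have -> : \sum_(i1 < n) \sum_(j1 < n) \sum_(i2 < n) \sum_(j2 < n)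
    tm (i1%:Z - j1%:Z, i2%:Z - j2%:Z) 1 0 p = tpoly L kap (fun=> 1) (fun=> 0) p ^+ 2 + tpoly L kap (fun=> - 0) (fun=> 1) p ^+ 2.
  rewrite tpoly_sqr.
  under eq_bigr => i1 _ do rewrite exchange_big/=.
  rewrite pair_bigA/=; apply: eq_bigr => i _.
  rewrite pair_bigA/=; apply: eq_bigr => j _.
  by rewrite /ksub/=; congr tmode; ring.
by rewrite addr_ge0 ?sqr_ge0.
Qed.

Lemma tm_shift k z w : tm k 1 0 (w.1 - z.1, w.2 - z.2) = tm k (tm k 1 0 z) (tm k 0 1 z) w.
Proof.
have e : phase L k.1 k.2 (w.1 - z.1, w.2 - z.2) = phase L k.1 k.2 w - phase L k.1 k.2 z.
  by rewrite !phaseE/=; ring.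
by rewrite /tmode e cosB; ring.
Qed.

Lemma box_pick (k : kk) (F : R) : (`|k.1| <= n)%N -> (`|k.2| <= n)%N ->
  \sum_i (if @boxfreq2 n i == k then F else 0) = F.
Proof.
move=> h1 h2; have [i0 e] := boxfreq2_onto h1 h2.
rewrite (bigD1 i0)//= e eqxx big1 ?addr0// => i ii0; case: eqP => // e'.
by move: ii0; rewrite (@boxfreq2_inj n i i0) ?eqxx// e'.
Qed.

Lemma fkerE z w : fker z w = \sum_i tm (@boxfreq2 n i) (rho (@boxfreq2 n i) * tm (@boxfreq2 n i) 1 0 z) (rho (@boxfreq2 n i) * tm (@boxfreq2 n i) 0 1 z) w.
Proof. by apply: eq_bigr => i _; rewrite tm_shift /tmode; ring. Qed.

Lemma fker_int z : oint (fker z).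
Proof.
have -> : fker z = (fun w => \sum_i tm (@boxfreq2 n i) (rho (@boxfreq2 n i) * tm (@boxfreq2 n i) 1 0 z) (rho (@boxfreq2 n i) * tm (@boxfreq2 n i) 0 1 z) w).
  by apply/funext => w; exact: fkerE.
by apply: (integrable_fsum mOm) => i; exact: integrable_tmode.
Qed.

Lemma fker_le z w : `|fker z w| <= \sum_(i : 'I_n.*2.+1 * 'I_n.*2.+1) 1.
Proof.
rewrite (le_trans (ler_norm_sum _ _ _))//; apply: ler_sum => i _.
have /andP[r0 r1] := rho_bound i.
rewrite normrM (ger0_norm r0) mulr_ile1//.
by rewrite (le_trans (tmode_le _ _ _ _ _))// normr1 normr0 addr0.
Qed.

Lemma fker_mul_int z g : oint g -> oint (fun w => g w * fker z w).
Proof.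
move=> ig; apply: (@integrable_bounded_mul _ _ _ nu Om mOm g (fker z) _ _ (fun w _ => fker_le z w)) => //.
by apply/measurable_EFinP; exact: measurable_int (fker_int z).
Qed.

Definition fejer (g : R * R -> R) (z : R * R) : R :=
  L ^- 2 * \sum_i rho (@boxfreq2 n i) * tm (@boxfreq2 n i) (cf g (@boxfreq2 n i) 1 0) (cf g (@boxfreq2 n i) 0 1) z.

Lemma int_fker g z : oint g -> \int[nu]_(w in Om) (g w * fker z w) = L ^+ 2 * fejer g z.
Proof.
move=> ig; rewrite /fejer mulrA mulfV ?mul1r ?gt_eqF ?exprn_gt0//.
transitivity (\int[nu]_(w in Om) (\sum_i g w * tm (@boxfreq2 n i) (rho (@boxfreq2 n i) * tm (@boxfreq2 n i) 1 0 z) (rho (@boxfreq2 n i) * tm (@boxfreq2 n i) 0 1 z) w)).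
  by apply: eq_Rintegral => w _; rewrite fkerE mulr_sumr.
rewrite Rintegral_sum//; last by move=> i; exact: integrable_tmodeM.
apply: eq_bigr => i _.
rewrite -/(cf g _ _ _) cf_linear// (tmode_linear L _ (cf g _ 1 0)); ring.
Qed.

(** The function tested is the cosine of the phase at [w - z], written as a mode in [w]; its Fejer
    mean at [z] is its value 1 there times [rho m]. *)
Lemma int_fker_mode m z : (`|m.1| <= n)%N -> (`|m.2| <= n)%N ->
  \int[nu]_(w in Om) (tm m (tm m 1 0 z) (tm m 0 1 z) w * fker z w) = L ^+ 2 * rho m.
Proof.
move=> m1 m2; rewrite int_fker; last exact: integrable_tmode.
congr (_ * _); rewrite /fejer.
have L2 : L ^+ 2 != 0 by rewrite gt_eqF// exprn_gt0.
have cs := cos2Dsin2 (phase L m.1 m.2 z).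
transitivity (L ^- 2 * \sum_i ((if @boxfreq2 n i == m then L ^+ 2 / 2 * rho m else 0) + (if @boxfreq2 n i == kopp m then L ^+ 2 / 2 * rho m else 0))).
  congr (_ * _); apply: eq_bigr => i _; rewrite !cf_tmode// !(eq_sym m).
  have -> : (kopp (boxfreq2 i) == m) = (boxfreq2 i == kopp m).
    by rewrite /kopp; case: (boxfreq2 i) (m) => a b [c d]/=; rewrite !xpair_eqE !eqr_oppLR.
  have [->|im] := eqVneq (boxfreq2 i) m.
    (* Here [m] is its own opposite, so both terms of [cf_tmode] are present and the sine at [z]
       vanishes. *)
    case: eqVneq => [e|_].
      rewrite {1 2}/tmode; rewrite /tmode in cs *.
      have s0 : sin (phase L m.1 m.2 z) = 0.
        have : tm (kopp m) 0 1 z = tm m 0 1 z by rewrite -e.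
        by rewrite tmode_kopp /tmode; lra.
      by rewrite s0 in cs *; rewrite -[RHS]mulr1 -[X in _ = _ * X]cs; field.
    by rewrite -[RHS]mulr1 -[X in _ = _ * X]cs /tmode; field.
  case: eqVneq => [->|_]; last by rewrite !mulr0 !addr0 /tmode; ring.
  have -> : rho (kopp m) = rho m by rewrite /rho /tri /kopp/= !normrN.
  by rewrite -[RHS]mulr1 -[X in _ = _ * X]cs tmode_kopp /tmode; field.
rewrite big_split/= (box_pick _ m1 m2) box_pick ?abszN//; field.
by rewrite gt_eqF.
Qed.

End Fejer.

(** * Pointwise convergence of Fejer means by Korovkin's argument *)

Section Korovkin.
Context {R : realType} (L : R).
Hypothesis L_gt0 : 0 < L.
Local Notation MR := (measurableTypeR R).
Local Notation nu := ((@lebesgue_measure R \x @lebesgue_measure R)%E).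
Local Notation Om := (Omega L : set (MR * MR)).
Local Notation tm := (tmode L).
Let mOm := measurable_Omega L.

Lemma cos_gap (d : R) : 0 < d -> d <= L / 2 -> exists2 c, 0 < c &
  forall x, d <= `|x| <= L - d -> c <= 1 - cos (2 * pi / L * x).
Proof.
move=> d0 dL; pose f (x : R) := 1 - cos (2 * pi / L * x).
have p0 : 0 < (pi : R) := pi_gt0 R.
have cf : {within `[d, L - d], continuous f}.
  apply: continuous_subspaceT => x; apply/differentiable_continuous/derivable1_diffP.
  by rewrite /f; apply: ex_derive.
have [|c cin cmin] := @EVT_min R f d (L - d) _ cf; first by lra.
move: cin; rewrite in_itv/= => /andP[c1 c2].
have w0 : 0 < 2 * pi / L by rewrite divr_gt0// mulr_gt0.
exists (f c).
  rewrite /f subr_gt0; apply: cos_lt1; rewrite gtr0_norm; last by rewrite mulr_gt0//; lra.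
  apply/andP; split; first by rewrite mulr_gt0//; lra.
  rewrite mulrAC ltr_pdivrMr// ltr_pM2l ?mulr_gt0//; lra.
move=> x xin; have := cmin `|x|; rewrite in_itv/= => /(_ xin) /le_trans; apply.
by rewrite /f; have [x0|x0] := ler0P x; rewrite ?mulrN ?cosN.
Qed.

Definition cont_at (g : R * R -> R) (z : R * R) := forall e : R, 0 < e ->
  exists2 d : R, 0 < d & forall w, `|w.1 - z.1| < d -> `|w.2 - z.2| < d -> `|g w - g z| <= e.

(** Near [z] continuity suffices. Elsewhere one of the two cosines stays away from 1 by [cos_gap],
    so a multiple of the nonnegative trigonometric function covers [2 * M]. *)
Lemma korovkin_bound (g : R * R -> R) z M : Om z -> (forall w, Om w -> `|g w| <= M) -> cont_at g z ->
  forall e, 0 < e -> exists2 C, 0 <= C & forall w, Om w ->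
   `|g w - g z| <= e + C * (2 - tm (1, 0) (tm (1, 0) 1 0 z) (tm (1, 0) 0 1 z) w
                              - tm (0, 1) (tm (0, 1) 1 0 z) (tm (0, 1) 0 1 z) w).
Proof.
move=> Oz gM cg e e0; have [d d0 hd] := cg e e0.
have OmP w : Om w -> (0 < w.1 < L) /\ (0 < w.2 < L) by case; rewrite /= !in_itv.
have [/andP[z1 z1'] /andP[z2 z2']] := OmP _ Oz.
(* As [dl] is at most the distance from [z] to the boundary, each coordinate of [w - z] stays below
   [L - dl]: a cosine cannot be near 1 at a point that is close to [z] only modulo the period. *)
pose dl := Num.min d (Num.min (Num.min z.1 (L - z.1)) (Num.min z.2 (L - z.2))).
have dl0 : 0 < dl by rewrite /dl !lt_min; apply/and3P; split => //; apply/andP; split; lra.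
have [dld [[dl1 dl1'] [dl2 dl2']]] : dl <= d /\ ((dl <= z.1 /\ dl <= L - z.1) /\ (dl <= z.2 /\ dl <= L - z.2)).
  by rewrite /dl !ge_min !lexx ?orbT.
have [c c0 hc] := @cos_gap dl dl0 ltac:(by lra).
have M0 : 0 <= M by exact: le_trans (normr_ge0 _) (gM _ Oz).
exists (2 * M / c); first by rewrite divr_ge0 ?mulr_ge0// ltW.
move=> w Ow; rewrite -!tm_shift.
set x := w.1 - z.1; set y := w.2 - z.2.
have -> : tm (1, 0) 1 0 (x, y) = cos (2 * pi / L * x).
  by rewrite /tmode phaseE /wave/= mulr1 mulr0 mul0r addr0; ring.
have -> : tm (0, 1) 1 0 (x, y) = cos (2 * pi / L * y).
  by rewrite /tmode phaseE /wave/= mulr1 mulr0 mul0r add0r; ring.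
have cx := cos_le1 (2 * pi / L * x); have cy := cos_le1 (2 * pi / L * y).
have gg : `|g w - g z| <= 2 * M.
  by rewrite (le_trans (ler_normB _ _))//; have := gM _ Ow; have := gM _ Oz; lra.
have far u : c <= u -> 2 * M <= 2 * M / c * u.
  by move=> cu; rewrite mulrAC ler_pdivlMr// ler_wpM2l ?mulr_ge0.
have [/andP[w1 w1'] /andP[w2 w2']] := OmP _ Ow.
have [xd|xd] := ltP `|x| dl; last first.
  have : c <= 1 - cos (2 * pi / L * x).
    apply: hc; rewrite xd/= /x ler_norml; apply/andP; split; lra.
  move=> h; have := far (2 - cos (2 * pi / L * x) - cos (2 * pi / L * y)) ltac:(by lra); lra.
have [yd|yd] := ltP `|y| dl; last first.
  have : c <= 1 - cos (2 * pi / L * y).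
    apply: hc; rewrite yd/= /y ler_norml; apply/andP; split; lra.
  move=> h; have := far (2 - cos (2 * pi / L * x) - cos (2 * pi / L * y)) ltac:(by lra); lra.
have := hd w (lt_le_trans xd dld) (lt_le_trans yd dld).
have : 0 <= 2 * M / c * (2 - cos (2 * pi / L * x) - cos (2 * pi / L * y)).
  by rewrite mulr_ge0 ?divr_ge0 ?mulr_ge0 ?(ltW c0)//; lra.
lra.
Qed.

(** The pointwise bound is integrated against the nonnegative kernel. Its mass is [L ^+ 2] and it
    damps each of the two test modes by [1 - n^-1], so only [2 / n] remains of the majorant. *)
Lemma fejer_error n (g : R * R -> R) z e C : (0 < n)%N -> oint L g ->
  (forall w, Om w ->
   `|g w - g z| <= e + C * (2 - tm (1, 0) (tm (1, 0) 1 0 z) (tm (1, 0) 0 1 z) w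
                              - tm (0, 1) (tm (0, 1) 1 0 z) (tm (0, 1) 0 1 z) w)) ->
  `|fejer L n g z - g z| <= e + C * (2 / n%:R).
Proof.
move=> n0 ig H.
have L2 : 0 < L ^+ 2 by rewrite exprn_gt0.
set c1 := tm (1, 0) _ _ in H; set c2 := tm (0, 1) _ _ in H.
pose K := fker L n z.
have nR : n%:R != 0 :> R by rewrite pnatr_eq0 -lt0n.
have tri0 : tri n 0 = 1 :> R by rewrite /tri normr0 subr0 divff.
have tri1 : tri n 1 = 1 - n%:R^-1 :> R.
  by rewrite /tri normr1 intrD mulrDl divff// mulrNz mulNr mul1r.
have iK : oint L K by exact: fker_int.
have ic (m : int * int) a b : oint L (fun w => tm m a b w * K w).
  by apply: fker_mul_int => //; exact: integrable_tmode.
have e0 : \int[nu]_(w in Om) K w = L ^+ 2.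
  have := @int_fker_mode R L L_gt0 n (0, 0) z (leq0n _) (leq0n _).
  rewrite /rho/= tri0 !mulr1 => <-; apply: eq_Rintegral => w _.
  by rewrite !tmode0 mul1r.
have e1 : \int[nu]_(w in Om) (c1 w * K w) = L ^+ 2 * (1 - n%:R^-1).
  by have := @int_fker_mode R L L_gt0 n (1, 0) z n0 (leq0n _); rewrite /rho/= tri0 tri1 mulr1.
have e2 : \int[nu]_(w in Om) (c2 w * K w) = L ^+ 2 * (1 - n%:R^-1).
  by have := @int_fker_mode R L L_gt0 n (0, 1) z (leq0n _) n0; rewrite /rho/= tri0 tri1 mul1r.
have eg := @int_fker R L L_gt0 n g z ig; rewrite -/K in eg.
have igK : oint L (fun w => g w * K w) by exact: fker_mul_int.
pose b w := (e + 2 * C) * K w + - C * (c1 w * K w + c2 w * K w).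
have ib : oint L b by apply: ointD; apply: ointZ => //; apply: ointD; exact: ic.
have eb : \int[nu]_(w in Om) b w = L ^+ 2 * (e + C * (2 / n%:R)).
  rewrite /b RintegralD//; [|by apply: ointZ|by apply: ointZ; apply: ointD; exact: ic].
  rewrite !RintegralZl//; last by apply: ointD; exact: ic.
  rewrite RintegralD//; [|exact: ic..].
  by rewrite e0 e1 e2; field.
have ed s : \int[nu]_(w in Om) (s * (g w * K w + - g z * K w)) = L ^+ 2 * (s * (fejer L n g z - g z)).
  rewrite RintegralZl//; last by apply: ointD => //; exact: ointZ.
  by rewrite RintegralD//; [rewrite RintegralZl// e0 eg; ring|exact: ointZ].
have main s : `|s| = 1 -> s * (fejer L n g z - g z) <= e + C * (2 / n%:R).
  move=> s1; rewrite -(ler_pM2l L2) -eb -ed; apply: le_Rintegral => //.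
    by apply: ointZ; apply: ointD => //; exact: ointZ.
  move=> w Ow; have K0 : 0 <= K w by exact: fker_ge0.
  have := ler_wpM2r K0 (H w Ow).
  have : s * (g w - g z) <= `|g w - g z| by rewrite -[leRHS]mul1r -s1 -normrM ler_norm.
  move=> h; have := ler_wpM2r K0 h; rewrite /b; lra.
by rewrite ler_norml -lerNl; apply/andP; split; [rewrite -mulN1r; apply: main; rewrite normrN1|rewrite -[leLHS]mul1r; apply: main; rewrite normr1].
Qed.

Theorem fejer_cvg (g : R * R -> R) z M : oint L g -> Om z -> (forall w, Om w -> `|g w| <= M) ->
  cont_at g z -> fejer L n.+1 g z @[n --> \oo] --> g z.
Proof.
move=> ig Oz gM cg; apply/cvgrPdist_le => eps eps0.
have [|C C0 hC] := korovkin_bound Oz gM cg (_ : 0 < eps / 2); first by lra.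
near=> n.
rewrite distrC (le_trans (fejer_error (ltn0Sn n) ig hC))//.
have n4 : 4 * C / eps <= n%:R by near: n; exact: nbhs_infty_ger.
have n0 : 0 < n.+1%:R :> R by rewrite ltr0n.
have : C * (2 / n.+1%:R) <= eps / 2.
  rewrite mulrA ler_pdivrMr//.
  have : 4 * C / eps <= n.+1%:R by rewrite (le_trans n4)// ler_nat.
  rewrite ler_pdivrMr//; lra.
move: (C * (2 / n.+1%:R)) => q; lra.
Unshelve. all: by end_near.
Qed.

End Korovkin.

(** * A weighted Wiener algebra *)

Section TrigPolynomials.
Context {R : realType} (L : R).
Hypothesis L_gt0 : 0 < L.
Local Notation MR := (measurableTypeR R).
Local Notation nu := ((@lebesgue_measure R \x @lebesgue_measure R)%E).
Local Notation Om := (Omega L : set (MR * MR)).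
Local Notation tm := (tmode L).
Local Notation kk := (int * int)%type.
Local Notation cf := (cf L).
Local Notation wgt := (wgt L).
Let mOm := measurable_Omega L.

(** Lists, in which frequencies may repeat, so that products are formed without collecting terms. *)
Definition tseq := seq (kk * (R * R)).
Definition teval (l : tseq) z := \sum_(x <- l) tm x.1 x.2.1 x.2.2 z.
Definition tnorm (l : tseq) := \sum_(x <- l) wgt x.1 ^+ 3 * (`|x.2.1| + `|x.2.2|).
Definition tmul1 (x y : kk * (R * R)) : tseq :=
  [:: ((x.1.1 + y.1.1, x.1.2 + y.1.2), ((x.2.1 * y.2.1 - x.2.2 * y.2.2) / 2, (x.2.1 * y.2.2 + x.2.2 * y.2.1) / 2));
      ((x.1.1 - y.1.1, x.1.2 - y.1.2), ((x.2.1 * y.2.1 + x.2.2 * y.2.2) / 2, (x.2.2 * y.2.1 - x.2.1 * y.2.2) / 2))].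
Definition tmul (l m : tseq) : tseq := flatten [seq flatten [seq tmul1 x y | y <- m] | x <- l].

Lemma teval_mul l m z : teval (tmul l m) z = teval l z * teval m z.
Proof.
rewrite /teval /tmul big_flatten/= big_map big_distrlr/=; apply: eq_bigr => x _.
rewrite big_flatten/= big_map; apply: eq_bigr => y _.
by rewrite /tmul1 !big_cons big_nil addr0/= -tmodeM.
Qed.

(** The sign [s] treats sum and difference frequencies at once; the weight is submultiplicative up
    to a factor 2, hence 2^3 = 8. *)
Lemma wgtD (k l m : kk) : (exists s : R, s ^+ 2 = 1 /\ forall w, w = wave L -> w m.1 = w k.1 + s * w l.1 /\ w m.2 = w k.2 + s * w l.2) ->
  wgt m ^+ 3 <= 8 * (wgt k ^+ 3 * wgt l ^+ 3).
Proof.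
move=> [s [s2 /(_ _ erefl)[e1 e2]]].
have h : wgt m <= 2 * (wgt k * wgt l).
  rewrite /wgt /lam e1 e2.
  have a : (wave L k.1 + s * wave L l.1) ^+ 2 <= 2 * (wave L k.1 ^+ 2 + wave L l.1 ^+ 2).
    have -> : wave L l.1 ^+ 2 = (s * wave L l.1) ^+ 2 by rewrite [RHS]exprMn s2 mul1r.
    by have := sqr_ge0 (wave L k.1 - s * wave L l.1); lra.
  have b : (wave L k.2 + s * wave L l.2) ^+ 2 <= 2 * (wave L k.2 ^+ 2 + wave L l.2 ^+ 2).
    have -> : wave L l.2 ^+ 2 = (s * wave L l.2) ^+ 2 by rewrite [RHS]exprMn s2 mul1r.
    by have := sqr_ge0 (wave L k.2 - s * wave L l.2); lra.
  have := mulr_ge0 (lam_ge0 L k) (lam_ge0 L l); rewrite /lam; lra.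
have -> : 8 * (wgt k ^+ 3 * wgt l ^+ 3) = (2 * (wgt k * wgt l)) ^+ 3 by ring.
by rewrite lerXn2r ?nnegrE ?mulr_ge0// ltW// wgt_gt0.
Qed.

(** A product of two modes is two modes with halved amplitudes, so only the loss of [wgtD]
    remains. *)
Lemma tnorm_mul l m : tnorm (tmul l m) <= 8 * (tnorm l * tnorm m).
Proof.
rewrite /tnorm /tmul big_flatten/= big_map big_distrlr/= mulr_sumr; apply: ler_sum => x _.
rewrite big_flatten/= big_map mulr_sumr; apply: ler_sum => y _.
rewrite /tmul1 !big_cons big_nil addr0/=.
case: x y => k [a b] [j [c d]]/=.
have w1 : wgt (k.1 + j.1, k.2 + j.2) ^+ 3 <= 8 * (wgt k ^+ 3 * wgt j ^+ 3).
  by apply: wgtD; exists 1; rewrite expr1n; split => // w ->; rewrite !mul1r !waveD.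
have w2 : wgt (k.1 - j.1, k.2 - j.2) ^+ 3 <= 8 * (wgt k ^+ 3 * wgt j ^+ 3).
  by apply: wgtD; exists (-1); rewrite sqrrN expr1n; split => // w ->; rewrite !mulN1r !waveD !waveN.
have nb (u v : R) : `|(u + v) / 2| <= (`|u| + `|v|) / 2.
  by rewrite normrM (gtr0_norm (_ : 0 < 2^-1))// ler_wpM2r// ler_normD.
have b1 : `|(a * c - b * d) / 2| + `|(a * d + b * c) / 2| <= (`|a| + `|b|) * (`|c| + `|d|) / 2.
  have := nb (a * c) (- (b * d)); have := nb (a * d) (b * c); rewrite normrN !normrM; lra.
have b2 : `|(a * c + b * d) / 2| + `|(b * c - a * d) / 2| <= (`|a| + `|b|) * (`|c| + `|d|) / 2.
  have := nb (a * c) (b * d); have := nb (b * c) (- (a * d)); rewrite normrN !normrM; lra.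
have w0 k' : 0 <= wgt k' ^+ 3 by rewrite exprn_ge0// ltW// wgt_gt0.
have s1 := ler_pM (w0 _) (addr_ge0 (normr_ge0 _) (normr_ge0 _)) w1 b1.
have s2 := ler_pM (w0 _) (addr_ge0 (normr_ge0 _) (normr_ge0 _)) w2 b2.
have -> : 8 * (wgt k ^+ 3 * (`|a| + `|b|) * (wgt j ^+ 3 * (`|c| + `|d|))) =
  8 * (wgt k ^+ 3 * wgt j ^+ 3) * ((`|a| + `|b|) * (`|c| + `|d|) / 2) +
  8 * (wgt k ^+ 3 * wgt j ^+ 3) * ((`|a| + `|b|) * (`|c| + `|d|) / 2) by field.
exact: lerD.
Qed.

Lemma tnorm_ge0 l : 0 <= tnorm l.
Proof.
apply: sumr_ge0 => x _; rewrite mulr_ge0 ?addr_ge0//.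
by rewrite exprn_ge0// ltW// wgt_gt0.
Qed.

Lemma teval_le l z : `|teval l z| <= tnorm l.
Proof.
rewrite (le_trans (ler_norm_sum _ _ _))//; apply: ler_sum => x _.
rewrite (le_trans (tmode_le _ _ _ _ _))// ler_peMl ?addr_ge0//.
by rewrite exprn_ege1// wgt_ge1.
Qed.

(* Estimates that are linear in [g] and bounded by [tnorm] on trigonometric
   polynomials pass to such limits, without summing the Fourier series of [g]. *)
Definition trig_limit (g : R * R -> R) (M : R) := exists l : nat -> tseq,
  (forall n, tnorm (l n) <= M) /\
  forall z, Om z -> teval (l n) z @[n --> \oo] --> g z.

Lemma trig_limitM f g M M' : trig_limit f M -> trig_limit g M' ->
  trig_limit (fun z => f z * g z) (8 * (M * M')).
Proof.
move=> [l [lM lf]] [m [mM mg]]; exists (fun n => tmul (l n) (m n)); split => [n|z Oz].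
  apply: (le_trans (tnorm_mul _ _)); rewrite ler_wpM2l//.
  by apply: ler_pM; rewrite ?tnorm_ge0.
under eq_cvg do rewrite teval_mul.
by apply: cvgM; [exact: lf|exact: mg].
Qed.

Lemma cvg_norm_le (x : nat -> R) (y M : R) : x n @[n --> \oo] --> y ->
  (forall n, `|x n| <= M) -> `|y| <= M.
Proof.
move=> xy xM; have nxy : `|x n| @[n --> \oo] --> `|y| by apply: cvg_norm.
by apply: (cvgr_to_le nxy); exact: nearW.
Qed.

Lemma cvg_sumr (I : Type) (s : seq I) (F : I -> nat -> R) (l : I -> R) :
  (forall i, F i n @[n --> \oo] --> l i) ->
  (\sum_(i <- s) F i n) @[n --> \oo] --> \sum_(i <- s) l i.
Proof.
move=> H; elim: s => [|i s IH].
  by under eq_cvg do rewrite big_nil; rewrite big_nil; exact: cvg_cst.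
by under eq_cvg do rewrite big_cons; rewrite big_cons; apply: cvgD.
Qed.

Lemma trig_limit_bound f M z : trig_limit f M -> Om z -> `|f z| <= M.
Proof.
move=> [l [lM lf]] Oz; apply: cvg_norm_le (lf z Oz) _ => n.
exact: le_trans (teval_le _ _) (lM n).
Qed.

Lemma teval_int l : oint L (teval l).
Proof. by apply: (integrable_fsum mOm) => x; exact: integrable_tmode. Qed.

Lemma trig_limit_measurable f M : trig_limit f M -> measurable_fun Om f.
Proof.
move=> [l [lM lf]]; apply: (@measurable_fun_cvg _ _ _ _ (fun n => teval (l n))) => // n.
by apply/measurable_EFinP; exact: measurable_int (teval_int (l n)).
Qed.

Lemma trig_limit_int f M : trig_limit f M -> oint L f.
Proof.
move=> tf; apply: (@integrable_bounded _ _ _ nu Om mOm f M (Omega_fin L_gt0)).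
- exact: trig_limit_measurable tf.
- by move=> z Oz; exact: trig_limit_bound tf Oz.
Qed.

Lemma cf_dominated (g_ : nat -> R * R -> R) g M k a b :
  (forall n, oint L (g_ n)) -> oint L g -> (forall n z, Om z -> `|g_ n z| <= M) ->
  (forall z, Om z -> g_ n z @[n --> \oo] --> g z) ->
  cf (g_ n) k a b @[n --> \oo] --> cf g k a b.
Proof.
move=> ign0 ig0 gM lg.
have ign : forall n, oint L (fun z => g_ n z * tm k a b z).
  by move=> n; apply: integrable_tmodeM; exact: ign0.
have ig : oint L (fun z => g z * tm k a b z) by exact: integrable_tmodeM.
have [||||| _ _ C] := @dominated_convergence _ _ _ nu Om mOm
  (fun n z => (g_ n z * tm k a b z)%:E) (fun z => (g z * tm k a b z)%:E) (fun=> (M * (`|a| + `|b|))%:E).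
- by move=> n; exact: measurable_int (ign n).
- exact: measurable_int ig.
- by apply: aeW => z Oz; apply/cvg_EFin; [exact: nearW|apply: cvgM; [exact: lg|exact: cvg_cst]].
- apply: (@integrable_bounded _ _ _ nu Om mOm (fun=> M * (`|a| + `|b|)) _ (Omega_fin L_gt0)) => //.
- apply: aeW => z n Oz; rewrite abse_EFin lee_fin normrM; apply: ler_pM => //.
    exact: gM.
  exact: tmode_le.
apply: fine_cvg; rewrite fineK//.
by apply: integrable_fin_num.
Qed.

Lemma cf_cvg (l : nat -> tseq) g M k a b : (forall n, tnorm (l n) <= M) ->
  (forall z, Om z -> teval (l n) z @[n --> \oo] --> g z) ->
  cf (teval (l n)) k a b @[n --> \oo] --> cf g k a b.
Proof.
move=> lM lg; have tg : trig_limit g M by exists l.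
apply: (@cf_dominated _ _ M) => // [n||n z _]; [exact: teval_int|exact: trig_limit_int tg|].
exact: le_trans (teval_le _ _) (lM n).
Qed.

Lemma cf_teval l k a b : cf (teval l) k a b = \sum_(x <- l) cf (tm x.1 x.2.1 x.2.2) k a b.
Proof.
rewrite /cf; transitivity (\int[nu]_(z in Om) (\sum_(x <- l) tm x.1 x.2.1 x.2.2 z * tm k a b z)).
  by apply: eq_Rintegral => z _; rewrite mulr_suml.
by rewrite Rintegral_sum// => x; apply: integrable_tmodeM => //; exact: integrable_tmode.
Qed.

(** The approximants are the Fejer means: their weights lie in [[0, 1]], so [weighted_sum_le] bounds
    [tnorm] uniformly. The factor 2 counts cosines and sines. *)
Lemma trig_limit_fejer g M B : oint L g -> (forall w, Om w -> `|g w| <= M) ->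
  (forall z, Om z -> cont_at g z) ->
  (forall (I : finType) (kap : I -> kk), injective kap ->
     \sum_i wgt (kap i) ^+ 8 * (cf g (kap i) 1 0 ^+ 2 + cf g (kap i) 0 1 ^+ 2) <= B) ->
  trig_limit g (2 * L ^- 2 * Num.sqrt (latC L * B)).
Proof.
move=> ig gM cg gB.
pose c n i := L ^- 2 * rho n.+1 (@boxfreq2 n.+1 i).
exists (fun n => [seq (@boxfreq2 n.+1 i, (c n i * cf g (@boxfreq2 n.+1 i) 1 0, c n i * cf g (@boxfreq2 n.+1 i) 0 1)) | i <- index_enum _]); split=> [n|z Oz]; last first.
  have -> : (fun n => teval [seq (@boxfreq2 n.+1 i, (c n i * cf g (@boxfreq2 n.+1 i) 1 0, c n i * cf g (@boxfreq2 n.+1 i) 0 1)) | i <- index_enum _] z) = (fun n => fejer L n.+1 g z).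
    apply/funext => n; rewrite /teval big_map/= /fejer mulr_sumr; apply: eq_bigr => i _.
    by rewrite /c /tmode; ring.
  by apply: (fejer_cvg L_gt0 ig Oz gM); exact: cg.
rewrite /tnorm big_map/=.
have L2 : 0 <= L ^- 2 by rewrite invr_ge0 sqr_ge0.
have B0 : 0 <= B by apply: le_trans (gB _ _ (@boxfreq2_inj 0)); apply: sumr_ge0 => i _; rewrite mulr_ge0 ?addr_ge0 ?sqr_ge0// exprn_ge0// ltW// wgt_gt0.
have key a b : (forall k, cf g k a b ^+ 2 <= cf g k 1 0 ^+ 2 + cf g k 0 1 ^+ 2) ->
  \sum_i wgt (@boxfreq2 n.+1 i) ^+ 3 * `|cf g (@boxfreq2 n.+1 i) a b| <= Num.sqrt (latC L * B).
  move=> hab; rewrite -[leLHS]ger0_norm; last by apply: sumr_ge0 => i _; rewrite mulr_ge0// exprn_ge0// ltW// wgt_gt0.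
  rewrite -sqrtr_sqr ler_wsqrtr//; apply: (le_trans (weighted_sum_le L_gt0 _ (@boxfreq2_inj n.+1))).
  rewrite ler_wpM2l ?latC_ge0//; apply: le_trans (gB _ _ (@boxfreq2_inj n.+1)).
  by apply: ler_sum => i _; rewrite ler_wpM2l// exprn_ge0// ltW// wgt_gt0.
have k1 := key 1 0 ltac:(by move=> k; rewrite lerDl sqr_ge0).
have k2 := key 0 1 ltac:(by move=> k; rewrite lerDr sqr_ge0).
apply: (@le_trans _ _ (\sum_i L ^- 2 * (wgt (@boxfreq2 n.+1 i) ^+ 3 * `|cf g (@boxfreq2 n.+1 i) 1 0| + wgt (@boxfreq2 n.+1 i) ^+ 3 * `|cf g (@boxfreq2 n.+1 i) 0 1|))).
  apply: ler_sum => i _; have /andP[r0 r1] := rho_bound L_gt0 (ltn0Sn n) i.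
  have c0 : 0 <= c n i by rewrite mulr_ge0.
  have nm x : `|c n i * x| = c n i * `|x| by rewrite normrM [X in X * _]ger0_norm.
  rewrite !nm -!mulrDr mulrCA; apply: ler_wpM2r.
    by rewrite mulr_ge0 ?addr_ge0// exprn_ge0// ltW// wgt_gt0.
  by rewrite /c ler_piMr.
rewrite -mulr_sumr big_split/=.
have := ler_wpM2l L2 (lerD k1 k2); lra.
Qed.

End TrigPolynomials.

(** * Projection errors on the grid *)

Section GridProjection.
Context {R : realType} (L : R) (N : nat).
Hypotheses (L_gt0 : 0 < L) (N_gt0 : (0 < N)%N) (N_even : ~~ odd N).
Local Notation tm := (tmode L).
Local Notation kk := (int * int)%type.
Local Notation cf := (cf L).
Local Notation wgt := (wgt L).
Let T : finType := ('I_N * 'I_N)%type.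
Let h := L / N%:R.
Let NR : 0 < N%:R :> R. Proof. by rewrite ltr0n. Qed.
Let h_gt0 : 0 < h. Proof. exact: divr_gt0. Qed.

Definition kapN (i : T) : kk := (freq N i.1, freq N i.2).

Lemma kapN_inj : injective kapN.
Proof.
by move=> [i j] [i' j'] [e1 e2]; congr pair; apply/val_inj => /=; move: e1 e2; rewrite /freq/=; lia.
Qed.

Lemma kapN_sep i j : i != j ->
  (0 < `|(ksub (kapN i) (kapN j)).1| < N)%N || (0 < `|(ksub (kapN i) (kapN j)).2| < N)%N.
Proof.
case: i j => [i j] [i' j']; rewrite xpair_eqE negb_and /ksub /kapN /freq/= -!val_eqE/=.
have := ltn_ord i; have := ltn_ord j; have := ltn_ord i'; have := ltn_ord j'.
move: (nat_of_ord i) (nat_of_ord j) (nat_of_ord i') (nat_of_ord j') => a b c d; lia.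
Qed.

(** Real part of the projection after a Fourier multiplier: [w = 1] gives the projection itself and
    [w = lam] minus its Laplacian. *)
Definition projW (w : kk -> R) (u : R * R -> R) (z : R * R) : R :=
  L ^- 2 * \sum_i w (kapN i) * tm (kapN i) (cf u (kapN i) 1 0) (cf u (kapN i) 0 1) z.
Definition projIm (u : R * R -> R) (z : R * R) : R :=
  L ^- 2 * \sum_i tm (kapN i) (- cf u (kapN i) 0 1) (cf u (kapN i) 1 0) z.

Definition inN (m : kk) : R := \sum_i (if kapN i == m then 1 else 0).

Lemma inN_pick (m : kk) (F : R) : \sum_i (if kapN i == m then F else 0) = inN m * F.
Proof. by rewrite /inN mulr_suml; apply: eq_bigr => i _; case: ifP => _; rewrite ?mul1r ?mul0r. Qed.

Lemma wave_large (k : int) : (N <= 2 * `|k|)%N -> 1 <= h ^+ 2 * wave L k ^+ 2.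
Proof.
move=> kN; have -> : h ^+ 2 * wave L k ^+ 2 = (pi * (2 * `|k%:~R| / N%:R)) ^+ 2.
  rewrite -[in RHS]sqr_normr -[k%:~R ^+ 2]real_normK ?num_real// || idtac.
  rewrite !exprMn real_normK ?num_real// /h /wave.
  move: (pi : R) (k%:~R : R) => p x; by field; rewrite !gt_eqF.
have p1 : 1 <= (pi : R) by have := pi_ge2 R; lra.
have k1 : 1 <= 2 * `|k%:~R| / N%:R :> R.
  rewrite ler_pdivlMr// mul1r -intr_norm -[N%:R]/((Posz N)%:~R) -[2]/(2%:~R) -intrM ler_int.
  by move: kN; lia.
by rewrite exprn_ege1// mulr_ege1.
Qed.

(** All powers of [h] in the projection errors come from here: as [N] is even, the range misses only
    frequencies with a component of size at least N / 2, for which [h] times the wave number is at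
    least pi. *)
Lemma inN_cases (m : kk) : inN m = 1 \/ (inN m = 0 /\ 1 <= h ^+ 2 * wgt m).
Proof.
have [/existsP[i /eqP e]|] := boolP [exists i, kapN i == m].
  left; rewrite /inN (bigD1 i)//= e eqxx big1 ?addr0// => j ji; case: eqP => // e'.
  by move: ji; rewrite (@kapN_inj j i) ?eqxx// e'.
rewrite negb_exists => /forallP H; right; split.
  by rewrite /inN big1// => i _; rewrite (negbTE (H i)).
have E2 : (N./2.*2 = N)%N by have := odd_double_half N; rewrite (negbTE N_even).
have bad : ((N <= 2 * `|m.1|) || (N <= 2 * `|m.2|))%N.
  apply: contraT; rewrite negb_or -!ltnNge => /andP[m1 m2].
  have p1 : (`|(m.1 + (N./2)%:Z - 1)%R| < N)%N by lia.
  have p2 : (`|(m.2 + (N./2)%:Z - 1)%R| < N)%N by lia.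
  have := H (Ordinal p1, Ordinal p2); rewrite /kapN /freq/= => /eqP; case.
  by case: m m1 m2 p1 p2 {H} => a b /= m1 m2 _ _; congr pair; lia.
rewrite /wgt /lam; have w1 := sqr_ge0 (wave L m.1); have w2 := sqr_ge0 (wave L m.2).
have h2 := sqr_ge0 h.
have a1 := mulr_ge0 h2 w1; have a2 := mulr_ge0 h2 w2.
by case/orP: bad => /wave_large; lra.
Qed.

Lemma inN_bound m : 0 <= inN m <= 1.
Proof. by case: (inN_cases m) => [->|[-> _]]; rewrite lexx ler01. Qed.

(** A real mode is carried by the exponentials at [m] and at [kopp m], each kept or dropped by the
    range. With a component N / 2 it may happen that only one is kept, hence the average. *)
Lemma projW_mode w m (c d : R) z : (forall k, w (kopp k) = w k) ->
  projW w (tm m c d) z = 2^-1 * (inN m + inN (kopp m)) * (w m * tm m c d z).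
Proof.
move=> wE; have L2 : L ^+ 2 != 0 by rewrite gt_eqF// exprn_gt0.
transitivity (L ^- 2 * \sum_i ((if kapN i == m then L ^+ 2 / 2 * (w m * tm m c d z) else 0) + (if kapN i == kopp m then L ^+ 2 / 2 * (w m * tm m c d z) else 0))).
  congr (_ * _); apply: eq_bigr => i _; rewrite !cf_tmode// !(eq_sym m).
  have -> : (kopp (kapN i) == m) = (kapN i == kopp m).
    by rewrite /kopp; case: (kapN i) (m) => a b [a' b']/=; rewrite !xpair_eqE !eqr_oppLR.
  have -> : tm (kapN i) (L ^+ 2 / 2 * (if kapN i == m then 1 * c + 0 * d else 0) +
     L ^+ 2 / 2 * (if kapN i == kopp m then 1 * c - 0 * d else 0))
    (L ^+ 2 / 2 * (if kapN i == m then 0 * c + 1 * d else 0) +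
     L ^+ 2 / 2 * (if kapN i == kopp m then 0 * c - 1 * d else 0)) z =
     L ^+ 2 / 2 * (if kapN i == m then tm (kapN i) c d z else 0) + L ^+ 2 / 2 * (if kapN i == kopp m then tm (kapN i) c (- d) z else 0).
    by do 2 case: ifP => _; rewrite /tmode; ring.
  rewrite mulrDr; congr (_ + _); case: eqP => [->|_]; rewrite ?mulr0//; first by ring.
  by rewrite tmode_kopp opprK wE; ring.
by rewrite big_split/= !inN_pick; field; rewrite gt_eqF.
Qed.

(** The imaginary parts of the two exponentials cancel unless exactly one of them is in the range,
    which happens only at high frequencies. *)
Lemma projIm_mode m (c d : R) z :
  projIm (tm m c d) z = 2^-1 * (inN m - inN (kopp m)) * tm m (- d) c z.
Proof.
have L2 : L ^+ 2 != 0 by rewrite gt_eqF// exprn_gt0.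
transitivity (L ^- 2 * \sum_i ((if kapN i == m then L ^+ 2 / 2 * tm m (- d) c z else 0) + (if kapN i == kopp m then L ^+ 2 / 2 * - tm m (- d) c z else 0))).
  congr (_ * _); apply: eq_bigr => i _; rewrite !cf_tmode// !(eq_sym m).
  have -> : (kopp (kapN i) == m) = (kapN i == kopp m).
    by rewrite /kopp; case: (kapN i) (m) => a b [a' b']/=; rewrite !xpair_eqE !eqr_oppLR.
  have -> : tm (kapN i) (- (L ^+ 2 / 2 * (if kapN i == m then 0 * c + 1 * d else 0) +
     L ^+ 2 / 2 * (if kapN i == kopp m then 0 * c - 1 * d else 0)))
    (L ^+ 2 / 2 * (if kapN i == m then 1 * c + 0 * d else 0) +
     L ^+ 2 / 2 * (if kapN i == kopp m then 1 * c - 0 * d else 0)) z =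
     L ^+ 2 / 2 * (if kapN i == m then tm (kapN i) (- d) c z else 0) + L ^+ 2 / 2 * (if kapN i == kopp m then tm (kapN i) d c z else 0).
    by do 2 case: ifP => _; rewrite /tmode; ring.
  congr (_ + _); case: eqP => [->|_]; rewrite ?mulr0//.
  by rewrite tmode_kopp /tmode; ring.
by rewrite big_split/= !inN_pick; field; rewrite gt_eqF.
Qed.

Lemma projW_teval w l z : projW w (teval L l) z = \sum_(x <- l) projW w (tm x.1 x.2.1 x.2.2) z.
Proof.
rewrite /projW -mulr_sumr exchange_big/=; congr (_ * _); apply: eq_bigr => i _.
rewrite !cf_teval// -mulr_sumr; congr (_ * _).
by rewrite /tmode !mulr_suml -big_split.
Qed.

Lemma projIm_teval l z : projIm (teval L l) z = \sum_(x <- l) projIm (tm x.1 x.2.1 x.2.2) z.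
Proof.
rewrite /projIm -mulr_sumr exchange_big/=; congr (_ * _); apply: eq_bigr => i _.
rewrite !cf_teval//.
by rewrite /tmode -sumrN !mulr_suml -big_split.
Qed.

Definition itlap j (f : T -> R) : T -> R := iter j (tlap h) f.

Lemma tlap_sum (I : Type) (s : seq I) (F : I -> T -> R) p :
  tlap h (fun p => \sum_(x <- s) F x p) p = \sum_(x <- s) tlap h (F x) p.
Proof.
rewrite /tlap /sdiff; elim: s => [|x s IH]; first by rewrite !big_nil; ring.
by rewrite !big_cons -IH; ring.
Qed.

Lemma itlap_sum j (I : Type) (s : seq I) (F : I -> T -> R) p :
  itlap j (fun p => \sum_(x <- s) F x p) p = \sum_(x <- s) itlap j (F x) p.
Proof.
rewrite /itlap; elim: j p => // j IH p; rewrite iterS -tlap_sum.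
by congr (tlap h _ p); apply/funext => q; rewrite IH.
Qed.

Lemma tlapZ c (f : T -> R) p : tlap h (fun p => c * f p) p = c * tlap h f p.
Proof. by rewrite /tlap /sdiff; ring. Qed.

Lemma itlap_mode j c m a b (p : T) :
  itlap j (fun p => c * tm m a b (gpt L p)) p = c * (dsym N L m ^+ j * tm m a b (gpt L p)).
Proof.
rewrite /itlap; elim: j p => [|j IH] p; first by rewrite expr0 mul1r.
rewrite iterS (_ : iter j _ _ = (fun p => (c * dsym N L m ^+ j) * tm m a b (gpt L p))).
  by rewrite tlapZ tlap_tmode// exprS; ring.
by apply/funext => q; rewrite IH mulrA.
Qed.

Lemma tlap_cvg (F : nat -> T -> R) (f : T -> R) :
  (forall p, F n p @[n --> \oo] --> f p) -> forall p, tlap h (F n) p @[n --> \oo] --> tlap h f p.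
Proof.
move=> H p; rewrite /tlap /sdiff.
by apply: cvgD; apply: cvgMl; apply: cvgB => //; apply: cvgB => //; apply: cvgMr.
Qed.

Lemma itlap_cvg j (F : nat -> T -> R) (f : T -> R) :
  (forall p, F n p @[n --> \oo] --> f p) -> forall p, itlap j (F n) p @[n --> \oo] --> itlap j f p.
Proof. by move=> H; elim: j => // j IH p; exact: tlap_cvg. Qed.

Lemma gpt_Omega (p : T) : Omega L (gpt L p).
Proof.
have c (i : 'I_N) : 0 < (i.+1%:~R - 2^-1) * h < L.
  have i1 : i.+1%:R <= N%:R :> R by rewrite ler_nat ltn_ord.
  have i0 : 1 <= i.+1%:R :> R by rewrite ler1n.
  rewrite -[(Posz i.+1)%:~R]/(i.+1%:R : R); apply/andP; split; first by rewrite mulr_gt0//; lra.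
  by rewrite /h mulrCA gtr_pMr// ltr_pdivrMr// mul1r; lra.
by split; rewrite /= in_itv/=; exact: c.
Qed.

(** Each of the [3 - j] missing powers of the weight is inserted through [1 <= h ^+ 2 * wgt m],
    which gains two powers of [h]. *)
Lemma dsym_pow_le j m : (j <= 3)%N -> 1 <= h ^+ 2 * wgt m ->
  0 <= dsym N L m ^+ j <= h ^+ (2 * (3 - j)) * wgt m ^+ 3.
Proof.
move=> j3 hw; have d0 := dsym_ge0 N_gt0 L_gt0 m.
rewrite exprn_ge0//=.
have w0 := wgt_gt0 L m.
have dw : dsym N L m <= wgt m by rewrite /wgt (le_trans (dsym_le N_gt0 L_gt0 _))// lerDr.
apply: (@le_trans _ _ (wgt m ^+ j)); first by rewrite lerXn2r ?nnegrE// ltW.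
rewrite exprM -{2}(subnK j3) exprD mulrA -exprMn ler_peMl ?exprn_ge0 ?(ltW w0)//.
exact: exprn_ege1.
Qed.

Lemma mode_tail j m th (p : T) a b : (j <= 3)%N -> `|th| <= 1 -> (th = 0 \/ 1 <= h ^+ 2 * wgt m) ->
  `|th * (dsym N L m ^+ j * tm m a b (gpt L p))| <= h ^+ (2 * (3 - j)) * (wgt m ^+ 3 * (`|a| + `|b|)).
Proof.
move=> j3 th1 [->|hw].
  by rewrite mul0r normr0 mulr_ge0 ?exprn_ge0 ?(ltW h_gt0)// mulr_ge0 ?addr_ge0// exprn_ge0// ltW// wgt_gt0.
have /andP[d0 d1] := dsym_pow_le j3 hw.
rewrite !normrM (ger0_norm d0) -[leRHS]mul1r; apply: ler_pM => //.
  by rewrite mulr_ge0.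
by rewrite mulrA; apply: ler_pM => //; exact: tmode_le.
Qed.

Section Limits.
Variables (g : R * R -> R) (M : R).
Hypothesis gM : trig_limit L g M.

(** Polynomials are estimated mode by mode. The bound passes to [g] because the approximants
    converge at every grid point and in every coefficient, which is all that the quantities [E] used
    below depend on. *)
Let limit_bound (E : (R * R -> R) -> T -> R) (c : R) : 0 <= c ->
  (forall l p, `|E (teval L l) p| <= c * tnorm L l) ->
  (forall l, (forall z, Omega L z -> teval L (l n) z @[n --> \oo] --> g z) ->
     (forall k a b, cf (teval L (l n)) k a b @[n --> \oo] --> cf g k a b) ->
     forall p, E (teval L (l n)) p @[n --> \oo] --> E g p) ->
  forall p, `|E g p| <= c * M.
Proof.
move=> c0 Hl Hc p; have [l [lM lg]] := gM.
apply: (cvg_norm_le (Hc l lg _ p)) => [k a b|n]; first exact: cf_cvg lM lg.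
by apply: (le_trans (Hl _ _)); rewrite ler_wpM2l.
Qed.

Let projW_cvg w l z : (forall k a b, cf (teval L (l n)) k a b @[n --> \oo] --> cf g k a b) ->
  projW w (teval L (l n)) z @[n --> \oo] --> projW w g z.
Proof.
move=> H; apply: cvgMr; apply: cvg_sumr => i; apply: cvgMr; rewrite /tmode.
by apply: cvgD; apply: cvgMl.
Qed.

Let projIm_cvg l z : (forall k a b, cf (teval L (l n)) k a b @[n --> \oo] --> cf g k a b) ->
  projIm (teval L (l n)) z @[n --> \oo] --> projIm g z.
Proof.
move=> H; apply: cvgMr; apply: cvg_sumr => i; rewrite /tmode.
by apply: cvgD; apply: cvgMl => //; apply: cvgN.
Qed.

(** Modes kept in full cancel. The grid values of any other mode are bounded by its amplitudes,
    whatever it is aliased to, and its weight supplies the powers of [h]. *)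
Lemma proj_tail j (p : T) : (j <= 3)%N ->
  `|itlap j (fun p : T => g (gpt L p) - projW (fun=> 1) g (gpt L p)) p| <= h ^+ (2 * (3 - j)) * M.
Proof.
move=> j3; pose E (u : R * R -> R) := itlap j (fun p : T => u (gpt L p) - projW (fun=> 1) u (gpt L p)).
apply: (@limit_bound E) => [|l q|l lg lc q].
- by rewrite exprn_ge0// ltW.
- rewrite /E.
  have -> : (fun p : T => teval L l (gpt L p) - projW (fun=> 1) (teval L l) (gpt L p)) =
    (fun p : T => \sum_(x <- l) (1 - 2^-1 * (inN x.1 + inN (kopp x.1))) * tm x.1 x.2.1 x.2.2 (gpt L p)).
    apply/funext => r; rewrite projW_teval /teval -sumrB; apply: eq_bigr => x _.
    by rewrite projW_mode//; ring.
  rewrite itlap_sum mulr_sumr (le_trans (ler_norm_sum _ _ _))//; apply: ler_sum => x _.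
  rewrite itlap_mode; apply: mode_tail => //.
    have /andP[a1 a2] := inN_bound x.1; have /andP[b1 b2] := inN_bound (kopp x.1).
    by rewrite ler_norml; apply/andP; split; lra.
  case: (inN_cases x.1) => [->|[_]]; last by right.
  case: (inN_cases (kopp x.1)) => [->|[_]]; first by left; field.
  by rewrite /wgt lam_kopp; right.
- apply: itlap_cvg => r; apply: cvgB; first by apply: lg; exact: gpt_Omega.
  exact: projW_cvg.
Qed.

Lemma projIm_tail j (p : T) : (j <= 3)%N ->
  `|itlap j (fun p : T => projIm g (gpt L p)) p| <= h ^+ (2 * (3 - j)) * M.
Proof.
move=> j3; pose E (u : R * R -> R) := itlap j (fun p : T => projIm u (gpt L p)).
apply: (@limit_bound E) => [|l q|l lg lc q].
- by rewrite exprn_ge0// ltW.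
- rewrite /E.
  have -> : (fun p : T => projIm (teval L l) (gpt L p)) =
    (fun p : T => \sum_(x <- l) (2^-1 * (inN x.1 - inN (kopp x.1))) * tm x.1 (- x.2.2) x.2.1 (gpt L p)).
    by apply/funext => r; rewrite projIm_teval; apply: eq_bigr => x _; rewrite projIm_mode.
  rewrite itlap_sum mulr_sumr (le_trans (ler_norm_sum _ _ _))//; apply: ler_sum => x _.
  rewrite itlap_mode [`|x.2.1| + _]addrC -(normrN x.2.2); apply: mode_tail => //.
    have /andP[a1 a2] := inN_bound x.1; have /andP[b1 b2] := inN_bound (kopp x.1).
    by rewrite ler_norml; apply/andP; split; lra.
  case: (inN_cases x.1) => [->|[_]]; last by right.
  case: (inN_cases (kopp x.1)) => [->|[_]]; first by left; ring.
  by rewrite /wgt lam_kopp; right.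
- by apply: itlap_cvg => r; exact: projIm_cvg.
Qed.

(** In the range this is the consistency of the five-point symbol; outside, both symbols are
    dominated by the weight. [wgt ^+ 3] covers [lam ^+ 2] in the first case and [wgt * lam] in the
    second. *)
Lemma tlap_consistent (p : T) :
  `|tlap h (fun p : T => g (gpt L p)) p - projW (lam L) g (gpt L p)| <= h ^+ 2 * M.
Proof.
pose E (u : R * R -> R) p := tlap h (fun p : T => u (gpt L p)) p - projW (lam L) u (gpt L p).
apply: (@limit_bound E) => [|l q|l lg lc q].
- exact: sqr_ge0.
- rewrite /E projW_teval /teval tlap_sum -sumrB mulr_sumr (le_trans (ler_norm_sum _ _ _))//.
  apply: ler_sum => x _.
  rewrite tlap_tmode// projW_mode; last exact: lam_kopp.
  set m := x.1; set th := 2^-1 * _.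
  have -> : dsym N L m * tm m x.2.1 x.2.2 (gpt L q) - th * (lam L m * tm m x.2.1 x.2.2 (gpt L q)) =
    (dsym N L m - th * lam L m) * tm m x.2.1 x.2.2 (gpt L q) by ring.
  rewrite normrM mulrA; apply: ler_pM => //; last exact: tmode_le.
  have d0 := dsym_ge0 N_gt0 L_gt0 m; have dl := dsym_le N_gt0 L_gt0 m.
  have dc := dsym_consistent N_gt0 L_gt0 m; rewrite -/h in dc.
  have l0 := lam_ge0 L m.
  have w3 : lam L m ^+ 2 <= wgt m ^+ 3 /\ wgt m * lam L m <= wgt m ^+ 3.
    by rewrite /wgt; have := sqr_ge0 (lam L m); have := exprn_ge0 3 l0; split; lra.
  have h2 := sqr_ge0 h.
  have t01 : 0 <= th <= 1.
    have /andP[a1 a2] := inN_bound m; have /andP[b1 b2] := inN_bound (kopp m).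
    by rewrite /th; apply/andP; split; lra.
  have tl : 0 <= th * lam L m <= lam L m.
    by case/andP: t01 => t0 t1; rewrite mulr_ge0//= ler_piMl.
  have big : 1 <= h ^+ 2 * wgt m -> `|dsym N L m - th * lam L m| <= h ^+ 2 * wgt m ^+ 3.
    move=> hw; apply: (@le_trans _ _ (lam L m)).
      by case/andP: tl => ? ?; rewrite ler_norml; apply/andP; split; lra.
    apply: (@le_trans _ _ (h ^+ 2 * (wgt m * lam L m))).
      by rewrite mulrA ler_peMl.
    by apply: ler_wpM2l => //; case: w3.
  case: (inN_cases m) => [e1|[_]]; last exact: big.
  case: (inN_cases (kopp m)) => [e2|[_]]; last by rewrite /wgt lam_kopp; exact: big.
  have -> : th = 1 by rewrite /th e1 e2; field.
  rewrite mul1r distrC ger0_norm ?subr_ge0//; apply: (le_trans dc).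
  by apply: ler_wpM2l => //; case: w3.
- apply: cvgB; last exact: projW_cvg.
  by apply: tlap_cvg => r; apply: lg; exact: gpt_Omega.
Qed.

End Limits.
End GridProjection.

(** * Fourier coefficients of the solution *)

Section PlaneMeasure.
Context {R : realType}.
Local Notation MR := (measurableTypeR R).
Local Notation leb := (@lebesgue_measure R).

Local Notation plane := ((leb \x leb)%E).

Let plane_sigma_finite : sigma_finite setT plane.
Proof.
pose I n := (`]- n%:R, n%:R[%classic : set MR).
have mI n : measurable (I n) by exact: measurable_itv.
have fI n : (leb (I n) < +oo)%E.
  by rewrite lebesgue_measure_itv/=; case: ifPn => _; exact: ltry.
exists (fun n => I n `*` I n).
  rewrite predeqE => -[x y]; split=> // _.
  have in_I (u : R) n : (Num.truncn `|u| < n)%N -> I n u.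
    move=> un; have : `|u| < n%:R.
      by apply: (lt_le_trans (truncnS_gt _)); rewrite ler_nat.
    by rewrite ltr_norml /I /= in_itv.
  exists (maxn (Num.truncn `|x|) (Num.truncn `|y|)).+1 => //; split; apply: in_I; rewrite ltnS.
    exact: leq_maxl.
  exact: leq_maxr.
move=> n; split; first exact: measurableX.
have -> : plane (I n `*` I n) = (leb (I n) * leb (I n))%E by exact: product_measure1E.
by rewrite lte_mul_pinfty// ge0_fin_numE.
Qed.

(* The canonical sigma-finite structure of a product measure is only inferred
   for probabilities, so it is rebuilt here for the plane. *)
Let plane_mixin := Measure_isSigmaFinite.Build _ _ _ plane plane_sigma_finite.
Definition planeL : {sigma_finite_measure set (MR * MR)%type -> \bar R} :=
  HB.pack_for (SigmaFiniteMeasure.type (MR * MR)%type R) plane plane_mixin.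

End PlaneMeasure.

(** * Fourier coefficients of functions of space and time *)

Section SpaceTime.
Context {R : realType} (T L : R).
Hypotheses (T_gt0 : 0 < T) (L_gt0 : 0 < L).
Local Notation MR := (measurableTypeR R).
Local Notation leb := (@lebesgue_measure R).
Local Notation nu := (@planeL R).
Local Notation Om := (Omega L : set (MR * MR)).
Local Notation It := (`]0%R, T[%classic : set MR).
Local Notation tm := (tmode L).
Local Notation kk := (int * int)%type.
Local Notation cf := (cf L).
Local Notation test := (time_test T).
Let mOm : measurable Om := measurable_Omega L.
Let mIt : measurable It. Proof. exact: measurable_itv. Qed.

Lemma L2norm_sqr (u : R * R -> R) : (L2norm L u `^ 2 = \int[nu]_(z in Om) ((u z) ^+ 2)%:E)%E.
Proof.
have p2 (x : R) : 0 <= x -> x `^ 2 = x ^+ 2 by move=> x0; rewrite -powR_mulrn.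
rewrite /L2norm poweR_Lnorm// [RHS]integral_mkcond; apply: eq_integral => z _.
rewrite /= /patch; case: ifP => _.
  by rewrite p2// real_normK// num_real.
by rewrite normr0 p2// expr0n.
Qed.

Lemma in_L2P (u : R * R -> R) : in_L2 L u ->
  [/\ measurable_fun Om u, oint L u & oint L (fun z => u z ^+ 2)].
Proof.
move=> [mu' fin].
have iu2 : oint L (fun z => u z ^+ 2).
  apply/integrableP; split; first by apply/measurable_EFinP; exact: measurable_funX.
  have := poweR_lty 2 fin; rewrite L2norm_sqr; congr (_ < _)%E.
  by apply: eq_integral => z _; rewrite /= ger0_norm// sqr_ge0.
split=> //.
have i1 : oint L (fun=> 1 ^+ 2).
  by apply: (@integrable_bounded _ _ _ nu Om mOm _ 1 (Omega_fin L_gt0)) => // z _; rewrite expr1n normr1.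
have := integrable_mul_sqr mOm mu' (@measurable_cst _ _ _ _ Om (1 : R)) iu2 i1.
by congr (_.-integrable _ _); apply/funext => z /=; rewrite mulr1.
Qed.

Lemma L2norm_le (u : R * R -> R) (M : R) : (L2norm L u <= M%:E)%E ->
  \int[nu]_(z in Om) (u z ^+ 2) <= M ^+ 2.
Proof.
move=> uM; have := L2norm_sqr u; have : (0 <= L2norm L u)%E by exact: Lnorm_ge0.
rewrite /Rintegral; move: uM; case: (L2norm L u) => [r|//|//]; rewrite !lee_fin => rM r0 <-.
by rewrite poweR_EFin/= -[2]/(2%:R) powR_mulrn// lerXn2r// nnegrE// (le_trans r0).
Qed.

Let D := It `*` Om.
Let mD : measurable D. Proof. exact: measurableX. Qed.

(** By Tonelli, the squared spatial norms integrated in time give the integral of the square over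
    the cylinder. *)
Lemma LpL2_joint_sqr U : in_LpL2 T L 2%:E U ->
  (leb \x nu)%E.-integrable D (EFin \o (fun q => U q.1 q.2 ^+ 2)).
Proof.
move=> [mU fin].
have mU2 : measurable_fun D (EFin \o (fun q : R * (R * R) => U q.1 q.2 ^+ 2)).
  by apply/measurable_EFinP; exact: measurable_funX.
apply/(integrable_mkcond _ mD); apply/integrable12ltyP.
  exact/(measurable_restrictT _ mD).
have := poweR_lty 2 fin; rewrite poweR_Lnorm//; congr (_ < _)%E.
apply: eq_integral => t _; rewrite /patch/=.
case: ifPn => [/set_mem tT|tT].
  rewrite gee0_abs ?Lnorm_ge0// L2norm_sqr [LHS]integral_mkcond; apply: eq_integral => z _.
  rewrite /patch; have -> : ((t, z) \in D) = (z \in Om).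
    by apply/idP/idP => /set_mem; [case=> _ ?; exact: mem_set|move=> ?; apply/mem_set; split].
  by case: ifP => _; rewrite /= ?normr0// ger0_norm// sqr_ge0.
rewrite abse0 poweR0r// integral0_eq// => z _.
rewrite (_ : ((t, z) \in D) = false) ?abse0//.
by apply/negbTE; apply: contra tT => /set_mem[? _]; exact: mem_set.
Qed.

Lemma leb_It : (leb It < +oo)%E.
Proof. by rewrite lebesgue_measure_itv/=; case: ifPn => _; exact: ltry. Qed.

Lemma D_fin : ((leb \x nu)%E D < +oo)%E.
Proof.
have -> : (leb \x nu)%E D = (leb It * nu Om)%E by exact: product_measure1E.
by rewrite lte_mul_pinfty// ?ge0_fin_numE ?leb_It// Omega_fin.
Qed.

Lemma LpL2_joint U : in_LpL2 T L 2%:E U -> (leb \x nu)%E.-integrable D (EFin \o (fun q => U q.1 q.2)).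
Proof.
move=> hU; have i2 := LpL2_joint_sqr hU; have [mU _] := hU.
have i1 : (leb \x nu)%E.-integrable D (EFin \o (fun=> 1 ^+ 2 : R)).
  by apply: (@integrable_bounded _ _ _ (leb \x nu)%E D mD _ 1 D_fin) => // z _; rewrite expr1n normr1.
have := integrable_mul_sqr mD mU (@measurable_cst _ _ _ _ D (1 : R)) i2 i1.
by congr (_.-integrable _ _); apply/funext => z /=; rewrite mulr1.
Qed.

Lemma LpL2_sections U : in_LpL2 T L 2%:E U -> {ae leb, forall t, It t -> oint L (U t) /\ oint L (fun z => U t z ^+ 2)}.
Proof.
move=> hU; have a1 := section_integrable1 mIt mOm (LpL2_joint hU).
have a2 := section_integrable1 mIt mOm (LpL2_joint_sqr hU).
by apply: ae_imply (ae_conj a1 a2) => t [h1 h2] tT; split; [exact: h1|exact: h2].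
Qed.

Lemma joint_section (U : R -> R * R -> R) t : measurable_fun D (fun q => U q.1 q.2) -> It t -> measurable_fun Om (U t).
Proof.
move=> mU tT; have mG : measurable_fun setT ((fun q => U q.1 q.2) \_ D).
  exact/(measurable_restrictT _ mD).
apply/(measurable_restrictT _ mOm).
have := measurable_fun_pair2 t mG; congr (measurable_fun _ _); apply/funext => z.
rewrite /patch; have -> // : ((t, z) \in D) = (z \in Om).
by apply/idP/idP => /set_mem; [case=> _ ?; exact: mem_set|move=> ?; apply/mem_set; split].
Qed.

(** Set to 0 outside []0, T[], where nothing is known of [V], so that integrals over [[0, T]] and
    over the line make sense. *)
Definition vcoef (V : R -> R * R -> R) k a b : R -> R := (fun t => cf (V t) k a b) \_ It.

Lemma vcoefE V k a b t : It t -> vcoef V k a b t = cf (V t) k a b.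
Proof. by move=> tT; rewrite /vcoef patchE mem_set. Qed.

Let meas_tm k a b (s : R -> R) : measurable_fun It s ->
  measurable_fun D (fun q : MR * (MR * MR) => s q.1 * tm k a b q.2).
Proof.
move=> ms; have m1 : measurable_fun setT (s \_ It) by exact/(measurable_restrictT _ mIt).
apply: (@eq_measurable_fun _ _ _ _ D (fun q : MR * (MR * MR) => (s \_ It) q.1 * tm k a b q.2)).
  by move=> q /set_mem[qT _]; rewrite patchE mem_set.
apply: measurable_funTS; apply: measurable_funM.
- by apply: measurableT_comp => //; exact: measurable_fst.
- apply: (@measurableT_comp _ _ _ _ _ _ (tm k a b)); last exact: measurable_snd.
  exact: measurable_tmode.
Qed.

Lemma joint_test U k a b (s : R -> R) B : in_LpL2 T L 2%:E U -> measurable_fun It s ->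
  (forall t, It t -> `|s t| <= B) ->
  (leb \x nu)%E.-integrable D (EFin \o (fun q => U q.1 q.2 * (s q.1 * tm k a b q.2))).
Proof.
move=> hU ms sB.
apply: (@integrable_bounded_mul _ _ _ (leb \x nu)%E D mD (fun q => U q.1 q.2) _ (B * (`|a| + `|b|)) (meas_tm k a b ms)).
  by move=> q [qT _]; rewrite normrM; apply: ler_pM => //; [exact: sB|exact: tmode_le].
exact: LpL2_joint.
Qed.

Let one_le (t : R) : It t -> `|(fun=> 1 : R) t| <= 1. Proof. by rewrite normr1. Qed.

Lemma vcoef_int V k a b : in_LpL2 T L 2%:E V -> leb.-integrable setT (EFin \o vcoef V k a b).
Proof.
move=> hV; have iF := joint_test k a b hV (@measurable_cst _ _ _ _ It (1 : R)) one_le.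
have := fubini_integrable1 mIt mOm iF => /(integrable_mkcond _ mIt).
congr (_.-integrable _ _); apply/funext => t; rewrite /vcoef /patch/=; case: ifP => // _.
by congr EFin; apply: eq_Rintegral => z _; rewrite mul1r.
Qed.

Lemma cf_sqr_le u k a b : oint L u -> oint L (fun z => u z ^+ 2) ->
  cf u k a b ^+ 2 <= L ^+ 2 * (`|a| + `|b|) ^+ 2 * \int[nu]_(z in Om) (u z ^+ 2).
Proof.
move=> iu iu2; have mtm : measurable_fun Om (tm k a b) by exact: measurable_tmode.
have im2 : oint L (fun z => (u z * tm k a b z) ^+ 2).
  have -> : (fun z => (u z * tm k a b z) ^+ 2) = (fun z => u z ^+ 2 * tm k a b z ^+ 2).
    by apply/funext => z; rewrite exprMn.
  apply: (@integrable_bounded_mul _ _ _ nu Om mOm _ _ ((`|a| + `|b|) ^+ 2)) => //.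
    exact: measurable_funX.
  by move=> z _; rewrite normrX lerXn2r ?nnegrE ?addr_ge0//; exact: tmode_le.
have := sqr_Rintegral_le mOm (Omega_fin L_gt0) (integrable_tmodeM k a b iu) im2.
move=> /le_trans; apply.
rewrite [fine _](_ : _ = L ^+ 2); last exact: (congr1 fine (Omega_measure L_gt0)).
rewrite -mulrA ler_wpM2l ?sqr_ge0// -RintegralZl//; apply: le_Rintegral => //.
  exact: ointZ.
move=> z _; rewrite exprMn mulrC; apply: ler_wpM2r; first exact: sqr_ge0.
by rewrite -[tm _ _ _ _ ^+ 2]real_normK ?num_real// lerXn2r ?nnegrE ?addr_ge0//; exact: tmode_le.
Qed.

Lemma energy_int V : in_LpL2 T L 2%:E V ->
  leb.-integrable It (EFin \o (fun t => \int[nu]_(z in Om) (V t z ^+ 2))).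
Proof. by move=> hV; exact: (fubini_integrable1 mIt mOm (LpL2_joint_sqr hV)). Qed.

Lemma vcoef_sqr_int V k a b : in_LpL2 T L 2%:E V -> leb.-integrable setT (EFin \o (fun t => vcoef V k a b t ^+ 2)).
Proof.
move=> hV.
have mv : measurable_fun setT (vcoef V k a b).
  by apply/measurable_EFinP; exact: measurable_int (vcoef_int k a b hV).
have iE : leb.-integrable It (EFin \o (fun t => L ^+ 2 * (`|a| + `|b|) ^+ 2 * \int[nu]_(z in Om) (V t z ^+ 2))).
  exact: (integrableZl mIt _ (energy_int hV)).
have -> : EFin \o (fun t => vcoef V k a b t ^+ 2) = (EFin \o (fun t => cf (V t) k a b ^+ 2)) \_ It.
  by apply/funext => t; rewrite /vcoef /patch/=; case: ifP => //; rewrite expr0n.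
apply/(integrable_mkcond _ mIt).
have m2 : measurable_fun It (fun t => cf (V t) k a b ^+ 2).
  apply: measurable_funX; apply: (@eq_measurable_fun _ _ _ _ It (vcoef V k a b)).
    by move=> t /set_mem tT; rewrite vcoefE.
  exact: measurable_funTS.
apply/integrableP; split; first exact/measurable_EFinP.
have /integrableP[mE fE] := iE.
apply: le_lt_trans fE; apply: ae_ge0_le_integral => //.
- by apply: measurableT_comp => //; exact/measurable_EFinP.
- by apply: measurableT_comp.
- apply: ae_imply (LpL2_sections hV) => t h tT; have [i1 i2] := h tT.
  rewrite lee_fin ger0_norm ?sqr_ge0// (le_trans (cf_sqr_le k a b i1 i2))//.
  exact: ler_norm.
Qed.

(** Weak time derivatives are formulated for almost every point, coefficients exist for almost every
    time; Fubini on the cylinder exchanges the two. *)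
Lemma vcoef_test V k a b (s : R -> R) B : in_LpL2 T L 2%:E V -> measurable_fun It s ->
  (forall t, It t -> `|s t| <= B) ->
  oint L (fun z => \int[leb]_(t in It) (V t z * s t)) /\
  \int[leb]_(t in It) (vcoef V k a b t * s t) =
  \int[nu]_(z in Om) ((\int[leb]_(t in It) (V t z * s t)) * tm k a b z).
Proof.
move=> hV ms sB.
have iF := joint_test k a b hV ms sB.
have iF1 : (leb \x nu)%E.-integrable D (EFin \o (fun q => V q.1 q.2 * s q.1)).
  have := joint_test (0, 0) 1 0 hV ms sB.
  by congr (_.-integrable _ _); apply/funext => q /=; rewrite tmode0 mulr1.
have i1 : oint L (fun z => \int[leb]_(t in It) (V t z * s t)) by exact: (fubini_integrable2 mIt mOm iF1).
have m1 : measurable_fun Om (fun z => \int[leb]_(t in It) (V t z * s t)).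
  by apply/measurable_EFinP; exact: measurable_int i1.
split=> //.
have mv : measurable_fun It (fun t => vcoef V k a b t * s t).
  apply: measurable_funM => //; apply: measurable_funTS.
  by apply/measurable_EFinP; exact: measurable_int (vcoef_int k a b hV).
transitivity (\int[leb]_(t in It) (\int[nu]_(z in Om) (V t z * (s t * tm k a b z)))).
  apply: ae_eq_Rintegral => //.
    by apply/measurable_EFinP; exact: measurable_int (fubini_integrable1 mIt mOm iF).
  apply: ae_imply (LpL2_sections hV) => t h tT; have [iV _] := h tT.
  rewrite vcoefE// mulrC -RintegralZl//; last exact: integrable_tmodeM.
  by apply: eq_Rintegral => z _; ring.
rewrite (Rfubini mIt mOm iF); apply: ae_eq_Rintegral => //.
- by apply/measurable_EFinP; exact: measurable_int (fubini_integrable2 mIt mOm iF).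
- by apply: measurable_funM => //; exact: measurable_tmode.
apply: ae_imply (section_integrable2 mIt mOm iF1) => z h Oz.
rewrite mulrC -RintegralZl//; last exact: h.
by apply: eq_Rintegral => t _; rewrite /=; ring.
Qed.

Lemma test_bounded th : test th -> exists B, forall t, `|th t| <= B.
Proof.
move=> tt; have ct : icont T th by apply: continuous_icont; exact: test_continuous tt.
have [B HB] := icont_bounded T_gt0 ct.
exists B => t; have [/HB//|tT] := boolP (0 <= t <= T).
have [_ [a [b [a0 bT /(_ t) z]]]] := tt; rewrite z ?normr0; last first.
  by move=> /andP[? ?]; move/negP: tT; apply; apply/andP; split; lra.
by apply: le_trans (normr_ge0 (th 0)) _; apply: HB; rewrite lexx ltW.
Qed.

Lemma intT_open (f : R -> R) : iint T f -> intT T f = \int[leb]_(t in It) f t.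
Proof.
move=> jf; rewrite /intT -(@Rintegral_itv_obnd_cbnd _ 0 (BRight T) f); last first.
  by apply: integrableS jf => //; apply: subset_itvr; rewrite bnd_simp.
rewrite -(@Rintegral_itv_bndo_bndc _ (BRight 0) T f)//.
by apply: integrableS jf => // z; rewrite /= !in_itv/= => /andP[/ltW -> /ltW ->].
Qed.

Lemma iintT_of (f : R -> R) : leb.-integrable setT (EFin \o f) -> iint T f.
Proof. by move=> jf; apply: integrableS jf. Qed.

(** The identity of [weak_dt], valid almost everywhere in the square, is multiplied by a mode and
    integrated. *)
Lemma weak_dt_coef U V j k a b th : weak_dt T L j U V -> icont T (fun t => cf (U t) k a b) -> test th ->
  intT T (fun t => cf (U t) k a b * derive1n j th t) =
  (-1) ^+ j * intT T (fun t => vcoef V k a b t * th t).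
Proof.
move=> [hU hV hw] cU tt.
have ms f : test f -> measurable_fun It f.
  by move=> tf; apply: measurable_funTS; apply: continuous_measurable_fun; exact: test_continuous tf.
have tj := test_derive1n j tt.
have [Bj hj] := test_bounded tj; have [B hB] := test_bounded tt.
have [m1 e1] := vcoef_test k a b hU (ms _ tj) (fun t _ => hj t).
have [m2 e2] := vcoef_test k a b hV (ms _ tt) (fun t _ => hB t).
rewrite intT_open; last exact: iint_test_mul.
rewrite intT_open; last first.
  apply: iintT_of; apply: (@integrable_bounded_mul _ _ _ leb setT _ _ _ B) => //; last exact: vcoef_int.
  by apply: continuous_measurable_fun; exact: test_continuous tt.
rewrite e2.
transitivity (\int[leb]_(t in It) (vcoef U k a b t * derive1n j th t)).
  by apply: eq_Rintegral => t /set_mem tT; rewrite vcoefE.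
rewrite e1 -RintegralZl//; last exact: integrable_tmodeM.
apply: (ae_eq_Rintegral mOm).
- by apply/measurable_EFinP; exact: measurable_int (integrable_tmodeM k a b m1).
- by apply: measurable_funM => //; apply/measurable_EFinP; exact: measurable_int (integrable_tmodeM k a b m2).
- by apply: ae_imply (hw th tt) => z h Oz; rewrite mulrA -(h Oz).
Qed.

End SpaceTime.

(** * Sobolev norms as weighted sums of squared coefficients *)

Section Sobolev.
Context {R : realType} (T L : R).
Hypotheses (T_gt0 : 0 < T) (L_gt0 : 0 < L).
Local Notation MR := (measurableTypeR R).
Local Notation leb := (@lebesgue_measure R).
Local Notation nu := (@planeL R).
Local Notation Om := (Omega L : set (MR * MR)).
Local Notation It := (`]0%R, T[%classic : set MR).
Local Notation tm := (tmode L).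
Local Notation kk := (int * int)%type.
Local Notation cf := (cf L).
Local Notation wgt := (wgt L).
Let mOm : measurable Om := measurable_Omega L.
Let mIt : measurable It. Proof. exact: measurable_itv. Qed.

Lemma cf_even_partial u ux uy k a b m :
  weak_partial L m.*2 0 u ux -> weak_partial L 0 m.*2 u uy ->
  cf ux k a b = (- wave L k.1 ^+ 2) ^+ m * cf u k a b /\
  cf uy k a b = (- wave L k.2 ^+ 2) ^+ m * cf u k a b.
Proof.
move=> [hu hx Hx] [_ hy Hy].
have [_ iu _] := in_L2P L_gt0 hu.
have scale c : cf u k (c * a) (c * b) = c * cf u k a b.
  by rewrite cf_linear// [cf u k a b]cf_linear//; ring.
have [d1 d2] := dpartial_tmode L k a b m.
have sm := smooth_tmode L k a b; have pm := periodic_tmode L_gt0 k a b.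
have := Hx _ sm pm; rewrite d1 addn0 -signr_odd odd_double mul1r => e1.
have := Hy _ sm pm; rewrite d2 add0n -signr_odd odd_double mul1r => e2.
by split; rewrite -scale; [rewrite /cf -e1|rewrite /cf -e2].
Qed.

(** The largest of 1 and the two squared wave numbers is at least a third of the weight. *)
Lemma wgt_pow_le k m : wgt k ^+ m.*2 <= 3 * 9 ^+ m * (1 + (wave L k.1 ^+ 2) ^+ m.*2 + (wave L k.2 ^+ 2) ^+ m.*2).
Proof.
rewrite /wgt /lam; have := sqr_ge0 (wave L k.1); have := sqr_ge0 (wave L k.2).
move: (wave L k.1 ^+ 2) (wave L k.2 ^+ 2) => x y y0 x0.
have bnd (z : R) : 0 <= z -> 1 + (x + y) <= 3 * z -> (1 + (x + y)) ^+ m.*2 <= 9 ^+ m * z ^+ m.*2.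
  move=> z0 h; have -> : 9 ^+ m * z ^+ m.*2 = (3 * z) ^+ m.*2 :> R.
    by rewrite exprMn -!mul2n !exprM; congr (_ ^+ _ * _); ring.
  by rewrite lerXn2r ?nnegrE ?mulr_ge0 ?addr_ge0.
have X0 : 0 <= x ^+ m.*2 by rewrite exprn_ge0.
have Y0 : 0 <= y ^+ m.*2 by rewrite exprn_ge0.
have N0 : 0 <= 9 ^+ m :> R by rewrite exprn_ge0.
have fin (z : R) : 0 <= z -> 1 + (x + y) <= 3 * z -> z ^+ m.*2 <= 1 + x ^+ m.*2 + y ^+ m.*2 ->
   (1 + (x + y)) ^+ m.*2 <= 3 * 9 ^+ m * (1 + x ^+ m.*2 + y ^+ m.*2).
  move=> z0 /(bnd z z0)/le_trans h hz; apply: h.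
  have S0 : 0 <= 9 ^+ m * (1 + x ^+ m.*2 + y ^+ m.*2) by rewrite mulr_ge0 ?addr_ge0.
  have := ler_wpM2l N0 hz; lra.
have [xy|yx] := leP x y.
  have [y1|y1] := leP y 1; first by apply: (fin 1) => //; [lra|rewrite expr1n; lra].
  by apply: (fin y) => //; lra.
have [x1|x1] := leP x 1; first by apply: (fin 1) => //; [lra|rewrite expr1n; lra].
by apply: (fin x) => //; lra.
Qed.

(** Bessel's inequality is used for the function and its two pure derivatives of order [m.*2], which
    together control the full weight. *)
Lemma bessel_sobolev u ux uy m (I : finType) (kap : I -> kk) : injective kap ->
  weak_partial L m.*2 0 u ux -> weak_partial L 0 m.*2 u uy ->
  \sum_i wgt (kap i) ^+ m.*2 * (cf u (kap i) 1 0 ^+ 2 + cf u (kap i) 0 1 ^+ 2) <=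
  3 * 9 ^+ m * L ^+ 2 * (\int[nu]_(z in Om) (u z ^+ 2) + \int[nu]_(z in Om) (ux z ^+ 2) + \int[nu]_(z in Om) (uy z ^+ 2)).
Proof.
move=> ki wx wy.
have [hu hx _] := wx; have [_ hy _] := wy.
have [_ iu iu2] := in_L2P L_gt0 hu; have [_ ix ix2] := in_L2P L_gt0 hx; have [_ iy iy2] := in_L2P L_gt0 hy.
have b0 := bessel L_gt0 ki iu iu2; have b1 := bessel L_gt0 ki ix ix2; have b2 := bessel L_gt0 ki iy iy2.
have C0 : 0 <= 3 * 9 ^+ m :> R by rewrite mulr_ge0 ?exprn_ge0.
apply: (@le_trans _ _ (3 * 9 ^+ m * (\sum_i (cf u (kap i) 1 0 ^+ 2 + cf u (kap i) 0 1 ^+ 2) +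
   \sum_i (cf ux (kap i) 1 0 ^+ 2 + cf ux (kap i) 0 1 ^+ 2) + \sum_i (cf uy (kap i) 1 0 ^+ 2 + cf uy (kap i) 0 1 ^+ 2)))).
  rewrite -!big_split/= mulr_sumr; apply: ler_sum => i _.
  have [e1 e2] := cf_even_partial (kap i) 1 0 wx wy.
  have [e3 e4] := cf_even_partial (kap i) 0 1 wx wy.
  rewrite e1 e2 e3 e4.
  have ev (x y : R) : ((- x) ^+ m * y) ^+ 2 = x ^+ m.*2 * y ^+ 2.
    by rewrite exprMn -exprM muln2 exprNn -signr_odd odd_double mul1r.
  rewrite !ev.
  set S := cf u (kap i) 1 0 ^+ 2 + _.
  have S0 : 0 <= S by rewrite addr_ge0 ?sqr_ge0.
  have := ler_wpM2r S0 (wgt_pow_le (kap i) m); rewrite /S; lra.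
rewrite -[3 * 9 ^+ m * L ^+ 2 * _]mulrA; apply: ler_wpM2l => //.
by rewrite !mulrDr; apply: lerD => //; apply: lerD.
Qed.

(** The supremum norm is defined by cases on whether the whole space has positive measure. *)
Lemma leb_setT_gt0 : (0 < leb [set: MR])%E.
Proof.
have m1 : measurable (`]0, 1[%classic : set MR) by exact: measurable_itv.
apply: (@lt_le_trans _ _ (leb (`]0, 1[%classic : set MR))).
  by rewrite lebesgue_measure_itv/= lte_fin ltr01 -EFinB lte_fin subr0.
by apply: le_measure; rewrite ?inE.
Qed.

Lemma Linf_bound U : in_LpL2 T L +oo%E U ->
  exists M : R, {ae leb, forall t, 0 < t < T -> (L2norm L (U t) <= M%:E)%E}.
Proof.
move=> [mU]; rewrite Lnorm.unlock /= leb_setT_gt0.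
set K := ess_sup_inf.ess_sup _ _ => KM.
have ge := ess_sup_inf.ess_sup_ge mu1 (abse \o (fun t => L2norm L (U t)) \_ `]0, T[); rewrite -/K in ge.
exists (fine K); apply: ae_imply ge => t + tT.
have tI : t \in `]0, T[%classic by apply/mem_set; rewrite /= in_itv.
rewrite /= patchE tI; have n0 : (0 <= L2norm L (U t))%E by exact: Lnorm_ge0.
rewrite gee0_abs// => h; apply: (le_trans h).
move: KM h; clearbody K; case: K => [r|//|]; rewrite ?lexx//= => _.
by rewrite leeNy_eq => /eqP e; move: n0; rewrite e.
Qed.

Lemma icont_sum (I : Type) (s : seq I) (F : I -> R -> R) :
  (forall i, icont T (F i)) -> icont T (fun t => \sum_(i <- s) F i t).
Proof.
move=> H; elim: s => [|i s IH].
  have -> : (fun t => \sum_(i <- [::]) F i t) = (fun=> 0) by apply/funext => t; rewrite big_nil.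
  by apply: continuous_icont; exact: cst_continuous.
have -> : (fun t => \sum_(i <- i :: s) F i t) = (fun t => F i t + \sum_(i <- s) F i t).
  by apply/funext => t; rewrite big_cons.
exact: icontD.
Qed.

(** The bound holds at almost every time, and a finite sum of continuous coefficients then obeys it
    at every time. The constant is chosen before the family of frequencies. *)
Lemma Linf_sobolev U m : in_LpH T L +oo%E m.*2 U ->
  (forall k a b, icont T (fun t => cf (U t) k a b)) ->
  exists M, forall (I : finType) (kap : I -> kk), injective kap -> forall t, 0 <= t <= T ->
   \sum_i wgt (kap i) ^+ m.*2 * (cf (U t) (kap i) 1 0 ^+ 2 + cf (U t) (kap i) 0 1 ^+ 2) <= M.
Proof.
move=> [hU [D HD]] cU.
have [M0 h0] := Linf_bound hU.
have l1 : (m.*2 + 0 <= m.*2)%N by rewrite addn0.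
have l2 : (0 + m.*2 <= m.*2)%N by [].
have [hx wx] := HD _ _ l1; have [hy wy] := HD _ _ l2.
have [M1 h1] := Linf_bound hx; have [M2 h2] := Linf_bound hy.
exists (3 * 9 ^+ m * L ^+ 2 * (M0 ^+ 2 + M1 ^+ 2 + M2 ^+ 2)) => I kap ki.
apply: (icont_ae_le T_gt0).
  apply: icont_sum => i; apply: icontM; first by apply: continuous_icont; exact: cst_continuous.
  by apply: icontD; apply: icontM.
apply: ae_imply (ae_conj (ae_conj h0 (ae_conj h1 h2)) (ae_conj wx wy)) => t [[a0 [a1 a2]] [b1 b2]] tT.
apply: (le_trans (bessel_sobolev ki (b1 tT) (b2 tT))).
apply: ler_wpM2l; first by rewrite !mulr_ge0 ?exprn_ge0// ltW.
by apply: lerD; [apply: lerD|]; apply: L2norm_le; [exact: a0|exact: a1|exact: a2].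
Qed.

Lemma L2_sobolev V m : in_LpH T L 2%:E m.*2 V ->
  exists M, forall (I : finType) (kap : I -> kk), injective kap ->
   \sum_i wgt (kap i) ^+ m.*2 * (intT T (fun t => vcoef T L V (kap i) 1 0 t ^+ 2) + intT T (fun t => vcoef T L V (kap i) 0 1 t ^+ 2)) <= M.
Proof.
move=> [hV [D HD]].
have l1 : (m.*2 + 0 <= m.*2)%N by rewrite addn0.
have l2 : (0 + m.*2 <= m.*2)%N by [].
have [hx wx] := HD _ _ l1; have [hy wy] := HD _ _ l2.
pose E (W : R -> R * R -> R) t := \int[nu]_(z in Om) (W t z ^+ 2).
pose B t := 3 * 9 ^+ m * L ^+ 2 * (E V t + E (D m.*2 0) t + E (D 0 m.*2) t).
have iB : leb.-integrable It (EFin \o B).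
  exact: (integrableZl mIt (3 * 9 ^+ m * L ^+ 2) (integrableD mIt (integrableD mIt (energy_int hV) (energy_int hx)) (energy_int hy))).
exists (\int[leb]_(t in It) B t) => I kap ki.
have iv k a b : leb.-integrable setT (EFin \o (fun t => vcoef T L V k a b t ^+ 2)) by exact: vcoef_sqr_int.
have ivI k a b : leb.-integrable It (EFin \o (fun t => vcoef T L V k a b t ^+ 2)).
  by apply: integrableS (iv k a b).
have iw i : leb.-integrable It (EFin \o (fun t => wgt (kap i) ^+ m.*2 * (vcoef T L V (kap i) 1 0 t ^+ 2 + vcoef T L V (kap i) 0 1 t ^+ 2))).
  exact: (integrableZl mIt _ (integrableD mIt (ivI (kap i) 1 0) (ivI (kap i) 0 1))).
apply: (@le_trans _ _ (\int[leb]_(t in It) (\sum_i wgt (kap i) ^+ m.*2 * (vcoef T L V (kap i) 1 0 t ^+ 2 + vcoef T L V (kap i) 0 1 t ^+ 2)))).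
  rewrite Rintegral_sum//; apply: ler_sum => i _.
  rewrite !intT_open//; [|exact: iintT_of..].
  rewrite le_eqVlt; apply/orP; left; apply/eqP.
  rewrite RintegralZl//; last exact: (integrableD mIt (ivI (kap i) 1 0) (ivI (kap i) 0 1)).
  by rewrite RintegralD.
apply: ae_le_Rintegral => //.
  by apply: integrable_fsum.
apply: ae_imply (ae_conj wx wy) => t [b1 b2] tT.
have tT' : 0 < t < T by move: tT; rewrite /= in_itv.
apply: le_trans (bessel_sobolev ki (b1 tT') (b2 tT')).
by apply: ler_sum => i _; rewrite !vcoefE.
Qed.

(** [weak_laplacian] fixes [w] only almost everywhere, so its measurability is supplied separately
    and its integrability inherited. *)
Lemma cf_weak_laplacian u w k a b : weak_laplacian L u w -> measurable_fun Om w ->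
  cf w k a b = - lam L k * cf u k a b /\ (oint L u /\ oint L w).
Proof.
move=> [uxx [uyy [wx wy ew]]] mw.
have [e1 e2] := @cf_even_partial u uxx uyy k a b 1 wx wy.
have [hu hx _] := wx; have [_ hy _] := wy.
have [_ iu _] := in_L2P L_gt0 hu.
have [mx ix _] := in_L2P L_gt0 hx; have [my iy _] := in_L2P L_gt0 hy.
have ixy := ointD ix iy.
have mxy : measurable_fun Om (fun z => uxx z + uyy z) by exact: measurable_funD.
have mtm : measurable_fun Om (tm k a b) by exact: measurable_tmode.
split.
  transitivity (cf (fun z => uxx z + uyy z) k a b).
    apply: (ae_eq_Rintegral mOm); [exact: measurable_funM|exact: measurable_funM|].
    by apply: ae_imply ew => z h Oz; rewrite h.
  by rewrite cfD// e1 e2 /lam !expr1; ring.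
split=> //.
apply/integrableP; split; first exact/measurable_EFinP.
have /integrableP[_ fin] := ixy.
apply: le_lt_trans fin; apply: ae_ge0_le_integral => //.
- by apply: measurableT_comp => //; exact/measurable_EFinP.
- by apply: measurableT_comp => //; exact/measurable_EFinP.
- by apply: ae_imply ew => z h Oz; rewrite /= h.
Qed.

End Sobolev.

(** * Continuity and measurability of the solution *)

Section Solution.
Context {R : realType} (T L : R).
Hypotheses (T_gt0 : 0 < T) (L_gt0 : 0 < L).
Variable Phi : R -> R * R -> R.
Hypothesis Phi_continuous :
  {within `[0, T] `*` [set: R * R], continuous (fun q : R * (R * R) => Phi q.1 q.2)}.
Local Notation MR := (measurableTypeR R).
Local Notation leb := (@lebesgue_measure R).
Local Notation nu := (@planeL R).
Local Notation Om := (Omega L : set (MR * MR)).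
Local Notation It := (`]0%R, T[%classic : set MR).
Local Notation tm := (tmode L).
Local Notation kk := (int * int)%type.
Local Notation cf := (cf L).
Local Notation wgt := (wgt L).
Let mOm : measurable Om := measurable_Omega L.

(** Nearest point of [[0, T]]. It extends [Phi] continuously to all times, so that results on open
    sets of times apply at the end points. *)
Definition clamp (t : R) : R := Num.max 0 (Num.min t T).

Lemma clamp_in t : 0 <= clamp t <= T.
Proof. by rewrite /clamp le_max lexx/= ge_max ge_min lexx orbT andbT ltW. Qed.

Lemma clamp_id t : 0 <= t <= T -> clamp t = t.
Proof. by move=> /andP[t0 tT]; rewrite /clamp (min_idPl tT) (max_idPr t0). Qed.

Lemma clamp_cases t : clamp t = 0 /\ t <= 0 \/ clamp t = t /\ 0 <= t <= T \/ clamp t = T /\ T <= t.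
Proof.
have [t0|t0] := leP t 0.
  by left; rewrite /clamp (min_idPl (le_trans t0 (ltW T_gt0))) (max_idPl t0).
have [tT|tT] := leP t T; first by right; left; rewrite clamp_id ?(ltW t0).
by right; right; rewrite /clamp (min_idPr (ltW tT)) (max_idPr (ltW T_gt0)) ltW.
Qed.

Lemma clamp_lip s t : `|clamp s - clamp t| <= `|s - t|.
Proof.
have T0 := T_gt0; have h1 := ler_norm (s - t); have h2 := ler_norm (t - s); rewrite (distrC t s) in h2.
rewrite ler_norml.
by case: (clamp_cases s) => [[-> a]|[[-> /andP[a a']]|[-> a]]];
  case: (clamp_cases t) => [[-> b]|[[-> /andP[b b']]|[-> b]]]; apply/andP; split; lra.
Qed.

Lemma clamp_continuous : continuous clamp.
Proof.
move=> t; apply/cvgrPdist_lt => e e0; near=> s.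
apply: (le_lt_trans (clamp_lip _ _)); near: s; exact: cvgr_dist_lt.
Unshelve. all: by end_near. Qed.

Definition cPhi (q : R * (R * R)) : R := Phi (clamp q.1) q.2.

Lemma cPhi_continuous : continuous cPhi.
Proof.
move=> q; have /subspace_continuousP H := Phi_continuous.
have cg : continuous (fun q : R * (R * R) => (clamp q.1, q.2)).
  move=> x; have c1 : clamp y.1 @[y --> x] --> clamp x.1.
    by apply: (@cvg_comp _ _ _ fst clamp _ (nbhs x.1)); [exact: cvg_fst|exact: clamp_continuous].
  have c2 : y.2 @[y --> x] --> x.2 by exact: cvg_snd.
  exact: (cvg_pair c1 c2).
have Aq x : (`[0, T] `*` [set: R * R]) (clamp x.1, x.2 : R * R).
  by split => //=; rewrite in_itv/=; exact: clamp_in.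
move=> P hP.
have h' : nbhs ((clamp q.1, q.2) : R * (R * R)) (fun x => (`[0, T] `*` [set: R * R]) x -> P (Phi x.1 x.2)).
  exact: (H _ (Aq q) P hP).
have h2 : nbhs q (fun x => (`[0, T] `*` [set: R * R]) (clamp x.1, x.2) -> P (cPhi x)) := cg q _ h'.
change (nbhs q (fun x => P (cPhi x))).
by apply: filterS h2 => x; apply; exact: Aq.
Qed.

Lemma Phi_bounded : exists2 M, 0 <= M & forall t z, 0 <= t <= T -> Om z -> `|Phi t z| <= M.
Proof.
pose K := `[0, T]%classic `*` (`[0, L]%classic `*` `[0, L]%classic) : set (R * (R * R)).
have cK : compact K.
  by apply: compact_setX; [|apply: compact_setX]; exact: segment_compact.
have : compact (cPhi @` K).
  by apply: continuous_compact => //; apply: continuous_subspaceT; exact: cPhi_continuous.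
move=> /compact_bounded[M [_ HM]].
have B t z : 0 <= t <= T -> Om z -> `|Phi t z| <= `|M| + 1.
  move=> tT [z1 z2]; apply: HM; first by rewrite (le_lt_trans (ler_norm _))// ltrDl.
  exists (t, z) => /=; last by rewrite /cPhi clamp_id.
  move: z1 z2; rewrite /K /= !in_itv/= => /andP[a b] /andP[c d].
  by rewrite tT !ltW.
by exists (`|M| + 1) => //; rewrite addr_ge0.
Qed.

Lemma Phi_cont_at t z : 0 <= t <= T -> cont_at (Phi t) z.
Proof.
move=> tT e e0.
have c : (fun w : R * R => Phi t w) @ nbhs z --> Phi t z.
  have -> : (fun w : R * R => Phi t w) = cPhi \o (fun w => (t, w)).
    by apply/funext => w; rewrite /= /cPhi clamp_id.
  rewrite [Phi t z](_ : _ = cPhi (t, z)); last by rewrite /cPhi clamp_id.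
  apply: (@cvg_comp _ _ _ (fun w => (t, w)) cPhi _ (nbhs (t, z))); last exact: cPhi_continuous.
  have c1 : (fun=> t) w @[w --> z] --> t by exact: cvg_cst.
  have c2 : w @[w --> z] --> z by exact: cvg_id.
  exact: (cvg_pair c1 c2).
have /cvgrPdist_le/(_ e e0)[[P Q] [/= hP hQ] sub] := c.
have /nbhs_ballP[d1 /= d10 b1] := hP; have /nbhs_ballP[d2 /= d20 b2] := hQ.
exists (Num.min d1 d2); first by rewrite lt_min d10.
move=> w; rewrite !lt_min => /andP[w1 _] /andP[_ w2].
case: w w1 w2 => wa wb /= w1 w2; rewrite distrC.
by apply: (sub (wa, wb)); split => /=; [apply: b1|apply: b2]; rewrite /ball/= distrC.
Qed.

Hypothesis Phi_measurable : measurable_fun (It `*` Om : set (MR * (MR * MR))) (fun q => Phi q.1 q.2).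

(** Joint measurability gives the sections at interior times; all times are reached as pointwise
    limits, by continuity. *)
Lemma Phi_section_measurable t : 0 <= t <= T -> measurable_fun Om (Phi t).
Proof.
move=> tT.
have inn : forall s, 0 < s < T -> measurable_fun Om (Phi s).
  by move=> s sT; apply: (joint_section Phi_measurable); rewrite /= in_itv.
(* A convex combination of [t] and [T / 2] with positive weight on the latter: it stays strictly
   inside and tends to [t]. *)
pose s n := clamp t + (T / 2 - t) / n.+2%:R.
have sin n : 0 < s n < T.
  rewrite /s clamp_id//; have n2 : 2 <= n.+2%:R :> R by rewrite ler_nat.
  have n0 : 0 < n.+2%:R :> R by rewrite ltr0n.
  have -> : t + (T / 2 - t) / n.+2%:R = ((n.+2%:R - 1) * t + T / 2) / n.+2%:R by field; rewrite gt_eqF.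
  case/andP: tT => t0 tT; rewrite divr_gt0//=; last first.
    have : 0 <= (n.+2%:R - 1) * t by rewrite mulr_ge0//; lra.
    by have T0 := T_gt0; move: ((n.+2%:R - 1) * t) => w; lra.
  rewrite ltr_pdivrMr//; have : (n.+2%:R - 1) * t <= (n.+2%:R - 1) * T by rewrite ler_wpM2l//; lra.
  by have T0 := T_gt0; move: n2; move: (n.+2%:R : R) => y y2; lra.
have cs : s n @[n --> \oo] --> t.
  rewrite -[X in _ --> X](addr0 t) /s clamp_id//; apply: cvgD; first exact: cvg_cst.
  rewrite -[X in _ --> X](mulr0 (T / 2 - t)); apply: cvgMr.
  by rewrite (cvg_shiftS (fun n => n.+1%:R^-1 : R)); exact: cvg_harmonic.
apply: (@measurable_fun_cvg _ _ _ _ (fun n => Phi (s n))) => [n|z _]; first exact: inn.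
have -> : (fun n => Phi (s n) z) = cPhi \o (fun n => (s n, z)).
  apply/funext => n; rewrite /= /cPhi clamp_id//; have /andP[? ?] := sin n; by rewrite !ltW.
rewrite [Phi t z](_ : _ = cPhi (t, z)); last by rewrite /cPhi clamp_id.
apply: (@cvg_comp _ _ _ (fun n => (s n, z)) cPhi _ (nbhs (t, z))); last exact: cPhi_continuous.
have c2 : (fun=> z) n @[n --> \oo] --> z by exact: cvg_cst.
exact: (cvg_pair cs c2).
Qed.

Lemma icont_cf (U : R -> R * R -> R) M k a b :
  (forall z, continuous (fun t => U (clamp t) z)) ->
  (forall t, 0 <= t <= T -> measurable_fun Om (U t)) ->
  (forall t z, 0 <= t <= T -> Om z -> `|U t z| <= M) ->
  icont T (fun t => cf (U t) k a b).
Proof.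
move=> cU mU bU.
have oU t : oint L (fun z => U (clamp t) z * tm k a b z).
  apply: integrable_tmodeM; apply: (@integrable_bounded _ _ _ nu Om mOm _ M (Omega_fin L_gt0)).
    by apply: mU; exact: clamp_in.
  by move=> z Oz; apply: bU => //; exact: clamp_in.
have := @continuity_under_integral R _ _ nu (fun t z => U (clamp t) z * tm k a b z) Om mOm (-1) (T + 1)
  (fun t _ => oU t) _ (fun=> M * (`|a| + `|b|)).
have h1 : {ae nu, forall z, Om z -> {in `]-1, T + 1[%classic, continuous (fun t => U (clamp t) z * tm k a b z)}}.
  by apply: aeW => z _ t _; apply: cvgM; [exact: cU|exact: cvg_cst].
have h2 : nu.-integrable Om (EFin \o (fun=> M * (`|a| + `|b|))).
  by apply: (@integrable_bounded _ _ _ nu Om mOm (fun=> M * (`|a| + `|b|)) _ (Omega_fin L_gt0)).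
move=> /(_ h1 h2 _) H.
have {}H : {in `]-1, T + 1[%classic, continuous (fun t => \int[nu]_(z in Om) (U (clamp t) z * tm k a b z))}.
  apply: H => t _; apply: aeW => z Oz; rewrite normrM; apply: ler_pM => //; last exact: tmode_le.
  by apply: bU => //; exact: clamp_in.
apply/icontP => x xT e e0.
have xin : x \in `]-1, T + 1[%classic by apply/mem_set; rewrite /= in_itv/=; case/andP: xT => ? ?; apply/andP; split; lra.
have /cvgrPdist_lt/(_ e e0)/nbhs_ballP[d /= d0 hd] := H x xin.
exists d => // y yT yx; have := hd y; rewrite /ball/= distrC => /(_ yx); rewrite !clamp_id//.
by rewrite distrC.
Qed.

Let cPhi_t z : continuous (fun t => Phi (clamp t) z).
Proof.
move=> t.
have c1 : w @[w --> t] --> t by exact: cvg_id.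
have c2 : (fun=> z) w @[w --> t] --> z by exact: cvg_cst.
have c3 : cPhi w @[w --> (t, z)] --> cPhi (t, z) := @cPhi_continuous (t, z).
exact: (cvg_comp (fun t => (t, z)) cPhi (cvg_pair c1 c2) c3).
Qed.

Lemma Phi_icont k a b : icont T (fun t => cf (Phi t) k a b).
Proof.
have [M M0 HM] := Phi_bounded.
by apply: (@icont_cf Phi M); [exact: cPhi_t|exact: Phi_section_measurable|exact: HM].
Qed.

Lemma Phi_cube_bound M : 0 <= M -> (forall t z, 0 <= t <= T -> Om z -> `|Phi t z| <= M) ->
  forall t z, 0 <= t <= T -> Om z -> `|Phi t z ^+ 3| <= M ^+ 3.
Proof. by move=> M0 H t z tT Oz; rewrite normrX lerXn2r ?nnegrE// H. Qed.

Lemma Phi_cube_icont k a b : icont T (fun t => cf (fun z => Phi t z ^+ 3) k a b).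
Proof.
have [M M0 HM] := Phi_bounded.
apply: (@icont_cf (fun t z => Phi t z ^+ 3) (M ^+ 3)).
- move=> z t; apply: (@cvg_comp _ _ _ (fun t => Phi (clamp t) z) (fun x : R => x ^+ 3) _ (nbhs (Phi (clamp t) z))); first exact: cPhi_t.
  exact: exprn_continuous.
- by move=> t tT; apply: measurable_funX; exact: Phi_section_measurable.
- exact: Phi_cube_bound.
Qed.

Lemma Phi_oint t : 0 <= t <= T -> oint L (Phi t).
Proof.
move=> tT; have [M M0 HM] := Phi_bounded.
apply: (@integrable_bounded _ _ _ nu Om mOm _ M (Omega_fin L_gt0)); first exact: Phi_section_measurable.
by move=> z; exact: HM.
Qed.

Lemma Phi_cube_oint t : 0 <= t <= T -> oint L (fun z => Phi t z ^+ 3).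
Proof.
move=> tT; have [M M0 HM] := Phi_bounded.
apply: (@integrable_bounded _ _ _ nu Om mOm _ (M ^+ 3) (Omega_fin L_gt0)).
  by apply: measurable_funX; exact: Phi_section_measurable.
by move=> z; exact: Phi_cube_bound.
Qed.

End Solution.

(** * The equation and the regularity, coefficient by coefficient *)

Section FourierData.
Context {R : realType}.
Local Notation kk := (int * int)%type.

Definition cc (L : R) (u : R * R -> R) (k : kk) (c : bool) : R := cf L u k c%:R (~~ c)%:R.

(* Time-dependent Fourier coefficients [F0], [true] marking the cosine and
   [false] the sine coefficients, with their time derivatives; the increments
   of [P2] and [P4] are the L^2-norms of the second and fourth derivatives. *)
Record spectral (T L alpha beta M : R) (F0 F1 F2 F3 P2 P4 G : kk -> bool -> R -> R) : Prop := Spectral {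
  sp_c0 : forall k c, icont T (F0 k c);
  sp_c1 : forall k c, icont T (F1 k c);
  sp_c2 : forall k c, icont T (F2 k c);
  sp_c3 : forall k c, icont T (F3 k c);
  sp_d0 : forall k c t, 0 < t < T -> is_derive t 1 (F0 k c) (F1 k c t);
  sp_d1 : forall k c t, 0 < t < T -> is_derive t 1 (F1 k c) (F2 k c t);
  sp_d2 : forall k c t, 0 < t < T -> is_derive t 1 (F2 k c) (F3 k c t);
  sp_m2 : forall k c, {homo P2 k c : x y / x <= y};
  sp_m4 : forall k c, {homo P4 k c : x y / x <= y};
  sp_z2 : forall k c, P2 k c 0 = 0;
  sp_z4 : forall k c, P4 k c 0 = 0;
  sp_i2 : forall k c x y, 0 <= x -> x <= y -> y <= T ->
    (F1 k c y - F1 k c x) ^+ 2 <= (y - x) * (P2 k c y - P2 k c x);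
  sp_i4 : forall k c x y, 0 <= x -> x <= y -> y <= T ->
    (F3 k c y - F3 k c x) ^+ 2 <= (y - x) * (P4 k c y - P4 k c x);
  sp_s0 : forall (I : finType) (kap : I -> kk), injective kap -> forall t, 0 <= t <= T ->
    \sum_i wgt L (kap i) ^+ 8 * (F0 (kap i) true t ^+ 2 + F0 (kap i) false t ^+ 2) <= M;
  sp_s2 : forall (I : finType) (kap : I -> kk), injective kap ->
    \sum_i wgt L (kap i) ^+ 6 * (P2 (kap i) true T + P2 (kap i) false T) <= M;
  sp_s4 : forall (I : finType) (kap : I -> kk), injective kap ->
    \sum_i (P4 (kap i) true T + P4 (kap i) false T) <= M;
  sp_pde : forall k c t, 0 <= t <= T -> beta * F2 k c t + F1 k c t =
    - lam L k * (G k c t + (alpha - 2 * lam L k + lam L k ^+ 2) * F0 k c t);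
  sp_init : forall k c, F1 k c 0 = 0 }.

Variables (T L alpha beta : R).
Hypotheses (T_gt0 : 0 < T) (L_gt0 : 0 < L).
Variable Phi : R -> R * R -> R.
Hypothesis Phi_continuous :
  {within `[0, T] `*` [set: R * R], continuous (fun q : R * (R * R) => Phi q.1 q.2)}.
Hypothesis Phi_solution : solves_MPFC T L alpha beta Phi.
Hypothesis Phi_t0 : forall z : R * R, (Phi t z - Phi 0 z) / t @[t --> 0^'+] --> (0 : R).
Hypothesis Phi_H4L2 : in_WH T L 4 2%:E 0 Phi.
Hypothesis Phi_LinfH8 : in_LpH T L +oo%E 8 Phi.
Hypothesis Phi_H2H6 : in_WH T L 2 2%:E 6 Phi.
Local Notation MR := (measurableTypeR R).
Local Notation leb := (@lebesgue_measure R).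
Local Notation nu := (@planeL R).
Local Notation Om := (Omega L : set (MR * MR)).
Local Notation It := (`]0%R, T[%classic : set MR).
Local Notation tm := (tmode L).
Local Notation cf := (cf L).
Local Notation wgt := (wgt L).
Local Notation IT := (intT T).
Let mOm : measurable Om := measurable_Omega L.
Let mIt : measurable It. Proof. exact: measurable_itv. Qed.

Let Phi_meas : measurable_fun (It `*` Om : set (MR * (MR * MR))) (fun q => Phi q.1 q.2).
Proof. by have [[]] := Phi_LinfH8. Qed.

Let f k a b (t : R) := cf (Phi t) k a b.
Let g k a b (t : R) := cf (fun z => Phi t z ^+ 3) k a b.

Let fc k a b : icont T (f k a b). Proof. exact: Phi_icont. Qed.
Let gc k a b : icont T (g k a b). Proof. exact: Phi_cube_icont. Qed.

Lemma prim_homo (v : R -> R) : leb.-integrable setT (EFin \o v) -> (forall t, 0 <= v t) ->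
  {homo prim v : x y / x <= y}.
Proof.
move=> jv v0 x y xy; rewrite /prim /Rintegral.
have i z : leb.-integrable (`[0, z]%classic : set MR) (EFin \o v) by apply: integrableS jv.
apply: fine_le; [exact: integrable_fin_num (i x)|exact: integrable_fin_num (i y)|].
apply: ge0_subset_integral => //.
- by apply: (measurable_int _ (i y)).
- by move=> t _; rewrite lee_fin.
- by move=> t; rewrite /= !in_itv/= => /andP[-> tx]; exact: le_trans xy.
Qed.

Lemma coef_regularity V2 V4 k a b : weak_dt T L 2 Phi V2 -> weak_dt T L 4 Phi V4 ->
  exists F : (R -> R) * (R -> R) * (R -> R),
  [/\ [/\ icont T F.1.1, icont T F.1.2 & icont T F.2],
      forall t, 0 < t < T -> [/\ is_derive t 1 (f k a b) (F.1.1 t), is_derive t 1 F.1.1 (F.1.2 t) & is_derive t 1 F.1.2 (F.2 t)],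
      forall x y, 0 <= x -> x <= y -> y <= T -> (F.1.1 y - F.1.1 x) ^+ 2 <=
        (y - x) * (prim (fun t => vcoef T L V2 k a b t ^+ 2) y - prim (fun t => vcoef T L V2 k a b t ^+ 2) x) &
      forall x y, 0 <= x -> x <= y -> y <= T -> (F.2 y - F.2 x) ^+ 2 <=
        (y - x) * (prim (fun t => vcoef T L V4 k a b t ^+ 2) y - prim (fun t => vcoef T L V4 k a b t ^+ 2) x)].
Proof.
move=> w2 w4; have [_ h2 _] := w2; have [_ h4 _] := w4.
have i2 : iint T (vcoef T L V2 k a b) by apply: iintT_of; exact: vcoef_int.
have i4 : iint T (vcoef T L V4 k a b) by apply: iintT_of; exact: vcoef_int.
have j2 : iint T (fun t => vcoef T L V2 k a b t ^+ 2) by apply: iintT_of; exact: vcoef_sqr_int.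
have j4 : iint T (fun t => vcoef T L V4 k a b t ^+ 2) by apply: iintT_of; exact: vcoef_sqr_int.
have [||F1 [F2 [F3 H]]] := time_regularity T_gt0 (@fc k a b) i2 j2 i4 j4.
- by move=> th tt; rewrite (weak_dt_coef T_gt0 L_gt0 w2 (@fc k a b) tt) sqrrN expr1n mul1r.
- by move=> th tt; rewrite (weak_dt_coef T_gt0 L_gt0 w4 (@fc k a b) tt) -signr_odd mul1r.
by exists (F1, F2, F3).
Qed.

(** Both sides are continuous in time, so it suffices to test. Under the integral the classical
    derivatives become the weak ones, and the equation, tested with a mode, holds at almost every
    time. *)
Lemma coef_pde k a b F1 F2 : icont T F1 -> icont T F2 ->
  (forall t, 0 < t < T -> is_derive t 1 (f k a b) (F1 t)) ->
  (forall t, 0 < t < T -> is_derive t 1 F1 (F2 t)) ->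
  forall t, 0 <= t <= T -> beta * F2 t + F1 t =
    - lam L k * (g k a b t + (alpha - 2 * lam L k + lam L k ^+ 2) * f k a b t).
Proof.
move=> c1 c2 d0 d1 t tT.
have [Ut [Utt [w1 w2 eqn]]] := Phi_solution.
have [_ h1 _] := w1; have [_ h2 _] := w2.
pose H t := - lam L k * (g k a b t + (alpha - 2 * lam L k + lam L k ^+ 2) * f k a b t).
have cc0 (x : R) : icont T (fun=> x) by apply: continuous_icont; exact: cst_continuous.
have cH : icont T H by apply: icontM => //; apply: icontD; [exact: gc|apply: icontM => //; exact: fc].
suff : forall t, 0 <= t <= T -> beta * F2 t + F1 t - H t = 0 by move=> /(_ t tT)/subr0_eq.
have cbF : icont T (fun t => beta * F2 t) by apply: icontM.
have cbFF : icont T (fun t => beta * F2 t + F1 t) by exact: icontD.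
apply: (test_vanish0 T_gt0); first exact: icontB.
move=> th tt; have tt1 := test_test tt.
have e2 : IT (fun t => F2 t * th t) = IT (fun t => vcoef T L Utt k a b t * th t).
  have := weak_dt_coef T_gt0 L_gt0 w2 (@fc k a b) tt; rewrite sqrrN expr1n mul1r => <-.
  rewrite -[LHS]opprK -(intT_parts_C1 T_gt0 c1 c2 d1 tt) -(intT_parts_C1 T_gt0 (@fc k a b) c1 d0 tt1).
  by [].
have e1 : IT (fun t => F1 t * th t) = IT (fun t => vcoef T L Ut k a b t * th t).
  have := weak_dt_coef T_gt0 L_gt0 w1 (@fc k a b) tt; rewrite expr1 mulN1r => /eqP.
  by rewrite -eqr_oppLR => /eqP <-; rewrite -[LHS]opprK -(intT_parts_C1 T_gt0 (@fc k a b) c1 d0 tt).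
have iv V : in_LpL2 T L 2%:E V -> iint T (fun t => vcoef T L V k a b t * th t).
  move=> hV; have [B hB] := test_bounded T_gt0 tt.
  apply: iintT_of; apply: (@integrable_bounded_mul _ _ _ leb setT _ _ _ B) => //; last exact: vcoef_int.
  by apply: continuous_measurable_fun; exact: test_continuous tt.
have i1 := iint_test_mul c1 tt; have i2 := iint_test_mul c2 tt; have iH := iint_test_mul cH tt.
have i2b : iint T (fun t => beta * (F2 t * th t)).
  by have := iint_test_mul cbF tt; congr (iint T _); apply/funext => s; rewrite mulrA.
have i12 : iint T (fun t => beta * (F2 t * th t) + F1 t * th t).
  by have := iint_test_mul cbFF tt; congr (iint T _); apply/funext => s; ring.
rewrite (@intT_ext _ T _ (fun t => beta * (F2 t * th t) + F1 t * th t - H t * th t)); last by move=> s; ring.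
rewrite intTB//.
have -> : IT (fun t => beta * (F2 t * th t) + F1 t * th t) = beta * IT (fun t => F2 t * th t) + IT (fun t => F1 t * th t).
  rewrite (@intT_ext _ T _ (fun t => beta * (F2 t * th t) - (-1) * (F1 t * th t))); last by move=> s; ring.
  rewrite intTB//; last first.
    have cN : icont T (fun t => (-1) * F1 t) by exact: icontM.
    by have := iint_test_mul cN tt; congr (iint T _); apply/funext => s; ring.
  by rewrite !intTZ//; ring.
rewrite e1 e2; apply/eqP; rewrite subr_eq0; apply/eqP.
have iV2 := iv _ h2; have iV1 := iv _ h1.
have iw : leb.-integrable It (EFin \o (fun t => vcoef T L Utt k a b t * th t)).
  by apply: integrableS iV2 => // s; rewrite /= !in_itv/= => /andP[/ltW -> /ltW ->].
have iw1 : leb.-integrable It (EFin \o (fun t => vcoef T L Ut k a b t * th t)).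
  by apply: integrableS iV1 => // s; rewrite /= !in_itv/= => /andP[/ltW -> /ltW ->].
have iwb := integrableZl mIt beta iw.
have iHo : leb.-integrable It (EFin \o (fun t => H t * th t)).
  by apply: integrableS iH => // s; rewrite /= !in_itv/= => /andP[/ltW -> /ltW ->].
rewrite !intT_open// -RintegralZl// -RintegralD//.
apply: ae_eq_Rintegral => //.
- by apply/measurable_EFinP; exact: measurable_int (integrableD mIt iwb iw1).
- by apply/measurable_EFinP; exact: measurable_int iHo.
have A1 := LpL2_sections L_gt0 h1; have A2 := LpL2_sections L_gt0 h2.
have A3 := ae_conj A1 A2.
have A4 := ae_conj eqn A3.
apply: ae_imply A4 => s [es [j1 j2]] sT.
have sT' : 0 < s < T by move: sT; rewrite /= in_itv.
have sT2 : 0 <= s <= T by case/andP: sT' => ? ?; rewrite !ltW.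
have [ou1 _] := j1 sT; have [ou2 _] := j2 sT.
have [x1 [x2 [l1 l2 l3]]] := es sT'.
have mP := Phi_section_measurable T_gt0 Phi_continuous Phi_meas sT2.
have oP := Phi_oint T_gt0 L_gt0 Phi_continuous Phi_meas sT2.
have oP3 := Phi_cube_oint T_gt0 L_gt0 Phi_continuous Phi_meas sT2.
have m1 : measurable_fun Om x1.
  by have [? [? [[hx _ _] _ _]]] := l2; have [] := in_L2P L_gt0 hx.
(* The second Laplacian is known to be square integrable only as part of the chemical potential, so
   its measurability is recovered by subtraction. *)
have m2 : measurable_fun Om x2.
  have [? [? [[hx _ _] _ _]]] := l3; have [mg _ _] := in_L2P L_gt0 hx.
  have -> : x2 = (fun z => (Phi s z ^+ 3 + alpha * Phi s z + 2 * x1 z + x2 z) - (Phi s z ^+ 3 + alpha * Phi s z + 2 * x1 z)).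
    by apply/funext => z; ring.
  apply: measurable_funB => //; apply: measurable_funD; last exact: measurable_funM.
  by apply: measurable_funD; [exact: measurable_funX|exact: measurable_funM].
have obt : oint L (fun z => beta * Utt s z) by exact: ointZ.
have ow : oint L (fun z => beta * Utt s z + Ut s z) by exact: ointD.
have mw : measurable_fun Om (fun z => beta * Utt s z + Ut s z).
  by apply/measurable_EFinP; exact: measurable_int ow.
have [q1 [_ ox1]] := cf_weak_laplacian L_gt0 k a b l1 m1.
have [q2 [_ ox2]] := cf_weak_laplacian L_gt0 k a b l2 m2.
have [q3 _] := cf_weak_laplacian L_gt0 k a b l3 mw.
have oa := ointZ alpha oP; have ox := ointZ 2 ox1.
rewrite !vcoefE// mulrA -mulrDl; congr (_ * _).
rewrite -cfZ// -cfD// q3 cfD//; last by apply: ointD => //; exact: ointD.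
rewrite cfD//; last exact: ointD.
rewrite cfD// !cfZ// q2 q1 /H /g /f; ring.
Qed.

(** The initial velocity vanishes pointwise in space. To pass to coefficients, the difference
    quotients must be dominated: Fejer means and the bound [B] give a Lipschitz estimate in time,
    uniform in space. Mean value points vary with the mode, which is why the bound allows a time for
    each. *)
Lemma coef_init (F1 : kk -> bool -> R -> R) (B : R) : (forall k c, icont T (F1 k c)) ->
  (forall (k : kk) (c : bool) (t : R), 0 < t < T -> is_derive t 1 (f k c%:R (~~ c)%:R) (F1 k c t)) ->
  (forall (I : finType) (kap : I -> kk), injective kap -> forall t : I -> bool -> R,
     (forall i c, 0 <= t i c <= T) ->
     \sum_i wgt (kap i) ^+ 6 * (F1 (kap i) true (t i true) ^+ 2 + F1 (kap i) false (t i false) ^+ 2) <= B) ->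
  forall k c, F1 k c 0 = 0.
Proof.
move=> c1 d1 HB k c.
have [M M0 HM] := @Phi_bounded R T L T_gt0 Phi Phi_continuous.
have B0 : 0 <= B.
  apply: le_trans (HB _ _ (@boxfreq2_inj 0) (fun _ _ => 0) _); last by move=> _ _; rewrite lexx ltW.
  by apply: sumr_ge0 => i _; rewrite mulr_ge0 ?addr_ge0 ?sqr_ge0// exprn_ge0// ltW// wgt_gt0.
have T0 : 0 <= (0 : R) <= T by rewrite lexx ltW.
have oP0 := Phi_oint T_gt0 L_gt0 Phi_continuous Phi_meas T0.
pose C := 2 * L ^- 2 * Num.sqrt (latC L * B).
pose dP t z := Phi t z + (-1) * Phi 0 z.
have odP t : 0 <= t <= T -> oint L (dP t).
  by move=> tT; apply: ointD; [exact: (Phi_oint T_gt0 L_gt0 Phi_continuous Phi_meas tT)|exact: ointZ].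
have mvt (k' : kk) (c' : bool) t : 0 <= t <= T -> exists2 s, 0 <= s <= T & cf (dP t) k' c'%:R (~~ c')%:R = t * F1 k' c' s.
  move=> tT; have oPt := Phi_oint T_gt0 L_gt0 Phi_continuous Phi_meas tT.
  have [t0 tT'] := andP tT.
  have [s /andP[s0 st] e] := MVT_inner (@fc k' c'%:R (~~ c')%:R) (d1 k' c') (lexx 0) t0 tT'.
  exists s; first by rewrite s0 (le_trans st).
  by rewrite cfD ?cfZ//; [rewrite mulN1r; move: e; rewrite /f subr0 => ->; rewrite mulrC|exact: ointZ].
have lip t z : 0 <= t <= T -> Om z -> `|dP t z| <= t * C.
  move=> tT Oz; have [t0 _] := andP tT.
  have cv : fejer L n.+1 (dP t) z @[n --> \oo] --> dP t z.
    apply: (@fejer_cvg R L L_gt0 (dP t) z (2 * M)) => //; first exact: odP.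
      move=> w Ow; rewrite /dP mulN1r (le_trans (ler_normB _ _))//.
      by have := HM _ _ tT Ow; have := HM _ _ T0 Ow; lra.
    move=> e e0; have e2 : 0 < e / 2 by lra.
    have [x x0 hx] := Phi_cont_at T_gt0 Phi_continuous z tT e2.
    have [y y0 hy] := Phi_cont_at T_gt0 Phi_continuous z T0 e2.
    exists (Num.min x y); first by rewrite lt_min x0.
    move=> w; rewrite !lt_min => /andP[w1 w1'] /andP[w2 w2'].
    have := hx w w1 w2; have := hy w w1' w2'.
    have -> : dP t w - dP t z = (Phi t w - Phi t z) - (Phi 0 w - Phi 0 z) by rewrite /dP; ring.
    by have := ler_normB (Phi t w - Phi t z) (Phi 0 w - Phi 0 z); lra.
  apply: cvg_norm_le cv _ => n.
  pose s i (c' : bool) := s2val (cid2 (mvt (@boxfreq2 n.+1 i) c' t tT)).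
  have sT i (c' : bool) : 0 <= s i c' <= T by rewrite /s; case: cid2.
  have sE i (c' : bool) : cf (dP t) (@boxfreq2 n.+1 i) c'%:R (~~ c')%:R = t * F1 (@boxfreq2 n.+1 i) c' (s i c').
    by rewrite /s; case: cid2.
  (* Cauchy-Schwarz leaves the sum of [wgt ^- 6], which is at most that of [wgt ^- 2]. *)
  have key (c' : bool) : \sum_i `|F1 (@boxfreq2 n.+1 i) c' (s i c')| <= Num.sqrt (latC L * B).
    rewrite -[leLHS]ger0_norm ?sumr_ge0// -sqrtr_sqr ler_wsqrtr//.
    have -> : \sum_i `|F1 (@boxfreq2 n.+1 i) c' (s i c')| =
      \sum_i wgt (@boxfreq2 n.+1 i) ^- 3 * (wgt (@boxfreq2 n.+1 i) ^+ 3 * `|F1 (@boxfreq2 n.+1 i) c' (s i c')|).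
      by apply: eq_bigr => i _; rewrite mulrA mulVf ?mul1r// expf_neq0// gt_eqF// wgt_gt0.
    apply: (le_trans (sqr_sum_le _ _)); apply: ler_pM.
    - by apply: sumr_ge0 => i _; exact: sqr_ge0.
    - by apply: sumr_ge0 => i _; exact: sqr_ge0.
    - apply: le_trans (lattice_sum L_gt0 (@boxfreq2_inj n.+1)); apply: ler_sum => i _.
      have w0 := wgt_gt0 L (@boxfreq2 n.+1 i).
      rewrite -exprVn -exprM -exprVn; apply: ler_wiXn2l => //; first by rewrite invr_ge0 ltW.
      by rewrite invf_le1// wgt_ge1.
    - apply: le_trans (HB _ _ (@boxfreq2_inj n.+1) s sT); apply: ler_sum => i _.
      rewrite exprMn real_normK ?num_real// -exprM; apply: ler_wpM2l.
        by rewrite exprn_ge0// ltW// wgt_gt0.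
      by case: c'; [rewrite lerDl sqr_ge0|rewrite lerDr sqr_ge0].
  have L2 : 0 <= L ^- 2 by rewrite invr_ge0 sqr_ge0.
  rewrite /fejer normrM (ger0_norm L2).
  have : `|\sum_i rho n.+1 (@boxfreq2 n.+1 i) * tm (@boxfreq2 n.+1 i) (cf (dP t) (@boxfreq2 n.+1 i) 1 0) (cf (dP t) (@boxfreq2 n.+1 i) 0 1) z|
    <= t * (Num.sqrt (latC L * B) + Num.sqrt (latC L * B)).
    apply: (@le_trans _ _ (t * (\sum_i `|F1 (@boxfreq2 n.+1 i) true (s i true)| + \sum_i `|F1 (@boxfreq2 n.+1 i) false (s i false)|))); last first.
      by apply: ler_wpM2l => //; apply: lerD; exact: key.
    rewrite -big_split/= mulr_sumr (le_trans (ler_norm_sum _ _ _))//; apply: ler_sum => i _.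
    have /andP[r0 r1] := rho_bound L_gt0 (ltn0Sn n) i.
    rewrite normrM (ger0_norm r0).
    apply: (@le_trans _ _ `|tm (@boxfreq2 n.+1 i) (cf (dP t) (@boxfreq2 n.+1 i) 1 0) (cf (dP t) (@boxfreq2 n.+1 i) 0 1) z|).
      by rewrite ler_piMl.
    rewrite (le_trans (tmode_le _ _ _ _ _))// mulrDr.
    have := sE i true; have := sE i false; rewrite /= => -> ->.
    by rewrite !normrM (ger0_norm t0).
  by move=> h; have := ler_wpM2l L2 h; rewrite /C; lra.
pose t_ n : R := T / n.+1%:R.
have t_p n : 0 < t_ n by rewrite divr_gt0// ltr0n.
have t_T n : 0 <= t_ n <= T.
  by rewrite (ltW (t_p n))/= ler_pdivrMr ?ltr0n// ler_peMr ?ler1n// ltW.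
have ct : t_ n @[n --> \oo] --> (0 : R).
  by rewrite -[X in _ --> X](mulr0 T); apply: cvgMr; exact: cvg_harmonic.
pose g_ n z := (t_ n)^-1 * dP (t_ n) z.
have og n : oint L (g_ n) by apply: ointZ; exact: odP.
have x1 : cf (g_ n) k c%:R (~~ c)%:R @[n --> \oo] --> cf (fun=> 0) k c%:R (~~ c)%:R.
  apply: (@cf_dominated _ L L_gt0 g_ _ C) => //.
  - by apply: (@integrable_bounded _ _ _ nu Om mOm (fun=> 0) 0 (Omega_fin L_gt0)) => // z _; rewrite normr0.
  - move=> n z Oz; rewrite /g_ normrM gtr0_norm ?invr_gt0// mulrC ler_pdivrMr// mulrC.
    exact: lip.
  - move=> z Oz; have /cvg_at_rightP H := Phi_t0 z.
    have -> : (fun n => g_ n z) = (fun n => (Phi (t_ n) z - Phi 0 z) / t_ n).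
      by apply/funext => n; rewrite /g_ /dP mulN1r mulrC.
    by apply: H; split.
have z0 : cf (fun=> 0) k c%:R (~~ c)%:R = 0.
  rewrite /cf; under eq_Rintegral do rewrite mul0r.
  by rewrite (Rintegral_cst _ mOm) mul0r.
rewrite z0 in x1.
(* By the mean value theorem the same coefficient is [F1] at a time between 0 and [t_ n], so it also
   tends to [F1 k c 0]. *)
have x2 : cf (g_ n) k c%:R (~~ c)%:R @[n --> \oo] --> F1 k c 0.
  apply/cvgrPdist_lt => e e0.
  have [x xp hx] := (icontP T (F1 k c)).1 (c1 k c) 0 T0 e e0.
  have ct' : \forall n \near \oo, t_ n < x by apply: (cvgr_lt _ ct).
  near=> n.
  have [t0 tT'] := andP (t_T n).
  have [s /andP[s0 st] es] := MVT_inner (@fc k c%:R (~~ c)%:R) (d1 k c) (lexx 0) t0 tT'.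
  have oPt := Phi_oint T_gt0 L_gt0 Phi_continuous Phi_meas (t_T n).
  have -> : cf (g_ n) k c%:R (~~ c)%:R = F1 k c s.
    rewrite /g_ cfZ ?odP// cfD ?cfZ//; last exact: ointZ.
    by rewrite mulN1r; move: es; rewrite /f subr0 => ->; rewrite mulrCA mulVf ?mulr1// gt_eqF.
  rewrite distrC; apply: hx; first by rewrite s0 (le_trans st).
  rewrite subr0 ger0_norm//; apply: (le_lt_trans st); near: n; exact: ct'.
by apply/esym; exact: (cvg_unique _ x1 x2).
Unshelve. all: by end_near. Qed.

Theorem fourier_data : exists (F1 F2 F3 P2 P4 : kk -> bool -> R -> R) (M : R),
  spectral T L alpha beta M (fun k c t => cc L (Phi t) k c) F1 F2 F3 P2 P4
    (fun k c t => cc L (fun z => Phi t z ^+ 3) k c).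
Proof.
have [V2 HV2] := Phi_H2H6; have [V4 HV4] := Phi_H4L2.
have [w2 s2] := HV2 2%N (leqnn _); have [w4 s4] := HV4 4%N (leqnn _).
have reg k (c : bool) := cid (coef_regularity k c%:R (~~ c)%:R w2 w4).
pose F1 k c := (projT1 (reg k c)).1.1; pose F2 k c := (projT1 (reg k c)).1.2; pose F3 k c := (projT1 (reg k c)).2.
pose P2 k (c : bool) := prim (fun t => vcoef T L (V2 2%N) k c%:R (~~ c)%:R t ^+ 2).
pose P4 k (c : bool) := prim (fun t => vcoef T L (V4 4%N) k c%:R (~~ c)%:R t ^+ 2).
have spec k c := projT2 (reg k c).
have c1 k c : icont T (F1 k c) by have [[]] := spec k c.
have c2 k c : icont T (F2 k c) by have [[]] := spec k c.
have c3 k c : icont T (F3 k c) by have [[]] := spec k c.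
have d0 k (c : bool) (t : R) : 0 < t < T -> is_derive t 1 (f k c%:R (~~ c)%:R) (F1 k c t).
  by move=> tT; have [_ /(_ t tT)[]] := spec k c.
have d1 k (c : bool) (t : R) : 0 < t < T -> is_derive t 1 (F1 k c) (F2 k c t).
  by move=> tT; have [_ /(_ t tT)[]] := spec k c.
have d2 k (c : bool) (t : R) : 0 < t < T -> is_derive t 1 (F2 k c) (F3 k c t).
  by move=> tT; have [_ /(_ t tT)[]] := spec k c.
have i2 k c x y : 0 <= x -> x <= y -> y <= T -> (F1 k c y - F1 k c x) ^+ 2 <= (y - x) * (P2 k c y - P2 k c x).
  by have [_ _ h _] := spec k c; exact: h.
have i4 k c x y : 0 <= x -> x <= y -> y <= T -> (F3 k c y - F3 k c x) ^+ 2 <= (y - x) * (P4 k c y - P4 k c x).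
  by have [_ _ _ h] := spec k c; exact: h.
have [M0 hM0] := @Linf_sobolev _ T L T_gt0 L_gt0 Phi 4 Phi_LinfH8 (fun k a b => @fc k a b).
have [M2 hM2] := @L2_sobolev _ T L L_gt0 (V2 2%N) 3 s2.
have [M4 hM4] := @L2_sobolev _ T L L_gt0 (V4 4%N) 0 s4.
have [_ h2 _] := w2; have [_ h4 _] := w4.
have m2 k c : {homo P2 k c : x y / x <= y}.
  by apply: prim_homo => [|t]; [exact: vcoef_sqr_int|exact: sqr_ge0].
have m4 k c : {homo P4 k c : x y / x <= y}.
  by apply: prim_homo => [|t]; [exact: vcoef_sqr_int|exact: sqr_ge0].
have z2 k c : P2 k c 0 = 0 by exact: prim0.
have z4 k c : P4 k c 0 = 0 by exact: prim0.
have S2 (I : finType) (kap : I -> kk) : injective kap ->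
    \sum_i wgt (kap i) ^+ 6 * (P2 (kap i) true T + P2 (kap i) false T) <= M2 by exact: hM2.
exists F1, F2, F3, P2, P4, (Num.max M0 (Num.max M2 M4)).
split=> //.
- by move=> k c; exact: fc.
- by move=> I kap ki t tT; rewrite le_max (hM0 I kap ki t tT).
- by move=> I kap ki; rewrite !le_max S2// orbT.
- move=> I kap ki; rewrite !le_max; have := hM4 I kap ki.
  by under eq_bigr do rewrite expr0 mul1r; move=> ->; rewrite !orbT.
- by move=> k c t tT; apply: (coef_pde (c1 k c) (c2 k c)).
apply: (@coef_init F1 (4 * T ^- 2 * (M0 + M0) + 2 * T * M2)) => // I kap ki t tT.
have T0 : 0 <= (0 : R) <= T by rewrite lexx ltW.
have TT : 0 <= T <= T by rewrite lexx ltW.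
(* At some time of [[0, T]] the derivative is the difference quotient of the end values; from there
   [P2] controls it at all other times. *)
have bd k c s : 0 <= s <= T -> F1 k c s ^+ 2 <= 4 * T ^- 2 * (f k c%:R (~~ c)%:R T ^+ 2 + f k c%:R (~~ c)%:R 0 ^+ 2) + 2 * T * P2 k c T.
  move=> /andP[s0 sT].
  have [r /andP[r0 rT] e] := MVT_inner (@fc k c%:R (~~ c)%:R) (d0 k c) (lexx 0) (ltW T_gt0) (lexx T).
  have p2 : (F1 k c s - F1 k c r) ^+ 2 <= T * P2 k c T.
    have mono x y : 0 <= x -> x <= y -> y <= T -> (y - x) * (P2 k c y - P2 k c x) <= T * P2 k c T.
      move=> x0 xy yT; apply: ler_pM; rewrite ?subr_ge0//; [exact: m2|lra|].
      have := m2 k c 0 x x0; have := m2 k c y T yT; rewrite z2; lra.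
    have [sr|/ltW rs] := leP s r; last exact: le_trans (i2 _ _ _ _ r0 rs sT) (mono _ _ r0 rs sT).
    rewrite -sqrrN opprB; exact: le_trans (i2 _ _ _ _ s0 sr rT) (mono _ _ s0 sr rT).
  have er : F1 k c r = (f k c%:R (~~ c)%:R T - f k c%:R (~~ c)%:R 0) / T.
    by rewrite e subr0 mulfK// gt_eqF.
  have r2 : F1 k c r ^+ 2 <= 2 * T ^- 2 * (f k c%:R (~~ c)%:R T ^+ 2 + f k c%:R (~~ c)%:R 0 ^+ 2).
    rewrite er exprMn exprVn; have Ti : 0 <= T ^- 2 by rewrite invr_ge0 sqr_ge0.
    have := ler_wpM2l Ti (_ : (f k c%:R (~~ c)%:R T - f k c%:R (~~ c)%:R 0) ^+ 2 <= 2 * (f k c%:R (~~ c)%:R T ^+ 2 + f k c%:R (~~ c)%:R 0 ^+ 2)).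
    move=> /(_ _)/le_trans h; rewrite mulrC; apply: h; last by rewrite mulrCA mulrA.
    by have := sqr_ge0 (f k c%:R (~~ c)%:R T + f k c%:R (~~ c)%:R 0); lra.
  by have := sqr_ge0 (F1 k c s - 2 * F1 k c r); lra.
pose h0 i := wgt (kap i) ^+ 8 * (f (kap i) 1 0 T ^+ 2 + f (kap i) 0 1 T ^+ 2) + wgt (kap i) ^+ 8 * (f (kap i) 1 0 0 ^+ 2 + f (kap i) 0 1 0 ^+ 2).
apply: (@le_trans _ _ (\sum_i (4 * T ^- 2 * h0 i + 2 * T * (wgt (kap i) ^+ 6 * (P2 (kap i) true T + P2 (kap i) false T))))).
  apply: ler_sum => i _.
  have w1 := wgt_ge1 L (kap i); have w0 := wgt_gt0 L (kap i).
  have w6 : 0 <= wgt (kap i) ^+ 6 by rewrite exprn_ge0// ltW.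
  have w68 : wgt (kap i) ^+ 6 <= wgt (kap i) ^+ 8 by rewrite ler_weXn2l.
  have b1 := ler_wpM2l w6 (bd (kap i) true _ (tT i true)).
  have b2 := ler_wpM2l w6 (bd (kap i) false _ (tT i false)).
  rewrite /= in b1 b2.
  have Ti : 0 <= 4 * T ^- 2 by rewrite mulr_ge0// invr_ge0 sqr_ge0.
  set A := f (kap i) 1 0 T ^+ 2 + f (kap i) 1 0 0 ^+ 2 in b1; set B := f (kap i) 0 1 T ^+ 2 + f (kap i) 0 1 0 ^+ 2 in b2.
  have A0 : 0 <= A + B by rewrite !addr_ge0 ?sqr_ge0.
  have w68A := ler_wpM2l Ti (ler_wpM2r A0 w68).
  have -> : h0 i = wgt (kap i) ^+ 8 * (A + B) by rewrite /h0 /A /B; ring.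
  lra.
rewrite big_split/= -!mulr_sumr /h0 big_split/=.
apply: lerD; last by apply: ler_wpM2l; [rewrite mulr_ge0// ltW|exact: S2].
apply: ler_wpM2l; first by rewrite mulr_ge0// invr_ge0 sqr_ge0.
by apply: lerD; exact: hM0.
Qed.

End FourierData.

(** * Convergence of the scheme *)

Section GridFunctions.
Context {R : realType} (N : nat) (h : R).
Hypotheses (N_gt0 : (0 < N)%N) (h_gt0 : 0 < h).
Let T : finType := ('I_N * 'I_N)%type.
Let V : lmodType R := (T -> R^o).

Definition gr (f : int -> int -> R) : V := fun p => f (p.1.+1)%:Z (p.2.+1)%:Z.

Let per_next (F : int -> R) : (forall i, F (i + N%:Z) = F i) -> forall i : 'I_N,
  F ((i.+1)%:Z + 1) = F ((ordS i).+1)%:Z /\ F ((i.+1)%:Z - 1) = F ((ord_pred i).+1)%:Z.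
Proof.
move=> per i; have iN := ltn_ord i; split.
  rewrite /= ; have [e|e] := eqVneq i.+1 N.
    by rewrite e modnn -(per 1); congr F; lia.
  by rewrite modn_small; [congr F; lia|lia].
rewrite /=; have [e|e] := eqVneq (val i) 0%N.
  rewrite /= in e; rewrite e add0n modn_small; last by lia.
  by rewrite -(per (1%:Z - 1)); congr F; lia.
have e1 : ((i + N).-1 %% N = i.-1)%N.
  by rewrite (_ : (i + N).-1 = i.-1 + N)%N; [rewrite modnDr modn_small//; lia|rewrite /= in e; lia].
by rewrite e1; congr F; rewrite /= in e; lia.
Qed.

Lemma gr_shift (f : int -> int -> R) : grid_periodic N f -> forall p : T,
  [/\ f ((p.1.+1)%:Z + 1) (p.2.+1)%:Z = gr f (shx p), f ((p.1.+1)%:Z - 1) (p.2.+1)%:Z = gr f (shx' p),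
      f (p.1.+1)%:Z ((p.2.+1)%:Z + 1) = gr f (shy p) & f (p.1.+1)%:Z ((p.2.+1)%:Z - 1) = gr f (shy' p)].
Proof.
move=> per p.
have [a b] := @per_next (fun i => f i (p.2.+1)%:Z) (fun i => (per i _).1) p.1.
by have [c d] := @per_next (fun j => f (p.1.+1)%:Z j) (fun j => (per _ j).2) p.2.
Qed.

Lemma dlap_periodic (K : fieldType) (x : K) (f : int -> int -> K) : grid_periodic N f -> grid_periodic N (dlap x f).
Proof.
move=> per i j; rewrite /dlap; split.
  have e a b : f (i + N%:Z + a) b = f (i + a) b by rewrite addrAC (per _ _).1.
  by rewrite !e -[f (i + N%:Z) _]/(f (i + N%:Z) _) !(per i _).1.
have e a b : f b (j + N%:Z + a) = f b (j + a) by rewrite addrAC (per _ _).2.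
by rewrite !e !(per _ j).2.
Qed.

Lemma gr_dlap f : grid_periodic N f -> gr (dlap h f) = - gA h (gr f) :> V.
Proof.
move=> per; apply/funext => p; rewrite gev gAE /gr /dlap/= /tlap /sdiff.
have [-> -> -> ->] := gr_shift per p; rewrite /gr; field.
by rewrite gt_eqF.
Qed.

Lemma sum_grid (F : int -> int -> R) :
  \sum_(1 <= i < N.+1) \sum_(1 <= j < N.+1) F i%:Z j%:Z = \sum_(p : T) F (p.1.+1)%:Z (p.2.+1)%:Z.
Proof.
rewrite big_add1/= big_mkord.
transitivity (\sum_(i < N) \sum_(j < N) F (i.+1)%:Z (j.+1)%:Z).
  by apply: eq_bigr => i _; rewrite big_add1 big_mkord.
by rewrite pair_bigA.
Qed.

Local Open Scope complex_scope.
Local Notation normc := ComplexField.Normc.normc.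

Lemma sqr_normc (x y : R) : normc (x +i* y) ^+ 2 = x ^+ 2 + y ^+ 2.
Proof. by rewrite /= sqr_sqrtr// addr_ge0 ?sqr_ge0. Qed.

Variables (re im : int -> int -> R).
Hypotheses (re_per : grid_periodic N re) (im_per : grid_periodic N im).
Let z i j : R[i] := re i j +i* im i j.

Lemma real_invc (x : R) : (x%:C)^-1 = (x^-1)%:C :> R[i].
Proof. by rewrite -fmorphV. Qed.

Lemma dlap_complex i j : dlap h%:C z i j = dlap h re i j +i* dlap h im i j.
Proof.
rewrite /dlap /z -rmorphXn/= real_invc.
have -> : 4 = (4 : R)%:C by rewrite rmorph_nat.
by apply/eqP; rewrite eq_complex /=; apply/andP; split; apply/eqP; ring.
Qed.

Lemma gnorm2_complex : gnorm2 N h z = Num.sqrt (gip h (gr re) (gr re) + gip h (gr im) (gr im)).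
Proof.
rewrite /gnorm2; congr Num.sqrt.
under eq_bigr => i _ do under eq_bigr => j _ do rewrite sqr_normc.
rewrite (sum_grid (fun i j => re i j ^+ 2 + im i j ^+ 2)) big_split/= mulrDr /gip.
by congr (_ * _ + _ * _); apply: eq_bigr => p _; rewrite /gr expr2.
Qed.

Lemma ggradnorm2_complex : ggradnorm2 N h z =
  Num.sqrt (gip h (gr re) (gA h (gr re)) + gip h (gr im) (gA h (gr im))).
Proof.
rewrite /ggradnorm2; congr Num.sqrt.
have dx i j : Dx h%:C z i j = ((re (i + 1) j - re i j) / h) +i* ((im (i + 1) j - im i j) / h).
  rewrite /Dx /z real_invc; apply/eqP; rewrite eq_complex /=; apply/andP; split; apply/eqP; ring.
have dy i j : Dy h%:C z i j = ((re i (j + 1) - re i j) / h) +i* ((im i (j + 1) - im i j) / h).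
  rewrite /Dy /z real_invc; apply/eqP; rewrite eq_complex /=; apply/andP; split; apply/eqP; ring.
under eq_bigr => i _ do under eq_bigr => j _ do rewrite dx dy !sqr_normc.
rewrite (sum_grid (fun i j => ((re (i + 1) j - re i j) / h) ^+ 2 + ((im (i + 1) j - im i j) / h) ^+ 2
   + (((re i (j + 1) - re i j) / h) ^+ 2 + ((im i (j + 1) - im i j) / h) ^+ 2))).
have gE (f : V) : gip h f (gA h f) = h ^+ 2 * (\sum_p fdiff shx h f p ^+ 2 + \sum_p fdiff shy h f p ^+ 2).
  exact: gip_gradE.
rewrite !gE -[RHS]mulrDr; congr (_ * _); rewrite -!big_split/=; apply: eq_bigr => p _.
have [-> _ -> _] := gr_shift re_per p; have [-> _ -> _] := gr_shift im_per p.
by rewrite /fdiff /gr; ring.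
Qed.

End GridFunctions.

Section SchemeOnGrid.
Context {R : realType} (N : nat) (h s alpha beta : R).
Hypotheses (N_gt0 : (0 < N)%N) (h_gt0 : 0 < h).
Let T : finType := ('I_N * 'I_N)%type.
Let V : lmodType R := (T -> R^o).
Local Notation gr := (@gr R N).

(** Periodicity makes the index shifts cyclic, and [mu] is eliminated; signs change because [gA] is
    minus [dlap]. *)
Lemma scheme_grid_step (phim phi psi phip psip : int -> int -> R) :
  grid_periodic N phim -> grid_periodic N phi -> grid_periodic N phip ->
  scheme_step N h s alpha beta phim phi psi phip psip ->
  grid_step h alpha beta s (gr phim : V) (gr phi) (gr psi) (gr phip) (gr psip).
Proof.
move=> p1 p2 p3 [mu [pmu H]].
pose hf i j := (phip i j + phi i j) / 2.
pose ht i j := (3 * phi i j - phim i j) / 2.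
have ph : grid_periodic N hf by move=> i j; rewrite /hf (p3 i j).1 (p2 i j).1 (p3 i j).2 (p2 i j).2.
have pt : grid_periodic N ht by move=> i j; rewrite /ht (p1 i j).1 (p2 i j).1 (p1 i j).2 (p2 i j).2.
have ehf : gr hf = (2^-1 *: (gr phip + gr phi) : V).
  by apply/funext => p; rewrite /gr !gev mulrC.
have eht : gr ht = (2^-1 *: (3 *: gr phi - gr phim) : V).
  by apply/funext => p; rewrite /gr !gev mulrC.
have emu : gr mu = (gchi (gr phip : V) (gr phi) + alpha *: (2^-1 *: (gr phip + gr phi))
        - 2 *: gA h (2^-1 *: (3 *: gr phi - gr phim)) + gA h (gA h (2^-1 *: (gr phip + gr phi))) : V).
  rewrite -ehf -eht; apply/funext => p; rewrite /gr !gev.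
  have [_ -> _] := H (p.1.+1)%:Z (p.2.+1)%:Z.
  have e1 := congr1 (fun F : V => F p) (gr_dlap N_gt0 h_gt0 pt).
  have e2 := congr1 (fun F : V => F p) (gr_dlap N_gt0 h_gt0 (dlap_periodic h ph)).
  rewrite (gr_dlap N_gt0 h_gt0 ph) gAN opprK in e2.
  rewrite /gr !gev in e1 e2.
  rewrite -/(hf _) -/ht in e1 e2 *.
  by rewrite e1 e2 /gchi /chi /hf; ring.
split; apply/funext => p.
  have [e _ _] := H (p.1.+1)%:Z (p.2.+1)%:Z.
  have e1 := congr1 (fun F : V => F p) (gr_dlap N_gt0 h_gt0 pmu).
  rewrite -emu; rewrite /gr !gev in e1 *.
  by rewrite e e1; ring.
have [_ _ e] := H (p.1.+1)%:Z (p.2.+1)%:Z.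
by rewrite /gr !gev e; ring.
Qed.

End SchemeOnGrid.

Section ComplexProjection.
Context {R : realType} (L : R) (N : nat).
Hypotheses (L_gt0 : 0 < L) (N_gt0 : (0 < N)%N).
Local Open Scope complex_scope.

Lemma fourier_coefE (u : R * R -> R) (k l : int) : oint L u ->
  fourier_coef L u k l = (L ^- 2 * cf L u (k, l) 1 0) +i* - (L ^- 2 * cf L u (k, l) 0 1).
Proof.
move=> iu; rewrite /fourier_coef /cintegral.
have -> : (\int[mu2]_(z in Omega L) complex.Re ((u z)%:C * cexpi (- phase L k l z)))%R = cf L u (k, l) 1 0.
  by apply: eq_Rintegral => z _; rewrite /cexpi /tmode/= cosN; ring.
have -> : (\int[mu2]_(z in Omega L) complex.Im ((u z)%:C * cexpi (- phase L k l z)))%R = - cf L u (k, l) 0 1.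
  rewrite -mulN1r -cfZ//; apply: eq_Rintegral => z _; rewrite /cexpi /tmode/= sinN; ring.
by apply/eqP; rewrite eq_complex /=; apply/andP; split; apply/eqP; ring.
Qed.

Lemma fourier_projE (u : R * R -> R) z : oint L u ->
  fourier_proj L N u z = projW L N (fun=> 1) u z +i* projIm L N u z.
Proof.
move=> iu; have e a b : fourier_coef L u (freq N a) (freq N b) * cexpi (phase L (freq N a) (freq N b) z) =
  (L ^- 2 * tmode L (freq N a, freq N b) (cf L u (freq N a, freq N b) 1 0) (cf L u (freq N a, freq N b) 0 1) z) +i*
  (L ^- 2 * tmode L (freq N a, freq N b) (- cf L u (freq N a, freq N b) 0 1) (cf L u (freq N a, freq N b) 1 0) z).
  by rewrite fourier_coefE// /cexpi /tmode/=; apply/eqP; rewrite eq_complex /=; apply/andP; split; apply/eqP; ring.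
rewrite /fourier_proj big_mkord.
under eq_bigr do rewrite big_mkord.
rewrite pair_bigA/=.
under eq_bigr do rewrite e.
rewrite /projW /projIm !mulr_sumr.
have cs (I : Type) (r : seq I) (F G : I -> R) : \sum_(i <- r) (F i +i* G i) = (\sum_(i <- r) F i) +i* (\sum_(i <- r) G i).
  elim: r => [|x r IH]; first by rewrite !big_nil.
  by rewrite !big_cons IH.
rewrite cs; congr (_ +i* _); apply: eq_bigr => -[i j] _; rewrite /kapN/=; by rewrite ?mul1r.
Qed.

End ComplexProjection.

(** * Time discretisation defects of a single mode *)

Section ModeDefects.
Context {R : realType}.
Local Notation kk := (int * int)%type.
Variables (T L alpha beta M : R) (F0 F1 F2 F3 P2 P4 G : kk -> bool -> R -> R).
Hypotheses (T_gt0 : 0 < T) (L_gt0 : 0 < L).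
Hypothesis sp : spectral T L alpha beta M F0 F1 F2 F3 P2 P4 G.
Variables (s : R) (n : nat).
Hypotheses (s_gt0 : 0 < s) (nT : n%:R * s <= T).
Local Notation wgt := (wgt L).
Local Notation tau j := (j%:R * s).

Let c0 k c : icont T (F0 k c). Proof. by case: sp. Qed.
Let c1 k c : icont T (F1 k c). Proof. by case: sp. Qed.
Let c2 k c : icont T (F2 k c). Proof. by case: sp. Qed.
Let c3 k c : icont T (F3 k c). Proof. by case: sp. Qed.
Let d0 k c (t : R) : 0 < t < T -> is_derive t 1 (F0 k c) (F1 k c t). Proof. by case: sp => *; auto. Qed.
Let d1 k c (t : R) : 0 < t < T -> is_derive t 1 (F1 k c) (F2 k c t). Proof. by case: sp => *; auto. Qed.
Let d2 k c (t : R) : 0 < t < T -> is_derive t 1 (F2 k c) (F3 k c t). Proof. by case: sp => *; auto. Qed.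
Let m2 k c : {homo P2 k c : x y / x <= y}. Proof. by case: sp. Qed.
Let m4 k c : {homo P4 k c : x y / x <= y}. Proof. by case: sp. Qed.
Let z2 k c : P2 k c 0 = 0. Proof. by case: sp. Qed.
Let z4 k c : P4 k c 0 = 0. Proof. by case: sp. Qed.
Let in0 k c : F1 k c 0 = 0. Proof. by case: sp. Qed.
Let i2 k c (x y : R) : 0 <= x -> x <= y -> y <= T ->
  (F1 k c y - F1 k c x) ^+ 2 <= (y - x) * (P2 k c y - P2 k c x).
Proof. by case: sp => *; auto. Qed.
Let i4 k c (x y : R) : 0 <= x -> x <= y -> y <= T ->
  (F3 k c y - F3 k c x) ^+ 2 <= (y - x) * (P4 k c y - P4 k c x).
Proof. by case: sp => *; auto. Qed.

(** Plays for the third derivatives the role of [P2] and [P4]; [spectral] has no such weight, as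
    third derivatives are reached only by interpolation. *)
Definition Q3 (k : kk) (c : bool) (t : R) : R := prim (fun t => F3 k c t ^+ 2) t.

Lemma tau_in j : (j <= n)%N -> 0 <= tau j <= T.
Proof.
move=> jn; have ? := ltW s_gt0; apply/andP; split; first exact: mulr_ge0.
by apply: le_trans nT; rewrite ler_pM2r// ler_nat.
Qed.

Lemma tauS j : tau j.+1 = tau j + s.
Proof. by rewrite -natr1; ring. Qed.

Lemma Q3_increment k c x y : 0 <= x -> x <= y -> y <= T ->
  (F2 k c y - F2 k c x) ^+ 2 <= (y - x) * (Q3 k c y - Q3 k c x).
Proof.
move=> x0 xy yT.
have i3 : iint T (F3 k c) by apply: icont_iint; exact: c3.
have i32 : iint T (fun t => F3 k c t ^+ 2).
  by apply: icont_iint; apply: icontM; exact: c3.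
have <- : prim (F3 k c) y - prim (F3 k c) x = F2 k c y - F2 k c x.
  rewrite (prim_diff (T := T))//.
  by apply: (FTC2_inner (T := T)) => // t tT; exact: d2.
exact: (prim_increment (T := T)).
Qed.

Lemma Q3_mono k c x y : 0 <= x -> x <= y -> y <= T -> Q3 k c x <= Q3 k c y.
Proof.
move=> x0 xy yT; rewrite -subr_ge0 /Q3 (prim_diff (T := T))//.
  by apply: Rintegral_ge0 => t _; exact: sqr_ge0.
by apply: icont_iint; apply: icontM; exact: c3.
Qed.

Lemma Q3_0 k c : Q3 k c 0 = 0. Proof. exact: prim0. Qed.

(** [interpolation] with [w = wgt k ^+ 3], the weight of the H^3 norm of the defect: its square is
    the weight 6 that two time derivatives in H^6 allow, and four time derivatives in L^2 carry
    none. *)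
Lemma Q3_weighted k c :
  wgt k ^+ 3 * Q3 k c T <= 432 * (1 + T ^- 2) * (wgt k ^+ 6 * P2 k c T) + 2 * P4 k c T.
Proof.
have w1 : 1 <= wgt k ^+ 3 by rewrite exprn_ege1// wgt_ge1.
have := @interpolation R T T_gt0 _ _ _ _ _ (@c1 k c) (@c2 k c) (@c3 k c)
  (@d1 k c) (@d2 k c) (@m2 k c) (@m4 k c)
  (@i2 k c) (@i4 k c) _ w1.
by rewrite z2 z4 !subr0 -exprM/= -!mulrA.
Qed.

(** Trapezoidal defect in phi_t = psi; [dq] is its analogue in the momentum equation, and [dw] stems
    from extrapolating the explicit term. *)
Definition dX j (k : kk) (c : bool) : R :=
  s^-1 * (F0 k c (tau j.+1) - F0 k c (tau j)) - 2^-1 * (F1 k c (tau j.+1) + F1 k c (tau j)).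
Definition dq j (k : kk) (c : bool) : R :=
  s^-1 * (F1 k c (tau j.+1) - F1 k c (tau j)) - 2^-1 * (F2 k c (tau j.+1) + F2 k c (tau j)).
Definition dw j (k : kk) (c : bool) : R :=
  F0 k c (tau j.+1) - 2 * F0 k c (tau j) + F0 k c (tau j.-1).

Let scaled (x y K : R) : (x - s * y) ^+ 2 <= 4^-1 * s ^+ 5 * K -> (s^-1 * x - y) ^+ 2 <= 4^-1 * s ^+ 3 * K.
Proof.
move=> H; have -> : s^-1 * x - y = s^-1 * (x - s * y).
  by rewrite mulrBr mulrA mulVf ?gt_eqF// mul1r.
rewrite exprMn; apply: le_trans (_ : s^-1 ^+ 2 * (4^-1 * s ^+ 5 * K) <= _).
  by apply: ler_wpM2l => //; exact: sqr_ge0.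
by rewrite le_eqVlt; apply/orP; left; apply/eqP; field; rewrite gt_eqF.
Qed.

Let tau_lt j : (j < n)%N -> [/\ 0 <= tau j, tau j <= tau j.+1, tau j.+1 <= T & tau j.+1 - tau j = s].
Proof.
move=> jn; have /andP[a b] := tau_in (ltnW jn); have /andP[c d] := tau_in jn.
by split=> //; rewrite tauS; have s0 := s_gt0; [lra|ring].
Qed.

Lemma dX_le j k c : (j < n)%N ->
  dX j k c ^+ 2 <= 4^-1 * s ^+ 3 * (Q3 k c (tau j.+1) - Q3 k c (tau j)).
Proof.
move=> jn; have [a0 ab bT ba] := tau_lt jn.
apply: scaled; set K := Q3 k c (tau j.+1) - _.
have H (x y : R) : tau j <= x -> x <= y -> y <= tau j.+1 ->
    (F2 k c y - F2 k c x) ^+ 2 <= (tau j.+1 - tau j) * K.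
  move=> ax xy yb; have x0 := le_trans a0 ax; have yT := le_trans yb bT.
  apply: (le_trans (Q3_increment k c x0 xy yT)).
  have q1 := Q3_mono k c a0 ax (le_trans xy yT).
  have q2 := Q3_mono k c (le_trans x0 xy) yb bT.
  have q3 := Q3_mono k c x0 xy yT.
  by apply: ler_pM; rewrite ?subr_ge0 ?/K//; lra.
have := @quadrature R T _ _ _ _ _ K (@c0 k c) (@c1 k c) (@c2 k c)
   (@d0 k c) (@d1 k c) a0 ab bT H.
by rewrite ba.
Qed.

Lemma dq_le j k c : (j < n)%N ->
  dq j k c ^+ 2 <= 4^-1 * s ^+ 3 * (P4 k c (tau j.+1) - P4 k c (tau j)).
Proof.
move=> jn; have [a0 ab bT ba] := tau_lt jn.
apply: scaled; set K := P4 k c (tau j.+1) - _.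
have H (x y : R) : tau j <= x -> x <= y -> y <= tau j.+1 ->
    (F3 k c y - F3 k c x) ^+ 2 <= (tau j.+1 - tau j) * K.
  move=> ax xy yb; have x0 := le_trans a0 ax; have yT := le_trans yb bT.
  apply: (le_trans (@i4 k c x y x0 xy yT)).
  have q1 := @m4 k c _ _ ax; have q2 := @m4 k c _ _ yb; have q3 := @m4 k c _ _ xy.
  by apply: ler_pM; rewrite ?subr_ge0 ?/K//; lra.
have := @quadrature R T _ _ _ _ _ K (@c1 k c) (@c2 k c) (@c3 k c)
   (@d1 k c) (@d2 k c) a0 ab bT H.
by rewrite ba.
Qed.

Lemma step_le j k c : (j < n)%N ->
  (F0 k c (tau j.+1) - F0 k c (tau j)) ^+ 2 <= s ^+ 2 * (T * P2 k c T).
Proof.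
move=> jn; have [a0 ab bT ba] := tau_lt jn.
have := @first_difference R T _ _ _ (tau j) (tau j.+1) (@c0 k c) (@d0 k c)
  (@i2 k c) (@m2 k c) (in0 k c) (@z2 k c) a0 ab bT.
rewrite ba => H; apply: (le_trans H); apply: ler_wpM2l; first exact: sqr_ge0.
have p0 : 0 <= P2 k c (tau j.+1) by rewrite -(z2 k c); apply: m2; exact: le_trans ab.
by apply: ler_pM => //; [exact: le_trans ab|exact: m2].
Qed.

(** In the first step [j.-1] is [j], in accordance with phi^{-1} = phi^0, and a first difference
    remains; the vanishing initial velocity makes it as small as a second one. *)
Lemma dw_le j k c : (j < n)%N ->
  dw j k c ^+ 2 <= 2 * s ^+ 3 * (P2 k c (tau j.+1) - P2 k c (tau j.-1)).
Proof.
case: j => [|j] jn.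
  have [a0 ab bT ba] := tau_lt jn.
  have := @first_difference R T _ _ _ (tau 0%N) (tau 1%N) (@c0 k c) (@d0 k c)
    (@i2 k c) (@m2 k c) (in0 k c) (@z2 k c) a0 ab bT.
  have e0 : 0%:R * s = 0 by rewrite mul0r.
  have e1 : 1%:R * s = s by rewrite mul1r.
  rewrite ba /dw /= e0 e1 z2.
  have -> : F0 k c s - 2 * F0 k c 0 + F0 k c 0 = F0 k c s - F0 k c 0 by ring.
  have p0 : 0 <= P2 k c s by rewrite -(z2 k c); apply: m2; exact: ltW.
  have : 0 <= s ^+ 3 * P2 k c s by rewrite mulr_ge0// exprn_ge0// ltW.
  by have -> : s ^+ 2 * (s * P2 k c s) = s ^+ 3 * P2 k c s by [ring|]; lra.
have /andP[a b] := tau_in jn.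
have e1 : tau j.+2 = tau j.+1 + s by exact: tauS.
have e2 : tau j = tau j.+1 - s by rewrite (tauS j); ring.
rewrite /dw /= e1 e2; apply: (second_difference (@c0 k c) (@d0 k c) (@i2 k c) (@m2 k c)) => //.
  by rewrite -subr_ge0 -e2 mulr_ge0// ltW.
by rewrite -e1.
Qed.

End ModeDefects.

Lemma telescope1 (R : realType) (p : nat -> R) n : \sum_(j < n) (p j.+1 - p j) = p n - p 0%N.
Proof. by elim: n => [|n IH]; rewrite ?big_ord0 ?subrr// big_ord_recr/= IH; ring. Qed.

Lemma telescope2 (R : realType) (p : nat -> R) n :
  \sum_(j < n) (p j.+1 - p j.-1) = p n + p n.-1 - 2 * p 0%N.
Proof.
elim: n => [|n IH]; first by rewrite big_ord0/=; ring.
by rewrite big_ord_recr/= IH; ring.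
Qed.

Section GridPoly.
Context {R : realType} (L : R) (N : nat).
Hypotheses (L_gt0 : 0 < L) (N_gt0 : (0 < N)%N) (N_even : ~~ odd N).
Local Notation kk := (int * int)%type.
Local Notation wgt := (wgt L).
Let T2 : finType := ('I_N * 'I_N)%type.
Let V : lmodType R := (T2 -> R^o).
Let h := L / N%:R.
Let h_gt0 : 0 < h. Proof. by rewrite divr_gt0// ltr0n. Qed.
Local Notation d := (dsym N L).

Definition tot (Y : kk -> bool -> R) : R := \sum_(i : T2) (Y (kapN i) true + Y (kapN i) false).

Lemma tot_le X Y : (forall k c, X k c <= Y k c) -> tot X <= tot Y.
Proof. by move=> XY; apply: ler_sum => i _; exact: lerD. Qed.

Lemma tot_ge0 X : (forall k c, 0 <= X k c) -> 0 <= tot X.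
Proof. by move=> X0; apply: sumr_ge0 => i _; exact: addr_ge0. Qed.

Lemma totZ a X : tot (fun k c => a * X k c) = a * tot X.
Proof. by rewrite /tot mulr_sumr; apply: eq_bigr => i _; ring. Qed.

Lemma totD X Y : tot (fun k c => X k c + Y k c) = tot X + tot Y.
Proof. by rewrite /tot -big_split; apply: eq_bigr => i _ /=; ring. Qed.

Lemma tot_sum n (X : nat -> kk -> bool -> R) :
  \sum_(j < n) tot (X j) = tot (fun k c => \sum_(j < n) X j k c).
Proof.
by rewrite /tot exchange_big; apply: eq_bigr => i _ /=; rewrite big_split.
Qed.

Definition gpoly (X : kk -> bool -> R) : V := fun p =>
  L ^- 2 * tpoly L (@kapN N) (fun i => X (kapN i) true) (fun i => X (kapN i) false) (gpt L p).

Lemma gpoly_lin a b X Y :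
  gpoly (fun k c => a * X k c + b * Y k c) = a *: gpoly X + b *: gpoly Y.
Proof.
apply/funext => p; rewrite !gev /gpoly /tpoly !mulr_sumr -big_split/=.
by apply: eq_bigr => i _; rewrite /tmode; ring.
Qed.

Lemma gpolyD X Y : gpoly (fun k c => X k c + Y k c) = gpoly X + gpoly Y.
Proof.
rewrite -[gpoly X]scale1r -[gpoly Y]scale1r -gpoly_lin.
by congr gpoly; apply/funext => k; apply/funext => c; rewrite !mul1r.
Qed.

Lemma gpolyZ a X : gpoly (fun k c => a * X k c) = a *: gpoly X.
Proof.
rewrite -[RHS]addr0 -(scale0r (gpoly X)) -gpoly_lin.
by congr gpoly; apply/funext => k; apply/funext => c; rewrite mul0r addr0.
Qed.

Lemma gpolyA X : gA h (gpoly X) = gpoly (fun k c => d k * X k c).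
Proof.
rewrite gAE; apply/funext => p.
have -> : tlap h (gpoly X) p = L ^- 2 * tlap h (fun p => tpoly L (@kapN N) (fun i => X (kapN i) true) (fun i => X (kapN i) false) (gpt L p)) p.
  exact: tlapZ.
by rewrite tlap_tpoly.
Qed.

Lemma projW_gpoly w u p :
  projW L N w u (gpt L p) = gpoly (fun k c => w k * cc L u k c) p.
Proof.
rewrite /projW /gpoly /tpoly; congr (_ * _); apply: eq_bigr => i _.
by rewrite /tmode /cc/=; ring.
Qed.

Let sep (i j : T2) : i != j -> (0 < `|(ksub (kapN i) (kapN j)).1| < N)%N || (0 < `|(ksub (kapN i) (kapN j)).2| < N)%N.
Proof. exact: (kapN_sep L_gt0). Qed.

Let d0 k : 0 <= d k. Proof. exact: dsym_ge0. Qed.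
Let dl k : d k <= lam L k. Proof. exact: dsym_le. Qed.

Lemma gip_gpoly X : gip h (gpoly X) (gpoly X) <= L ^- 2 * tot (fun k c => X k c ^+ 2).
Proof.
have := grid_parseval N_gt0 L_gt0 sep (fun i => X (kapN i) true) (fun i => X (kapN i) false).
set A := \sum_p _; set B := \sum_i _ => H.
have -> : gip h (gpoly X) (gpoly X) = L ^- 2 * (L ^- 2 * (h ^+ 2 * A)).
  rewrite /gip /A !mulr_sumr; apply: eq_bigr => p _; rewrite /gpoly; ring.
apply: ler_wpM2l; first by rewrite invr_ge0 sqr_ge0.
apply: le_trans (_ : L ^- 2 * (L ^+ 2 * B) <= _); first by rewrite ler_wpM2l// invr_ge0 sqr_ge0.
by rewrite mulrA mulVf ?mul1r// expf_neq0// gt_eqF.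
Qed.

Lemma gip_gpoly_grad X : gip h (gpoly X) (gA h (gpoly X)) <= L ^- 2 * tot (fun k c => d k * X k c ^+ 2).
Proof.
have := gip_tpoly_grad N_gt0 L_gt0 sep (fun i => X (kapN i) true) (fun i => X (kapN i) false).
rewrite /=; set f : V := (fun p => _ : R); set B := \sum_i _ => H.
have -> : gpoly X = L ^- 2 *: f by [].
rewrite gAZ gipZl gipC gipZl; apply: ler_wpM2l; first by rewrite invr_ge0 sqr_ge0.
have -> : tot (fun k c => d k * X k c ^+ 2) = B by apply: eq_bigr => i _; ring.
apply: le_trans (_ : L ^- 2 * (L ^+ 2 * B) <= _); last first.
  by rewrite mulrA mulVf ?mul1r// expf_neq0// gt_eqF.
by rewrite ler_wpM2l ?invr_ge0 ?sqr_ge0// gipC.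
Qed.

Lemma sob2_gpoly X : sob2 h (gpoly X) <= L ^- 2 * tot (fun k c => wgt k ^+ 2 * X k c ^+ 2).
Proof.
rewrite sob2_gip gpolyA; apply: le_trans (lerD (gip_gpoly _) (gip_gpoly _)) _.
rewrite -mulrDr -totD; apply: ler_wpM2l; first by rewrite invr_ge0 sqr_ge0.
apply: tot_le => k c; rewrite exprMn.
have -> : X k c ^+ 2 + d k ^+ 2 * X k c ^+ 2 = (1 + d k ^+ 2) * X k c ^+ 2 by ring.
apply: ler_wpM2r; first exact: sqr_ge0.
have := d0 k; have := dl k; rewrite /wgt; move: (d k) (lam L k) => x y xy x0; nra.
Qed.

Lemma gip3_gpoly X : gip h (gpoly X) (gpoly X) + gip h (gA h (gpoly X)) (gA h (gpoly X))
   + gip h (gA h (gpoly X)) (gA h (gA h (gpoly X))) <= L ^- 2 * tot (fun k c => wgt k ^+ 3 * X k c ^+ 2).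
Proof.
have g := gip_gpoly_grad (fun k c => d k * X k c).
have g1 := gip_gpoly X; have g2 := gip_gpoly (fun k c => d k * X k c).
rewrite !gpolyA in g *; apply: le_trans (lerD (lerD g1 g2) g) _.
rewrite -!mulrDr -!totD; apply: ler_wpM2l; first by rewrite invr_ge0 sqr_ge0.
apply: tot_le => k c; rewrite exprMn.
have -> : X k c ^+ 2 + d k ^+ 2 * X k c ^+ 2 + d k * (d k ^+ 2 * X k c ^+ 2) = (1 + d k ^+ 2 + d k ^+ 3) * X k c ^+ 2 by ring.
apply: ler_wpM2r; first exact: sqr_ge0.
have x0 := d0 k; have xy := dl k; rewrite /wgt; move: (d k) (lam L k) x0 xy => x y x0 xy.
have y0 := le_trans x0 xy.
have e2 : x ^+ 2 <= y ^+ 2 by rewrite ler_pXn2r.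
have e3 : x ^+ 3 <= y ^+ 3 by rewrite ler_pXn2r.
have -> : (1 + y) ^+ 3 = 1 + 3 * y + 3 * y ^+ 2 + y ^+ 3 by ring.
have := sqr_ge0 y; lra.
Qed.

End GridPoly.

Local Ltac nneg := repeat first [ assumption | exact: sqr_ge0 | exact: ler0n | apply: exprn_ge0
  | apply: addr_ge0 | apply: mulr_ge0 | rewrite invr_ge0 | (apply: ltW; assumption) | done ].

(** * Truncation errors of the projected solution *)

Section Consistency.
Context {R : realType}.
Local Notation kk := (int * int)%type.
Variables (T L alpha beta M K1 K3 : R) (Phi : R -> R * R -> R) (F1 F2 F3 P2 P4 : kk -> bool -> R -> R).
Let F0 (k : kk) (c : bool) (t : R) := cc L (Phi t) k c.
Let G (k : kk) (c : bool) (t : R) := cc L (fun z => Phi t z ^+ 3) k c.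
Hypotheses (T_gt0 : 0 < T) (L_gt0 : 0 < L) (alpha_gt0 : 0 < alpha) (beta_gt0 : 0 < beta).
Hypothesis sp : spectral T L alpha beta M F0 F1 F2 F3 P2 P4 G.
Hypothesis lim1 : forall t, 0 <= t <= T -> trig_limit L (Phi t) K1.
Hypothesis lim3 : forall t, 0 <= t <= T -> trig_limit L (fun z => Phi t z ^+ 3) K3.
Variables (N : nat) (s : R) (n : nat).
Hypotheses (N_gt0 : (0 < N)%N) (N_even : ~~ odd N) (s_gt0 : 0 < s) (nT : n%:R * s <= T).
Local Notation wgt := (wgt L).
Local Notation lam := (lam L).
Local Notation d := (dsym N L).
Local Notation tau j := (j%:R * s).
Let T2 : finType := ('I_N * 'I_N)%type.
Let V : lmodType R := (T2 -> R^o).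
Let h := L / N%:R.
Local Notation gp := (@gpoly R L N).
Local Notation tot := (@tot R N).

Let NR : 0 < N%:R :> R. Proof. by rewrite ltr0n. Qed.
Let h_gt0 : 0 < h. Proof. exact: divr_gt0. Qed.
Let hN : h * N%:R = L. Proof. by rewrite /h divfK// gt_eqF. Qed.
Let hL : h <= L.
Proof.
rewrite /h ler_pdivrMr//; have n1 : 1 <= N%:R :> R by rewrite ler1n.
by have := ler_wpM2l (ltW L_gt0) n1; rewrite mulr1.
Qed.

Let hLX m : h ^+ m <= L ^+ m.
Proof. by apply: lerXn2r => //; rewrite nnegrE ltW. Qed.

Let gpA X : gA h (gp X) = gp (fun k c => d k * X k c).
Proof. exact: gpolyA. Qed.

Lemma gpolyN X : gp (fun k c => - X k c) = - gp X.
Proof.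
rewrite -scaleN1r -gpolyZ; congr gp; apply/funext => k; apply/funext => c; ring.
Qed.

Lemma gpolyB X Y : gp (fun k c => X k c - Y k c) = gp X - gp Y.
Proof. by rewrite gpolyD gpolyN. Qed.

Lemma gip_sup (f : V) (c : R) : (forall p, `|f p : R| <= c) -> gip h f f <= L ^+ 2 * c ^+ 2.
Proof.
move=> fc; have e (x y z w : R) : x * y = z -> z ^+ 2 * w = x ^+ 2 * (y ^+ 2 * w) by move=> <-; ring.
rewrite /gip (e _ _ _ _ hN); apply: ler_wpM2l; first exact: sqr_ge0.
have -> : N%:R ^+ 2 * c ^+ 2 = \sum_(p : T2) c ^+ 2.
  by rewrite sumr_const card_prod card_ord -[RHS]mulr_natl natrM; ring.
apply: ler_sum => p _; move: (f p : R) (fc p) => x; rewrite ler_norml => /andP[a b].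
have a1 : 0 <= c - x by rewrite subr_ge0.
have a2 : 0 <= c + x by lra.
by have := mulr_ge0 a1 a2; lra.
Qed.

Lemma gip_split (f g : V) : gip h (f + g) (f + g) <= 2 * (gip h f f + gip h g g).
Proof.
rewrite /gip -mulrDr mulrCA; apply: ler_wpM2l; first exact: sqr_ge0.
rewrite -big_split mulr_sumr; apply: ler_sum => p _; rewrite !gev/=.
by move: (f p : R) (g p : R) => x y; have := sqr_ge0 (x - y); lra.
Qed.

Lemma tot_F0 t : 0 <= t <= T -> tot (fun k c => wgt k ^+ 8 * F0 k c t ^+ 2) <= M.
Proof.
move=> tT; have := sp_s0 sp (@kapN_inj R L N L_gt0 N_gt0 N_even) tT.
by apply: le_trans; rewrite le_eqVlt; apply/orP; left; apply/eqP; apply: eq_bigr => i _; ring.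
Qed.

Lemma tot_P2 : tot (fun k c => wgt k ^+ 6 * P2 k c T) <= M.
Proof.
have := sp_s2 sp (@kapN_inj R L N L_gt0 N_gt0 N_even).
by apply: le_trans; rewrite le_eqVlt; apply/orP; left; apply/eqP; apply: eq_bigr => i _; ring.
Qed.

Lemma tot_P4 : tot (fun k c => P4 k c T) <= M.
Proof. exact: (sp_s4 sp (@kapN_inj R L N L_gt0 N_gt0 N_even)). Qed.

Let P2_ge0 k c t : 0 <= t -> 0 <= P2 k c t.
Proof. by move=> t0; have z := sp_z2 sp; rewrite -(z k c); have m := sp_m2 sp; exact: m. Qed.

Let P4_ge0 k c t : 0 <= t -> 0 <= P4 k c t.
Proof. by move=> t0; have z := sp_z4 sp; rewrite -(z k c); have m := sp_m4 sp; exact: m. Qed.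

Let M_ge0 : 0 <= M.
Proof. by apply: le_trans tot_P4; apply: tot_ge0 => k c; apply: P4_ge0; exact: ltW. Qed.

Let w1 k : 1 <= wgt k. Proof. exact: wgt_ge1. Qed.
Let wX k (m m' : nat) : (m <= m')%N -> wgt k ^+ m <= wgt k ^+ m'.
Proof. by move=> mm; exact: ler_weXn2l. Qed.
Let w0 k m : 0 <= wgt k ^+ m.
Proof. by rewrite exprn_ge0// (le_trans _ (w1 k)). Qed.
Let Li0 : 0 <= L ^- 2. Proof. by rewrite invr_ge0 sqr_ge0. Qed.
Let sX m : 0 <= s ^+ m. Proof. by rewrite exprn_ge0// ltW. Qed.
Let hX m : 0 <= h ^+ m. Proof. by rewrite exprn_ge0// ltW. Qed.

Definition uproj (t : R) : V := gp (fun k c => F0 k c t).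
Definition vproj (t : R) : V := gp (fun k c => F1 k c t).
Definition gphi (t : R) : V := fun p => Phi t (gpt L p).
(** Minus the exact Laplacian of the projected cube, to which [chidef] compares the discrete
    nonlinear term. *)
Definition gcube (t : R) : V := gp (fun k c => lam k * G k c t).

Definition symdiff (k : kk) : R :=
  d k * (alpha - 2 * d k + d k ^+ 2) - lam k * (alpha - 2 * lam k + lam k ^+ 2).
Definition fmid j k c : R := 2^-1 * (F0 k c (tau j.+1) + F0 k c (tau j)).
Definition lindef j k c : R :=
  beta * dq F1 F2 s j k c + d k ^+ 2 * dw F0 s j k c + symdiff k * fmid j k c.
Definition chidef j : V := gA h (gchi (uproj (tau j.+1)) (uproj (tau j)))
  - 2^-1 *: (gcube (tau j.+1) + gcube (tau j)).
Definition tdef1 j : V := gp (lindef j) + chidef j.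
Definition tdef2 j : V := gp (dX F0 F1 s j).

(** Each coefficient satisfies the equation at both ends of the step. Subtracting the average from
    the discrete momentum equation leaves three linear defects and the nonlinear one. *)
Lemma residual j : (j < n)%N ->
  beta *: (vproj (tau j.+1) - vproj (tau j)) =
    - (s *: gA h (gchi (uproj (tau j.+1)) (uproj (tau j)) + alpha *: (2^-1 *: (uproj (tau j.+1) + uproj (tau j)))
        - 2 *: gA h (2^-1 *: (3 *: uproj (tau j) - uproj (tau j.-1)))
        + gA h (gA h (2^-1 *: (uproj (tau j.+1) + uproj (tau j))))))
    - s *: (2^-1 *: (vproj (tau j.+1) + vproj (tau j))) + s *: tdef1 j
  /\ uproj (tau j.+1) - uproj (tau j) =
     s *: (2^-1 *: (vproj (tau j.+1) + vproj (tau j))) + s *: tdef2 j.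
Proof.
move=> jn; have sn0 : s != 0 by rewrite gt_eqF.
split; last first.
  rewrite /uproj /vproj /tdef2 -gpolyB -gpolyD -!gpolyZ -gpolyD.
  by congr gp; apply/funext => k; apply/funext => c; rewrite /dX; field.
pose ft k c := 2^-1 * (3 * F0 k c (tau j) - F0 k c (tau j.-1)).
have eh : 2^-1 *: (uproj (tau j.+1) + uproj (tau j)) = gp (fmid j) by rewrite -gpolyD -gpolyZ.
have et : 2^-1 *: (3 *: uproj (tau j) - uproj (tau j.-1)) = gp ft by rewrite -gpolyZ -gpolyB -gpolyZ.
pose C : V := gchi (uproj (tau j.+1)) (uproj (tau j)).
have key : gp (lindef j) = (beta / s) *: (vproj (tau j.+1) - vproj (tau j))
    + 2^-1 *: (vproj (tau j.+1) + vproj (tau j)) + alpha *: gp (fun k c => d k * fmid j k c)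
    - 2 *: gp (fun k c => d k * (d k * ft k c)) + gp (fun k c => d k * (d k * (d k * fmid j k c)))
    + 2^-1 *: (gcube (tau j.+1) + gcube (tau j)).
  rewrite /vproj /gcube -!(gpolyB, gpolyD, gpolyZ).
  congr gp; apply/funext => k; apply/funext => c.
  have pde := sp_pde sp.
  have e1 := pde k c _ (tau_in s_gt0 nT jn); have e2 := pde k c _ (tau_in s_gt0 nT (ltnW jn)).
  apply/eqP; rewrite -subr_eq0; apply/eqP.
  (* The difference of the two sides is minus half the sum of the residuals of the equation at the
     two time levels, both zero. *)
  transitivity (- 2^-1 * ((beta * F2 k c (tau j.+1) + F1 k c (tau j.+1))
      - (- lam k * (G k c (tau j.+1) + (alpha - 2 * lam k + lam k ^+ 2) * F0 k c (tau j.+1))))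
    - 2^-1 * ((beta * F2 k c (tau j) + F1 k c (tau j))
      - (- lam k * (G k c (tau j) + (alpha - 2 * lam k + lam k ^+ 2) * F0 k c (tau j))))).
    by rewrite /lindef /dq /dw /symdiff /fmid /ft; field.
  have z (x y x' y' : R) : x = y -> x' = y' -> - 2^-1 * (x - y) - 2^-1 * (x' - y') = 0 by move=> -> ->; ring.
  exact: z e1 e2.
rewrite eh et !gpA !gAD gAN !gpA (gAZ h alpha) (gAZ h 2) !gpA /tdef1 key /chidef -/C.
by apply/funext => p; rewrite !gev; field.
Qed.

Definition bndU : R := L ^- 2 * M.
Definition tailC : R := L ^+ 2 * K1 ^+ 2 * (L ^+ 8 + L ^+ 4).
Definition bndP : R := 2 * (bndU + tailC * L ^+ 4).

Let bndU_ge0 : 0 <= bndU. Proof. exact: mulr_ge0. Qed.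
Let tailC_ge0 : 0 <= tailC.
Proof. by rewrite /tailC; nneg. Qed.

Lemma uproj_sob t : 0 <= t <= T -> sob2 h (uproj t) <= bndU.
Proof.
move=> tT; apply: le_trans (sob2_gpoly L_gt0 N_gt0 N_even _) _.
apply: ler_wpM2l => //; apply: le_trans (tot_F0 tT); apply: tot_le => k c.
by apply: ler_wpM2r; [exact: sqr_ge0|exact: wX].
Qed.

Lemma gphi_tail t j p : 0 <= t <= T -> (j <= 3)%N ->
  `|(iter j (gA h) (gphi t - uproj t) : V) p : R| <= h ^+ (2 * (3 - j)) * K1.
Proof.
move=> tT j3; have := proj_tail L_gt0 N_gt0 N_even (lim1 tT) p j3.
have -> : (fun p0 : 'I_N * 'I_N => Phi t (gpt L p0) - projW L N (fun=> 1) (Phi t) (gpt L p0)) = gphi t - uproj t.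
  apply/funext => q; rewrite projW_gpoly gev /gphi /uproj; congr (_ - gp _ _).
  by apply/funext => k; apply/funext => c; rewrite mul1r.
suff -> : iter j (gA h) (gphi t - uproj t) = itlap L j (gphi t - uproj t) by [].
by elim: j {j3} => //= j ->; rewrite gAE.
Qed.

Lemma gphi_near t : 0 <= t <= T -> sob2 h (gphi t - uproj t) <= tailC * h ^+ 4.
Proof.
move=> tT; rewrite sob2_gip.
have a : gip h (gphi t - uproj t) (gphi t - uproj t) <= L ^+ 2 * (h ^+ 6 * K1) ^+ 2.
  exact: (gip_sup (fun p => @gphi_tail t 0 p tT isT)).
have b : gip h (gA h (gphi t - uproj t)) (gA h (gphi t - uproj t)) <= L ^+ 2 * (h ^+ 4 * K1) ^+ 2.
  exact: (gip_sup (fun p => @gphi_tail t 1 p tT isT)).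
apply: le_trans (lerD a b) _.
have e8 := hLX 8; have e4 := hLX 4.
have k0 : 0 <= L ^+ 2 * K1 ^+ 2 * h ^+ 4 by nneg.
have -> : L ^+ 2 * (h ^+ 6 * K1) ^+ 2 + L ^+ 2 * (h ^+ 4 * K1) ^+ 2 = L ^+ 2 * K1 ^+ 2 * h ^+ 4 * (h ^+ 8 + h ^+ 4) by ring.
have -> : tailC * h ^+ 4 = L ^+ 2 * K1 ^+ 2 * h ^+ 4 * (L ^+ 8 + L ^+ 4) by rewrite /tailC; ring.
by apply: ler_wpM2l => //; exact: lerD.
Qed.

Lemma gphi_sob t : 0 <= t <= T -> sob2 h (gphi t) <= bndP.
Proof.
move=> tT.
have -> : gphi t = (fun p => uproj t p + (gphi t - uproj t) p).
  by apply/funext => p; rewrite gev addrC subrK.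
apply: (le_trans (sob2D h _ _)); rewrite /bndP ler_wpM2l//; apply: lerD; first exact: uproj_sob.
apply: le_trans (gphi_near tT) _; by apply: ler_wpM2l.
Qed.

Lemma step_sob j : (j < n)%N ->
  sob2 h (uproj (tau j.+1) - uproj (tau j)) <= L ^- 2 * T * M * s ^+ 2.
Proof.
move=> jn; rewrite -gpolyB; apply: le_trans (sob2_gpoly L_gt0 N_gt0 N_even _) _.
rewrite -!mulrA; apply: ler_wpM2l => //.
apply: le_trans (_ : tot (fun k c => (s ^+ 2 * T) * (wgt k ^+ 6 * P2 k c T)) <= _); last first.
  rewrite totZ mulrA [leRHS]mulrAC -mulrA mulrC -mulrA mulrC.
  have := ler_wpM2l (mulr_ge0 (sX 2) (ltW T_gt0)) tot_P2; lra.
apply: tot_le => k c; have st := step_le sp s_gt0 nT k c jn.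
have p0 := P2_ge0 k c (ltW T_gt0).
apply: le_trans (ler_wpM2l (w0 k 2) st) _.
have := ler_wpM2r (mulr_ge0 (mulr_ge0 (sX 2) (ltW T_gt0)) p0) (wX k (isT : (2 <= 6)%N)); lra.
Qed.

Definition cubC1 : R := 16^-1 * (230 * sobC L) ^+ 2 * (L ^- 2 * T * M) ^+ 2 * (4 * bndU).
Definition cubC2 : R := 2 * chiC L bndP * tailC.
Definition cubC : R := 2 * cubC1 + 4 * cubC2 + 4 * (L ^+ 2 * K3 ^+ 2).

Let sc0 : 0 <= 230 * sobC L. Proof. by rewrite mulr_ge0// ltW// sobC_gt0. Qed.
Let cubC1_ge0 : 0 <= cubC1. Proof. by rewrite /cubC1; nneg. Qed.
Let chiC_ge0 : 0 <= chiC L bndP. Proof. by rewrite /chiC; nneg. Qed.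
Let cubC2_ge0 : 0 <= cubC2. Proof. by rewrite /cubC2; nneg. Qed.
Let cubC_ge0 : 0 <= cubC. Proof. by rewrite /cubC; nneg. Qed.

Lemma gip_le_sob (f : V) : gip h (gA h f) (gA h f) <= sob2 h f.
Proof. by rewrite sob2_gip lerDr gip_ge0. Qed.

(** Three errors: [f1] is that of the time average, -(1/4)(up - um)^2 (up + um), quadratic in the
    step; [f2] passes from the projection to [Phi] on the grid by the Lipschitz bound; [f3] is the
    consistency of the discrete Laplacian on the cube. *)
Lemma chidef_le j : (j < n)%N -> gip h (chidef j) (chidef j) <= cubC * (s ^+ 4 + h ^+ 4).
Proof.
move=> jn; have tp := tau_in s_gt0 nT jn; have tm := tau_in s_gt0 nT (ltnW jn).
set up := uproj (tau j.+1); set um := uproj (tau j).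
set pp := gphi (tau j.+1); set pm := gphi (tau j).
pose f1 : V := gchi up um - 2^-1 *: (gchi up up + gchi um um).
pose f2 : V := - 2^-1 *: ((gchi pp pp - gchi up up) + (gchi pm pm - gchi um um)).
pose f3 : V := 2^-1 *: ((gA h (gchi pp pp) - gcube (tau j.+1)) + (gA h (gchi pm pm) - gcube (tau j))).
have -> : chidef j = gA h f1 + (gA h f2 + f3).
  rewrite /chidef -/up -/um /f1 /f2 /f3; apply/funext => p.
  by rewrite !(gAD, gAN, gAZ) !gev; field.
have b1 : sob2 h f1 <= cubC1 * s ^+ 4.
  pose D : V := up - um.
  have -> : f1 = (fun p => - 4^-1 * (D p * D p * (up p + um p))).
    by apply/funext => p; rewrite /f1 /D /gchi !gev; field.
  rewrite sob2Z.
  have m1 := sob2M h_gt0 L_gt0 hN D D.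
  have m2 := sob2M h_gt0 L_gt0 hN (fun p => D p * D p) (fun p => up p + um p).
  have m3 : sob2 h (fun p => up p + um p) <= 4 * bndU.
    apply: (le_trans (sob2D h _ _)); have := uproj_sob tp; have := uproj_sob tm; rewrite -/up -/um; lra.
  have m4 : sob2 h D <= L ^- 2 * T * M * s ^+ 2 by exact: step_sob.
  have n4 := sob2_ge0 h D; have n3 := sob2_ge0 h (fun p => up p + um p).
  have n1 := sob2_ge0 h (fun p => D p * D p).
  have m5 : sob2 h D * sob2 h D <= (L ^- 2 * T * M * s ^+ 2) * (L ^- 2 * T * M * s ^+ 2) by exact: ler_pM.
  have m6 : sob2 h (fun p => D p * D p) <= 230 * sobC L * ((L ^- 2 * T * M * s ^+ 2) * (L ^- 2 * T * M * s ^+ 2)).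
    by apply: le_trans m1 _; exact: ler_wpM2l.
  have m7 := ler_wpM2l sc0 (ler_pM n1 n3 m6 m3).
  have m8 := le_trans m2 m7.
  have -> : (- 4^-1) ^+ 2 = 16^-1 :> R by field.
  apply: le_trans (ler_wpM2l _ m8) _ => //.
  by rewrite /cubC1 le_eqVlt; apply/orP; left; apply/eqP; ring.
have b2 : sob2 h f2 <= cubC2 * h ^+ 4.
  have bu t : 0 <= t <= T -> sob2 h (uproj t) <= bndP.
    move=> tT; apply: le_trans (uproj_sob tT) _; rewrite /bndP.
    have : 0 <= tailC * L ^+ 4 by rewrite mulr_ge0// exprn_ge0// ltW.
    by move: bndU_ge0; lra.
  have bc t : 0 <= t <= T -> sob2 h (gchi (gphi t) (gphi t) - gchi (uproj t) (uproj t)) <= chiC L bndP * (2 * (tailC * h ^+ 4)).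
    move=> tT; apply: le_trans (sob2_gchiB h_gt0 L_gt0 hN (gphi_sob tT) (gphi_sob tT) (bu t tT) (bu t tT)) _.
    by apply: ler_wpM2l => //; have := gphi_near tT; lra.
  have c1 := bc _ tp; have c2 := bc _ tm; rewrite -/pp -/up -/pm -/um in c1 c2.
  rewrite (_ : f2 = (fun p => - 2^-1 * ((gchi pp pp - gchi up up) p + (gchi pm pm - gchi um um) p))); last first.
    by apply/funext => p; rewrite /f2 !gev.
  rewrite sob2Z; have := sob2D h (gchi pp pp - gchi up up) (gchi pm pm - gchi um um).
  have -> : (- 2^-1) ^+ 2 = 4^-1 :> R by field.
  rewrite /cubC2; lra.
have b3 : gip h f3 f3 <= L ^+ 2 * K3 ^+ 2 * h ^+ 4.
  have c3 t p : 0 <= t <= T -> `|(gA h (gchi (gphi t) (gphi t)) - gcube t) p : R| <= h ^+ 2 * K3.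
    move=> tT; have := tlap_consistent L_gt0 N_gt0 N_even (lim3 tT) p.
    rewrite projW_gpoly gev gAE.
    have -> : gchi (gphi t) (gphi t) = (fun p0 : 'I_N * 'I_N => Phi t (gpt L p0) ^+ 3) :> V.
      by apply/funext => q; rewrite /gchi /gphi; field.
    by [].
  have -> : L ^+ 2 * K3 ^+ 2 * h ^+ 4 = L ^+ 2 * (h ^+ 2 * K3) ^+ 2 by ring.
  apply: gip_sup => p; rewrite /f3 gevZ gevD.
  have c4 := c3 _ p tp; have c5 := c3 _ p tm; rewrite -/pp -/pm in c4 c5.
  move: ((_ - gcube (tau j.+1)) p : R) ((_ - gcube (tau j)) p : R) c4 c5 => x y c4 c5.
  rewrite normrM ger0_norm ?invr_ge0//; have := ler_normD x y; lra.
apply: le_trans (gip_split _ _) _; have g2 := gip_split (gA h f2) f3.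
have g3 := gip_le_sob f1; have g4 := gip_le_sob f2.
have h4 := hX 4; have s4 := sX 4.
have e1 := mulr_ge0 cubC1_ge0 h4; have e2 := mulr_ge0 cubC2_ge0 s4.
have k3 : 0 <= L ^+ 2 * K3 ^+ 2 * s ^+ 4 by nneg.
rewrite /cubC; lra.
Qed.

(** Up to sign, the factor [lam - dsym], at most [h ^+ 2 * lam ^+ 2], splits off with a quadratic
    cofactor. The total degree is 4, whose square fits the weight 8 of H^8; [alpha + 7] adds the
    coefficients alpha, 4 and 3. *)
Lemma symdiff_le k : symdiff k ^+ 2 <= h ^+ 4 * (alpha + 7) ^+ 2 * wgt k ^+ 8.
Proof.
have -> : h ^+ 4 * (alpha + 7) ^+ 2 * wgt k ^+ 8 = (h ^+ 2 * (alpha + 7) * wgt k ^+ 4) ^+ 2 by ring.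
rewrite -real_normK ?num_real//; apply: lerXn2r; rewrite ?nnegrE//.
  have a7 : 0 <= alpha + 7 by rewrite addr_ge0// ltW.
  by apply: mulr_ge0 => //; apply: mulr_ge0.
have x0 := dsym_ge0 N_gt0 L_gt0 k; have xy := dsym_le N_gt0 L_gt0 k; have cs := dsym_consistent N_gt0 L_gt0 k.
rewrite -/h in cs; rewrite /symdiff /wgt; move: (d k) (lam k) x0 xy cs => x y x0 xy cs.
have y0 := le_trans x0 xy.
have -> : x * (alpha - 2 * x + x ^+ 2) - y * (alpha - 2 * y + y ^+ 2) =
  - ((y - x) * (alpha - 2 * (x + y) + (x ^+ 2 + x * y + y ^+ 2))) by ring.
rewrite normrN normrM ger0_norm ?subr_ge0//.
have i1 : `|alpha - 2 * (x + y) + (x ^+ 2 + x * y + y ^+ 2)| <= alpha + 4 * y + 3 * y ^+ 2.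
  have xx : x ^+ 2 <= y ^+ 2 by rewrite ler_pXn2r.
  have xy2 : x * y <= y ^+ 2 by rewrite expr2 ler_wpM2r.
  have a0 := sqr_ge0 x; have b0 := mulr_ge0 x0 y0; have y20 := sqr_ge0 y.
  by rewrite ler_norml; move: alpha_gt0 => al; apply/andP; split; lra.
apply: le_trans (ler_pM _ _ cs i1) _; rewrite ?subr_ge0//.
have -> : h ^+ 2 * (alpha + 7) * (1 + y) ^+ 4 = h ^+ 2 * ((alpha + 7) * (1 + y) ^+ 4) by ring.
rewrite -mulrA; apply: ler_wpM2l; first exact: sqr_ge0.
have -> : (alpha + 7) * (1 + y) ^+ 4 = alpha * (1 + 4 * y + 6 * y ^+ 2 + 4 * y ^+ 3 + y ^+ 4)
   + 7 * (1 + 4 * y + 6 * y ^+ 2 + 4 * y ^+ 3 + y ^+ 4) by ring.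
have y2 : 0 <= y ^+ 2 by rewrite exprn_ge0.
have y3 : 0 <= y ^+ 3 by rewrite exprn_ge0.
have y4 : 0 <= y ^+ 4 by rewrite exprn_ge0.
have al := ltW alpha_gt0.
have q : 0 <= alpha * (1 + 4 * y + 5 * y ^+ 2 + 4 * y ^+ 3 + y ^+ 4) by rewrite mulr_ge0// !addr_ge0 ?mulr_ge0.
have -> : y ^+ 2 * (alpha + 4 * y + 3 * y ^+ 2) = alpha * y ^+ 2 + 4 * y ^+ 3 + 3 * y ^+ 4 by ring.
lra.
Qed.

Definition truncC : R := L ^- 2 * (6 * beta ^+ 2 * (4^-1 * M) + 6 * (4 * M) + 6 * ((alpha + 7) ^+ 2 * T * M)
  + 4^-1 * ((432 * (1 + T ^- 2) + 2) * M)) + 2 * T * cubC.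

Let tsum (X : nat -> kk -> bool -> R) (Y : kk -> bool -> R) c :
  (forall k b, \sum_(j < n) X j k b <= Y k b) -> tot Y <= c -> \sum_(j < n) tot (X j) <= c.
Proof. by move=> XY; rewrite tot_sum; apply: le_trans; exact: tot_le. Qed.

Let nT_in : 0 <= tau n <= T. Proof. exact: (tau_in s_gt0 nT (leqnn n)). Qed.

(** Each step costs an increment of [P4], and these telescope: the whole sum over the steps is of
    order s^3. *)
Lemma sum_dq : \sum_(j < n) tot (fun k c => dq F1 F2 s j k c ^+ 2) <= 4^-1 * s ^+ 3 * M.
Proof.
have q0 : 0 <= 4^-1 * s ^+ 3 by rewrite mulr_ge0.
apply: (@tsum (fun j k c => dq F1 F2 s j k c ^+ 2) (fun k c => 4^-1 * s ^+ 3 * P4 k c T)); last by rewrite totZ ler_wpM2l// tot_P4.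
move=> k c; apply: le_trans (_ : \sum_(j < n) 4^-1 * s ^+ 3 * (P4 k c (tau j.+1) - P4 k c (tau j)) <= _).
  by apply: ler_sum => j _; exact: (dq_le sp s_gt0 nT).
rewrite -mulr_sumr (telescope1 (fun j => P4 k c (tau j))); apply: ler_wpM2l => //.
have p0 := @P4_ge0 k c (tau 0%N); rewrite mul0r lexx in p0 *; have {}p0 := p0 isT.
have m4 := sp_m4 sp; have /andP[_ b] := nT_in; have := m4 k c _ _ b; lra.
Qed.

(** The increments span two steps and are counted twice, hence 4 in place of 2; the weight 4 of the
    squared Laplacian is within the available 6. *)
Lemma sum_dw : \sum_(j < n) tot (fun k c => wgt k ^+ 4 * dw F0 s j k c ^+ 2) <= 4 * s ^+ 3 * M.
Proof.
have q0 : 0 <= 4 * s ^+ 3 by rewrite mulr_ge0.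
apply: (@tsum (fun j k c => wgt k ^+ 4 * dw F0 s j k c ^+ 2) (fun k c => 4 * s ^+ 3 * (wgt k ^+ 6 * P2 k c T))); last by rewrite totZ ler_wpM2l// tot_P2.
move=> k c; rewrite -mulr_sumr.
have m2 := sp_m2 sp; have p0 := @P2_ge0 k c (tau 0%N); rewrite mul0r lexx in p0.
have /andP[_ b] := nT_in; have b1 := m2 k c _ _ b.
have : tau n.-1 <= T by have /andP[] := tau_in s_gt0 nT (leq_pred n).
move=> /(m2 k c) b2; have pT := P2_ge0 k c (ltW T_gt0).
have : \sum_(j < n) dw F0 s j k c ^+ 2 <= 4 * s ^+ 3 * P2 k c T.
  apply: le_trans (_ : \sum_(j < n) 2 * s ^+ 3 * (P2 k c (tau j.+1) - P2 k c (tau j.-1)) <= _).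
    by apply: ler_sum => j _; exact: (dw_le sp s_gt0 nT).
  rewrite -mulr_sumr (telescope2 (fun j => P2 k c (tau j))) mul0r.
  have {}p0 := p0 isT.
  have -> : 4 * s ^+ 3 * P2 k c T = 2 * s ^+ 3 * (2 * P2 k c T) by ring.
  by apply: ler_wpM2l; [rewrite mulr_ge0|lra].
move=> H; apply: le_trans (ler_wpM2l (w0 k 4) H) _.
have := ler_wpM2r (mulr_ge0 q0 pT) (wX k (isT : (4 <= 6)%N)); lra.
Qed.

Lemma sum_dX : \sum_(j < n) tot (fun k c => wgt k ^+ 3 * dX F0 F1 s j k c ^+ 2) <=
  4^-1 * s ^+ 3 * ((432 * (1 + T ^- 2) + 2) * M).
Proof.
have q0 : 0 <= 4^-1 * s ^+ 3 by rewrite mulr_ge0.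
have c0 : 0 <= 432 * (1 + T ^- 2) by nneg.
apply: (@tsum (fun j k c => wgt k ^+ 3 * dX F0 F1 s j k c ^+ 2)
  (fun k c => 4^-1 * s ^+ 3 * (432 * (1 + T ^- 2) * (wgt k ^+ 6 * P2 k c T) + 2 * P4 k c T))); last first.
  rewrite totZ totD !totZ; apply: ler_wpM2l => //.
  have := ler_wpM2l c0 tot_P2; have := tot_P4; lra.
move=> k c; rewrite -mulr_sumr.
have H : \sum_(j < n) dX F0 F1 s j k c ^+ 2 <= 4^-1 * s ^+ 3 * Q3 F3 k c T.
  apply: le_trans (_ : \sum_(j < n) 4^-1 * s ^+ 3 * (Q3 F3 k c (tau j.+1) - Q3 F3 k c (tau j)) <= _).
    by apply: ler_sum => j _; exact: (dX_le T_gt0 sp s_gt0 nT).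
  rewrite -mulr_sumr (telescope1 (fun j => Q3 F3 k c (tau j))) mul0r Q3_0 subr0.
  by apply: ler_wpM2l => //; have /andP[a b] := nT_in; exact: (Q3_mono sp).
apply: le_trans (ler_wpM2l (w0 k 3) H) _.
rewrite mulrCA; apply: ler_wpM2l => //.
exact: (Q3_weighted T_gt0 sp).
Qed.

Lemma sum_sym j : (j < n)%N ->
  tot (fun k c => symdiff k ^+ 2 * fmid j k c ^+ 2) <= h ^+ 4 * (alpha + 7) ^+ 2 * M.
Proof.
move=> jn; have tp := tot_F0 (tau_in s_gt0 nT jn); have tm := tot_F0 (tau_in s_gt0 nT (ltnW jn)).
have q0 : 0 <= h ^+ 4 * (alpha + 7) ^+ 2 by rewrite mulr_ge0// sqr_ge0.
apply: le_trans (_ : tot (fun k c => h ^+ 4 * (alpha + 7) ^+ 2 * (2^-1 * (wgt k ^+ 8 * F0 k c (tau j.+1) ^+ 2 + wgt k ^+ 8 * F0 k c (tau j) ^+ 2))) <= _).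
  apply: tot_le => k c; apply: le_trans (ler_wpM2r (sqr_ge0 _) (symdiff_le k)) _.
  rewrite -[leLHS]mulrA; apply: ler_wpM2l => //.
  rewrite [leRHS](_ : _ = wgt k ^+ 8 * (2^-1 * (F0 k c (tau j.+1) ^+ 2 + F0 k c (tau j) ^+ 2))); last by ring.
  apply: ler_wpM2l => //.
  by rewrite /fmid; have := sqr_ge0 (F0 k c (tau j.+1) - F0 k c (tau j)); lra.
by rewrite totZ totZ totD; apply: ler_wpM2l => //; lra.
Qed.

(** The linear time defects sum to order s^3 and gain the factor [s] in front. The others are of
    order s^4 + h^4 in each step, and [n%:R * s <= T]. *)
Lemma truncation_sum :
  s * \sum_(j < n) truncation h (tdef1 j) (tdef2 j) <= truncC * (s ^+ 4 + h ^+ 4).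
Proof.
have tj (j : 'I_n) : truncation h (tdef1 j) (tdef2 j) <=
   L ^- 2 * (6 * beta ^+ 2 * tot (fun k c => dq F1 F2 s j k c ^+ 2)
     + 6 * tot (fun k c => wgt k ^+ 4 * dw F0 s j k c ^+ 2)
     + tot (fun k c => wgt k ^+ 3 * dX F0 F1 s j k c ^+ 2))
   + (L ^- 2 * (6 * (h ^+ 4 * (alpha + 7) ^+ 2 * M)) + 2 * (cubC * (s ^+ 4 + h ^+ 4))).
  have t2 := gip3_gpoly L_gt0 N_gt0 N_even (dX F0 F1 s j); rewrite -/h in t2.
  have cd := chidef_le (ltn_ord j); have sm := sum_sym (ltn_ord j).
  have t1 := gip_split (gp (lindef j)) (chidef j).
  have t3 := gip_gpoly L_gt0 N_gt0 N_even (lindef j); rewrite -/h in t3.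
  have t4 : tot (fun k c => lindef j k c ^+ 2) <= 3 * beta ^+ 2 * tot (fun k c => dq F1 F2 s j k c ^+ 2)
     + 3 * tot (fun k c => wgt k ^+ 4 * dw F0 s j k c ^+ 2)
     + 3 * tot (fun k c => symdiff k ^+ 2 * fmid j k c ^+ 2).
    rewrite -!totZ -!totD; apply: tot_le => k c.
    have dd : (d k ^+ 2) ^+ 2 <= wgt k ^+ 4.
      have x0 := dsym_ge0 N_gt0 L_gt0 k; have xy := dsym_le N_gt0 L_gt0 k.
      rewrite -exprM; apply: lerXn2r; rewrite ?nnegrE// /wgt; lra.
    have := ler_wpM2r (sqr_ge0 (dw F0 s j k c)) dd.
    have e x y : (x * y : R) ^+ 2 = x ^+ 2 * y ^+ 2 by rewrite exprMn.
    rewrite /lindef -!e; set x := beta * _; set y := d k ^+ 2 * _; set z := symdiff k * _ => W.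
    have -> : 3 * beta ^+ 2 * dq F1 F2 s j k c ^+ 2 = 3 * x ^+ 2 by rewrite /x; ring.
    have := sqr_ge0 (x - y); have := sqr_ge0 (x - z); have := sqr_ge0 (y - z); lra.
  have t5 := ler_wpM2l Li0 t4; have t6 := ler_wpM2l Li0 sm.
  rewrite /truncation /tdef1 /tdef2; lra.
have q1 := sum_dq; have q2 := sum_dw; have q3 := sum_dX.
have spl (A B C : nat -> R) (a b X : R) : \sum_(j < n) (a * (b * A j + 6 * B j + C j) + X) =
    a * (b * \sum_(j < n) A j + 6 * \sum_(j < n) B j + \sum_(j < n) C j) + n%:R * X.
  rewrite big_split/= -mulr_sumr !big_split/= -!mulr_sumr sumr_const card_ord.
  by rewrite (mulr_natl X).
pose A (j : nat) := tot (fun k c => dq F1 F2 s j k c ^+ 2).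
pose B (j : nat) := tot (fun k c => wgt k ^+ 4 * dw F0 s j k c ^+ 2).
pose C (j : nat) := tot (fun k c => wgt k ^+ 3 * dX F0 F1 s j k c ^+ 2).
pose X := L ^- 2 * (6 * (h ^+ 4 * (alpha + 7) ^+ 2 * M)) + 2 * (cubC * (s ^+ 4 + h ^+ 4)).
have tj' (j : 'I_n) : truncation h (tdef1 j) (tdef2 j) <= L ^- 2 * (6 * beta ^+ 2 * A j + 6 * B j + C j) + X by exact: tj.
have := @ler_sum _ _ (index_enum 'I_n) xpredT _ _ (fun j _ => tj' j).
rewrite (spl A B C) => /(ler_wpM2l (ltW s_gt0)) H; apply: (le_trans H).
have {}q3 : \sum_(j < n) C j <= 4^-1 * s ^+ 3 * ((432 * (1 + T ^- 2) + 2) * M) by [].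
have h4 := hX 4; have s4 := sX 4.
have X0 : 0 <= X.
  by rewrite /X; nneg.
have r1 : s * (n%:R * X) <= T * X by rewrite mulrA [s * _]mulrC; apply: ler_wpM2r => //; have /andP[] := nT_in.
have b2 : 0 <= 6 * beta ^+ 2 by rewrite mulr_ge0// sqr_ge0.
have r2 := ler_wpM2l b2 (q1 : \sum_(j < n) A j <= _).
have {}q2 : \sum_(j < n) B j <= 4 * s ^+ 3 * M by [].
have r3 := ler_wpM2l (mulr_ge0 (ltW s_gt0) Li0) (lerD (lerD r2 (ler_wpM2l (ler0n R 6) q2)) q3).
rewrite mulrDr mulrA; apply: le_trans (lerD r3 r1) _.
rewrite /truncC /X.
have c2 : 0 <= 432 * (1 + T ^- 2) + 2 by nneg.
have a2 := sqr_ge0 (alpha + 7).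
set W1 := 6 * beta ^+ 2 * (4^-1 * M); set W2 := (432 * _ + 2) * M; set W3 := (alpha + 7) ^+ 2 * T * M.
have W10 : 0 <= L ^- 2 * W1 by rewrite /W1; nneg.
have W20 : 0 <= L ^- 2 * W2 by rewrite /W2; nneg.
have W30 : 0 <= L ^- 2 * W3 by rewrite /W3; nneg.
have W40 : 0 <= L ^- 2 * M by nneg.
have -> : s * L ^- 2 * (6 * beta ^+ 2 * (4^-1 * s ^+ 3 * M) + 6 * (4 * s ^+ 3 * M) + 4^-1 * s ^+ 3 * W2)
  = s ^+ 4 * (L ^- 2 * W1 + 24 * (L ^- 2 * M) + 4^-1 * (L ^- 2 * W2)) by rewrite /W1; ring.
have -> : T * (L ^- 2 * (6 * (h ^+ 4 * (alpha + 7) ^+ 2 * M)) + 2 * (cubC * (s ^+ 4 + h ^+ 4)))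
  = h ^+ 4 * (6 * (L ^- 2 * W3)) + 2 * T * cubC * (s ^+ 4 + h ^+ 4) by rewrite /W3; ring.
rewrite addrA [leRHS]mulrDl; apply: lerD; last exact: lexx.
have -> : L ^- 2 * (W1 + 6 * (4 * M) + 6 * W3 + 4^-1 * W2) =
  (L ^- 2 * W1 + 24 * (L ^- 2 * M) + 4^-1 * (L ^- 2 * W2)) + 6 * (L ^- 2 * W3) by ring.
move: (L ^- 2 * W1) (L ^- 2 * W2) (L ^- 2 * W3) (L ^- 2 * M) W10 W20 W30 W40 => a b c e a0 b0 c0 e0.
have := mulr_ge0 h4 a0; have := mulr_ge0 h4 b0; have := mulr_ge0 s4 c0; have := mulr_ge0 h4 e0.
lra.
Qed.

End Consistency.

(** * Error bounds for the real and the imaginary part *)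

Section Convergence.
Context {R : realType}.
Local Notation kk := (int * int)%type.
Variables (T L alpha beta M K1 K3 : R) (Phi : R -> R * R -> R) (F1 F2 F3 P2 P4 : kk -> bool -> R -> R).
Hypotheses (T_gt0 : 0 < T) (L_gt0 : 0 < L) (alpha_gt0 : 0 < alpha) (beta_gt0 : 0 < beta).
Hypothesis sp : spectral T L alpha beta M (fun k c t => cc L (Phi t) k c) F1 F2 F3 P2 P4
  (fun k c t => cc L (fun z => Phi t z ^+ 3) k c).
Hypothesis lim1 : forall t : R, 0 <= t <= T -> trig_limit L (Phi t) K1.
Hypothesis lim3 : forall t : R, 0 <= t <= T -> trig_limit L (fun z => Phi t z ^+ 3) K3.

Lemma spectral_ge0 : 0 <= M.
Proof.
have inj : injective (fun i : 'I_0 => (0, 0) : kk) by case.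
by have := sp_s4 sp inj; rewrite big_ord0.
Qed.

Let M_ge0 : 0 <= M := spectral_ge0.
Let LX m : 0 <= L ^+ m. Proof. by rewrite exprn_ge0// ltW. Qed.
(** Dominates the H^2 norms of both the numerical solution and the projection, since [grid_error]
    uses a single bound. *)
Definition bndA : R := bndP L M K1 + stabC L alpha (bndP L M K1).
Definition rateC : R := errC L alpha beta bndA.
Definition initC : R := L ^+ 2 * K1 ^+ 2 * ((1 + alpha) * (2^-1 * (L ^+ 4 + 1)) + (10 + 2 * alpha) * L ^+ 8).
Definition convC : R := (4 + 2 / beta) *
  (expR (4 * rateC * T) * (initC + 2 * rateC * truncC T L alpha beta M K1 K3)).
Definition imC : R := L ^+ 2 * K1 ^+ 2 * (L ^+ 8 + L ^+ 4 + 1).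

Let sob0 : 0 <= 230 * sobC L. Proof. by rewrite mulr_ge0// ltW// sobC_gt0. Qed.
Let sob1 : 0 <= sobC L. Proof. by rewrite ltW// sobC_gt0. Qed.
Let tail0 : 0 <= tailC L K1. Proof. by rewrite /tailC; nneg. Qed.
Let bndU0 : 0 <= bndU L M. Proof. by rewrite /bndU; nneg. Qed.
Let bndP0 : 0 <= bndP L M K1. Proof. by rewrite /bndP; nneg. Qed.
Let stab0 : 0 <= stabC L alpha (bndP L M K1). Proof. by rewrite /stabC; nneg. Qed.
Let rate0 : 0 <= rateC. Proof. by rewrite /rateC /errC /chiC; nneg. Qed.
Let init0 : 0 <= initC. Proof. by rewrite /initC; nneg. Qed.
Let trunc0 : 0 <= truncC T L alpha beta M K1 K3.
Proof. by rewrite /truncC /cubC /cubC1 /cubC2 /chiC; nneg. Qed.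

Lemma rateC_ge0 : 0 <= rateC. Proof. exact: rate0. Qed.
Lemma convC_ge0 : 0 <= convC.
Proof. by have e := expR_ge0 (4 * rateC * T); rewrite /convC; nneg. Qed.
Lemma imC_ge0 : 0 <= imC. Proof. by rewrite /imC; nneg. Qed.

Variables (N : nat) (s : R).
Hypotheses (N_gt0 : (0 < N)%N) (N_even : ~~ odd N) (s_gt0 : 0 < s).
Let T2 : finType := ('I_N * 'I_N)%type.
Let V : lmodType R := (T2 -> R^o).
Let h := L / N%:R.
Let NR : 0 < N%:R :> R. Proof. by rewrite ltr0n. Qed.
Let h_gt0 : 0 < h. Proof. exact: divr_gt0. Qed.
Let hN : h * N%:R = L. Proof. by rewrite /h divfK// gt_eqF. Qed.
Let hL m : h ^+ m <= L ^+ m.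
Proof.
apply: lerXn2r; rewrite ?nnegrE ?(ltW h_gt0) ?(ltW L_gt0)//.
rewrite /h ler_pdivrMr//; have n1 : 1 <= N%:R :> R by rewrite ler1n.
by have := ler_wpM2l (ltW L_gt0) n1; rewrite mulr1.
Qed.
Let hX m : 0 <= h ^+ m. Proof. by rewrite exprn_ge0// ltW. Qed.

Lemma gip_cross (f g : V) : gip h f g <= 2^-1 * (gip h f f + gip h g g).
Proof.
rewrite /gip -mulrDr mulrCA; apply: ler_wpM2l; first exact: sqr_ge0.
rewrite -big_split mulr_sumr; apply: ler_sum => p _ /=.
by move: (f p : R) (g p : R) => x y; have := sqr_ge0 (x - y); lra.
Qed.

(** The third-order form is split by Young's inequality into squared norms of [gA h e] and of its
    image under [gA h], controlled by sup bounds; surplus powers of [h] are traded for powers of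
    [L]. *)
Lemma tail_energy (e : V) :
  (forall j p, (j <= 3)%N -> `|(iter j (gA h) e : V) p : R| <= h ^+ (2 * (3 - j)) * K1) ->
  gip h e e <= L ^+ 2 * K1 ^+ 2 * L ^+ 8 * h ^+ 4 /\
  gip h (gA h e) (gA h (gA h e)) <= L ^+ 2 * K1 ^+ 2 * (2^-1 * (L ^+ 4 + 1)) * h ^+ 4.
Proof.
move=> H.
have a : gip h e e <= L ^+ 2 * (h ^+ 6 * K1) ^+ 2 by exact: (gip_sup L N_gt0 (fun p => H 0%N p isT)).
have b : gip h (gA h e) (gA h e) <= L ^+ 2 * (h ^+ 4 * K1) ^+ 2.
  exact: (gip_sup L N_gt0 (fun p => H 1%N p isT)).
have c : gip h (gA h (gA h e)) (gA h (gA h e)) <= L ^+ 2 * (h ^+ 2 * K1) ^+ 2.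
  exact: (gip_sup L N_gt0 (fun p => H 2%N p isT)).
have k0 : 0 <= L ^+ 2 * K1 ^+ 2 * h ^+ 4 by nneg.
have k8 := ler_wpM2l k0 (hL 8); have k4 := ler_wpM2l k0 (hL 4).
split; first by apply: le_trans a _; move: k8; lra.
apply: le_trans (gip_cross _ _) _; move: k4; lra.
Qed.

Lemma growth_le n : n%:R * s <= T -> (1 + 4 * (s * rateC)) ^+ n <= expR (4 * rateC * T).
Proof.
move=> nT; have x0 : 0 <= 4 * (s * rateC) by nneg.
apply: le_trans (_ : expR (4 * (s * rateC)) ^+ n <= _).
  by apply: lerXn2r; rewrite ?nnegrE ?expR_ge0 ?expR_ge1Dx// addr_ge0.
rewrite -expRM_natl ler_expR.
have -> : n%:R * (4 * (s * rateC)) = 4 * rateC * (n%:R * s) by ring.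
by apply: ler_wpM2l => //; nneg.
Qed.

(** Stability supplies the common H^2 bound, [residual] the perturbed scheme and [truncation_sum]
    the size of the perturbation. The initial error is not zero: the scheme starts from [Phi 0] on
    the grid, not from its projection. *)
Lemma grid_convergence (phi psi : nat -> V) n :
  s * rateC <= 2^-1 -> n%:R * s <= T -> phi 0%N = gphi L Phi 0 -> psi 0%N = 0 ->
  (forall k, (k < n)%N -> grid_step h alpha beta s (phi k.-1) (phi k) (psi k) (phi k.+1) (psi k.+1)) ->
  gip h (uproj L Phi (n%:R * s) - phi n) (uproj L Phi (n%:R * s) - phi n)
    + gip h (gA h (uproj L Phi (n%:R * s) - phi n)) (gA h (gA h (uproj L Phi (n%:R * s) - phi n))) <= convC * (s ^+ 4 + h ^+ 4).
Proof.
move=> small nT phi0 psi0 steps; set e := uproj L Phi (n%:R * s) - phi n.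
have T0 : 0 <= (0 : R) <= T by rewrite lexx ltW.
have v0 : psi 0%N = vproj L F1 (0%:R * s).
  rewrite psi0 mul0r /vproj; apply/funext => p.
  rewrite /gpoly /tpoly big1 ?mulr0// => i _.
  by have z := sp_init sp; rewrite !z /tmode !mul0r addr0.
have s0 : sob2 h (phi 0%N) <= bndP L M K1.
  by rewrite phi0; exact: (gphi_sob L_gt0 sp lim1 N_gt0 N_even T0).
have stable k : (k <= n)%N -> sob2 h (phi k) <= bndA /\ sob2 h (uproj L Phi (k%:R * s) : V) <= bndA.
  move=> kn; split.
    have st j : (j < k)%N -> grid_step h alpha beta s (phi j.-1) (phi j) (psi j) (phi j.+1) (psi j.+1).
      by move=> jk; apply: steps; exact: leq_trans kn.
    apply: le_trans (grid_stable h_gt0 L_gt0 hN (ltW alpha_gt0) beta_gt0 s_gt0 psi0 s0 st) _.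
    by rewrite /bndA; have := bndP0; lra.
  apply: le_trans (uproj_sob L_gt0 sp N_gt0 N_even (tau_in s_gt0 nT kn)) _.
  have : 0 <= tailC L K1 * L ^+ 4 by rewrite mulr_ge0.
  by rewrite /bndA; move: stab0; rewrite /bndP; have := bndU0; lra.
have res k (kn : (k < n)%N) := residual L_gt0 sp N_gt0 s_gt0 nT kn.
have := @grid_error R N h L h_gt0 L_gt0 hN alpha beta s bndA phi psi
  (fun k => uproj L Phi (k%:R * s)) (fun k => vproj L F1 (k%:R * s))
  (tdef1 L alpha beta Phi F1 F2 s) (tdef2 L Phi F1 s) n (ltW alpha_gt0) beta_gt0 s_gt0 small steps res v0 stable.
rewrite -/e -/rateC => H; apply: (le_trans H) => {H}.
have bb : 0 <= 4 + 2 / beta by nneg.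
rewrite /convC -[leRHS]mulrA; apply: ler_wpM2l => //.
set e0 := uproj L Phi (0%:R * s) - phi 0%N.
have E0 : e0 = - (gphi L Phi 0 - uproj L Phi 0) by rewrite /e0 mul0r phi0 opprB.
have [a b] : gip h e0 e0 <= L ^+ 2 * K1 ^+ 2 * L ^+ 8 * h ^+ 4 /\
  gip h (gA h e0) (gA h (gA h e0)) <= L ^+ 2 * K1 ^+ 2 * (2^-1 * (L ^+ 4 + 1)) * h ^+ 4.
  apply: tail_energy => j p j3; have := gphi_tail L_gt0 lim1 N_gt0 N_even p T0 j3.
  rewrite -/h E0; have -> : iter j (gA h) (- (gphi L Phi 0 - uproj L Phi 0) : V) = - iter j (gA h) (gphi L Phi 0 - uproj L Phi 0).
    by elim: j {j3} => // j IH; rewrite !iterS IH gAN.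
  by rewrite gevN normrN.
have ts := truncation_sum T_gt0 L_gt0 alpha_gt0 sp lim1 lim3 N_gt0 N_even s_gt0 nT.
rewrite -/h in ts; set S := \sum_(k < n) _ in ts *.
have s4 : 0 <= s ^+ 4 by rewrite exprn_ge0// ltW.
have tc := ler_wpM2l (mulr_ge0 (ler0n R 2) rate0) ts.
have al1 : 0 <= 1 + alpha by nneg.
have al2 : 0 <= 10 + 2 * alpha by nneg.
have i1 := mulr_ge0 init0 s4.
have inner : (1 + alpha) * gip h (gA h e0) (gA h (gA h e0)) + (10 + 2 * alpha) * gip h e0 e0
   + 2 * (s * rateC) * S <= (initC + 2 * rateC * truncC T L alpha beta M K1 K3) * (s ^+ 4 + h ^+ 4).
  have b' := ler_wpM2l al1 b; have a' := ler_wpM2l al2 a.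
  move: i1; rewrite /initC; lra.
apply: le_trans (ler_wpM2l _ inner) _; first by rewrite exprn_ge0// addr_ge0// mulr_ge0// mulr_ge0// ltW.
rewrite -[leRHS]mulrA; apply: ler_wpM2r; last exact: growth_le.
by have h4 := hX 4; nneg.
Qed.

(** The scheme is real, so the whole imaginary part of the projection counts as error; it consists
    of high frequencies only. *)
Lemma im_energy t (f : V) : 0 <= t <= T -> (forall p, f p = projIm L N (Phi t) (gpt L p)) ->
  gip h f f + gip h (gA h f) (gA h (gA h f)) <= imC * (s ^+ 4 + h ^+ 4).
Proof.
move=> tT fE; have [|a b] := @tail_energy f.
  move=> j p j3; have := projIm_tail L_gt0 N_gt0 N_even (lim1 tT) p j3.
  have -> : (fun p0 : 'I_N * 'I_N => projIm L N (Phi t) (gpt L p0)) = f by apply/funext => q; rewrite fE.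
  suff -> : iter j (gA h) f = itlap L j f by [].
  by elim: j {j3} => //= j ->; rewrite gAE.
have s4 : 0 <= s ^+ 4 by rewrite exprn_ge0// ltW.
have h4 := hX 4.
have := mulr_ge0 imC_ge0 s4.
have : 0 <= L ^+ 2 * K1 ^+ 2 * (L ^+ 4 + 1) * h ^+ 4 by nneg.
rewrite /imC; lra.
Qed.

End Convergence.

(** * From energies to the complex grid norms *)

Section ErrorNorms.
Context {R : realType} (L : R) (N : nat).
Hypotheses (L_gt0 : 0 < L) (N_gt0 : (0 < N)%N).
Let h := L / N%:R.
Let NR : 0 < N%:R :> R. Proof. by rewrite ltr0n. Qed.
Let h_gt0 : 0 < h. Proof. exact: divr_gt0. Qed.
Local Open Scope complex_scope.

Lemma gpoint_periodic (u : R * R -> R) : periodic2 L u ->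
  grid_periodic N (fun i j => u (gpoint h i j)).
Proof.
move=> per; have e (i : int) : ((i + N%:Z)%:~R - 2^-1) * h = (i%:~R - 2^-1) * h + L.
  rewrite intrD; have -> : L = (N%:Z)%:~R * h by rewrite mulrC /h divfK// gt_eqF.
  by ring.
by move=> i j; rewrite /gpoint !e; have [-> _] := per ((i%:~R - 2^-1) * h) ((j%:~R - 2^-1) * h); have [_ ->] := per ((i%:~R - 2^-1) * h) ((j%:~R - 2^-1) * h).
Qed.

Lemma projW_periodic w u : periodic2 L (projW L N w u).
Proof.
move=> x y; rewrite /projW; split; congr (_ * _); apply: eq_bigr => i _.
  by rewrite (periodic_tmode L_gt0 _ _ _ x y).1.
by rewrite (periodic_tmode L_gt0 _ _ _ x y).2.
Qed.

Lemma projIm_periodic u : periodic2 L (projIm L N u).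
Proof.
move=> x y; rewrite /projIm; split; congr (_ * _); apply: eq_bigr => i _.
  by rewrite (periodic_tmode L_gt0 _ _ _ x y).1.
by rewrite (periodic_tmode L_gt0 _ _ _ x y).2.
Qed.

Lemma error_norms (re im : int -> int -> R) (K : R) :
  grid_periodic N re -> grid_periodic N im ->
  (forall f, f = re \/ f = im -> @gip R N h (gr f) (gr f) + @gip R N h (gA h (gr f)) (gA h (gA h (gr f))) <= K) ->
  gnorm2 N h (fun i j => re i j +i* im i j) + ggradnorm2 N h (dlap h%:C (fun i j => re i j +i* im i j))
    <= 2 * Num.sqrt (K + K).
Proof.
move=> pr pi H.
have -> : dlap h%:C (fun i j => re i j +i* im i j) = (fun i j => dlap h re i j +i* dlap h im i j).
  by apply/funext => i; apply/funext => j; rewrite dlap_complex.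
rewrite gnorm2_complex (ggradnorm2_complex N_gt0 h_gt0 (dlap_periodic h pr) (dlap_periodic h pi)).
rewrite !(gr_dlap N_gt0 h_gt0)//.
have n f : @gip R N h (- gA h (gr f)) (gA h (- gA h (gr f))) = @gip R N h (gA h (gr f)) (gA h (gA h (gr f))).
  rewrite gAN; congr (_ * _); apply: eq_bigr => p _.
  by rewrite !gev mulrNN.
rewrite !n; have h1 := H re (or_introl erefl); have h2 := H im (or_intror erefl).
have a1 := gip_ge0 h (@gr R N re); have a2 := gip_ge0 h (@gr R N im).
have a3 := gipA_ge0 h_gt0 (gA h (@gr R N re)); have a4 := gipA_ge0 h_gt0 (gA h (@gr R N im)).
rewrite mulr_natl mulr2n; apply: lerD; apply: ler_wsqrtr; lra.
Qed.

End ErrorNorms.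

Theorem theorem3p5 (R : realType) (alpha beta L T : R)
    (alpha_gt0 : 0 < alpha) (beta_gt0 : 0 < beta) (L_gt0 : 0 < L) (T_gt0 : 0 < T)
    (Phi : R -> R * R -> R)
    (Phi_periodic : forall t, 0 <= t <= T -> periodic2 L (Phi t))
    (Phi_continuous :
      {within `[0, T] `*` [set: R * R], continuous (fun q : R * (R * R) => Phi q.1 q.2)})
    (Phi_solution : solves_MPFC T L alpha beta Phi)
    (Phi_t0 : forall z : R * R, (Phi t z - Phi 0 z) / t @[t --> 0^'+] --> (0 : R))
    (Phi_H4L2 : in_WH T L 4 2%:E 0 Phi)
    (Phi_LinfH8 : in_LpH T L +oo%E 8 Phi)
    (Phi_W2infH2 : in_WH T L 2 +oo%E 2 Phi)
    (Phi_H2H6 : in_WH T L 2 2%:E 6 Phi) :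
  exists C s0 : R, [/\ 0 < C, 0 < s0 &
    forall (N : nat), (0 < N)%N -> ~~ odd N ->
    let h := L / N%:R in
    forall s : R, 0 < s <= s0 ->
    forall (phi : int -> int -> int -> R) (psi : nat -> int -> int -> R),
      scheme_solution N h s alpha beta (Phi 0) phi psi ->
    let err (k : nat) (i j : int) : R[i] :=
      fourier_proj L N (Phi (k%:R * s)) (gpoint h i j) - (phi k%:Z i j)%:C%C in
    forall k : nat, (1 <= k)%N -> k%:R * s <= T ->
      gnorm2 N h (err k) + ggradnorm2 N h (dlap h%:C%C (err k))
        <= C * (s ^+ 2 + h ^+ 2)].
Proof.
have [[Phi_meas _] _] := Phi_LinfH8.
have [M0 _ bdd] := @Phi_bounded R T L T_gt0 Phi Phi_continuous.
have [F1 [F2 [F3 [P2 [P4 [M sp]]]]]] :=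
  fourier_data T_gt0 L_gt0 Phi_continuous Phi_solution Phi_t0 Phi_H4L2 Phi_LinfH8 Phi_H2H6.
pose K1 := 2 / L ^+ 2 * Num.sqrt (latC L * M).
have lim1 (t : R) : 0 <= t <= T -> trig_limit L (Phi t) K1.
  move=> tT; apply: (@trig_limit_fejer R L L_gt0 (Phi t) M0 M).
  - exact: (Phi_oint T_gt0 L_gt0 Phi_continuous Phi_meas tT).
  - by move=> w Ow; exact: bdd.
  - by move=> z _; exact: (Phi_cont_at T_gt0 Phi_continuous z tT).
  - by move=> I kap inj; exact: (sp_s0 sp inj tT).
(* The cube is a product of three factors in the weighted algebra, whose product constant is 8. *)
pose K3 := 8 * (K1 * (8 * (K1 * K1))).
have lim3 (t : R) : 0 <= t <= T -> trig_limit L (fun z => Phi t z ^+ 3) K3.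
  by move=> tT; have l := lim1 _ tT; exact: (trig_limitM l (trig_limitM l l)).
pose rate := rateC L alpha beta M K1.
pose K := convC T L alpha beta M K1 K3 + imC L K1.
have rate0 : 0 <= rate by apply: rateC_ge0.
have conv0 : 0 <= convC T L alpha beta M K1 K3 by apply: convC_ge0 sp.
have im0 : 0 <= imC L K1 by exact: imC_ge0.
have K0 : 0 <= K by rewrite addr_ge0.
(* The bound on [s] ensures [s * rate <= 1/2], the smallness required by the implicit Gronwall
   inequality; the summand 1 in both witnesses secures positivity. *)
exists (2 * Num.sqrt (K + K) + 1), (2 * rate + 1)^-1; split.
- by rewrite ltr_wpDl// mulr_ge0// sqrtr_ge0.
- by rewrite invr_gt0 ltr_wpDl// mulr_ge0.
move=> N N_gt0 N_even h s /andP[s_gt0 ss0] phi psi [phi0 phim psi0 per steps] err n n1 nT.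
have NR : 0 < N%:R :> R by rewrite ltr0n.
have h_gt0 : 0 < h by exact: divr_gt0.
have small : s * rate <= 2^-1.
  have r1 : 0 < 2 * rate + 1 by rewrite ltr_wpDl// mulr_ge0.
  have := ler_wpM2r (ltW r1) ss0; rewrite mulVf ?gt_eqF//.
  by have := s_gt0; lra.
have nT_in : 0 <= n%:R * s <= T by rewrite nT mulr_ge0// ltW.
have T0 : 0 <= (0 : R) <= T by rewrite lexx ltW.
(* The scheme provides periodicity from the first step on; for the initial data it comes from
   [Phi 0]. *)
have phi_per k : grid_periodic N (phi k%:Z).
  case: k => [|k]; last by have [] := per k.
  have -> : phi 0%:Z = fun i j => Phi 0 (gpoint h i j) by apply/funext => i; apply/funext => j; exact: phi0.
  exact: gpoint_periodic (Phi_periodic 0 T0).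
(* At [k = 0] the truncated predecessor is 0, in accordance with phi^{-1} = phi^0. *)
have phi_pred k : phi (k%:Z - 1) = phi (k.-1)%:Z.
  case: k => [|k]; last by rewrite intS addrAC subrr add0r.
  by rewrite sub0r; apply/funext => i; apply/funext => j; rewrite phim.
pose gphin k := @gr R N (phi k%:Z); pose gpsin k := @gr R N (psi k).
have gstep k : (k < n)%N -> grid_step h alpha beta s (gphin k.-1) (gphin k) (gpsin k) (gphin k.+1) (gpsin k.+1).
  move=> _; apply: (scheme_grid_step N_gt0 h_gt0); [exact: phi_per..|].
  by have := steps k; rewrite phi_pred.
pose t := n%:R * s.
pose re i j := projW L N (fun=> 1) (Phi t) (gpoint h i j) - phi n%:Z i j.
pose im i j := projIm L N (Phi t) (gpoint h i j).
have iPhi : oint L (Phi t) by exact: (Phi_oint T_gt0 L_gt0 Phi_continuous Phi_meas nT_in).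
have -> : err n = (fun i j => (re i j +i* im i j)%C).
  apply/funext => i; apply/funext => j; rewrite /err -/t fourier_projE// /re /im.
  by apply/eqP; rewrite eq_complex /= subr0 !eqxx.
have im_per : grid_periodic N im by exact: (gpoint_periodic N_gt0 (projIm_periodic N L_gt0 (Phi t))).
have re_per : grid_periodic N re.
  have p1 := gpoint_periodic N_gt0 (projW_periodic N L_gt0 (fun=> 1) (Phi t)).
  move=> i j; rewrite /re; have [q1 q2] := phi_per n i j; have [-> ->] := p1 i j.
  by rewrite q1 q2.
have g0 : gphin 0%N = gphi L Phi 0 by apply/funext => p; exact: phi0.
have gp0 : gpsin 0%N = 0 by apply/funext => p; exact: psi0.
have c1 := grid_convergence T_gt0 L_gt0 alpha_gt0 beta_gt0 sp lim1 lim3 N_gt0 N_even s_gt0 small nT g0 gp0 gstep.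
have c2 := @im_energy R T L K1 Phi L_gt0 lim1 N s N_gt0 N_even s_gt0 t (gr im) nT_in (fun p => erefl).
rewrite /= -/h -/t in c1 c2.
have ere : uproj L Phi t - gphin n = gr re.
  apply/funext => p; rewrite gev /gr /re /gphin /gr -[in RHS]/(gpt L p) projW_gpoly; congr (gpoly L _ p - _).
  by apply/funext => k; apply/funext => c; rewrite mul1r.
rewrite ere in c1.
have s4 : 0 <= s ^+ 4 + h ^+ 4 by rewrite addr_ge0// exprn_ge0// ltW.
have x1 := mulr_ge0 conv0 s4; have x2 := mulr_ge0 im0 s4.
have bound f : f = re \/ f = im -> @gip R N h (gr f) (gr f) + @gip R N h (gA h (gr f)) (gA h (gA h (gr f))) <= K * (s ^+ 4 + h ^+ 4).
  by move=> [] ->; rewrite /K mulrDl; [move: c1|move: c2]; lra.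
have en := error_norms L_gt0 N_gt0 re_per im_per bound.
rewrite -/h in en; apply: (le_trans en).
have e : K * (s ^+ 4 + h ^+ 4) + K * (s ^+ 4 + h ^+ 4) = (K + K) * (s ^+ 4 + h ^+ 4) by ring.
have sq : Num.sqrt (s ^+ 4 + h ^+ 4) <= s ^+ 2 + h ^+ 2.
  have p0 : 0 <= s ^+ 2 + h ^+ 2 by rewrite addr_ge0 ?sqr_ge0.
  rewrite -[leRHS](ger0_norm p0) -sqrtr_sqr; apply: ler_wsqrtr.
  have : 0 <= s ^+ 2 * h ^+ 2 by rewrite mulr_ge0 ?sqr_ge0.
  lra.
rewrite e sqrtrM ?addr_ge0// mulrA.
have k1 : 0 <= 2 * Num.sqrt (K + K) by rewrite mulr_ge0// sqrtr_ge0.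
apply: le_trans (ler_wpM2l k1 sq) _; apply: ler_wpM2r; first by rewrite addr_ge0 ?sqr_ge0.
by rewrite lerDl ler01.
Qed.
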